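(* Let $u^\epsilon$ be the solution of the rough problem and let $u_\epsilon^{2,\infty}$ be the second order full boundary layer approximation $$u_\epsilon^{2,\infty}(x) = u_2^0(x) + \frac{\epsilon}{1+\epsilon\overline{\beta}}\frac{\partial u_2^0}{\partial x_2}(x_1,0)\left(\beta\left(\frac{x}{\epsilon}\right) - \overline{\beta}x_2\right) + \frac{\epsilon^2}{2}\frac{\partial^2 u_2^0}{\partial x_2^2}(x_1,0)\left[\left(\gamma\left(\frac{x}{\epsilon}\right) - \overline{\gamma}x_2\right) - \frac{\epsilon\overline{\gamma}}{1+\epsilon\overline{\beta}}\left(\beta\left(\frac{x}{\epsilon}\right) - \overline{\beta}x_2\right)\right],\quad x\in\Omega^\epsilon,$$ where $u_2^0(x)=\frac{C}{2}(1-x_2)x_2$ for $x\in\Omega^\epsilon$. Then there exist constants $c_{10},c_{11}$ independent of $\epsilon$ such that $$\left\|u^\epsilon - u_\epsilon^{2,\infty}\right\|_{H^1(\Omega^\epsilon)} \leq c_{10}\,e^{-\frac{1}{\epsilon}}, \qquad \left\|u^\epsilon - u_\epsilon^{2,\infty}\right\|_{L^2(\Omega^0)} \leq c_{11}\sqrt{\epsilon}\,e^{-\frac{1}{\epsilon}}.$$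
   Context: Fix $L>0$ and a real constant $C$. Let $f:[0,2\pi)\to[-1,0)$ be a function whose $2\pi$-periodic extension to $\mathbb{R}$ (still denoted $f$) is Lipschitz, and suppose there is $\delta>0$ with $f(y_1)<-\delta$ for all $y_1$. The parameter $\epsilon>0$ is always such that $L/(2\pi\epsilon)$ is an integer. Macroscopic domains: $\Omega^\epsilon=\{x: 0<x_1<L,\ \epsilon f(x_1/\epsilon)<x_2<1\}$, $\Omega^0=(0,L)\times(0,1)$, $\Gamma^\epsilon=\{x: 0<x_1<L,\ x_2=\epsilon f(x_1/\epsilon)\}$, $\Gamma^1=\{0<x_1<L,\ x_2=1\}$. Rough problem: $u^\epsilon\in H^1(\Omega^\epsilon)$ is the (weak) solution of $-\Delta u^\epsilon=C$ in $\Omega^\epsilon$, $u^\epsilon=0$ on $\Gamma^\epsilon\cup\Gamma^1$, $u^\epsilon$ is $x_1$-periodic (period $L$, i.e. periodic conditions on the lateral boundaries $x_1=0$ and $x_1=L$). Cell problems: $Z^+=(0,2\pi)\times(0,\infty)$, $P=\{y: 0<y_1<2\pi,\ f(y_1)<y_2<0\}$, $P^0=\{y: y_1\in[0,2\pi],\ y_2=f(y_1)\}$, $\Gamma=\{y: 0<y_1<2\pi,\ y_2=0\}$; $Z^+\cup P$ denotes the whole cell domain $\{0<y_1<2\pi,\ y_2>f(y_1)\}$ (including $\Gamma$). $D^{1,2}=\{v\in L^1_{\rm loc}(Z^+\cup P): \nabla v\in L^2(Z^+\cup P)^2,\ v \text{ is } y_1\text{-periodic}\}$. $\beta\in D^{1,2}$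 is the unique solution of $-\Delta\beta=0$ in $Z^+\cup P$, $\beta=-y_2$ on $P^0$, $\beta$ $y_1$-periodic; $\gamma\in D^{1,2}$ is the unique solution of $-\Delta\gamma=0$ in $Z^+\cup P$, $\gamma=-y_2^2$ on $P^0$, $\gamma$ $y_1$-periodic. Both are extended $2\pi$-periodically in $y_1$. Averages: $\overline{\beta}=\frac{1}{2\pi}\int_0^{2\pi}\beta(y_1,0)\,dy_1$ and $\overline{\gamma}=\frac{1}{2\pi}\int_0^{2\pi}\gamma(y_1,0)\,dy_1$. *)

(* Defs.v *)
From HB Require Import structures.
From mathcomp Require Import all_boot all_order all_algebra.
From mathcomp Require Import all_classical all_reals all_analysis.
Set Implicit Arguments.
Unset Strict Implicit.
Unset Printing Implicit Defensive.
Import Order.TTheory GRing.Theory Num.Theory.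
Import numFieldNormedType.Exports.
Local Open Scope classical_set_scope.
Local Open Scope ring_scope.

Notation area R := (@lebesgue_measure R \x @lebesgue_measure R)%E.

Section Sobolev.
Variable R : realType.
Implicit Types (D : set (R * R)) (v phi : R * R -> R) (G H : R * R -> R * R).

Definition e1 : R * R := (1, 0).
Definition e2 : R * R := (0, 1).

Fixpoint of_class_C (k : nat) phi : Prop :=
  if k is k'.+1 then
    [/\ continuous phi,
        forall x, derivable phi x e1 /\ derivable phi x e2,
        of_class_C k' ('D_e1 phi) & of_class_C k' ('D_e2 phi)]
  else continuous phi.

Definition smooth phi : Prop := forall k, of_class_C k phi.

Definition test_function D phi : Prop :=
  smooth phi /\
  exists K : set (R * R), [/\ compact K, K `<=` D & forall x, ~ K x -> phi x = 0].

Definition loc_integrable D v : Prop :=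
  measurable_fun D v /\
  forall K : set (R * R), compact K -> K `<=` D ->
    (area R).-integrable K (EFin \o v).

Definition weak_grad D v G : Prop :=
  [/\ loc_integrable D v,
      loc_integrable D (fun x => (G x).1),
      loc_integrable D (fun x => (G x).2) &
      forall phi, test_function D phi ->
        \int[area R]_(x in D) (v x * 'D_e1 phi x) =
          - (\int[area R]_(x in D) ((G x).1 * phi x)) /\
        \int[area R]_(x in D) (v x * 'D_e2 phi x) =
          - (\int[area R]_(x in D) ((G x).2 * phi x))].

Definition dot (p q : R * R) : R := p.1 * q.1 + p.2 * q.2.

Definition L2norm D v : \bar R :=
  ((\int[area R]_(x in D) (v x ^+ 2)%:E) `^ 2^-1)%E.

(* The weak gradient is unique almost everywhere, so the infimum is over at
   most one value; it is +oo exactly when v is not in H^1(D). *)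
Definition H1norm D v : \bar R :=
  ereal_inf [set ((\int[area R]_(x in D) (v x ^+ 2 + dot (G x) (G x))%:E)
                   `^ 2^-1)%E | G in weak_grad D v].

(* b is the trace of v on the part {(t, h t) : 0 < t < l} of the boundary of D,
   i.e. the L^2 limit of the restrictions of functions smooth up to the
   boundary that converge to v in H^1(D).  The graphs in use are Lipschitz, so
   dt and the arc length define the same L^2 convergence. *)
Definition has_trace D (l : R) (h : R -> R) v (b : R -> R) : Prop :=
  measurable_fun `]0, l[%classic b /\
  exists phi : nat -> R * R -> R,
    [/\ forall n, smooth (phi n),
        H1norm D (fun x => phi n x - v x) @[n --> \oo] --> 0%E &
        (\int[@lebesgue_measure R]_(t in `]0%R, l[)
            ((phi n (t, h t) - b t) ^+ 2)%:E)%E @[n --> \oo] --> 0%E].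

End Sobolev.

Arguments e1 {R}.
Arguments e2 {R}.

(* Functions that are periodic in the first variable are represented by their
   periodic extension, and weak gradients are taken on the extended domain:
   this is what makes the values agree across the lateral sides of a period. *)

Section CellProblems.
Variable R : realType.
Variable f : R -> R.
Implicit Types (v : R * R -> R).

Definition cell : set (R * R) := [set y | 0 < y.1 < 2 * pi /\ f y.1 < y.2].
Definition ext_cell : set (R * R) := [set y | f y.1 < y.2].
Definition cell_P : set (R * R) := [set y | 0 < y.1 < 2 * pi /\ f y.1 < y.2 < 0].

Definition D12 v : Prop :=
  periodic v (2 * pi, 0) /\
  exists2 G, weak_grad ext_cell v G &
    (\int[area R]_(y in cell) (dot (G y) (G y))%:E < +oo)%E.

(* Functions in D12 need not be square integrable on the unbounded cell, but
   they are in H^1 of its bounded part P, which carries the traces on P^0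
   and on Gamma. *)
Definition trace_P0 v (b : R -> R) : Prop := has_trace cell_P (2 * pi) f v b.
Definition trace_Gamma v (b : R -> R) : Prop :=
  has_trace cell_P (2 * pi) (fun=> 0) v b.

Definition cell_solution (g : R * R -> R) v : Prop :=
  [/\ D12 v,
      trace_P0 v (fun t => g (t, f t)) &
      forall phi, D12 phi -> trace_P0 phi (fun=> 0) ->
        forall G H, weak_grad ext_cell v G -> weak_grad ext_cell phi H ->
          \int[area R]_(y in cell) dot (G y) (H y) = 0].

Definition Gamma_average v (m : R) : Prop :=
  exists2 b, trace_Gamma v b &
    m = (2 * pi)^-1 * \int[@lebesgue_measure R]_(t in `]0, 2 * pi[) b t.

End CellProblems.

Section RoughProblem.
Variable R : realType.
Variables (L C : R) (f : R -> R) (eps : R).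
Implicit Types (u phi : R * R -> R).

Definition Omega_eps : set (R * R) :=
  [set x | 0 < x.1 < L /\ eps * f (x.1 / eps) < x.2 < 1].
Definition ext_Omega_eps : set (R * R) :=
  [set x | eps * f (x.1 / eps) < x.2 < 1].
Definition Omega0 : set (R * R) := [set x | 0 < x.1 < L /\ 0 < x.2 < 1].

Definition H1_per u : Prop :=
  [/\ periodic u (L, 0),
      exists G, weak_grad ext_Omega_eps u G &
      (H1norm Omega_eps u < +oo)%E].

Definition rough_space u : Prop :=
  [/\ H1_per u,
      has_trace Omega_eps L (fun t => eps * f (t / eps)) u (fun=> 0) &
      has_trace Omega_eps L (fun=> 1) u (fun=> 0)].

Definition rough_solution u : Prop :=
  rough_space u /\
  forall phi, rough_space phi ->
    forall G H, weak_grad ext_Omega_eps u G -> weak_grad ext_Omega_eps phi H ->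
      \int[area R]_(x in Omega_eps) dot (G x) (H x) =
        \int[area R]_(x in Omega_eps) (C * phi x).

End RoughProblem.

Section Approximation.
Variable R : realType.
Variables (C : R) (beta gamma : R * R -> R) (beta_bar gamma_bar : R) (eps : R).

Definition u20 (x : R * R) : R := C / 2 * (1 - x.2) * x.2.

Definition beta_layer (x : R * R) : R :=
  beta (x.1 / eps, x.2 / eps) - beta_bar * x.2.
Definition gamma_layer (x : R * R) : R :=
  gamma (x.1 / eps, x.2 / eps) - gamma_bar * x.2.

Definition u2_inf (x : R * R) : R :=
  u20 x
  + eps / (1 + eps * beta_bar) * 'D_e2 u20 (x.1, 0) * beta_layer x
  + eps ^+ 2 / 2 * 'D_e2 ('D_e2 u20) (x.1, 0)
    * (gamma_layer x - eps * gamma_bar / (1 + eps * beta_bar) * beta_layer x).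

End Approximation.

(* Main.v *)
(* In the variables y = x / eps, the approximation is a quadratic in y_2 plus the single cell
   function V = A beta + B gamma, up to an affine term in y_2, with A and B of order eps. A
   function harmonic in the cell has no vertical flux through horizontal slices (test with a ramp
   in y_2), so all its slice means above the wall agree with the mean over Gamma. With this,
   Wirtinger's inequality on slices and a weight growing like e^(2 y_2) up to height s show that
   the energy of V above height s is O(e^(-2 s)).

   Replace V by its mean near the top by means of a cutoff on a layer of thickness at most 1 below
   y_2 = 1 / eps. The difference between the exact solution and this corrected approximation
   vanishes on both horizontal boundaries, hence is admissible in the rough problem; times the
   cutoff and summed over the translates by periods, it is admissible in the cell problem. All
   bulk terms then cancel in the energy identity, and only the cutoff layer, of size
   O(e^(-1 / eps)), remains. The Poincare inequality turns the energy bound into the L^2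
   bounds. All functions are square integrable with weak gradients; smooth approximations up to
   the wall come from mollifiers with support shifted upwards, which stay above the Lipschitz
   graph. *)

Require Import Defs.
From HB Require Import structures.
From mathcomp Require Import all_boot all_order all_algebra.
From mathcomp Require Import all_classical all_reals all_analysis.
From mathcomp Require Import measurable_realfun lra ring.
Import Order.TTheory GRing.Theory Num.Theory.
Import numFieldNormedType.Exports.
Local Open Scope classical_set_scope.
Local Open Scope ring_scope.
Set Implicit Arguments.
Unset Strict Implicit.
Unset Printing Implicit Defensive.

(** * Smooth functions and bump functions *)

Section Smooth1.
Variable R : realType.
Implicit Types f g : R -> R.

(** The exponent 1 / eps needs Wirtinger's inequality on a period of length 2 pi with constant
    exactly 1: any larger constant would lower the rate. The powers of eps come from counting. The
    coefficients A and B are O(eps), so the squared layer energy of one period is O(eps^2 e^(-2 /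
    eps)); there are L / (2 pi eps) periods, and the Dirichlet integral is invariant under scaling
    in the plane. The squared error is thus O(eps e^(-2 / eps)), in H^1 as well as in L^2. Since the
    number of periods is a positive integer, eps is at most L / (2 pi); this absorbs sqrt eps in the
    H^1 bound and allows one layer thickness for all eps. The denominator 1 + eps beta_bar must not
    vanish. It does not, because beta_bar >= 0: test the problem of beta with beta + min(y_2, 0).
    The obstacle is that weak gradients are determined only almost everywhere and traces are given
    by smooth approximation. Every statement on slices, boundary values or periodicity is therefore
    proved for approximants and passed to the limit, and the traces at the wall and at the top may
    come from different sequences. *)

Fixpoint ck (k : nat) f : Prop :=
  if k is k'.+1 then (forall x : R, derivable f x 1) /\ ck k' ((derive1 f)) else True.

Definition smooth1 f := forall k, ck k f.

Lemma ckS k f g : (forall x : R, is_derive x 1 f (g x)) -> ck k g -> ck k.+1 f.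
Proof.
move=> fg ckg; split; first by move=> x; have [] := fg x.
have -> : (derive1 f) = g by apply/funext => x; rewrite derive1E; exact: (@derive_val _ _ _ _ _ _ _ (fg x)).
exact: ckg.
Qed.

Lemma ckS_derive k f : ck k.+1 f -> forall x : R, is_derive x 1 f ((derive1 f) x).
Proof. by move=> [df _] x; rewrite derive1E; apply: derivableP. Qed.

Lemma ckW k f : ck k.+1 f -> ck k f.
Proof. by elim: k f => // k IH f [df ckf]; split => //; apply: IH. Qed.

Lemma smooth1_derive f : smooth1 f -> forall x : R, is_derive x 1 f ((derive1 f) x).
Proof. by move=> /(_ 1%N)/ckS_derive. Qed.

Lemma smooth1_derive1 f : smooth1 f -> smooth1 (derive1 f).
Proof. by move=> sf k; have [] := sf k.+1. Qed.

Lemma smooth1_continuous f : smooth1 f -> continuous f.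
Proof.
by move=> /smooth1_derive df x; apply/differentiable_continuous/derivable1_diffP; have [] := df x.
Qed.

Lemma ck_cst k (c : R) : ck k (fun=> c).
Proof.
elim: k c => // k IH c; apply: (@ckS _ _ (fun=> 0)); last exact: IH.
Qed.

Lemma ck_id k : ck k (fun x => x).
Proof.
case: k => // k; apply: (@ckS _ _ (fun=> 1)); last exact: ck_cst.
Qed.

Lemma ckD k f g : ck k f -> ck k g -> ck k (fun x => f x + g x).
Proof.
elim: k f g => // k IH f g cf cg.
apply: (@ckS _ _ (fun x => (derive1 f) x + (derive1 g) x)); last first.
  by apply: IH; [case: cf|case: cg].
by move=> x; exact: (is_deriveD (ckS_derive cf x) (ckS_derive cg x)).
Qed.

Lemma ckM k f g : ck k f -> ck k g -> ck k (fun x => f x * g x).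
Proof.
elim: k f g => // k IH f g cf cg.
apply: (@ckS _ _ (fun x => f x * (derive1 g) x + g x * (derive1 f) x)); last first.
  apply: ckD; apply: IH; by [exact: ckW|case: cf|case: cg].
by move=> x; exact: (is_deriveM (ckS_derive cf x) (ckS_derive cg x)).
Qed.

Lemma ckN k f : ck k f -> ck k (fun x => - f x).
Proof.
move=> cf; have := ckM (ck_cst k (-1)) cf.
by under eq_fun do rewrite mulN1r.
Qed.

Lemma ckB k f g : ck k f -> ck k g -> ck k (fun x => f x - g x).
Proof. by move=> cf cg; apply: ckD => //; exact: ckN. Qed.

Lemma ck_comp k f g : ck k f -> ck k g -> ck k (fun x => f (g x)).
Proof.
elim: k f g => // k IH f g cf cg.
apply: (ckS (fun x => is_derive1_comp (ckS_derive cf (g x)) (ckS_derive cg x))).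
by apply: ckM; [apply: IH; [case: cf|exact: ckW]|case: cg].
Qed.

Lemma ckV k f : (forall x, f x != 0) -> ck k f -> ck k (fun x => (f x)^-1).
Proof.
move=> f0; elim: k f f0 => // k IH f f0 cf.
apply: (@ckS _ _ (fun x => - ((f x)^-1 * (f x)^-1) * (derive1 f) x)); last first.
  apply: ckM; last by case: cf.
  by apply: ckN; apply: ckM; apply: IH => //; exact: ckW.
move=> x; have := @is_deriveV R f x _ 1 (f0 x) (ckS_derive cf x).
move=> h; apply: (is_derive_eq h).
by rewrite /GRing.scale /= expr2 invfM.
Qed.

Lemma ck_expR k : ck k (@expR R).
Proof.
by elim: k => // k IH; apply: (@ckS _ _ (@expR R)) => // x; exact: is_derive_expR.
Qed.

Lemma smooth1_cst (c : R) : smooth1 (fun=> c). Proof. by move=> k; exact: ck_cst. Qed.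
Lemma smooth1_id : smooth1 (fun x => x). Proof. by move=> k; exact: ck_id. Qed.
Lemma smooth1D f g : smooth1 f -> smooth1 g -> smooth1 (fun x => f x + g x).
Proof. by move=> sf sg k; apply: ckD. Qed.
Lemma smooth1B f g : smooth1 f -> smooth1 g -> smooth1 (fun x => f x - g x).
Proof. by move=> sf sg k; apply: ckB. Qed.
Lemma smooth1M f g : smooth1 f -> smooth1 g -> smooth1 (fun x => f x * g x).
Proof. by move=> sf sg k; apply: ckM. Qed.
Lemma smooth1_comp f g : smooth1 f -> smooth1 g -> smooth1 (fun x => f (g x)).
Proof. by move=> sf sg k; apply: ck_comp. Qed.
Lemma smooth1V f : (forall x, f x != 0) -> smooth1 f -> smooth1 (fun x => (f x)^-1).
Proof. by move=> f0 sf k; apply: ckV. Qed.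
Lemma smooth1_expR : smooth1 (@expR R). Proof. by move=> k; exact: ck_expR. Qed.
Lemma smooth1_affine (a b : R) : smooth1 (fun x => a * x + b).
Proof. apply: smooth1D; [apply: smooth1M; [exact: smooth1_cst|exact: smooth1_id]|exact: smooth1_cst]. Qed.

Lemma derive1_affine_comp f (a b : R) x : smooth1 f ->
  derive1 (fun y => f (a * y + b)) x = a * (derive1 f) (a * x + b).
Proof.
move=> sf; rewrite derive1E.
have h : is_derive x 1 (fun y => f (a * y + b)) ((derive1 f) (a * x + b) * a).
  apply: is_derive1_comp; first exact: smooth1_derive.
  have -> : (fun y : R => a * y + b) = (a \*: id) + cst b by apply/funext => y; rewrite /= fctE.
  apply: (is_derive_eq (is_deriveD (is_deriveZ a (is_derive_id x 1)) (is_derive_cst b x 1))).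
  by rewrite addr0 /GRing.scale /= mulr1.
by rewrite (@derive_val _ _ _ _ _ _ _ h) mulrC.
Qed.

End Smooth1.

(** * A smooth step function *)

Section Bump.
Variable R : realType.

(** The functions x^(-n) e^(-1/x), extended by 0. The powers are carried along because the
    derivative of such a function combines those of orders n + 1 and n + 2, so that one induction on
    the order of differentiation treats them all. *)
Definition flat (n : nat) (x : R) : R :=
  if 0 < x then x^-1 ^+ n * expR (- x^-1) else 0.

Lemma flat_ge0 n x : 0 <= flat n x.
Proof.
rewrite /flat; case: ifP => // x0.
by rewrite mulr_ge0 ?expR_ge0 // exprn_ge0 // invr_ge0 ltW.
Qed.

(** From e^y >= y^(n+2) / (n+2)! at y = 1/x. It gives the continuity at 0 on which the
    differentiability of [flat] at the origin rests. *)
Lemma flat_le n x : flat n x <= (n.+2)`!%:R * x ^+ 2 .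
Proof.
rewrite /flat; case: ifP => [x0|_]; last by rewrite mulr_ge0 // sqr_ge0.
have y0 : 0 < x^-1 by rewrite invr_gt0.
have := @expR_ge1Dxn R _ n.+1 (ltW y0).
set N := (_`!)%:R => h.
have N0 : 0 < N by rewrite ltr0n fact_gt0.
have {}h : x^-1 ^+ n.+2 / N <= expR x^-1 by apply: le_trans h; rewrite lerDr.
rewrite expRN ler_pdivrMr ?expR_gt0 // mulrC.
rewrite -[x in N * x ^+ 2]invrK -ler_pdivrMr; last by rewrite mulr_gt0 // exprn_gt0 // invr_gt0.
rewrite exprVn invfM invrK; apply: le_trans h.
have -> : x^-1 ^+ n.+2 = x ^- n * x ^- 2 by rewrite -!exprVn -exprD addn2.
by rewrite (mulrC N^-1) mulrA.
Qed.

Lemma flat_derive n (x : R) : is_derive x 1 (flat n) (flat n.+2 x - n%:R * flat n.+1 x).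
Proof.
have [x0|x0|x0] := ltgtP x 0.
- apply: (@near_eq_is_derive _ _ _ (cst 0)).
    near=> y; rewrite /flat ifF //=; apply/negbTE; rewrite -leNgt.
    by near: y; apply: filterS (lt_nbhsl x0) => y; exact: ltW.
  rewrite /flat ltNge (ltW x0) /= mulr0 subr0; exact: is_derive_cst.
- apply: (@near_eq_is_derive _ _ _ (fun y : R => (y^-1 ^+ n * expR (- y^-1)) : R)).
    near=> y; rewrite /flat ifT //.
    by near: y; exact: lt_nbhsr.
  have xn0 : x != 0 by rewrite gt_eqF.
  have dV : is_derive x 1 (fun y : R => y^-1) (- x ^- 2).
    have := @is_deriveV R id x 1 1 xn0 (is_derive_id _ _).
    by move=> h; apply: (is_derive_eq h); rewrite scaler1.
  have dX : is_derive x 1 (fun y : R => y^-1 ^+ n) (n%:R * x^-1 ^+ n.-1 * (- x ^- 2)).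
    have h := @is_deriveX _ _ (fun y : R => y^-1) n x 1 _ dV.
    have -> : (fun y : R => y^-1 ^+ n) = (fun y : R => y^-1) ^+ n.
      by apply/funext => y; rewrite /= exprfctE.
    apply: (is_derive_eq h).
    by rewrite /GRing.scale /= -mulr_natl.
  have dE : is_derive x 1 (fun y : R => expR (- y^-1)) (expR (- x^-1) * x ^- 2).
    have h : is_derive x 1 (fun y : R => - y^-1) (x ^- 2).
      have h := @is_deriveN _ _ _ (fun y : R => y^-1) x 1 _ dV.
      by apply: (is_derive_eq h); rewrite opprK.
    exact: (@is_derive1_comp _ expR (fun y => - y^-1) x _ _ (is_derive_expR _) h).
  apply: (is_derive_eq (is_deriveM dX dE)).
  rewrite /flat x0 /GRing.scale /=.
  case: n {dX} => [|n]; first by rewrite /= -!exprVn !exprS !expr0; ring.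
  by rewrite /= -!exprVn !exprS; ring.
- subst x; have -> : flat n.+2 0 - n%:R * flat n.+1 0 = 0 by rewrite /flat ltxx mulr0 subr0.
  (* At the origin the difference quotient of [flat n] is [flat n.+1], squeezed between 0 and a
     multiple of x^2. *)
  apply/is_derive1_caratheodory; exists (flat n.+1); split.
  + move=> z; rewrite /flat ltxx !subr0; case: ifP => [z0|_]; last by rewrite mul0r.
    by rewrite exprS (mulrC _ z) !mulrA divff ?mul1r // gt_eqF.
  + have E0 : flat n.+1 0 = 0 by rewrite /flat ltxx.
    rewrite /prop_for /continuous_at E0.
    apply: (@squeeze_cvgr _ _ _ _ (cst 0) (fun x => (n.+3)`!%:R * x ^+ 2)).
    * by apply: nearW => x /=; rewrite flat_ge0 flat_le.
    * exact: cvg_cst.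
    * have H : (fun x : R => (n.+3)`!%:R * x ^+ 2) @ (0 : R) --> (n.+3)`!%:R * (0 : R) ^+ 2.
        by apply: cvgM; [exact: cvg_cst|exact: exprn_continuous].
      by rewrite expr0n mulr0 in H.
  + by rewrite /flat ltxx.
Unshelve. all: by end_near. Qed.

Lemma flat_smooth n : smooth1 (flat n).
Proof.
move=> k; elim: k n => // k IH n; apply: (ckS (flat_derive n)).
by apply: ckB => //; apply: ckM => //; exact: ck_cst.
Qed.

Lemma flat0_nincr : {homo flat 0 : x y / x <= y}.
Proof.
move=> x y xy; rewrite /flat; case: ifPn => [x0|_]; last by case: ifP => // _; rewrite mul1r expR_ge0.
rewrite (lt_le_trans x0 xy) !mul1r ler_expR lerN2 lef_pV2 // posrE //.
exact: lt_le_trans xy.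
Qed.

Lemma flat0_gt0 x : 0 < x -> 0 < flat 0 x.
Proof. by move=> x0; rewrite /flat x0 mul1r expR_gt0. Qed.

Lemma flat0_le0 x : x <= 0 -> flat 0 x = 0.
Proof. by move=> x0; rewrite /flat ltNge x0. Qed.

Definition step (x : R) : R := flat 0 x / (flat 0 x + flat 0 (1 - x)).

Lemma step_den x : 0 < flat 0 x + flat 0 (1 - x).
Proof.
have [x0|x0] := ltP 0 x.
  by apply: ltr_pwDl; [exact: flat0_gt0|exact: flat_ge0].
by apply: ltr_wpDl; [exact: flat_ge0|apply: flat0_gt0; rewrite subr_gt0 (le_lt_trans x0)].
Qed.

Lemma step_smooth : smooth1 step.
Proof.
apply: smooth1M; first exact: flat_smooth.
apply: smooth1V; first by move=> x; rewrite gt_eqF // step_den.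
apply: smooth1D; first exact: flat_smooth.
apply: (@smooth1_comp _ _ (fun x => 1 - x)); first exact: flat_smooth.
by apply: smooth1B; [exact: smooth1_cst|exact: smooth1_id].
Qed.

Lemma step_le0 x : x <= 0 -> step x = 0.
Proof. by move=> x0; rewrite /step flat0_le0 // mul0r. Qed.

Lemma step_ge1 x : 1 <= x -> step x = 1.
Proof.
move=> x1; have := step_den x; rewrite /step (@flat0_le0 (1 - x)) ?subr_le0 // addr0 => h.
by rewrite divff // gt_eqF.
Qed.

Lemma step_ge0 x : 0 <= step x.
Proof. by rewrite divr_ge0 ?flat_ge0 // ltW // step_den. Qed.

Lemma step_le1 x : step x <= 1.
Proof. by rewrite ler_pdivrMr ?step_den // mul1r lerDl flat_ge0. Qed.

Lemma step_homo : {homo step : x y / x <= y}.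
Proof.
move=> x y xy; rewrite /step ler_pdivrMr ?step_den // mulrAC ler_pdivlMr ?step_den //.
have h1 := flat0_nincr xy.
have h2 : flat 0 (1 - y) <= flat 0 (1 - x) by apply: flat0_nincr; rewrite lerD2l lerN2.
have := flat_ge0 0 x; have := flat_ge0 0 (1 - y); nra.
Qed.

Definition dstep : R -> R := derive1 step.

Lemma is_derive_step (x : R) : is_derive x 1 step (dstep x).
Proof. exact/smooth1_derive/step_smooth. Qed.

Lemma dstep_smooth : smooth1 dstep.
Proof. exact/smooth1_derive1/step_smooth. Qed.

Lemma dstep_ge0 x : 0 <= dstep x.
Proof.
have [h <-] := is_derive_step x.
apply: limr_ge => //; near=> t.
have t0 : t != 0 by near: t; exact: nbhs_dnbhs_neq.
rewrite /= /GRing.scale /= mulr1.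
have [t1|t1|/eqP] := ltgtP t 0; last by rewrite (negbTE t0).
  rewrite mulr_le0 // ?invr_le0 ?(ltW t1) // subr_le0; apply: step_homo.
  by rewrite gerDr ltW.
rewrite mulr_ge0 // ?invr_ge0 ?(ltW t1) // subr_ge0; apply: step_homo.
by rewrite lerDr ltW.
Unshelve. all: by end_near. Qed.

(** At these points [step] attains its global minimum 0 or maximum 1, so its derivative vanishes;
    this includes the end points 0 and 1. *)
Lemma dstep_out x : x <= 0 \/ 1 <= x -> dstep x = 0.
Proof.
have hx : x \in `]x - 1, x + 1[ by rewrite in_itv /=; lra.
have dx t : derivable step t 1 by have [] := is_derive_step t.
rewrite /dstep derive1E => -[x0|x1]; apply/esym/esym; apply: derive_val.
  apply: (@derive1_at_min _ _ (x - 1) (x + 1)) => //; first lra.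
  by move=> t _; rewrite (step_le0 x0) step_ge0.
apply: (@derive1_at_max _ _ (x - 1) (x + 1)) => //; first lra.
by move=> t _; rewrite (step_ge1 x1) step_le1.
Qed.

Lemma dstep_bounded : exists2 K : R, 0 < K & forall x, dstep x <= K.
Proof.
have [c _ hc] : exists2 c, c \in `[(0:R), 1] & forall t, t \in `[0, 1] -> dstep t <= dstep c.
  apply: EVT_max => //.
  by apply: continuous_subspaceT => x; exact: (smooth1_continuous dstep_smooth).
exists (1 + dstep c); first by rewrite ltr_pwDl // dstep_ge0.
move=> x; have [x0|x0] := leP x 0.
  by rewrite dstep_out ?addr_ge0 ?dstep_ge0 //; left.
have [x1|x1] := leP 1 x; first by rewrite dstep_out ?addr_ge0 ?dstep_ge0 //; right.
by rewrite (le_trans (hc x _)) ?lerDr // in_itv /= !ltW.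
Qed.

End Bump.

(** * Smooth functions of two variables *)

Section Smooth2.
Variable R : realType.
Implicit Types (F G : R * R -> R) (x : R * R).

Lemma is_derive_e1 F x (d : R) :
  is_derive x e1 F d <-> is_derive x.1 1 (fun t => F (t, x.2)) d.
Proof.
have E : (fun h : R => h^-1 *: ((F \o shift x) (h *: e1) - F x)) =
         (fun h : R => h^-1 *: (((fun t => F (t, x.2)) \o shift x.1) (h *: 1) - F (x.1, x.2))).
  apply/funext => h; congr (_ *: (F _ - F _)); last by case: x.
  by rewrite /=; congr pair; rewrite /= /GRing.scale /= mulr0 add0r.
by split=> -[dF <-]; [rewrite /derivable /derive E in dF *|rewrite /derivable /derive -E in dF *]; split.
Qed.

Lemma is_derive_e2 F x (d : R) :
  is_derive x e2 F d <-> is_derive x.2 1 (fun t => F (x.1, t)) d.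
Proof.
have E : (fun h : R => h^-1 *: ((F \o shift x) (h *: e2) - F x)) =
         (fun h : R => h^-1 *: (((fun t => F (x.1, t)) \o shift x.2) (h *: 1) - F (x.1, x.2))).
  apply/funext => h; congr (_ *: (F _ - F _)); last by case: x.
  by rewrite /=; congr pair; rewrite /= /GRing.scale /= mulr0 add0r.
by split=> -[dF <-]; [rewrite /derivable /derive E in dF *|rewrite /derivable /derive -E in dF *]; split.
Qed.

Lemma class_CS k F F1 F2 : continuous F ->
  (forall x, is_derive x e1 F (F1 x)) -> (forall x, is_derive x e2 F (F2 x)) ->
  of_class_C k F1 -> of_class_C k F2 -> of_class_C k.+1 F.
Proof.
move=> cF d1 d2 c1 c2.
have E1 : 'D_e1 F = F1 by apply/funext => x; exact: (@derive_val _ _ _ _ _ _ _ (d1 x)).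
have E2 : 'D_e2 F = F2 by apply/funext => x; exact: (@derive_val _ _ _ _ _ _ _ (d2 x)).
split; [exact: cF| |by rewrite E1|by rewrite E2].
by move=> x; split; [have [] := d1 x|have [] := d2 x].
Qed.

Lemma class_CW k F : of_class_C k.+1 F -> of_class_C k F.
Proof.
elim: k F => [|k IH] F; first by case.
by move=> [cF dF c1 c2]; split; [exact: cF|exact: dF|exact: IH c1|exact: IH c2].
Qed.

Lemma class_CS_derive k F x : of_class_C k.+1 F ->
  is_derive x e1 F ('D_e1 F x) /\ is_derive x e2 F ('D_e2 F x).
Proof. by move=> [_ /(_ x)[d1 d2] _ _]; split; exact: derivableP. Qed.

Lemma class_C_cst k (c : R) : of_class_C k (fun=> c : R).
Proof.
elim: k c => [|k IH] c; first by move=> x; exact: cvg_cst.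
apply: (@class_CS _ _ (fun=> 0) (fun=> 0)); [|exact: IH|exact: IH].
by move=> x; exact: cvg_cst.
Qed.

Lemma class_CD k F G : of_class_C k F -> of_class_C k G -> of_class_C k (fun x => F x + G x).
Proof.
elim: k F G => [|k IH] F G cF cG; first by move=> x; apply: cvgD; [exact: cF|exact: cG].
have [f0 _ f1 f2] := cF; have [g0 _ g1 g2] := cG.
apply: (@class_CS _ _ (fun x => 'D_e1 F x + 'D_e1 G x) (fun x => 'D_e2 F x + 'D_e2 G x)).
- by move=> x; apply: cvgD; [exact: f0|exact: g0].
- by move=> x; exact: (is_deriveD (class_CS_derive x cF).1 (class_CS_derive x cG).1).
- by move=> x; exact: (is_deriveD (class_CS_derive x cF).2 (class_CS_derive x cG).2).
- exact: IH.
- exact: IH.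
Qed.

Lemma class_CM k F G : of_class_C k F -> of_class_C k G -> of_class_C k (fun x => F x * G x).
Proof.
elim: k F G => [|k IH] F G cF cG; first by move=> x; apply: cvgM; [exact: cF|exact: cG].
have [f0 _ f1 f2] := cF; have [g0 _ g1 g2] := cG.
apply: (@class_CS _ _ (fun x => F x * 'D_e1 G x + G x * 'D_e1 F x)
                      (fun x => F x * 'D_e2 G x + G x * 'D_e2 F x)).
- by move=> x; apply: cvgM; [exact: f0|exact: g0].
- by move=> x; exact: (is_deriveM (class_CS_derive x cF).1 (class_CS_derive x cG).1).
- by move=> x; exact: (is_deriveM (class_CS_derive x cF).2 (class_CS_derive x cG).2).
- by apply: class_CD; apply: IH => //; exact: class_CW.
- by apply: class_CD; apply: IH => //; exact: class_CW.
Qed.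

Lemma class_C_fst k (g : R -> R) : smooth1 g -> of_class_C k (fun x : R * R => g x.1).
Proof.
elim: k g => [|k IH] g sg.
  by move=> x; apply: (@continuous_comp _ _ _ fst g); [exact: cvg_fst|exact: smooth1_continuous].
apply: (@class_CS _ _ (fun x => derive1 g x.1) (fun=> 0)).
- by move=> x; apply: (@continuous_comp _ _ _ fst g); [exact: cvg_fst|exact: smooth1_continuous].
- by move=> x; apply/is_derive_e1; exact: smooth1_derive.
- by move=> x; apply/is_derive_e2; exact: (is_derive_cst (g x.1)).
- by apply: IH; exact: smooth1_derive1.
- exact: class_C_cst.
Qed.

Lemma class_C_snd k (g : R -> R) : smooth1 g -> of_class_C k (fun x : R * R => g x.2).
Proof.
elim: k g => [|k IH] g sg.
  by move=> x; apply: (@continuous_comp _ _ _ snd g); [exact: cvg_snd|exact: smooth1_continuous].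
apply: (@class_CS _ _ (fun=> 0) (fun x => derive1 g x.2)).
- by move=> x; apply: (@continuous_comp _ _ _ snd g); [exact: cvg_snd|exact: smooth1_continuous].
- by move=> x; apply/is_derive_e1; exact: (is_derive_cst (g x.2)).
- by move=> x; apply/is_derive_e2; exact: smooth1_derive.
- exact: class_C_cst.
- by apply: IH; exact: smooth1_derive1.
Qed.

(** One form for both changes of variables in use: the translation by periods, [aff 1 s 1 0], and
    the scaling between cell and rough domain, [aff eps 0 eps 0] and its inverse. *)
Definition aff (a b c d : R) (y : R * R) : R * R := (a * y.1 + b, c * y.2 + d).

Lemma aff_continuous a b c d : continuous (aff a b c d).
Proof.
move=> x.
have h1 : (a * y.1 + b) @[y --> x] --> a * x.1 + b.
  by apply: cvgD; [apply: cvgM; [exact: cvg_cst|exact: cvg_fst]|exact: cvg_cst].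
have h2 : (c * y.2 + d) @[y --> x] --> c * x.2 + d.
  by apply: cvgD; [apply: cvgM; [exact: cvg_cst|exact: cvg_snd]|exact: cvg_cst].
exact: (cvg_pair h1 h2).
Qed.

Lemma is_derive_affine (a b : R) (t : R) : is_derive t 1 (fun t => a * t + b) a.
Proof.
apply: (is_derive_eq (is_deriveD (is_deriveZ a (is_derive_id t 1)) (is_derive_cst b t 1))).
by rewrite addr0 /GRing.scale /= mulr1.
Qed.

Lemma is_derive_aff1 F a b c d x (l : R) : is_derive (aff a b c d x) e1 F l ->
  is_derive x e1 (F \o aff a b c d) (a * l).
Proof.
move=> /is_derive_e1 h; apply/is_derive_e1; rewrite mulrC.
exact: (@is_derive1_comp _ (fun t => F (t, c * x.2 + d)) (fun t => a * t + b) _ _ _ h (is_derive_affine a b x.1)).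
Qed.

Lemma is_derive_aff2 F a b c d x (l : R) : is_derive (aff a b c d x) e2 F l ->
  is_derive x e2 (F \o aff a b c d) (c * l).
Proof.
move=> /is_derive_e2 h; apply/is_derive_e2; rewrite mulrC.
exact: (@is_derive1_comp _ (fun t => F (a * x.1 + b, t)) (fun t => c * t + d) _ _ _ h (is_derive_affine c d x.2)).
Qed.

Lemma class_C_aff k F a b c d : of_class_C k F -> of_class_C k (F \o aff a b c d).
Proof.
elim: k F => [|k IH] F cF.
  by move=> x; apply: continuous_comp; [exact: aff_continuous|exact: cF].
have [f0 _ f1 f2] := cF.
apply: (@class_CS _ _ (fun x => a * ('D_e1 F \o aff a b c d) x) (fun x => c * ('D_e2 F \o aff a b c d) x)).
- by move=> x; apply: continuous_comp; [exact: aff_continuous|exact: f0].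
- by move=> x; apply: is_derive_aff1; exact: (class_CS_derive _ cF).1.
- by move=> x; apply: is_derive_aff2; exact: (class_CS_derive _ cF).2.
- by apply: class_CM; [exact: class_C_cst|exact: IH].
- by apply: class_CM; [exact: class_C_cst|exact: IH].
Qed.

Lemma smooth_continuous F : smooth F -> continuous F. Proof. by move=> /(_ 0%N). Qed.
Lemma smooth_D1 F x : smooth F -> is_derive x e1 F ('D_e1 F x).
Proof. by move=> /(_ 1%N)/(class_CS_derive x)[]. Qed.
Lemma smooth_D2 F x : smooth F -> is_derive x e2 F ('D_e2 F x).
Proof. by move=> /(_ 1%N)/(class_CS_derive x)[]. Qed.
Lemma D1_smooth F : smooth F -> smooth ('D_e1 F). Proof. by move=> sF k; have [] := sF k.+1. Qed.
Lemma D2_smooth F : smooth F -> smooth ('D_e2 F). Proof. by move=> sF k; have [] := sF k.+1. Qed.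
Lemma smooth_cst (c : R) : smooth (fun=> c : R). Proof. by move=> k; exact: class_C_cst. Qed.
Lemma smoothD F G : smooth F -> smooth G -> smooth (fun x => F x + G x).
Proof. by move=> sF sG k; exact: class_CD. Qed.
Lemma smoothM F G : smooth F -> smooth G -> smooth (fun x => F x * G x).
Proof. by move=> sF sG k; exact: class_CM. Qed.
Lemma smooth_fst (g : R -> R) : smooth1 g -> smooth (fun x : R * R => g x.1).
Proof. by move=> sg k; exact: class_C_fst. Qed.
Lemma smooth_snd (g : R -> R) : smooth1 g -> smooth (fun x : R * R => g x.2).
Proof. by move=> sg k; exact: class_C_snd. Qed.
Lemma smooth_aff F a b c d : smooth F -> smooth (F \o aff a b c d).
Proof. by move=> sF k; exact: class_C_aff. Qed.
Lemma D1_cst (c : R) x : 'D_e1 (fun=> c : R) x = 0. Proof. exact: derive_cst. Qed.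
Lemma D2_cst (c : R) x : 'D_e2 (fun=> c : R) x = 0. Proof. exact: derive_cst. Qed.
Lemma D1_add F G x : smooth F -> smooth G -> 'D_e1 (fun x => F x + G x) x = 'D_e1 F x + 'D_e1 G x.
Proof. by move=> /(smooth_D1 x) h1 /(smooth_D1 x) h2; exact: (@derive_val _ _ _ _ _ _ _ (is_deriveD h1 h2)). Qed.
Lemma D2_add F G x : smooth F -> smooth G -> 'D_e2 (fun x => F x + G x) x = 'D_e2 F x + 'D_e2 G x.
Proof. by move=> /(smooth_D2 x) h1 /(smooth_D2 x) h2; exact: (@derive_val _ _ _ _ _ _ _ (is_deriveD h1 h2)). Qed.
Lemma D1_mul F G x : smooth F -> smooth G ->
  'D_e1 (fun x => F x * G x) x = F x * 'D_e1 G x + G x * 'D_e1 F x.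
Proof. by move=> /(smooth_D1 x) h1 /(smooth_D1 x) h2; exact: (@derive_val _ _ _ _ _ _ _ (is_deriveM h1 h2)). Qed.
Lemma D2_mul F G x : smooth F -> smooth G ->
  'D_e2 (fun x => F x * G x) x = F x * 'D_e2 G x + G x * 'D_e2 F x.
Proof. by move=> /(smooth_D2 x) h1 /(smooth_D2 x) h2; exact: (@derive_val _ _ _ _ _ _ _ (is_deriveM h1 h2)). Qed.
Lemma D1_fst (g : R -> R) x : smooth1 g -> 'D_e1 (fun x : R * R => g x.1) x = derive1 g x.1.
Proof.
move=> sg; have h : is_derive x e1 (fun x : R * R => g x.1) (derive1 g x.1).
  by apply/is_derive_e1; exact: smooth1_derive.
exact: (@derive_val _ _ _ _ _ _ _ h).
Qed.
Lemma D2_fst (g : R -> R) x : 'D_e2 (fun x : R * R => g x.1) x = 0.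
Proof.
have h : is_derive x e2 (fun x : R * R => g x.1) 0.
  by apply/is_derive_e2; exact: (is_derive_cst (g x.1)).
exact: (@derive_val _ _ _ _ _ _ _ h).
Qed.
Lemma D2_snd (g : R -> R) x : smooth1 g -> 'D_e2 (fun x : R * R => g x.2) x = derive1 g x.2.
Proof.
move=> sg; have h : is_derive x e2 (fun x : R * R => g x.2) (derive1 g x.2).
  by apply/is_derive_e2; exact: smooth1_derive.
exact: (@derive_val _ _ _ _ _ _ _ h).
Qed.
Lemma D1_snd (g : R -> R) x : 'D_e1 (fun x : R * R => g x.2) x = 0.
Proof.
have h : is_derive x e1 (fun x : R * R => g x.2) 0.
  by apply/is_derive_e1; exact: (is_derive_cst (g x.2)).
exact: (@derive_val _ _ _ _ _ _ _ h).
Qed.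
Lemma D1_aff F a b c d x : smooth F ->
  'D_e1 (F \o aff a b c d) x = a * 'D_e1 F (aff a b c d x).
Proof. by move=> /(@smooth_D1 _ (aff a b c d x))/is_derive_aff1 h; exact: (@derive_val _ _ _ _ _ _ _ h). Qed.
Lemma D2_aff F a b c d x : smooth F ->
  'D_e2 (F \o aff a b c d) x = c * 'D_e2 F (aff a b c d x).
Proof. by move=> /(@smooth_D2 _ (aff a b c d x))/is_derive_aff2 h; exact: (@derive_val _ _ _ _ _ _ _ h). Qed.
End Smooth2.

(** * Lebesgue measure on the plane *)

Section Borel2.
Variable R : realType.
Definition obox (p : R * R) (r : R) : set (R * R) :=
  [set x | `|x.1 - p.1| < r /\ `|x.2 - p.2| < r].

Lemma obox_nbhs (p : R * R) (r : R) : 0 < r -> nbhs p (obox p r).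
Proof.
move=> r0; rewrite nbhs_ballP; exists r => //= y [/= h1 h2].
by split; rewrite distrC.
Qed.

Lemma nbhs_obox (p : R * R) (U : set (R * R)) : nbhs p U -> exists2 r, 0 < r & obox p r `<=` U.
Proof.
rewrite nbhs_ballP => -[r /= r0 h]; exists r => // y [h1 h2]; apply: h.
by split => /=; rewrite /ball /= distrC.
Qed.

Lemma measurable_fst1 : measurable_fun setT (fun x : R * R => x.1).
Proof. exact: measurable_fst. Qed.
Lemma measurable_snd1 : measurable_fun setT (fun x : R * R => x.2).
Proof. exact: measurable_snd. Qed.

Lemma measurable_rect (A B : set R) : measurable A -> measurable B ->
  measurable [set x : R * R | A x.1 /\ B x.2].
Proof. exact: measurableX. Qed.

(** Measurability on [R * R] refers to the product sigma-algebra; an open set is the countable union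
    of the rational boxes that it contains. *)
Lemma open_measurable2 (U : set (R * R)) : open U -> measurable U.
Proof.
move=> oU.
pose box (q : (rat * rat) * (rat * rat)) : set (R * R) :=
  [set x | (`]ratr q.1.1, ratr q.1.2[%classic : set R) x.1 /\
           (`]ratr q.2.1, ratr q.2.2[%classic : set R) x.2].
have -> : U = \bigcup_q (if pselect (box q `<=` U) then box q else set0).
  apply/seteqP; split => [p Up|p [q _]]; last by case: pselect => // h /h.
  have [r r0 hr] := nbhs_obox (oU p Up).
  have rat_between (a b : R) : a < b -> exists q : rat, a < ratr q < b.
    by move=> /rat_in_itvoo[q]; rewrite in_itv; exists q.
  have [a1 /andP[? ?]] := rat_between (p.1 - r) p.1 ltac:(lra).
  have [b1 /andP[? ?]] := rat_between p.1 (p.1 + r) ltac:(lra).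
  have [a2 /andP[? ?]] := rat_between (p.2 - r) p.2 ltac:(lra).
  have [b2 /andP[? ?]] := rat_between p.2 (p.2 + r) ltac:(lra).
  exists ((a1, b1), (a2, b2)) => //.
  case: pselect => [h|[]]; first by rewrite /box /= !in_itv /=; split; lra.
  move=> y; rewrite /box /= !in_itv /= => -[/andP[? ?] /andP[? ?]]; apply: hr.
  by rewrite /obox /= !ltr_norml; split; apply/andP; split; lra.
apply: countable_bigcupT_measurable => // q.
case: pselect => [h|h]; last exact: measurable0.
by apply: measurable_rect; exact: measurable_itv.
Qed.

Lemma closed_measurable2 (U : set (R * R)) : closed U -> measurable U.
Proof. by move/closed_openC/open_measurable2/measurableC; rewrite setCK. Qed.

Lemma continuous_measurable2 (F : R * R -> R) : continuous F -> measurable_fun setT F.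
Proof.
move=> cF; apply: (measurability _ (RGenOpens.measurableE R)).
move=> _ [_ [a [b ->] <-]]; rewrite setTI; apply: open_measurable2.
by apply: open_comp; [move=> x _; exact: cF|exact: interval_open].
Qed.

Lemma continuous_measurable_funS2 (F : R * R -> R) D : continuous F -> measurable D -> measurable_fun D F.
Proof. by move=> cF mD; apply: measurable_funTS; exact: continuous_measurable2. Qed.

Lemma smooth_measurable (F : R * R -> R) D : smooth F -> measurable D -> measurable_fun D F.
Proof. by move=> /smooth_continuous cF mD; exact: continuous_measurable_funS2. Qed.
End Borel2.

Section IntE.
Context d (T : measurableType d) (R : realType) (mu : {measure set T -> \bar R}).
Variables (D : set T) (mD : measurable D).
Implicit Types f g : T -> R.
Local Open Scope ereal_scope.

Lemma le_intE f g : measurable_fun D f -> measurable_fun D g ->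
  (forall x, D x -> (0 <= f x)%R) -> (forall x, D x -> (f x <= g x)%R) ->
  \int[mu]_(x in D) (f x)%:E <= \int[mu]_(x in D) (g x)%:E.
Proof.
move=> mf mg f0 fg; apply: ge0_le_integral.
- exact: mD.
- by move=> x Dx; rewrite lee_fin f0.
- exact/measurable_EFinP.
- exact/measurable_EFinP.
- by move=> x Dx; rewrite lee_fin fg.
Qed.

Lemma intDE f g : measurable_fun D f -> measurable_fun D g ->
  (forall x, D x -> (0 <= f x)%R) -> (forall x, D x -> (0 <= g x)%R) ->
  \int[mu]_(x in D) (f x + g x)%:E = \int[mu]_(x in D) (f x)%:E + \int[mu]_(x in D) (g x)%:E.
Proof.
move=> mf mg f0 g0; under eq_integral do rewrite EFinD.
apply: ge0_integralD; try exact/measurable_EFinP; first exact: mD.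
- by move=> x Dx; rewrite lee_fin f0.
- by move=> x Dx; rewrite lee_fin g0.
Qed.

Lemma intZE f (c : R) : measurable_fun D f -> (forall x, D x -> (0 <= f x)%R) -> (0 <= c)%R ->
  \int[mu]_(x in D) (c * f x)%:E = c%:E * \int[mu]_(x in D) (f x)%:E.
Proof.
move=> mf f0 c0; under eq_integral do rewrite EFinM.
apply: ge0_integralZl; [exact: mD|exact/measurable_EFinP| |by rewrite lee_fin].
by move=> x Dx; rewrite lee_fin f0.
Qed.

Lemma intE_ge0 f : (forall x, D x -> (0 <= f x)%R) -> 0 <= \int[mu]_(x in D) (f x)%:E.
Proof. by move=> f0; apply: integral_ge0 => x Dx; rewrite lee_fin f0. Qed.

Lemma le_int_sub f (E : set T) : measurable E -> measurable_fun D f ->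
  (forall x, D x -> (0 <= f x)%R) -> E `<=` D ->
  \int[mu]_(x in E) (f x)%:E <= \int[mu]_(x in D) (f x)%:E.
Proof.
move=> mE mf f0 ED; apply: ge0_subset_integral; [exact: mE|exact: mD|exact/measurable_EFinP| |exact: ED].
by move=> x Dx; rewrite lee_fin f0.
Qed.

Lemma int_sqr_add (f a b : T -> R) : measurable_fun D f -> measurable_fun D a -> measurable_fun D b ->
  (forall x, D x -> f x = (a x + b x)%R) ->
  \int[mu]_(x in D) (f x ^+ 2)%:E <=
  2%:E * (\int[mu]_(x in D) (a x ^+ 2)%:E + \int[mu]_(x in D) (b x ^+ 2)%:E).
Proof.
move=> mf ma mb fab.
have ma2 : measurable_fun D (fun x => a x ^+ 2)%R by exact: measurable_funX.
have mb2 : measurable_fun D (fun x => b x ^+ 2)%R by exact: measurable_funX.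
have mab : measurable_fun D (fun x => a x ^+ 2 + b x ^+ 2)%R by exact: measurable_funD.
have ge0 (x : T) : (0 <= a x ^+ 2 + b x ^+ 2)%R by rewrite addr_ge0 // sqr_ge0.
rewrite -intDE //; [|by move=> x _; exact: sqr_ge0|by move=> x _; exact: sqr_ge0].
rewrite -intZE //; apply: le_intE.
- exact: measurable_funX.
- exact: measurable_funM.
- by move=> x _; exact: sqr_ge0.
- by move=> x Dx; rewrite fab //; have := sqr_ge0 (a x - b x)%R; nra.
Qed.
End IntE.

Section DCT.
Context d (T : measurableType d) (R : realType) (mu : {measure set T -> \bar R}).
Variables (D : set T) (mD : measurable D).

Lemma dct (c : nat -> T -> R) (b g : T -> R) :
  (forall m, measurable_fun D (c m)) -> measurable_fun D b -> mu.-integrable D (EFin \o g) ->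
  (forall m x, D x -> `|c m x| <= g x) -> (forall x, D x -> c m x @[m --> \oo] --> b x) ->
  [/\ mu.-integrable D (EFin \o b),
      (\int[mu]_(x in D) (`|c m x - b x|)%:E)%E @[m --> \oo] --> 0%E &
      \int[mu]_(x in D) c m x @[m --> \oo] --> \int[mu]_(x in D) b x].
Proof.
move=> mc mb ig cg cb.
have h1 m : measurable_fun D (EFin \o c m) by apply/measurable_EFinP.
have h2 : measurable_fun D (EFin \o b) by apply/measurable_EFinP.
have h3 : {ae mu, forall x, D x -> (EFin \o c m) x @[m --> \oo] --> (EFin \o b) x}.
  apply: aeW => x Dx; apply/fine_cvgP; split; first exact: nearW.
  exact: cb.
have h4 : {ae mu, forall x m, D x -> (`|(EFin \o c m) x| <= (EFin \o g) x)%E}.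
  by apply: aeW => x m Dx; rewrite /= lee_fin cg.
have [ib k1 k2] := dominated_convergence mD h1 h2 h3 ig h4; split => //.
by apply: fine_cvg; rewrite fineK //; exact: integrable_fin_num.
Qed.
End DCT.

Section TonelliE.
Context d1 d2 (T1 : measurableType d1) (T2 : measurableType d2) (R : realType).
Variables (m1 : {sigma_finite_measure set T1 -> \bar R}) (m2 : {sigma_finite_measure set T2 -> \bar R}).
Variable F : T1 -> T2 -> R.
Hypothesis mF : measurable_fun setT (fun xy : T1 * T2 => F xy.1 xy.2).
Hypothesis F0 : forall x y, 0 <= F x y.
Local Open Scope ereal_scope.

Let F0' (xy : T1 * T2) : 0 <= (F xy.1 xy.2)%:E. Proof. by rewrite lee_fin F0. Qed.
Let mF' : measurable_fun setT (fun xy : T1 * T2 => (F xy.1 xy.2)%:E).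
Proof. exact/measurable_EFinP. Qed.

Lemma tonelli_swapE : \int[m1]_x \int[m2]_y (F x y)%:E = \int[m2]_y \int[m1]_x (F x y)%:E.
Proof. exact: (@fubini_tonelli _ _ _ _ _ m1 m2 _ mF' F0'). Qed.

Lemma measurable_intE : measurable_fun setT (fun x => \int[m2]_y (F x y)%:E).
Proof. exact: (@measurable_fun_fubini_tonelli_F _ _ _ _ _ m2 _ mF' F0'). Qed.
End TonelliE.

(** * Affine changes of variables in integrals *)

Section ChangeVar.
Variable R : realType.
Local Notation mu := (area R).
Local Notation leb := (@lebesgue_measure R).
Local Open Scope ereal_scope.

Lemma measurable_affine1 (a b : R) : measurable_fun setT (fun t : R => (a * t + b)%R).
Proof.
apply: continuous_measurable_fun => x; apply: cvgD; last exact: cvg_cst.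
by apply: cvgM; [exact: cvg_cst|exact: cvg_id].
Qed.

(** The right side is a measure in [A], so by uniqueness of Lebesgue measure half-open intervals
    suffice. The sign of [a] matters because a negative factor exchanges the closed and the open
    end. *)
Lemma leb_affine (a b : R) (A : set R) : a != 0%R -> measurable A ->
  leb A = `|a|%:E * leb ((fun t : R => (a * t + b)%R) @^-1` A).
Proof.
move=> a0 mA.
have ma : measurable_fun setT (fun t : measurableTypeR R => (a * t + b)%R : measurableTypeR R).
  exact: measurable_affine1.
pose nu : {measure set (measurableTypeR R) -> \bar R} := mscale (NngNum (normr_ge0 a)) (pushforward leb (fun t : measurableTypeR R => (a * t + b)%R : measurableTypeR R)).
rewrite (@lebesgue_measure_unique _ (nu ma) _ A mA) // => X [[c d]] /= cd <-.
rewrite /nu /mscale /= /pushforward.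
have [a_gt0|a_lt0|/eqP] := ltgtP a 0%R; last by rewrite (negbTE a0).
- have -> : (fun t : R => (a * t + b)%R) @^-1` `]c, d]%classic = `[((d - b) / a)%R, ((c - b) / a)%R[%classic.
    apply/seteqP; split => t /=; rewrite !in_itv /= ler_ndivrMr // ltr_ndivlMr //; lra.
  rewrite !lebesgue_measure_itv /= !lte_fin ltr_ndivrMr // divfK // ltrD2r.
  case: ifPn => cd'; last by rewrite mule0.
  rewrite -!EFinD -EFinM ltr0_norm //; congr (_%:E); field.
  by rewrite a0.
- have -> : (fun t : R => (a * t + b)%R) @^-1` `]c, d]%classic = `]((c - b) / a)%R, ((d - b) / a)%R]%classic.
    apply/seteqP; split => t /=; rewrite !in_itv /= ltr_pdivrMr // ler_pdivlMr //; lra.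
  rewrite !lebesgue_measure_itv /= !lte_fin ltr_pdivrMr // divfK // ltrD2r.
  case: ifPn => cd'; last by rewrite mule0.
  rewrite -!EFinD -EFinM gtr0_norm //; congr (_%:E); field.
  by rewrite a0.
Qed.

Lemma ge0_int_affine1 (a b : R) (F : R -> \bar R) : a != 0%R ->
  measurable_fun setT F -> (forall t, 0 <= F t) ->
  \int[leb]_t F t = `|a|%:E * \int[leb]_t F (a * t + b)%R.
Proof.
move=> a0 mF F0.
pose T : measurableTypeR R -> measurableTypeR R := fun t => (a * t + b)%R.
have mT : measurable_fun setT T by exact: measurable_affine1.
have := @ge0_integral_pushforward _ _ _ _ R T mT leb setT F measurableT mF (fun t _ => F0 t).
rewrite preimage_setT /= => <-.
rewrite -ge0_integral_mscale //.
by apply: eq_measure_integral => A mA _ /=; rewrite /mscale /= (leb_affine b a0 mA).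
Qed.

Lemma tonelli (F : R * R -> \bar R) : measurable_fun setT F -> (forall x, 0 <= F x) ->
  \int[mu]_x F x = \int[leb]_s \int[leb]_t F (s, t).
Proof. by move=> mF F0; rewrite fubini_tonelli1. Qed.

Lemma measurable_int2 (F : R * R -> \bar R) : measurable_fun setT F -> (forall x, 0 <= F x) ->
  measurable_fun setT (fun s : R => \int[leb]_t F (s, t)).
Proof. by move=> mF F0; exact: (@measurable_fun_fubini_tonelli_F _ _ _ _ _ leb F). Qed.

Lemma aff_measurable (a b c d : R) : measurable_fun setT (aff a b c d).
Proof.
apply: measurable_fun_pair.
  by apply: (measurableT_comp (measurable_affine1 a b)); exact: measurable_fst1.
by apply: (measurableT_comp (measurable_affine1 c d)); exact: measurable_snd1.
Qed.

Lemma ge0_int_affine2 (a b c d : R) (F : R * R -> \bar R) : a != 0%R -> c != 0%R ->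
  measurable_fun setT F -> (forall x, 0 <= F x) ->
  \int[mu]_x F x = `|a * c|%:E * \int[mu]_x F (aff a b c d x).
Proof.
move=> a0 c0 mF F0.
have mFa : measurable_fun setT (F \o aff a b c d) by apply: measurableT_comp => //; exact: aff_measurable.
rewrite tonelli // (tonelli mFa (fun x => F0 _)).
rewrite (@ge0_int_affine1 a b _ a0 (measurable_int2 mF F0)); last by move=> s; exact: integral_ge0.
rewrite normrM EFinM -muleA; congr (_ * _).
have mac : measurable_fun setT (fun s : R => \int[leb]_t (F \o aff a b c d) (s, t)).
  exact: (measurable_int2 mFa (fun x => F0 _)).
transitivity (\int[leb]_s (`|c|%:E * \int[leb]_t (F \o aff a b c d) (s, t))); last first.
  apply: (ge0_integralZl leb measurableT mac) => [s _|]; last by rewrite lee_fin.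
  by apply: integral_ge0 => t _; exact: F0.
apply: eq_integral => s _.
rewrite (@ge0_int_affine1 c d (fun t => F ((a * s + b)%R, t))) //.
by apply: measurableT_comp => //; exact: measurable_pair1.
Qed.

End ChangeVar.

(** * Convolution and mollification *)

Section CSupp.
Variable R : realType.
Implicit Types p q : R -> R.

Definition csupp p := exists r : R, forall t, r < `|t| -> p t = 0.

Lemma csupp_derive1 p : csupp p -> csupp (derive1 p).
Proof.
move=> [r hr]; exists r => t rt; rewrite derive1E.
apply: derive_val; apply: (@near_eq_is_derive _ _ _ (cst (0:R))).
have : \forall s \near t, r < `|s|.
  have e0 : 0 < `|t| - r by rewrite subr_gt0.
  apply: filterS (nbhsx_ballx t _ e0) => s; rewrite /ball /= => h.
  have := ler_normD (t - s) s; rewrite subrK; lra.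
by apply: filterS => s hs; rewrite hr.
Qed.

Lemma csupp_bounded p : continuous p -> csupp p -> exists2 K, 0 < K & forall t, `|p t| <= K.
Proof.
move=> cp [r hr].
have [r0|r0] := ltP r 0.
  by exists 1 => // t; rewrite hr ?normr0 // (lt_le_trans r0).
have [c _ hc] : exists2 c, c \in `[- r, r] & forall t, t \in `[- r, r] -> `|p t| <= `|p c|.
  apply: (@EVT_max _ (fun t => `|p t|)); first lra.
  by apply: continuous_subspaceT => x; apply: continuous_comp; [exact: cp|exact: norm_continuous].
exists (1 + `|p c|); first by rewrite ltr_pwDl.
move=> t; have [tr|tr] := ltP r `|t|; first by rewrite hr // normr0 addr_ge0.
by rewrite (le_trans (hc t _)) ?lerDr // in_itv /= -ler_norml.
Qed.

Lemma smooth1_csupp_lip p : smooth1 p -> csupp p ->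
  exists2 K, 0 < K & forall s t, `|p s - p t| <= K * `|s - t|.
Proof.
move=> sp cp; have [K K0 hK] := csupp_bounded (smooth1_continuous (smooth1_derive1 sp)) (csupp_derive1 cp).
exists K => // s t; wlog st : s t / t <= s.
  by have [ts|/ltW st] := leP t s; [apply|rewrite distrC (distrC s); apply].
have [c _ ->] := @MVT_segment R p (derive1 p) t s st (fun x _ => smooth1_derive sp x)
  (continuous_subspaceT (smooth1_continuous sp)).
by rewrite normrM ler_wpM2r.
Qed.

(** The mean value theorem replaces the increment by a derivative nearby, and the derivative is
    Lipschitz. A constant uniform in [t] allows convolutions to be differentiated by a direct
    estimate under the integral. *)
Lemma smooth1_csupp_taylor p : smooth1 p -> csupp p ->
  exists2 K, 0 < K & forall t h, `|p (t + h) - p t - h * derive1 p t| <= K * h ^+ 2.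
Proof.
move=> sp cp; have [K K0 hK] := smooth1_csupp_lip (smooth1_derive1 sp) (csupp_derive1 cp).
have key : forall a b : R, a <= b -> exists2 c, a <= c <= b & p b - p a = derive1 p c * (b - a).
  move=> a b ab; have [c + ->] := @MVT_segment R p (derive1 p) a b ab (fun x _ => smooth1_derive sp x)
    (continuous_subspaceT (smooth1_continuous sp)).
  by rewrite in_itv; exists c.
exists K => // t h; have [h0|h0] := leP 0 h.
  have [c /andP[c1 c2] ->] := key t (t + h) ltac:(lra).
  have -> : derive1 p c * (t + h - t) - h * derive1 p t = h * (derive1 p c - derive1 p t) by ring.
  rewrite normrM expr2 mulrCA ler_pM // ?(ger0_norm h0) //.
  apply: le_trans (hK _ _) _; rewrite ler_pM2l // ger0_norm; lra.
have [c /andP[c1 c2] hc] := key (t + h) t ltac:(lra).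
have -> : p (t + h) - p t - h * derive1 p t = h * (derive1 p c - derive1 p t).
  by rewrite -(opprB (p t)) hc; ring.
rewrite normrM -[h ^+ 2]sqrrN expr2 mulrCA (ltr0_norm h0) ler_pM2l ?oppr_gt0 //.
apply: le_trans (hK _ _) _; rewrite ler_pM2l // ler0_norm; lra.
Qed.

Lemma is_derive_quad (f : R -> R) (t d C : R) :
  (forall h, `|f (t + h) - f t - h * d| <= C * h ^+ 2) -> is_derive t 1 f d.
Proof.
move=> H.
have C0 : 0 <= C by have := H 1; rewrite expr1n mulr1; exact: le_trans.
suff Hf : h^-1 *: ((f \o shift t) h%:A - f t) @[h --> 0^'] --> d.
  by have F1 : 'D_1 f t = d; [apply: cvg_lim|rewrite -F1 in Hf; constructor].
apply/cvgrPdist_le => e e0; near=> h.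
have h0 : h != 0 by near: h; exact: nbhs_dnbhs_neq.
rewrite /= /GRing.scale /= mulr1 distrC.
have -> : h^-1 * (f (h + t) - f t) - d = h^-1 * (f (t + h) - f t - h * d).
  by rewrite (addrC h) [RHS]mulrBr (mulKf h0).
rewrite normrM normfV ler_pdivrMl ?normr_gt0 //.
apply: le_trans (H h) _; rewrite -real_normK ?num_real // expr2 mulrCA ler_pM2l ?normr_gt0 //.
have hC : `|h| <= e / (C + 1).
  near: h; apply: dnbhs0_le; rewrite divr_gt0 // ltr_wpDl //.
apply: (@le_trans _ _ ((C + 1) * (e / (C + 1)))).
  by apply: ler_pM => //; lra.
by rewrite mulrCA divff ?mulr1 // gt_eqF // ltr_wpDl.
Unshelve. all: by end_near. Qed.

End CSupp.

Section Conv.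
Variable R : realType.
Local Notation mu := (area R).
Implicit Types (p q : R -> R) (b : R * R -> R).

Definition bmeas (w : R * R -> R) :=
  measurable_fun setT w /\ exists K, forall z, `|w z| <= K.

Lemma bmeas_integrable b w : mu.-integrable setT (EFin \o b) -> bmeas w ->
  mu.-integrable setT (EFin \o (fun z => b z * w z)).
Proof.
move=> ib [mw [K hK]].
have mb : measurable_fun setT b by apply/measurable_EFinP; exact: measurable_int ib.
have K0 : 0 <= K by exact: le_trans (hK point).
apply: (@le_integrable _ _ _ mu setT measurableT _ (EFin \o (fun z => K * b z))).
- by apply/measurable_EFinP; apply: measurable_funM.
- move=> z _; rewrite /= lee_fin !normrM mulrC (ger0_norm K0); exact: ler_wpM2r.
- by have := integrableZl measurableT K ib; under eq_fun do rewrite /= -EFinM.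
Qed.

Definition pair_with b w : R := \int[mu]_z (b z * w z).
Definition mass b : R := \int[mu]_z `|b z|.

Lemma pair_withB b w1 w2 : mu.-integrable setT (EFin \o b) -> bmeas w1 -> bmeas w2 ->
  pair_with b w1 - pair_with b w2 = pair_with b (fun z => w1 z - w2 z).
Proof.
move=> ib h1 h2; rewrite /pair_with -RintegralB //; try exact: bmeas_integrable.
by apply: eq_Rintegral => z _; rewrite mulrBr.
Qed.

Lemma pair_withZ b w (c : R) : mu.-integrable setT (EFin \o b) -> bmeas w ->
  c * pair_with b w = pair_with b (fun z => c * w z).
Proof.
move=> ib h; rewrite /pair_with -RintegralZl //; try exact: bmeas_integrable.
by apply: eq_Rintegral => z _; rewrite mulrCA.
Qed.

Lemma pair_with_le b w (c : R) : mu.-integrable setT (EFin \o b) -> bmeas w ->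
  (forall z, `|w z| <= c) -> `|pair_with b w| <= c * mass b.
Proof.
move=> ib h hc; have ibw := bmeas_integrable ib h.
have ian : mu.-integrable setT (EFin \o (fun z => `|b z|)) by exact: integrable_abse ib.
apply: le_trans (le_normr_Rintegral measurableT ibw) _.
rewrite /mass -RintegralZl //.
apply: le_Rintegral => //.
- exact: integrable_abse ibw.
- by have := integrableZl measurableT c ian; under eq_fun do rewrite /= -EFinM.
- by move=> z _; rewrite normrM mulrC ler_wpM2r.
Qed.

(** With a product kernel, differentiating the convolution in one variable replaces one factor by
    its derivative and gives a convolution of the same kind; this closes the induction in
    [conv_smooth]. *)
Definition ker p q (x z : R * R) : R := p (x.1 - z.1) * q (x.2 - z.2).
Definition conv p q b (x : R * R) : R := pair_with b (ker p q x).

Lemma ker_measurable p q x : continuous p -> continuous q -> measurable_fun setT (ker p q x).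
Proof.
move=> cp cq; apply: measurable_funM.
  apply: (@measurableT_comp _ _ _ _ _ _ p); first exact: continuous_measurable_fun.
  by apply: measurable_funB => //; exact: measurable_fst1.
apply: (@measurableT_comp _ _ _ _ _ _ q); first exact: continuous_measurable_fun.
by apply: measurable_funB => //; exact: measurable_snd1.
Qed.

Lemma ker_bmeas p q x : smooth1 p -> csupp p -> smooth1 q -> csupp q -> bmeas (ker p q x).
Proof.
move=> /smooth1_continuous sp cp /smooth1_continuous sq cq.
split; first exact: ker_measurable.
have [K K0 hK] := csupp_bounded sp cp; have [K' K0' hK'] := csupp_bounded sq cq.
by exists (K * K') => z; rewrite normrM ler_pM.
Qed.

Lemma bmeasB w1 w2 : bmeas w1 -> bmeas w2 -> bmeas (fun z => w1 z - w2 z).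
Proof.
move=> [m1 [K1 h1]] [m2 [K2 h2]]; split; first exact: measurable_funB.
by exists (K1 + K2) => z; rewrite (le_trans (ler_normB _ _)) // lerD.
Qed.

Lemma bmeasZ w (c : R) : bmeas w -> bmeas (fun z => c * w z).
Proof.
move=> [m1 [K1 h1]]; split; first exact: measurable_funM.
by exists (`|c| * K1) => z; rewrite normrM ler_wpM2l.
Qed.

Section ConvSmooth.
Variable b : R * R -> R.
Hypothesis ib : mu.-integrable setT (EFin \o b).

Let mass_ge0 : 0 <= mass b. Proof. exact: Rintegral_ge0. Qed.

Lemma conv_continuous p q : smooth1 p -> csupp p -> smooth1 q -> csupp q -> continuous (conv p q b).
Proof.
move=> sp cp sq cq x.
have [K K0 hK] := csupp_bounded (smooth1_continuous sp) cp.
have [K' K0' hK'] := csupp_bounded (smooth1_continuous sq) cq.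
have [M M0 hM] := smooth1_csupp_lip sp cp; have [M' M0' hM'] := smooth1_csupp_lip sq cq.
have key y : `|conv p q b x - conv p q b y| <= (M * `|x.1 - y.1| * K' + K * (M' * `|x.2 - y.2|)) * mass b.
  rewrite /conv pair_withB //; try exact: ker_bmeas.
  apply: pair_with_le => //; first by apply: bmeasB; exact: ker_bmeas.
  move=> z; rewrite /ker.
  have -> : p (x.1 - z.1) * q (x.2 - z.2) - p (y.1 - z.1) * q (y.2 - z.2) =
    (p (x.1 - z.1) - p (y.1 - z.1)) * q (x.2 - z.2) + p (y.1 - z.1) * (q (x.2 - z.2) - q (y.2 - z.2)) by ring.
  apply: le_trans (ler_normD _ _) _; rewrite !normrM; apply: lerD; apply: ler_pM => //.
    by apply: le_trans (hM _ _) _; rewrite ler_pM2l //; have -> : x.1 - z.1 - (y.1 - z.1) = x.1 - y.1 by ring.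
  by apply: le_trans (hM' _ _) _; rewrite ler_pM2l //; have -> : x.2 - z.2 - (y.2 - z.2) = x.2 - y.2 by ring.
apply/cvgrPdist_le => e e0.
pose B := (M * K' + K * M') * mass b + 1.
have B0 : 0 < B by rewrite ltr_wpDl // mulr_ge0 // addr_ge0 // mulr_ge0 // ltW.
have := @obox_nbhs R x (e / B) (divr_gt0 e0 B0).
apply: filterS => y [h1 h2]; apply: le_trans (key y) _.
apply: (@le_trans _ _ ((M * K' + K * M') * mass b * (e / B))).
  rewrite [leRHS]mulrAC ler_wpM2r // mulrDl lerD //.
    rewrite mulrAC; apply: ler_wpM2l; first by apply: mulr_ge0; exact: ltW.
    by rewrite distrC; exact: ltW.
  rewrite mulrA; apply: ler_wpM2l; first by apply: mulr_ge0; exact: ltW.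
  by rewrite distrC; exact: ltW.
rewrite mulrCA ler_piMr ?ltW // ltr_pdivrMr //.
by rewrite mul1r /B ltrDl.
Qed.

Lemma conv_D1 p q x : smooth1 p -> csupp p -> smooth1 q -> csupp q ->
  is_derive x e1 (conv p q b) (conv (derive1 p) q b x).
Proof.
move=> sp cp sq cq; apply/is_derive_e1.
have [K' K0' hK'] := csupp_bounded (smooth1_continuous sq) cq.
have [M M0 hM] := smooth1_csupp_taylor sp cp.
have bm y : bmeas (ker p q y) by exact: ker_bmeas.
have bm' y : bmeas (ker (derive1 p) q y).
  by apply: ker_bmeas => //; [exact: smooth1_derive1|exact: csupp_derive1].
apply: (@is_derive_quad _ _ _ _ (M * K' * mass b)) => h.
rewrite /conv pair_withZ // pair_withB // -?surjective_pairing //.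
rewrite pair_withB //; [|exact: bmeasB|exact: bmeasZ].
rewrite (mulrAC _ (mass b)); apply: pair_with_le => //.
  by apply: bmeasB; [exact: bmeasB|exact: bmeasZ].
move=> z; rewrite /ker /=.
have -> : p (x.1 + h - z.1) * q (x.2 - z.2) - p (x.1 - z.1) * q (x.2 - z.2) -
  h * (derive1 p (x.1 - z.1) * q (x.2 - z.2)) =
  (p (x.1 - z.1 + h) - p (x.1 - z.1) - h * derive1 p (x.1 - z.1)) * q (x.2 - z.2).
  by rewrite (addrAC x.1 h); ring.
by rewrite normrM mulrAC ler_pM.
Qed.

Lemma conv_D2 p q x : smooth1 p -> csupp p -> smooth1 q -> csupp q ->
  is_derive x e2 (conv p q b) (conv p (derive1 q) b x).
Proof.
move=> sp cp sq cq; apply/is_derive_e2.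
have [K' K0' hK'] := csupp_bounded (smooth1_continuous sp) cp.
have [M M0 hM] := smooth1_csupp_taylor sq cq.
have bm y : bmeas (ker p q y) by exact: ker_bmeas.
have bm' y : bmeas (ker p (derive1 q) y).
  by apply: ker_bmeas => //; [exact: smooth1_derive1|exact: csupp_derive1].
apply: (@is_derive_quad _ _ _ _ (K' * M * mass b)) => h.
rewrite /conv pair_withZ // pair_withB // -?surjective_pairing //.
rewrite pair_withB //; [|exact: bmeasB|exact: bmeasZ].
rewrite (mulrAC _ (mass b)); apply: pair_with_le => //.
  by apply: bmeasB; [exact: bmeasB|exact: bmeasZ].
move=> z; rewrite /ker /=.
have -> : p (x.1 - z.1) * q (x.2 + h - z.2) - p (x.1 - z.1) * q (x.2 - z.2) -
  h * (p (x.1 - z.1) * derive1 q (x.2 - z.2)) =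
  p (x.1 - z.1) * (q (x.2 - z.2 + h) - q (x.2 - z.2) - h * derive1 q (x.2 - z.2)).
  by rewrite (addrAC x.2 h); ring.
by rewrite normrM -mulrA ler_pM.
Qed.

Lemma conv_smooth p q : smooth1 p -> csupp p -> smooth1 q -> csupp q -> smooth (conv p q b).
Proof.
move=> sp cp sq cq k; elim: k p q sp cp sq cq => [|k IH] p q sp cp sq cq.
  exact: conv_continuous.
apply: (@class_CS _ _ _ (conv (derive1 p) q b) (conv p (derive1 q) b)).
- exact: conv_continuous.
- by move=> x; exact: conv_D1.
- by move=> x; exact: conv_D2.
- by apply: IH => //; [exact: smooth1_derive1|exact: csupp_derive1].
- by apply: IH => //; [exact: smooth1_derive1|exact: csupp_derive1].
Qed.

End ConvSmooth.
End Conv.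

Section Tends0.
Variable R : realType.
Implicit Types u v : nat -> \bar R.
Local Open Scope ereal_scope.

Lemma tends0P u : (forall n, 0 <= u n) ->
  (u @ \oo --> 0) <-> (forall e : R, (0 < e)%R -> \forall n \near \oo, u n <= e%:E).
Proof.
move=> u0; split=> [/fine_cvgP[ufin uc] e e0|H].
  near=> n.
  have fn : u n \is a fin_num by near: n.
  rewrite -(fineK fn) lee_fin.
  by near: n; exact: (cvgr_le _ uc).
apply/fine_cvgP; split.
  have := H 1%R ltr01; apply: filterS => n un.
  by rewrite ge0_fin_numE // (le_lt_trans un) // ltry.
apply/cvgrPdist_le => e e0; have := H e e0; apply: filterS => n un /=.
have fn : u n \is a fin_num by rewrite ge0_fin_numE // (le_lt_trans un) // ltry.
by rewrite sub0r normrN ger0_norm ?fine_ge0 // -lee_fin fineK.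
Unshelve. all: by end_near. Qed.

Lemma tends0_le u v : (forall n, 0 <= u n) -> (forall n, u n <= v n) -> v @ \oo --> 0 -> u @ \oo --> 0.
Proof.
move=> u0 uv v0; have v0' n : 0 <= v n by exact: le_trans (uv n).
apply/tends0P => // e e0; move/(tends0P v0') : v0 => /(_ e e0).
by apply: filterS => n; exact: le_trans.
Qed.

Lemma tends0D u v : (forall n, 0 <= u n) -> (forall n, 0 <= v n) ->
  u @ \oo --> 0 -> v @ \oo --> 0 -> (fun n => u n + v n) @ \oo --> 0.
Proof. by move=> u0 v0 cu cv; rewrite -[X in _ --> X]adde0; apply: cvgeD. Qed.

Lemma tends0Z u (c : R) : u @ \oo --> 0 -> (fun n => c%:E * u n) @ \oo --> 0.
Proof. by move=> cu; rewrite -[X in _ --> X](mule0 c%:E); apply: cvgeZl. Qed.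
End Tends0.

(** * One-sided mollifiers *)

Section Kern.
Variable R : realType.
Local Notation leb := (@lebesgue_measure R).

Lemma smooth1_measurable (p : R -> R) D : smooth1 p -> measurable_fun D p.
Proof.
move=> sp; apply: measurable_funTS; apply: continuous_measurable_fun; exact: smooth1_continuous.
Qed.

(** An approximate identity of mass 1, supported where -t lies in [k / (n+1), (k+1) / (n+1)]: the
    convolution at x samples only points ahead of x, at a distance in this interval. Horizontally
    [k] is 0; vertically it exceeds the slope of the graph above which the samples must stay. *)
Definition kern (k : R) (n : nat) (t : R) : R := n.+1%:R * dstep (- n.+1%:R * t + - k).

Lemma kern_smooth k n : smooth1 (kern k n).
Proof.
apply: smooth1M; first exact: smooth1_cst.
apply: (@smooth1_comp _ (@dstep R)); first exact: dstep_smooth.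
exact: smooth1_affine.
Qed.

Lemma kern_ge0 k n t : 0 <= kern k n t.
Proof. by rewrite mulr_ge0 // dstep_ge0. Qed.

Lemma kern_supp k n t : kern k n t != 0 -> k / n.+1%:R <= - t <= (k + 1) / n.+1%:R.
Proof.
have N0 : 0 < n.+1%:R :> R by [].
rewrite /kern => h.
have : ~ (- n.+1%:R * t + - k <= 0 \/ 1 <= - n.+1%:R * t + - k).
  by move=> /dstep_out E; move: h; rewrite E mulr0 eqxx.
rewrite ler_pdivrMr // ler_pdivlMr // => /not_orP[/negP h1 /negP h2].
move: h1 h2; rewrite -!ltNge => h1 h2; apply/andP; split; lra.
Qed.

Lemma kern_supp1 k n t : 0 <= k -> kern k n t != 0 -> 0 <= - t <= k + 1.
Proof.
move=> k0 /kern_supp/andP[h1 h2]; apply/andP; split.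
  by apply: le_trans h1; rewrite divr_ge0.
apply: le_trans h2 _; rewrite ler_pdivrMr // ler_peMr ?ler1n //; lra.
Qed.

Lemma kern_csupp k n : 0 <= k -> csupp (kern k n).
Proof.
move=> k0; exists (k + 1) => t ht; apply/eqP; apply: contraTT ht => /(kern_supp1 k0)/andP[h1 h2].
by rewrite -leNgt ler_norml; apply/andP; split; lra.
Qed.

Lemma int_dstep : (\int[leb]_t (dstep t)%:E = 1)%E.
Proof.
have -> : (\int[leb]_t (dstep t)%:E = \int[leb]_(t in `[0%R, 1%R]) (dstep t)%:E)%E.
  rewrite [RHS]integral_mkcond; apply: eq_integral => t _.
  rewrite patchE; case: ifPn => // /negP ht; rewrite dstep_out //.
  have [t0|t0] := leP (t : R) 0; [by left|right; rewrite leNgt; apply/negP => t1].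
  by apply: ht; rewrite inE /= in_itv /= !ltW.
rewrite (@continuous_FTC2 _ _ (@step R)) //.
- by rewrite step_ge1 // step_le0 // sube0.
- by apply: continuous_subspaceT => x; exact: (smooth1_continuous (@dstep_smooth R)).
- split.
  + by move=> x _; have [] := is_derive_step x.
  + exact/cvg_at_right_filter/smooth1_continuous/step_smooth.
  + exact/cvg_at_left_filter/smooth1_continuous/step_smooth.
Qed.

Lemma dstep_measurable : measurable_fun setT (fun t => (@dstep R t)%:E).
Proof.
by apply/measurable_EFinP; apply: smooth1_measurable; exact: dstep_smooth.
Qed.

Lemma int_kern k n : (\int[leb]_t (kern k n t)%:E = 1)%E.
Proof.
have N0 : - n.+1%:R != 0 :> R by rewrite oppr_eq0 pnatr_eq0.
have := ge0_int_affine1 (- k) N0 dstep_measurable (fun t => dstep_ge0 t).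
rewrite int_dstep normrN => ->; rewrite ger0_norm //.
rewrite -ge0_integralZl //; last 2 first.
- apply/measurable_EFinP; apply: (@smooth1_measurable (fun t => dstep (- n.+1%:R * t + - k))).
  apply: (@smooth1_comp _ (@dstep R)); first exact: dstep_smooth.
  exact: smooth1_affine.
- by move=> t _; rewrite lee_fin dstep_ge0.
Qed.

Lemma int_kern_l k n (z : R) : (\int[leb]_x (kern k n (x - z)%R)%:E = 1)%E.
Proof.
rewrite -(int_kern k n).
rewrite (@ge0_int_affine1 R 1 (- z) (fun t => (kern k n t)%:E)) ?oner_eq0 //.
- by rewrite normr1 mul1e; apply: eq_integral => x _; rewrite mul1r.
- by apply/measurable_EFinP; apply: smooth1_measurable; exact: kern_smooth.
- by move=> t; rewrite lee_fin kern_ge0.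
Qed.

Lemma int_kern_r k n (x : R) : (\int[leb]_z (kern k n (x - z)%R)%:E = 1)%E.
Proof.
rewrite -(int_kern k n).
rewrite (@ge0_int_affine1 R (-1) x (fun t => (kern k n t)%:E)) ?oppr_eq0 ?oner_eq0 //.
- by rewrite normrN1 mul1e; apply: eq_integral => z _; rewrite mulN1r addrC.
- by apply/measurable_EFinP; apply: smooth1_measurable; exact: kern_smooth.
- by move=> t; rewrite lee_fin kern_ge0.
Qed.
End Kern.

Section AreaSigmaFinite.
Variable R : realType.
Local Notation mu := (area R).

Lemma area_box_lty (a1 b1 a2 b2 : R) :
  (mu [set x | (`[a1, b1[%classic : set R) x.1 /\ (`[a2, b2[%classic : set R) x.2] < +oo)%E.
Proof.
have -> : [set x : R * R | (`[a1, b1[%classic : set R) x.1 /\ (`[a2, b2[%classic : set R) x.2] = `[a1, b1[%classic `*` `[a2, b2[%classic by [].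
rewrite product_measure1E; [|exact: measurable_itv|exact: measurable_itv].
have e1 := @lebesgue_measure_itv R `[a1, b1[; have e2 := @lebesgue_measure_itv R `[a2, b2[.
rewrite /= in e1 e2; rewrite [X in (X * _)%E]e1 [X in (_ * X)%E]e2.
by case: ifP => _; case: ifP => _; rewrite ?mul0e ?mule0 ?ltry // -!EFinD -EFinM ltry.
Qed.

Lemma area_sigma_finite : sigma_finite setT mu.
Proof.
exists (fun n => [set x : R * R | (`[- n%:R, n%:R[%classic : set R) x.1 /\ (`[- n%:R, n%:R[%classic : set R) x.2]).
  apply/esym; apply/seteqP; split => // x _.
  pose m := (Num.trunc (`|x.1| + `|x.2|)).+1.
  have hm : `|x.1| + `|x.2| < m%:R by exact: truncnS_gt.
  exists m => //=; rewrite !in_itv /=.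
  have := ler_norm x.1; have := ler_norm (- x.1); have := ler_norm x.2; have := ler_norm (- x.2).
  have := normr_ge0 x.1; have := normr_ge0 x.2; rewrite !normrN => *; split; apply/andP; split; lra.
move=> n; split; last exact: area_box_lty.
by apply: measurable_rect; exact: measurable_itv.
Qed.

(** The plane measure with its sigma-finite structure, for exchanging integrals over pairs of points
    of the plane in [schur]. *)
Definition area_sf : {sigma_finite_measure set (measurableTypeR R * measurableTypeR R)%type -> \bar R} :=
  HB.pack mu (Measure_isSigmaFinite.Build _ _ _ _ area_sigma_finite).

End AreaSigmaFinite.

Section Moll.
Variable R : realType.
Local Notation mu := (area R).
Variable k : R.
Hypothesis k0 : 0 <= k.
Implicit Types b c : R * R -> R.

Definition kern2 n := ker (kern 0 n) (kern k n).
Definition moll n b := conv (kern 0 n) (kern k n) b.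

Lemma kern2_ge0 n x z : 0 <= kern2 n x z.
Proof. by rewrite mulr_ge0 // kern_ge0. Qed.

Lemma kern_measurable l n D : measurable D -> measurable_fun D (@kern R l n).
Proof.
by move=> mD; apply: smooth1_measurable; exact: kern_smooth.
Qed.

Lemma measurable_subr (x : R) : measurable_fun setT (fun z : R => x - z).
Proof. by apply: measurable_funB. Qed.

Lemma int_kern2_r n x : (\int[mu]_z (kern2 n x z)%:E = 1)%E.
Proof.
rewrite tonelli; last 2 first.
- by apply/measurable_EFinP; apply: ker_measurable; exact/smooth1_continuous/kern_smooth.
- by move=> z; rewrite lee_fin kern2_ge0.
rewrite -(int_kern_r 0 n x.1); apply: eq_integral => s _.
rewrite /kern2 /ker /=; under eq_integral do rewrite EFinM.
rewrite ge0_integralZl //; first by rewrite int_kern_r mule1.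
- apply/measurable_EFinP; apply: (@measurableT_comp _ _ _ _ _ _ (kern k n)); first exact: kern_measurable.
  exact: measurable_subr.
- by move=> t _; rewrite lee_fin kern_ge0.
- by rewrite lee_fin kern_ge0.
Qed.

Lemma kern_shift_measurable (l w : R) n : measurable_fun setT (fun s : R => kern l n (s - w)).
Proof.
apply: (@measurableT_comp _ _ _ _ _ _ (kern l n)); first exact: kern_measurable.
by apply: measurable_funB.
Qed.

Lemma kern2_measurable_l n z : measurable_fun setT (fun x => kern2 n x z).
Proof.
apply: measurable_funM.
  by apply: (measurableT_comp (kern_shift_measurable 0 z.1 n)); exact: measurable_fst1.
by apply: (measurableT_comp (kern_shift_measurable k z.2 n)); exact: measurable_snd1.
Qed.

Lemma int_kern2_l n z : (\int[mu]_x (kern2 n x z)%:E = 1)%E.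
Proof.
rewrite tonelli; last 2 first.
- by apply/measurable_EFinP; exact: kern2_measurable_l.
- by move=> x; rewrite lee_fin kern2_ge0.
rewrite -(int_kern_l 0 n z.1); apply: eq_integral => s _.
rewrite /kern2 /ker /=; under eq_integral do rewrite EFinM.
rewrite ge0_integralZl //; first by rewrite int_kern_l mule1.
- by apply/measurable_EFinP; exact: kern_shift_measurable.
- by move=> t _; rewrite lee_fin kern_ge0.
- by rewrite lee_fin kern_ge0.
Qed.

Definition N1 (g : R * R -> R) : \bar R := (\int[mu]_z (`|g z|)%:E)%E.

Lemma N1_ge0 g : (0 <= N1 g)%E. Proof. by apply: integral_ge0 => z _; rewrite lee_fin. Qed.

Lemma N1D (g h : R * R -> R) : measurable_fun setT g -> measurable_fun setT h ->
  (N1 (fun z => (g z + h z)%R) <= N1 g + N1 h)%E.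
Proof.
move=> mg mh.
have mg' : measurable_fun setT (fun z => `|g z|) by exact: measurableT_comp.
have mh' : measurable_fun setT (fun z => `|h z|) by exact: measurableT_comp.
rewrite /N1 -intDE //; apply: le_intE => //.
- by apply: measurableT_comp => //; exact: measurable_funD.
- exact: measurable_funD.
- by move=> z _; rewrite ler_normD.
Qed.

Lemma N1Z (a : R) g : measurable_fun setT g -> N1 (fun z => a * g z) = (`|a|%:E * N1 g)%E.
Proof.
move=> mg; rewrite /N1 -ge0_integralZl //.
- by apply: eq_integral => z _; rewrite normrM EFinM.
- by apply/measurable_EFinP; exact: measurableT_comp.
Qed.

Lemma N1_integrable b : mu.-integrable setT (EFin \o b) <-> measurable_fun setT b /\ (N1 b < +oo)%E.
Proof.
split=> [/integrableP[/measurable_EFinP mb h]|[mb h]] //.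
by apply/integrableP; split => //; apply/measurable_EFinP.
Qed.

Lemma kern2_bmeas n x : bmeas (kern2 n x).
Proof. by apply: ker_bmeas; [exact: kern_smooth|exact: kern_csupp|exact: kern_smooth|exact: kern_csupp]. Qed.

Lemma moll_smooth n b : mu.-integrable setT (EFin \o b) -> smooth (moll n b).
Proof. by move=> ib; apply: conv_smooth => //; [exact: kern_smooth|exact: kern_csupp|exact: kern_smooth|exact: kern_csupp]. Qed.

Lemma moll_measurable n b D : mu.-integrable setT (EFin \o b) -> measurable D -> measurable_fun D (moll n b).
Proof. by move=> ib mD; apply: smooth_measurable => //; exact: moll_smooth. Qed.

Lemma mollB n b c x : mu.-integrable setT (EFin \o b) -> mu.-integrable setT (EFin \o c) ->
  moll n (fun z => b z - c z) x = moll n b x - moll n c x.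
Proof.
move=> ib ic; rewrite /moll /conv /pair_with -RintegralB //; try exact: (bmeas_integrable _ (kern2_bmeas n x)).
by apply: eq_Rintegral => z _; rewrite mulrBl.
Qed.

Lemma mollZ n (a : R) b x : mu.-integrable setT (EFin \o b) ->
  moll n (fun z => a * b z) x = a * moll n b x.
Proof.
move=> ib; rewrite /moll /conv /pair_with -RintegralZl //; try exact: (bmeas_integrable _ (kern2_bmeas n x)).
by apply: eq_Rintegral => z _; rewrite mulrA.
Qed.

Lemma measurable_kern2 n : measurable_fun setT (fun xz : (R * R) * (R * R) => kern2 n xz.1 xz.2).
Proof.
have mm (l : R) (g : (R * R) * (R * R) -> R) : measurable_fun setT g -> measurable_fun setT (fun z => kern l n (g z)).
  by move=> mg; apply: (@measurableT_comp _ _ _ _ _ _ (kern l n)) => //; exact: kern_measurable.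
apply: measurable_funM; apply: mm; apply: measurable_funB.
- by apply: (measurableT_comp (@measurable_fst1 R)); exact: measurable_fst.
- by apply: (measurableT_comp (@measurable_fst1 R)); exact: measurable_snd.
- by apply: (measurableT_comp (@measurable_snd1 R)); exact: measurable_fst.
- by apply: (measurableT_comp (@measurable_snd1 R)); exact: measurable_snd.
Qed.

(** The kernel also has mass 1 in its first argument, so exchanging the integrals removes it. Hence
    mollification is a contraction in L^1 and in L^2. *)
Lemma schur n (g : R * R -> R) : measurable_fun setT g -> (forall z, 0 <= g z) ->
  (\int[mu]_x \int[mu]_z (g z * kern2 n x z)%:E = \int[mu]_z (g z)%:E)%E.
Proof.
move=> mg g0.
have mF : measurable_fun setT (fun xz : (R * R) * (R * R) => g xz.2 * kern2 n xz.1 xz.2).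
  apply: measurable_funM; last exact: measurable_kern2.
  by apply: measurableT_comp => //; exact: measurable_snd.
rewrite (@tonelli_swapE _ _ _ _ _ (area_sf R) (area_sf R) (fun x z => g z * kern2 n x z)) //; last first.
  by move=> x z; rewrite mulr_ge0 // kern2_ge0.
apply: eq_integral => z _; under eq_integral do rewrite EFinM.
rewrite ge0_integralZl //; first by rewrite int_kern2_l mule1.
- by apply/measurable_EFinP; exact: kern2_measurable_l.
- by move=> x _; rewrite lee_fin kern2_ge0.
- by rewrite lee_fin.
Qed.

Lemma moll_le n b x : mu.-integrable setT (EFin \o b) ->
  ((`|moll n b x|)%:E <= \int[mu]_z (`|b z| * kern2 n x z)%:E)%E.
Proof.
move=> ib; have ibk := bmeas_integrable ib (kern2_bmeas n x).
rewrite /moll /conv /pair_with EFin_normr_Rintegral //.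
apply: le_trans (le_abse_integral _ measurableT (measurable_int _ ibk)) _.
rewrite le_eqVlt; apply/predU1P; left; apply: eq_integral => z _ /=.
by rewrite normrM (ger0_norm (kern2_ge0 _ _ _)).
Qed.

(** Jensen's inequality, read off from the nonnegative variance of [b] under the probability density
    [kern2 n x]. *)
Lemma moll_sqr_le n b x : mu.-integrable setT (EFin \o b) ->
  ((moll n b x ^+ 2)%:E <= \int[mu]_z (b z ^+ 2 * kern2 n x z)%:E)%E.
Proof.
move=> ib; have ibk := bmeas_integrable ib (kern2_bmeas n x).
have mb : measurable_fun setT b by apply/measurable_EFinP; exact: measurable_int ib.
have [mk _] := kern2_bmeas n x.
have m2 : measurable_fun setT (fun z => (b z ^+ 2 * kern2 n x z)%:E).
  by apply/measurable_EFinP; apply: measurable_funM => //; exact: measurable_funX.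
have [->|fin] := eqVneq (\int[mu]_z (b z ^+ 2 * kern2 n x z)%:E)%E +oo%E; first by rewrite leey.
have i2 : mu.-integrable setT (EFin \o (fun z => b z ^+ 2 * kern2 n x z)).
  apply/integrableP; split => //.
  rewrite [ltLHS](_ : _ = \int[mu]_z (b z ^+ 2 * kern2 n x z)%:E)%E ?ltey //.
  by apply: eq_integral => z _ /=; rewrite ger0_norm //; apply: mulr_ge0; [exact: sqr_ge0|exact: kern2_ge0].
have ik : mu.-integrable setT (EFin \o kern2 n x).
  apply/integrableP; split; first exact/measurable_EFinP.
  rewrite [ltLHS](_ : _ = \int[mu]_z (kern2 n x z)%:E)%E; first by rewrite int_kern2_r ltry.
  by apply: eq_integral => z _ /=; rewrite ger0_norm // kern2_ge0.
have e1k : \int[mu]_z kern2 n x z = 1 by rewrite /Rintegral int_kern2_r.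
set m := moll n b x.
rewrite -[leRHS]fineK; last by apply: integrable_fin_num.
rewrite lee_fin -/(Rintegral mu setT (fun z => b z ^+ 2 * kern2 n x z)).
have : 0 <= \int[mu]_z ((b z - m) ^+ 2 * kern2 n x z).
  by apply: Rintegral_ge0 => z _; apply: mulr_ge0; [exact: sqr_ge0|exact: kern2_ge0].
have -> : \int[mu]_z ((b z - m) ^+ 2 * kern2 n x z) =
  \int[mu]_z (b z ^+ 2 * kern2 n x z) - (2 * m) * m + m ^+ 2 * 1.
  rewrite -{2}e1k {3}/m /moll /conv /pair_with -/(kern2 n x).
  have j1 : mu.-integrable setT (EFin \o (fun z => 2 * m * (b z * kern2 n x z))).
    by have := integrableZl measurableT (2 * m) ibk; under eq_fun do rewrite /= -EFinM.
  have j2 : mu.-integrable setT (EFin \o (fun z => m ^+ 2 * kern2 n x z)).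
    by have := integrableZl measurableT (m ^+ 2) ik; under eq_fun do rewrite /= -EFinM.
  have j3 : mu.-integrable setT (EFin \o (fun z => b z ^+ 2 * kern2 n x z - 2 * m * (b z * kern2 n x z))).
    by have := integrableB measurableT i2 j1; under eq_fun do rewrite /= -EFinB.
  rewrite -(RintegralZl (2 * m) measurableT ibk) -(RintegralZl (m ^+ 2) measurableT ik) -(RintegralB measurableT i2 j1) -(RintegralD measurableT j3 j2).
  by apply: eq_Rintegral => z _; ring.
lra.
Qed.

Lemma moll_N1 n b : mu.-integrable setT (EFin \o b) -> (N1 (moll n b) <= N1 b)%E.
Proof.
move=> ib; have mb : measurable_fun setT b by apply/measurable_EFinP; exact: measurable_int ib.
have mab : measurable_fun setT (fun z => `|b z|) by exact: measurableT_comp.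
rewrite /N1 -(@schur n (fun z => `|b z|)) //.
have mF : measurable_fun setT (fun xz : (R * R) * (R * R) => `|b xz.2| * kern2 n xz.1 xz.2).
  apply: measurable_funM; last exact: measurable_kern2.
  by apply: (measurableT_comp mab); exact: measurable_snd.
apply: ge0_le_integral; [exact: measurableT|by move=> x _; rewrite lee_fin| | |].
- by apply/measurable_EFinP; apply: measurableT_comp => //; exact: moll_measurable.
- apply: (@measurable_intE _ _ _ _ _ (area_sf R) (fun x z => `|b z| * kern2 n x z)) => // x z.
  by rewrite mulr_ge0 // kern2_ge0.
- by move=> x _; exact: moll_le.
Qed.

Definition N2 (g : R * R -> R) : \bar R := (\int[mu]_z (g z ^+ 2)%:E)%E.

Lemma moll_N2 n b : mu.-integrable setT (EFin \o b) -> (N2 (moll n b) <= N2 b)%E.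
Proof.
move=> ib; have mb : measurable_fun setT b by apply/measurable_EFinP; exact: measurable_int ib.
have mab : measurable_fun setT (fun z => b z ^+ 2) by exact: measurable_funX.
rewrite /N2 -(@schur n (fun z => b z ^+ 2)) //; last by move=> z; exact: sqr_ge0.
have mF : measurable_fun setT (fun xz : (R * R) * (R * R) => b xz.2 ^+ 2 * kern2 n xz.1 xz.2).
  apply: measurable_funM; last exact: measurable_kern2.
  by apply: (measurableT_comp mab); exact: measurable_snd.
apply: ge0_le_integral; [exact: measurableT|by move=> x _; rewrite lee_fin sqr_ge0| | |].
- by apply/measurable_EFinP; apply: measurable_funX; exact: moll_measurable.
- apply: (@measurable_intE _ _ _ _ _ (area_sf R) (fun x z => b z ^+ 2 * kern2 n x z)) => // x z.
  by rewrite mulr_ge0 ?sqr_ge0 // kern2_ge0.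
- by move=> x _; exact: moll_sqr_le.
Qed.

End Moll.

(** * Convergence of mollifications in L^1 and L^2 *)

Section MollCvg.
Import HBSimple.
Variable R : realType.
Local Notation mu := (area R).
Variable k : R.
Hypothesis k0 : 0 <= k.
Implicit Types b c : R * R -> R.
Local Notation moll := (@moll R k).

Definition intg b := mu.-integrable setT (EFin \o b).

Lemma intg_meas b : intg b -> measurable_fun setT b.
Proof. by move=> ib; apply/measurable_EFinP; exact: measurable_int ib. Qed.

Lemma intgB b c : intg b -> intg c -> intg (fun z => b z - c z).
Proof. by move=> ib ic; have := integrableB measurableT ib ic; under eq_fun do rewrite /= -EFinB. Qed.

Lemma intgZ (a : R) b : intg b -> intg (fun z => a * b z).
Proof. by move=> ib; have := integrableZl measurableT a ib; under eq_fun do rewrite /= -EFinM. Qed.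

Definition mdist n b : \bar R := N1 (fun x => moll n b x - b x).

Lemma mdist_meas n b : intg b -> measurable_fun setT (fun x => moll n b x - b x).
Proof. by move=> ib; apply: measurable_funB; [exact: moll_measurable|exact: intg_meas]. Qed.

Lemma mdist_ge0 n b : (0 <= mdist n b)%E. Proof. exact: N1_ge0. Qed.

Definition mollL1 b := intg b /\ mdist n b @[n --> \oo] --> 0%E.

Lemma N1N b : N1 (fun z => - b z) = N1 b.
Proof. by apply: eq_integral => z _; rewrite normrN. Qed.

Lemma mdistB n b c : intg b -> intg c -> (mdist n (fun z => (b z - c z)%R) <= mdist n b + mdist n c)%E.
Proof.
move=> ib ic.
have := N1D (mdist_meas n ib) (measurableT_comp (@oppr_measurable R setT) (mdist_meas n ic)).
rewrite [X in (_ <= _ + X)%E -> _]N1N; apply: le_trans.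
rewrite le_eqVlt; apply/predU1P; left; congr N1; apply/funext => x /=.
by rewrite mollB //; ring.
Qed.

Lemma mollL1B b c : mollL1 b -> mollL1 c -> mollL1 (fun z => b z - c z).
Proof.
move=> [ib hb] [ic hc]; split; first exact: intgB.
apply: (tends0_le (fun n => mdist_ge0 n _) (fun n => mdistB n ib ic)).
by apply: tends0D => // n; exact: mdist_ge0.
Qed.

Lemma mollL1Z (a : R) b : mollL1 b -> mollL1 (fun z => a * b z).
Proof.
move=> [ib hb]; split; first exact: intgZ.
have E n : mdist n (fun z => a * b z) = (`|a|%:E * mdist n b)%E.
  rewrite /mdist -N1Z; last exact: mdist_meas.
  by congr N1; apply/funext => x; rewrite mollZ // mulrBr.
by under eq_fun do rewrite E; exact: tends0Z.
Qed.

Lemma mollL1_0 : mollL1 (fun=> 0).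
Proof.
have i0 : intg (fun=> 0) by exact: integrable0.
split=> //; have E n : mdist n (fun=> 0) = 0%E.
  rewrite /mdist /N1; apply: integral0_eq => x _.
  rewrite /moll /conv /pair_with subr0.
  under eq_Rintegral do rewrite mul0r.
  by rewrite /Rintegral integral0 /= normr0.
by under eq_fun do rewrite E; exact: cvg_cst.
Qed.

Lemma mollL1D b c : mollL1 b -> mollL1 c -> mollL1 (fun z => b z + c z).
Proof.
move=> hb hc; have := mollL1B hb (mollL1B mollL1_0 hc).
by under eq_fun do rewrite sub0r opprK.
Qed.

(** The usual argument with e / 3: mollification contracts L^1, so replacing [b] by [c] costs at
    most e / 3 before and e / 3 after mollifying. *)
Lemma mollL1_closed b : intg b ->
  (forall e : R, 0 < e -> exists2 c, mollL1 c & (N1 (fun z => (b z - c z)%R) <= e%:E)%E) -> mollL1 b.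
Proof.
move=> ib H; split => //; apply/tends0P => [n|e e0]; first exact: mdist_ge0.
have e3 : 0 < e / 3 by rewrite divr_gt0.
have [c [ic hc] bc] := H _ e3.
move/(tends0P (fun n => mdist_ge0 n c)) : hc => /(_ _ e3).
apply: filterS => n hn.
have ibc := intgB ib ic.
have mbc := intg_meas ibc.
have h1 : (N1 (fun x => (moll n (fun z => (b z - c z)%R) x - (b x - c x))%R) <= (e / 3)%:E + (e / 3)%:E)%E.
  apply: (@le_trans _ _ (N1 (moll n (fun z => (b z - c z)%R)) + N1 (fun z => (- (b z - c z))%R))%E).
    apply: (@N1D R _ (fun z => - (b z - c z)%R)); first exact: moll_measurable.
    exact: measurableT_comp.
  by rewrite N1N; apply: leeD => //; exact: le_trans (moll_N1 k0 n ibc) _.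
have h2 : (mdist n b <= N1 (fun x => (moll n (fun z => (b z - c z)%R) x - (b x - c x))%R) + mdist n c)%E.
  apply: le_trans (N1D (mdist_meas n ibc) (mdist_meas n ic)).
  rewrite le_eqVlt; apply/predU1P; left; congr N1; apply/funext => x.
  by rewrite mollB //; ring.
apply: le_trans h2 _; apply: le_trans (leeD h1 hn) _.
by rewrite -!EFinD lee_fin; lra.
Qed.

Lemma mollL1_lim (c : nat -> R * R -> R) b g : intg g -> measurable_fun setT b ->
  (forall m, mollL1 (c m)) -> (forall m x, `|c m x| <= g x) ->
  (forall x, c m x @[m --> \oo] --> b x) -> mollL1 b.
Proof.
move=> ig mb hc cg cb.
have [ib h _] := @dct _ _ _ mu setT measurableT c b g (fun m => intg_meas (hc m).1) mb ig (fun m x _ => cg m x) (fun x _ => cb x).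
apply: mollL1_closed => // e e0.
move/(tends0P (fun n => N1_ge0 _)) : h => /(_ _ e0)[m _ /(_ m (leqnn m))] /= hm.
exists (c m); first exact: hc.
apply: le_trans hm; rewrite le_eqVlt; apply/predU1P; left; apply: eq_integral => x _.
by rewrite distrC.
Qed.

Lemma moll_local n b x : (forall z, 0 <= z.1 - x.1 <= n.+1%:R^-1 -> k / n.+1%:R <= z.2 - x.2 <= (k + 1) / n.+1%:R -> b z = b x) ->
  moll n b x = b x.
Proof.
move=> H; rewrite /moll /conv /pair_with.
have -> : \int[mu]_z (b z * ker (kern 0 n) (kern k n) x z) = \int[mu]_z (b x * kern2 k n x z).
  apply: eq_Rintegral => z _; rewrite /kern2 /ker.
  have [->|h1] := eqVneq (kern 0 n (x.1 - z.1)) 0; first by rewrite mul0r !mulr0.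
  have [->|h2] := eqVneq (kern k n (x.2 - z.2)) 0; first by rewrite !mulr0.
  have := kern_supp h1; have := kern_supp h2; rewrite !opprB mul0r add0r div1r => h3 h4.
  by rewrite H.
rewrite RintegralZl //; first by rewrite {1}/Rintegral int_kern2_r mulr1.
apply/integrableP; split; first by apply/measurable_EFinP; have [] := kern2_bmeas k0 n x.
rewrite [ltLHS](_ : _ = \int[mu]_z (kern2 k n x z)%:E)%E; first by rewrite int_kern2_r ltry.
by apply: eq_integral => z _ /=; rewrite ger0_norm // kern2_ge0.
Qed.

Lemma moll_norm_le1 n b x : intg b -> (forall z, `|b z| <= 1) -> `|moll n b x| <= 1.
Proof.
move=> ib b1; rewrite -lee_fin; apply: le_trans (moll_le k0 n x ib) _.
rewrite -(int_kern2_r k n x); apply: le_intE => //.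
- apply: measurable_funM; first by apply: measurableT_comp => //; exact: intg_meas.
  by have [] := kern2_bmeas k0 n x.
- by have [] := kern2_bmeas k0 n x.
- by move=> z _; rewrite mulr_ge0 // kern2_ge0.
- by move=> z _; rewrite ler_piMl // kern2_ge0.
Qed.

Definition hbox (a1 b1 a2 b2 : R) : set (R * R) :=
  [set x | (`[a1, b1[%classic : set R) x.1 /\ (`[a2, b2[%classic : set R) x.2].

Lemma hbox_meas (a1 b1 a2 b2 : R) : measurable (hbox a1 b1 a2 b2).
Proof. by apply: measurable_rect; exact: measurable_itv. Qed.

Lemma intg_indic (A : set (R * R)) (a1 b1 a2 b2 : R) : measurable A ->
  intg (\1_(A `&` hbox a1 b1 a2 b2) : R * R -> R).
Proof.
move=> mA; have mAb : measurable (A `&` hbox a1 b1 a2 b2) by apply: measurableI => //; exact: hbox_meas.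
apply/integrableP; split; first by apply/measurable_EFinP; exact: measurable_indic.
rewrite [ltLHS](_ : _ = \int[mu]_z (\1_(A `&` hbox a1 b1 a2 b2) z)%:E)%E; last first.
  by apply: eq_integral => z _ /=; rewrite ger0_norm.
rewrite integral_indic // setIT.
apply: le_lt_trans (area_box_lty a1 b1 a2 b2); apply: le_measure; rewrite ?inE //.
exact: hbox_meas.
Qed.

Lemma near_inv_le (e : R) : 0 < e -> \forall n \near \oo, (k + 1) / n.+1%:R <= e.
Proof.
move=> e0; near=> n.
rewrite ler_pdivrMr // mulrC -ler_pdivrMr //.
apply: le_trans (ltW (truncnS_gt _)) _; rewrite ler_nat ltnS.
by near: n; exact: nbhs_infty_ge.
Unshelve. all: by end_near. Qed.

Lemma hbox_aux (a c X Z : R) : a <= Z -> Z < c -> 0 <= Z - X -> Z - X <= k + 1 -> a - (k + 1) <= X < c.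
Proof. by move=> *; apply/andP; split; lra. Qed.

(** The samples lie to the right and above, and the indicator of a box closed below and on the left,
    open above and on the right, is constant in these directions near every point. Mollification is
    eventually exact at each point, and dominated convergence concludes. *)
Lemma mollL1_box (a1 b1 a2 b2 : R) : mollL1 (\1_(hbox a1 b1 a2 b2) : R * R -> R).
Proof.
have ib : intg (\1_(hbox a1 b1 a2 b2) : R * R -> R).
  by have := @intg_indic setT a1 b1 a2 b2 measurableT; rewrite setTI.
split => //.
pose g : R * R -> R := \1_(hbox (a1 - (k + 1)) b1 (a2 - (k + 1)) b2).
have ig : intg g.
  by have := @intg_indic setT (a1 - (k + 1)) b1 (a2 - (k + 1)) b2 measurableT; rewrite setTI.
have b1' z : `|\1_(hbox a1 b1 a2 b2) z| <= 1 :> R.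
  by rewrite indicE; case: (_ \in _); rewrite ?normr1 ?normr0.
have [] := @dct _ _ _ mu setT measurableT (fun n => moll n (\1_(hbox a1 b1 a2 b2))) (\1_(hbox a1 b1 a2 b2)) g.
- by move=> m; exact: moll_measurable.
- exact: intg_meas.
- exact: ig.
- move=> m x _; rewrite /g indicE; have [xg|/negP xg] := boolP (x \in _).
    exact: moll_norm_le1.
  rewrite /moll /conv /pair_with normr_le0.
  under eq_Rintegral => z _.
    have -> : \1_(hbox a1 b1 a2 b2) z * ker (kern 0 m) (kern k m) x z = 0.
      rewrite indicE; have [zb|_] := boolP (z \in _); last by rewrite mul0r.
      rewrite mul1r /ker; have [->|h1] := eqVneq (kern 0 m (x.1 - z.1)) 0; first by rewrite mul0r.
      have [->|h2] := eqVneq (kern k m (x.2 - z.2)) 0; first by rewrite mulr0.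
      have := kern_supp1 (lexx 0) h1; have := kern_supp1 k0 h2; rewrite !opprB.
      move: zb; rewrite inE /hbox /= !in_itv /= => -[/andP[z1 z2] /andP[z3 z4]] /andP[z5 z6] /andP[z7 z8].
      exfalso; apply: xg; rewrite inE /hbox /= !in_itv /=.
      split; last exact: (hbox_aux z3 z4 z5 z6).
      by apply: (hbox_aux z1 z2 z7); rewrite (le_trans z8) // lerD2r.
    over.
  by rewrite /Rintegral integral0.
- move=> x _; apply: cvg_near_cst.
  have [e e0 he] : exists2 e : R, 0 < e & forall z, 0 <= z.1 - x.1 <= e -> 0 <= z.2 - x.2 <= e ->
      \1_(hbox a1 b1 a2 b2) z = \1_(hbox a1 b1 a2 b2) x :> R.
    (* Distance to an edge that is still ahead of the point; the value 1 is a default for an edge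
       already reached. *)
    pose gap (a c : R) := if c < a then a - c else 1.
    have gap0 (a c : R) : 0 < gap a c by rewrite /gap; case: ifPn => // ac; rewrite subr_gt0.
    pose e := Num.min (Num.min (gap a1 x.1) (gap b1 x.1)) (Num.min (gap a2 x.2) (gap b2 x.2)).
    have e0 : 0 < e by rewrite !lt_min !gap0.
    exists (e / 2); first by rewrite divr_gt0.
    have side (a c t : R) : 0 <= t - c <= e / 2 -> e <= gap a c -> (a <= t) = (a <= c).
      move=> /andP[h1 h2] h3; apply/idP/idP => [at_|ac]; last by lra.
      rewrite leNgt; apply/negP => ca; move: h3; rewrite /gap ca; lra.
    move=> z hz1 hz2; rewrite !indicE; congr (_%:R); congr nat_of_bool.
    have i1 : e <= gap a1 x.1 by rewrite /e !ge_min lexx.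
    have i2 : e <= gap b1 x.1 by rewrite /e !ge_min lexx !orbT.
    have i3 : e <= gap a2 x.2 by rewrite /e !ge_min lexx !orbT.
    have i4 : e <= gap b2 x.2 by rewrite /e !ge_min lexx !orbT.
    apply/idP/idP; rewrite !inE /hbox /= !in_itv /= !ltNge => -[].
      by rewrite (side a1 x.1) // (side b1 x.1) // (side a2 x.2) // (side b2 x.2) //; split.
    by rewrite -(side a1 x.1 z.1) // -(side b1 x.1 z.1) // -(side a2 x.2 z.2) // -(side b2 x.2 z.2) //; split.
  apply: filterS (near_inv_le e0) => n hn; apply: moll_local => z /andP[h1 h2] /andP[h3 h4]; apply: he.
    rewrite h1 /=; apply: le_trans h2 _; apply: le_trans hn.
    by apply: ler_peMl; [rewrite invr_ge0|rewrite lerDr].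
  by rewrite (le_trans _ h3) ?divr_ge0 //=; apply: le_trans hn.
- by move=> _ + _.
Qed.

(** A pi-lambda argument from the open lower left quadrants: cut by the box they are boxes again,
    complements become differences, and disjoint unions become dominated limits. *)
Lemma mollL1_indic (m : R) (A : set (R * R)) : measurable A ->
  mollL1 (\1_(A `&` hbox (- m) m (- m) m) : R * R -> R).
Proof.
move=> mA.
pose Q := hbox (- m) m (- m) m.
pose G := [set B : set (R * R) | exists a c : R, B = [set x | (`]-oo, a[%classic : set R) x.1 /\ (`]-oo, c[%classic : set R) x.2]].
(* Both projections are measurable for the sigma-algebra generated by the quadrants, since a half
   plane is a countable union of quadrants. *)
have GE : @measurable _ (R * R)%type = <<s G >>.
  rewrite eqEsubset; split; last first.
    apply: smallest_sub; first exact: sigma_algebra_measurable.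
    by move=> _ [a [c ->]]; apply: measurable_rect; exact: measurable_itv.
  have nat_above (t : R) : exists n : nat, t < n%:R.
    by exists (Num.trunc t).+1; exact: truncnS_gt.
  have m1 : measurable_fun setT (fst : g_sigma_algebraType G -> R).
    apply: (measurability _ (RGenInftyO.measurableE R)) => _ [_ [a ->] <-]; rewrite setTI.
    rewrite (_ : _ @^-1` _ = \bigcup_n [set x : R * R | (`]-oo, a[%classic : set R) x.1 /\ (`]-oo, n%:R[%classic : set R) x.2]).
      by apply: bigcup_measurable => n _; apply: sub_sigma_algebra; exists a, n%:R.
    apply/seteqP; split => [x|x [n _ []] //] /= xa.
    by have [n xn] := nat_above x.2; exists n => //=; rewrite !in_itv /= in xa *.
  have m2 : measurable_fun setT (snd : g_sigma_algebraType G -> R).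
    apply: (measurability _ (RGenInftyO.measurableE R)) => _ [_ [a ->] <-]; rewrite setTI.
    rewrite (_ : _ @^-1` _ = \bigcup_n [set x : R * R | (`]-oo, n%:R[%classic : set R) x.1 /\ (`]-oo, a[%classic : set R) x.2]).
      by apply: bigcup_measurable => n _; apply: sub_sigma_algebra; exists n%:R, a.
    apply/seteqP; split => [x|x [n _ []] //] /= xa.
    by have [n xn] := nat_above x.1; exists n => //=; rewrite !in_itv /= in xa *.
  rewrite measurable_prod_measurableType; apply: smallest_sub; first exact: smallest_sigma_algebra.
  move=> _ [X mX] [Y mY] <-.
  have -> : X `*` Y = (fst @^-1` X) `&` (snd @^-1` Y) by [].
  have h1 := m1 measurableT X mX; have h2 := m2 measurableT Y mY; rewrite !setTI in h1 h2.
  exact: (@measurableI _ (g_sigma_algebraType G) _ _ h1 h2).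
have GI : setI_closed G.
  move=> _ _ [a [c ->]] [a' [c' ->]]; exists (Num.min a a'), (Num.min c c').
  apply/seteqP; split => x /=; rewrite !in_itv /= !lt_min.
    by move=> [[-> ->] [-> ->]].
  by move=> [/andP[-> ->] /andP[-> ->]].
have bQ : mollL1 (\1_Q : R * R -> R) by exact: mollL1_box.
have mQ : measurable Q by exact: hbox_meas.
move: A mA; rewrite GE; apply: (dynkin_induction GE GI).
- by rewrite setTI.
- move=> _ [a [c ->]].
  rewrite (_ : _ `&` _ = hbox (- m) (Num.min m a) (- m) (Num.min m c)); first exact: mollL1_box.
  apply/seteqP; split => x; rewrite /hbox /= !in_itv /= !lt_min.
    by move=> [[-> ->] [/andP[-> ->] /andP[-> ->]]].
  by move=> [/and3P[-> -> ->] /and3P[-> -> ->]].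
- move=> S mS PS.
  have -> : (\1_(~` S `&` Q) : R * R -> R) = (fun x => \1_Q x - \1_(S `&` Q) x).
    apply/funext => x; rewrite !indicE !in_setI in_setC.
    by case: (x \in S); case: (x \in Q); rewrite ?subrr ?subr0.
  exact: mollL1B.
- move=> F mF tF PF.
  pose B i := \bigcup_(j in `I_i) F j.
  have mB i : measurable (B i) by apply: bigcup_measurable => j _; exact: mF.
  apply: (@mollL1_lim (fun i => \1_(B i `&` Q)) _ (\1_Q)).
  + exact: bQ.1.
  + apply: measurable_indic; apply: measurableI => //; exact: bigcup_measurable.
  + elim=> [|i IH].
      rewrite /B II0 bigcup_set0 set0I indic0; exact: mollL1_0.
    have -> : (\1_(B i.+1 `&` Q) : R * R -> R) = (fun x => \1_(B i `&` Q) x + \1_(F i `&` Q) x).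
      apply/funext => x; rewrite !indicE !in_setI.
      have -> : (x \in B i.+1) = (x \in B i) || (x \in F i).
        apply/idP/orP; rewrite !inE /B.
          move=> [j /=]; rewrite ltnS leq_eqVlt => /predU1P[->|ji] Fj; [by right|left].
          by exists j.
        by move=> [[j /= ji Fj]|Fi]; [exists j => //=; exact: ltnW|exists i => /=].
      have [xB|_] := boolP (x \in B i) => /=; last by rewrite add0r.
      have [xF|_] := boolP (x \in F i); last by rewrite addr0.
      move: xB xF; rewrite !inE => -[j /= ji Fj] Fi.
      have := tF j i I I (ex_intro _ x (conj Fj Fi)) => ji'.
      by move: ji; rewrite ji' ltnn.
    exact: mollL1D.
  + move=> i x; rewrite !indicE in_setI; case: (x \in Q); rewrite ?andbF ?andbT.
      by case: (_ \in _); rewrite ?normr1 ?normr0.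
    by rewrite normr0.
  + move=> x; apply: cvg_near_cst.
    have [xF|xF] := pselect ((\bigcup_j F j) x).
      have [j _ Fj] := xF; exists j.+1 => // i /= ij.
      rewrite !indicE 2!in_setI; congr ((_ && _)%:R).
      by rewrite !mem_set //; exists j.
    apply: nearW => i; rewrite !indicE 2!in_setI; congr ((_ && _)%:R).
    by rewrite !memNset // => -[j _ Fj]; apply: xF; exists j.
Qed.

Lemma mollL1_sum (m : R) (s : seq R) (A : R -> set (R * R)) : (forall y, measurable (A y)) ->
  mollL1 (fun x => \sum_(y <- s) y * \1_(A y `&` hbox (- m) m (- m) m) x).
Proof.
move=> mA; elim: s => [|y s IH].
  by under eq_fun do rewrite big_nil; exact: mollL1_0.
under eq_fun do rewrite big_cons; apply: mollL1D => //.
by apply: mollL1Z; exact: mollL1_indic.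
Qed.

(** Simple functions are dense in L^1 of the box, and they are finite combinations of indicators
    already treated. *)
Lemma mollL1_box_supp (m : R) b : intg b -> (forall x, ~ hbox (- m) m (- m) m x -> b x = 0) -> mollL1 b.
Proof.
move=> ib b0.
pose Q := hbox (- m) m (- m) m.
have mQ : measurable Q by exact: hbox_meas.
apply: mollL1_closed => // e e0.
have iQ : mu.-integrable Q (EFin \o b) by apply: integrableS ib.
have [g [_ _ gc]] := @approximation_sfun_integrable _ _ _ mu Q mQ (EFin \o b) iQ.
move/tends0P : gc => /(_ _)/(_ e e0)[|n _ /(_ n (leqnn n)) hn].
  by move=> n; apply: integral_ge0.
pose gn : R * R -> R := g n.
exists (fun x => gn x * \1_Q x).
  have -> : (fun x => gn x * \1_Q x) = (fun x : R * R => \sum_(y <- finmap.enum_fset (fset_set (range (g n)))) y * \1_((gn @^-1` [set y]) `&` Q) x).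
    apply/funext => x; rewrite /gn fimfunE fsbig_finite //= mulr_suml; apply: eq_bigr => y _.
    by rewrite -mulrA !indicE in_setI -natrM mulnb.
  apply: (@mollL1_sum m _ (fun y => gn @^-1` [set y])) => y.
  by rewrite -[_ @^-1` _]setTI; exact: (measurable_funP (g n)).
apply: le_trans hn; rewrite [leRHS]integral_mkcond le_eqVlt; apply/predU1P; left.
apply: eq_integral => x _; rewrite patchE indicE; have [xQ|/negP xQ] := boolP (x \in Q).
  by rewrite mulr1.
by rewrite mulr0 subr0 b0 ?normr0 // => xQ'; apply: xQ; rewrite inE.
Qed.

Definition trunc_at (M : R) b (x : R * R) : R := if `|b x| <= M then b x else 0.

(** Truncate at height j. The discarded part is small in L^2 and stays so under mollification, an
    L^2 contraction. For the truncation the difference is at most 2 j, which turns L^1 convergence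
    into L^2 convergence. *)
Lemma moll_N2_cvg (m : R) b : intg b -> (forall x, ~ hbox (- m) m (- m) m x -> b x = 0) ->
  (N2 b < +oo)%E -> N2 (fun x => moll n b x - b x) @[n --> \oo] --> 0%E.
Proof.
move=> ib b0 b2.
have mb := intg_meas ib.
have mt M : measurable_fun setT (trunc_at M b).
  apply: measurable_fun_ifT => //.
  by apply: measurable_fun_ler => //; exact: measurableT_comp.
have tle M x : `|trunc_at M b x| <= `|b x| by rewrite /trunc_at; case: ifP => // _; rewrite normr0.
have it M : intg (trunc_at M b).
  apply: (le_integrable measurableT _ _ ib); first by apply/measurable_EFinP; exact: mt.
  by move=> x _; rewrite /= lee_fin.
have i2 : intg (fun x => 4 * b x ^+ 2).
  apply/integrableP; split; first by apply/measurable_EFinP; apply: measurable_funM => //; exact: measurable_funX.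
  rewrite [ltLHS](_ : _ = 4%:E * N2 b)%E ?lte_mul_pinfty //.
  rewrite -intZE //; [|exact: measurable_funX|by move=> x _; exact: sqr_ge0].
  by apply: eq_integral => x _ /=; rewrite ger0_norm // mulr_ge0 // sqr_ge0.
have ht : N2 (fun x => b x - trunc_at j%:R b x) @[j --> \oo] --> 0%E.
  have [] := @dct _ _ _ mu setT measurableT (fun j x => (b x - trunc_at j%:R b x) ^+ 2) (fun=> 0) (fun x => 4 * b x ^+ 2).
  - by move=> j; exact: (measurable_funX 2 (measurable_funB mb (mt _))).
  - exact: measurable_cst.
  - exact: i2.
  - move=> j x _; rewrite normrX /trunc_at; case: ifP => _.
      by rewrite subrr normr0 expr0n mulr_ge0 // sqr_ge0.
    by rewrite subr0 real_normK ?num_real // ler_peMl ?sqr_ge0 // ler1n.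
  - move=> x _; apply: cvg_near_cst; near=> j; rewrite /trunc_at ifT ?subrr ?expr0n //.
    apply: le_trans (ltW (truncnS_gt _)) _; rewrite ler_nat.
    by near: j; exact: nbhs_infty_ge.
  move=> _ h _; apply: (tends0_le _ _ h) => j; first by apply: intE_ge0 => x _; exact: sqr_ge0.
  rewrite le_eqVlt; apply/predU1P; left.
  by apply: eq_integral => x _; rewrite subr0 ger0_norm // sqr_ge0.
have N2_ge0 c : (0 <= N2 c)%E by apply: intE_ge0 => x _; exact: sqr_ge0.
apply/tends0P => // e e0.
have e10 : 0 < e / 10 by rewrite divr_gt0.
move/(tends0P (fun j => N2_ge0 _)) : ht => /(_ _ e10)[j _ /(_ j (leqnn j)) hj].
pose c := trunc_at j%:R b.
have ic : intg c by exact: it.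
have c0 x : ~ hbox (- m) m (- m) m x -> c x = 0.
  by move=> xQ; rewrite /c /trunc_at b0 //; case: ifP.
have [_ hc] := mollL1_box_supp ic c0.
have cj x : `|c x| <= j%:R by rewrite /c /trunc_at; case: ifP => // _; rewrite normr0.
have mcj n x : `|moll n c x| <= j%:R.
  have [j0|j0] := posnP j.
    have c00 z : c z = 0 by apply/eqP; rewrite -normr_le0 -[X in _ <= X](_ : j%:R = 0) // j0.
    rewrite /moll /conv /pair_with.
    by under eq_Rintegral do rewrite c00 mul0r; rewrite /Rintegral integral0 /= normr0.
  have jn : j%:R != 0 :> R by rewrite pnatr_eq0 -lt0n.
  have -> : c = (fun z => j%:R * (j%:R^-1 * c z)) by apply/funext => z; rewrite mulVKf.
  rewrite mollZ //; last exact: intgZ.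
  rewrite normrM ger0_norm // ler_piMr //; apply: moll_norm_le1; first exact: intgZ.
  by move=> z; rewrite normrM ger0_norm ?invr_ge0 // ler_pdivrMl ?mulr1 // lt_neqAle eq_sym jn /=.
(* Multiplied by the bound 2 j of the difference, this tolerance stays below e / 10; adding 1 to j
   covers j = 0. *)
have d0 : 0 < e / (20 * (j%:R + 1)) by rewrite divr_gt0 // mulr_gt0 // ltr_wpDl.
move/(tends0P (fun n => mdist_ge0 n c)) : hc => /(_ _ d0).
apply: filterS => n hn.
have ibc := intgB ib ic.
have m1 : measurable_fun setT (moll n (fun z => b z - c z)) by exact: moll_measurable.
have m2 : measurable_fun setT (fun x => moll n c x - c x) by exact: mdist_meas.
have m3 : measurable_fun setT (fun x => c x - b x) by exact: intg_meas (intgB ic ib).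
have m4 : measurable_fun setT (fun x => (moll n c x - c x) + (c x - b x)) by exact: measurable_funD.
have l1 : (N2 (fun x => (moll n b x - b x)%R) <= 2%:E * (N2 (moll n (fun z => (b z - c z)%R)) + N2 (fun x => ((moll n c x - c x) + (c x - b x))%R)))%E.
  by apply: int_sqr_add => //; [exact: mdist_meas|move=> x _; rewrite mollB //; ring].
have l2 : (N2 (fun x => ((moll n c x - c x) + (c x - b x))%R) <= 2%:E * (N2 (fun x => (moll n c x - c x)%R) + N2 (fun x => (c x - b x)%R)))%E.
  exact: int_sqr_add.
have l3 : N2 (fun x => (c x - b x)%R) = N2 (fun x => (b x - c x)%R).
  by apply: eq_integral => x _; rewrite -sqrrN opprB.
have k1 : (N2 (moll n (fun z => (b z - c z)%R)) <= (e / 10)%:E)%E by apply: le_trans (moll_N2 k0 n ibc) _.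
have k2 : (N2 (fun x => (moll n c x - c x)%R) <= (e / 10)%:E)%E.
  apply: (@le_trans _ _ ((2 * j%:R)%:E * mdist n c)%E).
    rewrite /N2 /mdist /N1 -intZE //; [|by apply: measurableT_comp => //; exact: mdist_meas].
    apply: le_intE => //.
    + by apply: measurable_funX; exact: mdist_meas.
    + by apply: measurable_funM => //; apply: measurableT_comp => //; exact: mdist_meas.
    + by move=> x _; exact: sqr_ge0.
    + move=> x _; rewrite -real_normK ?num_real // expr2 ler_wpM2r //.
      by rewrite (le_trans (ler_normB _ _)) // mulr_natl mulr2n lerD.
  apply: (@le_trans _ _ ((2 * j%:R)%:E * (e / (20 * (j%:R + 1)))%:E)%E).
    by apply: lee_wpmul2l => //; rewrite lee_fin.
  have j1 : 0 < j%:R + 1 :> R by rewrite ltr_wpDl.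
  rewrite -EFinM lee_fin mulrA ler_pdivrMr ?mulr_gt0 //.
  have j0 : 0 <= j%:R :> R by [].
  have -> : e / 10 * (20 * (j%:R + 1)) = 2 * e * (j%:R + 1) by field.
  nra.
have {l2}l2 : (N2 (fun x => ((moll n c x - c x) + (c x - b x))%R) <= (4 * e / 10)%:E)%E.
  apply: le_trans l2 _; rewrite l3; apply: le_trans (lee_wpmul2l _ (leeD k2 hj)) _; first by rewrite lee_fin.
  by rewrite -!EFinD -EFinM lee_fin; lra.
apply: le_trans l1 _; apply: le_trans (lee_wpmul2l _ (leeD k1 l2)) _; first by rewrite lee_fin.
by rewrite -!EFinD -EFinM lee_fin; lra.
Unshelve. all: by end_near. Qed.

End MollCvg.

(** * Integration by parts on the half plane *)

Section BoundedSupport.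
Variable R : realType.
Local Notation mu := (area R).
Local Notation leb := (@lebesgue_measure R).
Implicit Types (g : R * R -> R) (h : R -> R).

Definition sq (m : R) : set (R * R) := [set x | `|x.1| <= m /\ `|x.2| <= m].

Lemma sq_hbox m : sq m `<=` hbox (- (m + 1)) (m + 1) (- (m + 1)) (m + 1).
Proof.
by move=> x [/=]; rewrite !ler_norml => /andP[h1 h2] /andP[h3 h4]; split; rewrite /= in_itv /=; apply/andP; split; lra.
Qed.

Lemma sq_compact m : compact (sq m).
Proof.
have -> : sq m = `[- m, m]%classic `*` `[- m, m]%classic.
  by apply/seteqP; split => x; rewrite /sq /= !in_itv /= !ler_norml.
by apply: compact_setX; exact: segment_compact.
Qed.

Lemma compact_sq (K : set (R * R)) : compact K -> exists2 m, 0 < m & K `<=` sq m.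
Proof.
move=> /compact_bounded[M [_ hM]].
exists (`|M| + 1); first by rewrite ltr_wpDl.
have MM : M < `|M| + 1 by rewrite (le_lt_trans (ler_norm _)) // ltrDl.
by move=> x Kx; have /= := hM (`|M| + 1) MM x Kx; rewrite prod_normE /= ge_max => /andP[].
Qed.

Lemma continuous_sq_bounded g m : continuous g -> exists2 C, 0 < C & forall x, sq m x -> `|g x| <= C.
Proof.
move=> cg; have := @continuous_compact _ _ g (sq m) (continuous_subspaceT cg) (@sq_compact m).
move=> /compact_bounded[M [_ hM]]; exists (`|M| + 1); first by rewrite ltr_wpDl.
move=> x xm; apply: (hM (`|M| + 1)); last by exists x.
by rewrite (le_lt_trans (ler_norm _)) // ltrDl.
Qed.

Definition bbs g := measurable_fun setT g /\
  exists C m, forall x, `|g x| <= C /\ (g x != 0 -> sq m x).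

Lemma bbs_integrable g : bbs g -> mu.-integrable setT (EFin \o g).
Proof.
move=> [mg [C [m hg]]].
have C0 : 0 <= C by have [/(le_trans (normr_ge0 _))] := hg (0, 0).
have ih := intgZ C (@intg_indic R setT (- (m + 1)) (m + 1) (- (m + 1)) (m + 1) measurableT).
apply: (le_integrable measurableT _ _ ih); first by apply/measurable_EFinP; exact: mg.
move=> x _; rewrite /= lee_fin setTI normrM (ger0_norm C0) indicE.
have [gC gm] := hg x; have [->|/gm/sq_hbox xm] := eqVneq (g x) 0; first by rewrite normr0 mulr_ge0.
by rewrite mem_set // normr1 mulr1.
Qed.

Definition bbs1 h := measurable_fun setT h /\
  exists C m, forall t, `|h t| <= C /\ (h t != 0 -> `|t| <= m).

Lemma bbs1_integrable h : bbs1 h -> leb.-integrable setT (EFin \o h).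
Proof.
move=> [mh [C [m hh]]].
have C0 : 0 <= C by have [/(le_trans (normr_ge0 _))] := hh 0.
apply/integrableP; split; first by apply/measurable_EFinP; exact: mh.
apply: (@le_lt_trans _ _ (\int[leb]_t (C * \1_(`[- m, m]%classic) t)%:E)%E).
  apply: le_intE => //.
  - by apply: measurableT_comp.
  - by apply: measurable_funM => //; exact: measurable_indic.
  - move=> t _; rewrite indicE; have [hC hm] := hh t.
    have [->|/hm tm] := eqVneq (h t) 0; first by rewrite normr0 mulr_ge0.
    by rewrite mem_set ?mulr1 //= in_itv /= -ler_norml.
rewrite intZE //.
rewrite integral_indic // setIT.
have := @lebesgue_measure_itv R `[- m, m]; rewrite /= => ->.
by case: ifP => _; rewrite -?EFinN -?EFinD -EFinM ltry.
Qed.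

Lemma bbs_slice1 g s : bbs g -> bbs1 (fun t => g (s, t)).
Proof.
move=> [mg [C [m hg]]]; split; first by apply: measurableT_comp => //; exact: measurable_pair1.
by exists C, m => t; have [h1 h2] := hg (s, t); split => // /h2[].
Qed.

Lemma bbs_slice2 g t : bbs g -> bbs1 (fun s => g (s, t)).
Proof.
move=> [mg [C [m hg]]]; split; first by apply: measurableT_comp => //; exact: measurable_pair2.
by exists C, m => s; have [h1 h2] := hg (s, t); split => // /h2[].
Qed.

Lemma fubini12 g : bbs g -> \int[mu]_x g x = \int[leb]_s \int[leb]_t g (s, t).
Proof.
move=> bg; have ig := bbs_integrable bg.
rewrite /Rintegral -(@integral12_prod_meas1 _ _ _ _ _ leb leb _ ig); congr fine.
apply: eq_integral => s _; rewrite /fubini_F /= fineK //.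
by apply: integrable_fin_num => //; exact: (bbs1_integrable (bbs_slice1 s bg)).
Qed.

Lemma fubini21 g : bbs g -> \int[mu]_x g x = \int[leb]_t \int[leb]_s g (s, t).
Proof.
move=> bg; have ig := bbs_integrable bg.
rewrite /Rintegral -(@integral21_prod_meas1 _ _ _ _ _ leb leb _ ig); congr fine.
apply: eq_integral => t _; rewrite /fubini_G /= fineK //.
by apply: integrable_fin_num => //; exact: (bbs1_integrable (bbs_slice2 t bg)).
Qed.

Lemma bbs_restrict g (D : set (R * R)) m : continuous g -> measurable D -> D `<=` sq m -> bbs (g \_ D).
Proof.
move=> cg mD Dm; split.
  by apply/(measurable_restrictT _ mD); exact: continuous_measurable_funS2.
have [C C0 hC] := continuous_sq_bounded m cg.
exists C, m => x; rewrite patchE; case: ifPn => [/set_mem/Dm xm|_]; first by split => //; exact: hC.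
by rewrite normr0 ltW //; split => //; rewrite eqxx.
Qed.

Lemma continuous_integrable g (D : set (R * R)) m : continuous g -> measurable D -> D `<=` sq m ->
  mu.-integrable D (EFin \o g).
Proof.
move=> cg mD Dm; apply/(@integrable_mkcond _ _ _ mu D (EFin \o g) mD).
by have := bbs_integrable (bbs_restrict cg mD Dm); rewrite restrict_EFin.
Qed.

Lemma ftc1 (F F' : R -> R) (a b : R) : a < b -> (forall t : R, is_derive t 1 F (F' t)) -> continuous F' ->
  \int[leb]_(t in `]a, b[) F' t = F b - F a.
Proof.
move=> ab dF cF'.
have cF : continuous F.
  by move=> t; apply/differentiable_continuous/derivable1_diffP; have [] := dF t.
have iF : leb.-integrable `[a, b] (EFin \o F').
  by apply: continuous_compact_integrable; [exact: segment_compact|exact: continuous_subspaceT].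
have h : \int[leb]_(t in `[a, b]) F' t = F b - F a.
  rewrite /Rintegral (@continuous_FTC2 _ _ F) //.
  - exact: continuous_subspaceT.
  - split; [by move=> t _; have [] := dF t|exact/cvg_at_right_filter/cF|exact/cvg_at_left_filter/cF].
  - by move=> t _; rewrite derive1E; exact: (@derive_val _ _ _ _ _ _ _ (dF t)).
rewrite -h -Rintegral_itv_obnd_cbnd; last by apply: integrableS iF => //; exact: subset_itv_oc_cc.
rewrite Rintegral_itv_bndo_bndc //; apply: integrableS iF => //; exact: subset_itv_oo_cc.
Qed.
End BoundedSupport.

Section Strip.
Variable R : realType.
Local Notation mu := (area R).
Local Notation leb := (@lebesgue_measure R).
Implicit Types (F : R * R -> R) (h : R -> R).

(** The shape of almost all domains below: the part P of the cell, cells cut at a finite height, the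
    rescaled rough domain over N periods and, for constant [h], rectangles and layers. *)
Definition strip (a b : R) h (M : R) : set (R * R) := [set x | a < x.1 < b /\ h x.1 < x.2 < M].

Definition above h : set (R * R) := [set x | h x.1 < x.2].

Lemma above_open h : continuous h -> open (above h).
Proof.
move=> ch; have -> : above h = (fun x : R * R => x.2 - h x.1) @^-1` [set y | 0 < y].
  by apply/seteqP; split => x /=; rewrite /above /= subr_gt0.
apply: open_comp; last exact: open_gt.
move=> x _; apply: cvgB; first exact: cvg_snd.
by apply: continuous_comp; [exact: cvg_fst|exact: ch].
Qed.

Lemma half_open (a : R) : open [set x : R * R | a < x.1] /\ open [set x : R * R | x.1 < a]
  /\ open [set x : R * R | x.2 < a].
Proof.
split; [|split].
- apply: (@open_comp _ _ fst [set y : R | a < y]); last exact: open_gt.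
  by move=> x _; exact: cvg_fst.
- apply: (@open_comp _ _ fst [set y : R | y < a]); last exact: open_lt.
  by move=> x _; exact: cvg_fst.
- apply: (@open_comp _ _ snd [set y : R | y < a]); last exact: open_lt.
  by move=> x _; exact: cvg_snd.
Qed.

Lemma strip_open a b h M : continuous h -> open (strip a b h M).
Proof.
move=> ch; have -> : strip a b h M = ([set x | a < x.1] `&` [set x | x.1 < b]) `&` (above h `&` [set x | x.2 < M]).
  by apply/seteqP; split => x; rewrite /strip /above /= => -[/andP[? ?] /andP[? ?]] || move=> [[? ?] [? ?]]; split => //; apply/andP.
have [h1 [h2 h3]] := half_open a; have [h4 [h5 h6]] := half_open b; have [_ [_ h7]] := half_open M.
by apply: openI; apply: openI => //; exact: above_open.
Qed.

Lemma strip_measurable a b h M : continuous h -> measurable (strip a b h M).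
Proof. by move=> ch; apply: open_measurable2; exact: strip_open. Qed.

Lemma strip_sq a b h M m : (forall t, m <= h t) -> exists r, strip a b h M `<=` sq r.
Proof.
move=> hm; exists (`|a| + `|b| + `|m| + `|M|) => x [/andP[h1 h2] /andP[h3 h4]].
have := hm x.1; have := ler_norm a; have := ler_norm (- a); have := ler_norm b; have := ler_norm (- b).
have := ler_norm m; have := ler_norm (- m); have := ler_norm M; have := ler_norm (- M); rewrite !normrN.
have := normr_ge0 a; have := normr_ge0 b; have := normr_ge0 m; have := normr_ge0 M.
by move=> *; split; rewrite ler_norml; apply/andP; split; lra.
Qed.

Lemma pair_continuous1 (s : R) : continuous (fun t : R => (s, t)).
Proof.
move=> t; have h1 : (fun _ : R => s) @ t --> s by exact: cvg_cst.
have h2 : (fun u : R => u) @ t --> t by exact: cvg_id.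
exact: (cvg_pair h1 h2).
Qed.

Lemma pair_continuous2 (s : R) : continuous (fun t : R => (t, s)).
Proof.
move=> t; have h1 : (fun _ : R => s) @ t --> s by exact: cvg_cst.
have h2 : (fun u : R => u) @ t --> t by exact: cvg_id.
exact: (cvg_pair h2 h1).
Qed.

Lemma strip_D2 F F' a b h M m : continuous h -> (forall t, m <= h t) -> (forall t, a < t < b -> h t < M) ->
  (forall x, is_derive x e2 F (F' x)) -> continuous F' ->
  \int[mu]_(x in strip a b h M) F' x = \int[leb]_(t in `]a, b[) (F (t, M) - F (t, h t)).
Proof.
move=> ch hm hM dF cF'.
have mS := @strip_measurable a b h M ch; have [r Sr] := @strip_sq a b h M m hm.
rewrite Rintegral_mkcond (fubini12 (bbs_restrict cF' mS Sr)) [RHS]Rintegral_mkcond.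
apply: eq_Rintegral => s _; rewrite patchE.
have [sab|sab] := boolP (a < s < b).
  rewrite mem_set /= ?in_itv //.
  have <- : \int[leb]_(t in `]h s, M[) F' (s, t) = F (s, M) - F (s, h s).
    apply: (@ftc1 _ (fun t => F (s, t)) (fun t => F' (s, t))); first exact: hM.
      by move=> t; exact: (proj1 (is_derive_e2 F (s, t) _) (dF (s, t))).
    move=> t; apply: (@continuous_comp _ _ _ (fun t : R => (s, t)) F'); last exact: cF'.
    exact: pair_continuous1.
  rewrite [RHS]Rintegral_mkcond; apply: eq_Rintegral => t _; rewrite !patchE.
  congr (if _ then _ else _); apply/idP/idP; rewrite !inE /strip /= in_itv /=; first by case.
  by rewrite sab.
rewrite memNset /= ?in_itv //; last exact/negP.
rewrite -[RHS](_ : \int[leb]__ (0 : R) = 0); last by rewrite /Rintegral integral0.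
apply: eq_Rintegral => t _; rewrite patchE memNset // => -[] /=.
by rewrite (negbTE sab).
Qed.

Lemma rect_D1 F F' a b c d : a < b -> 
  (forall x, is_derive x e1 F (F' x)) -> continuous F' ->
  \int[mu]_(x in strip a b (fun=> c) d) F' x = \int[leb]_(t in `]c, d[) (F (b, t) - F (a, t)).
Proof.
move=> ab dF cF'.
have ch : continuous (fun _ : R => c) by exact: cst_continuous.
have mS := @strip_measurable a b _ d ch; have [r Sr] := @strip_sq a b (fun=> c) d c (fun=> lexx c).
rewrite Rintegral_mkcond (fubini21 (bbs_restrict cF' mS Sr)) [RHS]Rintegral_mkcond.
apply: eq_Rintegral => s _; rewrite patchE.
have [sab|sab] := boolP (c < s < d).
  rewrite mem_set /= ?in_itv //.
  have <- : \int[leb]_(t in `]a, b[) F' (t, s) = F (b, s) - F (a, s).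
    apply: (@ftc1 _ (fun t => F (t, s)) (fun t => F' (t, s))); first exact: ab.
      by move=> t; exact: (proj1 (is_derive_e1 F (t, s) _) (dF (t, s))).
    move=> t; apply: (@continuous_comp _ _ _ (fun t : R => (t, s)) F'); last exact: cF'.
    exact: pair_continuous2.
  rewrite [RHS]Rintegral_mkcond; apply: eq_Rintegral => t _; rewrite !patchE.
  congr (if _ then _ else _); apply/idP/idP; rewrite !inE /strip /= in_itv /=; first by case.
  by rewrite sab.
rewrite memNset /= ?in_itv //; last exact/negP.
rewrite -[RHS](_ : \int[leb]__ (0 : R) = 0); last by rewrite /Rintegral integral0.
apply: eq_Rintegral => t _; rewrite patchE memNset // => -[] /=.
by rewrite (negbTE sab).
Qed.

End Strip.

(** * Weak gradients *)

Section WeakGrad.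
Variable R : realType.
Local Notation mu := (area R).
Implicit Types (v w F phi g : R * R -> R) (D K : set (R * R)).

(* The following restate library lemmas so that the carrier [R * R] is used instead of the
   product of the measurable types, which are convertible but do not unify. *)
Lemma areaD D v w : measurable D -> mu.-integrable D (EFin \o v) -> mu.-integrable D (EFin \o w) ->
  mu.-integrable D (EFin \o (fun x => v x + w x)).
Proof. by move=> mD iv iw; exact: (@integrableD _ _ _ mu D mD _ _ iv iw). Qed.

Lemma areaZ D (c : R) v : measurable D -> mu.-integrable D (EFin \o v) -> mu.-integrable D (EFin \o (fun x => c * v x)).
Proof. by move=> mD iv; exact: (@integrableZl _ _ _ mu D mD c _ iv). Qed.

Lemma areaB D v w : measurable D -> mu.-integrable D (EFin \o v) -> mu.-integrable D (EFin \o w) ->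
  mu.-integrable D (EFin \o (fun x => v x - w x)).
Proof. by move=> mD iv iw; exact: (@integrableB _ _ _ mu D mD _ _ iv iw). Qed.

Lemma area_le D v w : measurable D -> measurable_fun D v -> (forall x, D x -> `|v x| <= w x) ->
  mu.-integrable D (EFin \o w) -> mu.-integrable D (EFin \o v).
Proof.
move=> mD mv vw iw; apply: (@le_integrable _ _ _ mu D mD _ _ _ _ iw); first exact/measurable_EFinP.
by move=> x Dx; rewrite /= lee_fin (le_trans (vw x Dx)) // ler_norm.
Qed.

Lemma RintD D v w : measurable D -> mu.-integrable D (EFin \o v) -> mu.-integrable D (EFin \o w) ->
  \int[mu]_(x in D) (v x + w x) = \int[mu]_(x in D) v x + \int[mu]_(x in D) w x.
Proof. by move=> mD iv iw; exact: (@RintegralD _ _ _ mu D v w mD iv iw). Qed.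

Lemma RintB D v w : measurable D -> mu.-integrable D (EFin \o v) -> mu.-integrable D (EFin \o w) ->
  \int[mu]_(x in D) (v x - w x) = \int[mu]_(x in D) v x - \int[mu]_(x in D) w x.
Proof. by move=> mD iv iw; exact: (@RintegralB _ _ _ mu D v w mD iv iw). Qed.

Lemma RintZ D (c : R) v : measurable D -> mu.-integrable D (EFin \o v) ->
  \int[mu]_(x in D) (c * v x) = c * \int[mu]_(x in D) v x.
Proof. by move=> mD iv; exact: (@RintegralZl _ _ _ mu D v c mD iv). Qed.

Lemma Rint_eq D v w : (forall x, D x -> v x = w x) -> \int[mu]_(x in D) v x = \int[mu]_(x in D) w x.
Proof. by move=> h; apply: eq_Rintegral => x /set_mem; exact: h. Qed.

Lemma nsetT (P : R * R -> Prop) x : ~ [set: R * R] x -> P x.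
Proof. by move=> h; case: h. Qed.

Lemma derive_off1 F K x (v : R * R) : closed K -> (forall x, ~ K x -> F x = 0) -> ~ K x -> 'D_v F x = 0.
Proof.
move=> cK F0 xK; apply: derive_val; apply: (@near_eq_is_derive _ _ _ (cst (0:R))).
have : nbhs x (~` K) by apply: open_nbhs_nbhs; split => //; exact: closed_openC.
by apply: filterS => y yK; rewrite F0.
Qed.

Lemma compact_closed2 K : compact K -> closed K.
Proof. by apply: compact_closed; exact: norm_hausdorff. Qed.

Lemma test_D1 D phi : test_function D phi -> test_function D ('D_e1 phi).
Proof.
move=> [sphi [K [cK KD phi0]]]; split; first exact: D1_smooth.
by exists K; split => // x xK; apply: (@derive_off1 _ K) => //; exact: compact_closed2.
Qed.

Lemma test_D2 D phi : test_function D phi -> test_function D ('D_e2 phi).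
Proof.
move=> [sphi [K [cK KD phi0]]]; split; first exact: D2_smooth.
by exists K; split => // x xK; apply: (@derive_off1 _ K) => //; exact: compact_closed2.
Qed.

Lemma int_supp D K (g : R * R -> \bar R) : K `<=` D -> (forall x, D x -> ~ K x -> g x = 0%E) ->
  (\int[mu]_(x in D) g x = \int[mu]_(x in K) g x)%E.
Proof.
move=> KD g0; rewrite integral_mkcond [RHS]integral_mkcond; apply: eq_integral => x _.
rewrite !patchE; have [xK|xK] := boolP (x \in K).
  by rewrite mem_set //; apply: KD; exact: set_mem.
case: ifPn => // xD; apply: g0; first exact: set_mem.
by move=> Kx; move: xK; rewrite mem_set.
Qed.

Lemma Rint_supp D K g : K `<=` D -> (forall x, D x -> ~ K x -> g x = 0) ->
  \int[mu]_(x in D) g x = \int[mu]_(x in K) g x.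
Proof.
move=> KD g0; rewrite /Rintegral (@int_supp D K) // => x Dx Kx.
by rewrite g0.
Qed.

Lemma loc_pair_integrable D K v w : measurable D -> loc_integrable D v -> continuous w -> compact K -> K `<=` D ->
  (forall x, ~ K x -> w x = 0) -> mu.-integrable D (EFin \o (fun x => v x * w x)).
Proof.
move=> mD [mv lv] cw cK KD w0.
have mw : measurable_fun D w by exact: continuous_measurable_funS2.
have [m _ Km] := compact_sq cK.
have [C C0 hC] := continuous_sq_bounded m cw.
have mK : measurable K by apply: closed_measurable2; exact: compact_closed2.
have /integrableP[_ ivK] := lv K cK KD.
apply/integrableP; split; first by apply/measurable_EFinP; exact: measurable_funM.
rewrite (@int_supp D K) //; last by move=> x _ Kx; rewrite /= w0 // mulr0 normr0.
have mvK : measurable_fun K v by exact: measurable_funS mv.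
have mwK : measurable_fun K w by exact: measurable_funS mw.
have mavK : measurable_fun K (fun x => `|v x|) by exact: measurableT_comp.
apply: (@le_lt_trans _ _ (\int[mu]_(x in K) (C * `|v x|)%:E)%E).
  apply: le_intE => //.
  - by apply: measurableT_comp => //; exact: (measurable_funM mvK mwK).
  - exact: (measurable_funM (measurable_cst C) mavK).
  - by move=> x Kx; rewrite normrM mulrC ler_wpM2r // hC //; exact: Km.
rewrite intZE //; last exact: ltW.
by rewrite lte_mul_pinfty // ?lee_fin ?ltW.
Qed.

Lemma test_pair_integrable D v phi : measurable D -> loc_integrable D v -> test_function D phi ->
  mu.-integrable D (EFin \o (fun x => v x * phi x)).
Proof.
move=> mD lv [sphi [K [cK KD phi0]]]; apply: (@loc_pair_integrable _ K) => //.
exact: smooth_continuous.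
Qed.

Lemma continuous_loc_integrable D F : measurable D -> continuous F -> loc_integrable D F.
Proof.
move=> mD cF; split; first exact: continuous_measurable_funS2.
move=> K cK KD; have [m _ Km] := compact_sq cK.
apply: (@continuous_integrable _ _ _ m) => //.
by apply: closed_measurable2; exact: compact_closed2.
Qed.

Lemma loc_integrableD D v w : measurable D -> loc_integrable D v -> loc_integrable D w -> loc_integrable D (fun x => v x + w x).
Proof.
move=> mD [mv lv] [mw lw]; split; first exact: measurable_funD.
move=> K cK KD; have mK : measurable K by apply: closed_measurable2; exact: compact_closed2.
exact: (@integrableD _ _ _ mu K mK _ _ (lv K cK KD) (lw K cK KD)).
Qed.

Lemma loc_integrableM D F v : measurable D -> continuous F -> loc_integrable D v -> loc_integrable D (fun x => F x * v x).
Proof.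
move=> mD cF [mv lv]; split; first by apply: measurable_funM => //; exact: continuous_measurable_funS2.
move=> K cK KD; have mK : measurable K by apply: closed_measurable2; exact: compact_closed2.
have [m _ Km] := compact_sq cK; have [C C0 hC] := continuous_sq_bounded m cF.
have mvK : measurable_fun K v by exact: measurable_funS mv.
have mFK : measurable_fun K F by exact: continuous_measurable_funS2.
have ih := @integrableZl _ _ _ mu K mK C _ (lv K cK KD).
apply: (@le_integrable _ _ _ mu K mK _ _ _ _ ih); first by apply/measurable_EFinP; exact: (measurable_funM mFK mvK).
move=> x Kx; rewrite /= lee_fin !normrM (gtr0_norm C0) ler_wpM2r // hC //; exact: Km.
Qed.

Lemma loc_integrableZ D (c : R) v : measurable D -> loc_integrable D v -> loc_integrable D (fun x => c * v x).
Proof. by move=> mD; apply: loc_integrableM => //; exact: cst_continuous. Qed.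

Lemma loc_integrableS D D' v : measurable D' -> D' `<=` D -> loc_integrable D v -> measurable D -> loc_integrable D' v.
Proof.
move=> mD' D'D [mv lv] mD; split; first exact: measurable_funS mv.
by move=> K cK KD'; apply: lv => //; exact: subset_trans D'D.
Qed.

Lemma int_D1_test phi : test_function setT phi -> \int[mu]_x 'D_e1 phi x = 0.
Proof.
move=> tphi; have [sphi [K [cK _ phi0]]] := tphi; have [m m0 Km] := compact_sq cK.
have cl := compact_closed2 cK.
rewrite (@Rint_supp setT (strip (- (m + 1)) (m + 1) (fun=> - (m + 1)) (m + 1))) //; last first.
  move=> x _ xS; apply: (@derive_off1 _ K _ _ cl phi0) => /Km[/=]; rewrite !ler_norml => /andP[? ?] /andP[? ?].
  by apply: xS; split; apply/andP; split; lra.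
rewrite (@rect_D1 _ phi _ _ _ _ _ _ (fun x => smooth_D1 x sphi)); last 2 first.
- lra.
- exact/smooth_continuous/D1_smooth.
rewrite -[RHS](_ : \int[lebesgue_measure]_(t in `]- (m + 1), m + 1[) (0 : R) = 0); last by rewrite /Rintegral integral0.
apply: eq_Rintegral => t _; rewrite !phi0 ?subrr //.
  by move=> /Km[/=]; rewrite ler_norml => /andP[? ?]; lra.
by move=> /Km[/=]; rewrite ler_norml => /andP[? ?]; lra.
Qed.

Lemma int_D2_test phi : test_function setT phi -> \int[mu]_x 'D_e2 phi x = 0.
Proof.
move=> tphi; have [sphi [K [cK _ phi0]]] := tphi; have [m m0 Km] := compact_sq cK.
have cl := compact_closed2 cK.
rewrite (@Rint_supp setT (strip (- (m + 1)) (m + 1) (fun=> - (m + 1)) (m + 1))) //; last first.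
  move=> x _ xS; apply: (@derive_off1 _ K _ _ cl phi0) => /Km[/=]; rewrite !ler_norml => /andP[? ?] /andP[? ?].
  by apply: xS; split; apply/andP; split; lra.
rewrite (@strip_D2 _ phi _ _ _ _ _ (- (m + 1)) _ _ _ (fun x => smooth_D2 x sphi)); last 4 first.
- exact: cst_continuous.
- by [].
- by move=> t _; lra.
- exact/smooth_continuous/D2_smooth.
rewrite -[RHS](_ : \int[lebesgue_measure]_(t in `]- (m + 1), m + 1[) (0 : R) = 0); last by rewrite /Rintegral integral0.
apply: eq_Rintegral => t _; rewrite !phi0 ?subrr //.
  by move=> /Km[_ /=]; rewrite ler_norml => /andP[? ?]; lra.
by move=> /Km[_ /=]; rewrite ler_norml => /andP[? ?]; lra.
Qed.

Lemma weak_grad_restrict D D' v G : measurable D -> measurable D' -> D' `<=` D -> weak_grad D v G -> weak_grad D' v G.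
Proof.
move=> mD mD' D'D [l0 l1 l2 H]; split; try exact: loc_integrableS mD.
move=> phi tphi; have [sphi [K [cK KD phi0]]] := tphi.
have tphi' : test_function D phi by split => //; exists K; split => //; exact: subset_trans D'D.
have [H1 H2] := H phi tphi'; have cl := compact_closed2 cK.
have o (w psi : R * R -> R) : (forall x, ~ K x -> psi x = 0) ->
    \int[mu]_(x in D') (w x * psi x) = \int[mu]_(x in D) (w x * psi x).
  move=> p0; rewrite (@Rint_supp D' K) ?(@Rint_supp D K) // => [|x _ Kx|x _ Kx]; rewrite ?p0 ?mulr0 //.
  exact: subset_trans D'D.
split; first by rewrite o ?o // => x xK; exact: (@derive_off1 _ K _ _ cl phi0).
by rewrite o ?o // => x xK; exact: (@derive_off1 _ K _ _ cl phi0).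
Qed.

(* [D] may exceed [D1] outside the support [Z] of [F]: with [D1 = D] this is the product rule,
   otherwise [F v] is an extension by zero. *)
Lemma weak_grad_mul D1 D Z v G F : measurable D1 -> measurable D -> D1 `<=` D -> closed Z -> D `&` Z `<=` D1 ->
  smooth F -> (forall x, ~ Z x -> F x = 0) -> weak_grad D1 v G ->
  weak_grad D (fun x => F x * v x) (fun x => (F x * (G x).1 + v x * 'D_e1 F x, F x * (G x).2 + v x * 'D_e2 F x)).
Proof.
move=> mD1 mD D1D cZ DZ sF F0 [l0 l1 l2 H].
have cF := smooth_continuous sF.
have dF1 := D1_smooth sF; have dF2 := D2_smooth sF.
have lext (E w : R * R -> R) : continuous E -> (forall x, ~ Z x -> E x = 0) -> loc_integrable D1 w ->
    loc_integrable D (fun x => E x * w x).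
  move=> cE E0 lw; have [mEw _] := loc_integrableM mD1 cE lw.
  have mg : measurable_fun D (fun x => E x * w x).
    have mD2 : measurable (D `\` D1) by exact: measurableD.
    have m2 : measurable_fun (D `\` D1) (fun x => E x * w x).
      have m0 : measurable_fun (D `\` D1) (fun _ : R * R => 0 : R) by exact: measurable_cst.
      apply: eq_measurable_fun m0.
      by move=> x /set_mem[Dx nx]; rewrite E0 ?mul0r // => Zx; apply: nx; exact: DZ.
    have -> : D = D1 `|` (D `\` D1) by rewrite setDUK.
    by apply: (proj2 (measurable_funU _ mD1 mD2)); split.
  split => // K cK KD.
  have cKZ : compact (K `&` Z) by apply: compact_closedI.
  have KZD : K `&` Z `<=` D1 by move=> x [Kx Zx]; apply: DZ; split => //; exact: KD.
  have mK : measurable K by apply: closed_measurable2; exact: compact_closed2.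
  have mKZ : measurable (K `&` Z) by apply: closed_measurable2; exact: compact_closed2.
  have [_ lKZ] := loc_integrableM mD1 cE lw; have /integrableP[_ i1] := lKZ _ cKZ KZD.
  apply/integrableP; split; first by apply/measurable_EFinP; exact: measurable_funS mg.
  rewrite (_ : (\int[mu]_(x in K) _ = \int[mu]_(x in K `&` Z) `|(EFin \o (fun x0 => E x0 * w x0)%R) x|)%E) //.
  apply: int_supp => [x []//|x Kx nKZ].
  by rewrite /= E0 ?mul0r ?normr0 // => Zx; apply: nKZ.
have lcomm E w : loc_integrable D (fun x => E x * w x) -> loc_integrable D (fun x => w x * E x).
  by under eq_fun do rewrite mulrC.
split.
- exact: lext.
- apply: loc_integrableD => //; first exact: lext.
  apply: lcomm; apply: lext => //; first exact: smooth_continuous.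
  by move=> x xZ; exact: (@derive_off1 _ Z _ _ cZ F0).
- apply: loc_integrableD => //; first exact: lext.
  apply: lcomm; apply: lext => //; first exact: smooth_continuous.
  by move=> x xZ; exact: (@derive_off1 _ Z _ _ cZ F0).
move=> phi [sphi [K [cK KD phi0]]].
have cl := compact_closed2 cK.
have cKZ : compact (K `&` Z) by apply: compact_closedI.
have KZD : K `&` Z `<=` D1 by move=> x [Kx Zx]; apply: DZ; split => //; exact: KD.
have KZ0 x : ~ (K `&` Z) x -> F x * phi x = 0.
  move=> nKZ; have [Kx|nK] := pselect (K x); last by rewrite phi0 ?mulr0.
  by rewrite F0 ?mul0r // => Zx; apply: nKZ.
have tF : test_function D1 (fun x => F x * phi x) by split; [exact: smoothM|exists (K `&` Z)].
have KZ1 (A B : R * R -> R) x : (forall x, ~ Z x -> A x = 0) -> (forall x, ~ K x -> B x = 0) -> ~ (K `&` Z) x -> A x * B x = 0.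
  move=> A0 B0 nKZ; have [Kx|nK] := pselect (K x); last by rewrite B0 ?mulr0.
  by rewrite A0 ?mul0r // => Zx; apply: nKZ.
have intKZ (w A B : R * R -> R) : loc_integrable D1 w -> continuous A -> continuous B ->
    (forall x, ~ Z x -> A x = 0) -> (forall x, ~ K x -> B x = 0) ->
    mu.-integrable D1 (EFin \o (fun x => w x * (A x * B x))).
  move=> lw cA cB A0 B0; apply: (@loc_pair_integrable _ (K `&` Z)) => //.
    by move=> x; apply: cvgM; [exact: cA|exact: cB].
  by move=> x; exact: KZ1.
have DD1 (w : R * R -> R) : (forall x, ~ (K `&` Z) x -> w x = 0) ->
    \int[mu]_(x in D) w x = \int[mu]_(x in D1) w x.
  move=> w0; rewrite (@Rint_supp D (K `&` Z)) ?(@Rint_supp D1 (K `&` Z)) //.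
  - by move=> x _; exact: w0.
  - by move=> x [Kx _]; exact: KD.
  - by move=> x _; exact: w0.
have Z1 x : ~ Z x -> 'D_e1 F x = 0 by exact: (@derive_off1 _ Z _ _ cZ F0).
have Z2 x : ~ Z x -> 'D_e2 F x = 0 by exact: (@derive_off1 _ Z _ _ cZ F0).
have K1 x : ~ K x -> 'D_e1 phi x = 0 by exact: (@derive_off1 _ K _ _ cl phi0).
have K2 x : ~ K x -> 'D_e2 phi x = 0 by exact: (@derive_off1 _ K _ _ cl phi0).
have [H1 H2] := H _ tF.
have cphi := smooth_continuous sphi.
have cp1 := smooth_continuous (D1_smooth sphi); have cp2 := smooth_continuous (D2_smooth sphi).
have cF1 := smooth_continuous dF1; have cF2 := smooth_continuous dF2.
split.
- rewrite DD1; last by move=> x nKZ; rewrite mulrAC (KZ1 F ('D_e1 phi)) // mul0r.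
  rewrite DD1; last first.
    move=> x nKZ; rewrite mulrDl mulrAC (KZ1 F phi) // mul0r add0r -mulrA (KZ1 ('D_e1 F) phi) ?mulr0 //.
  have i1 := intKZ v F ('D_e1 phi) l0 cF cp1 F0 K1.
  have i2 := intKZ v ('D_e1 F) phi l0 cF1 cphi Z1 phi0.
  have i3 := intKZ _ F phi l1 cF cphi F0 phi0.
  move: H1; under eq_Rintegral do rewrite D1_mul // mulrDr [phi _ * _]mulrC.
  rewrite (RintD mD1 i1 i2) => H1.
  rewrite (@Rint_eq D1 _ (fun x => v x * (F x * 'D_e1 phi x))); last by move=> x _; rewrite mulrCA mulrA.
  rewrite [in RHS](@Rint_eq D1 _ (fun x => (G x).1 * (F x * phi x) + v x * ('D_e1 F x * phi x))); last first.
    by move=> x _ /=; ring.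
  by rewrite (RintD mD1 i3 i2) opprD -H1 addrK.
- rewrite DD1; last by move=> x nKZ; rewrite mulrAC (KZ1 F ('D_e2 phi)) // mul0r.
  rewrite DD1; last first.
    move=> x nKZ; rewrite mulrDl mulrAC (KZ1 F phi) // mul0r add0r -mulrA (KZ1 ('D_e2 F) phi) ?mulr0 //.
  have i1 := intKZ v F ('D_e2 phi) l0 cF cp2 F0 K2.
  have i2 := intKZ v ('D_e2 F) phi l0 cF2 cphi Z2 phi0.
  have i3 := intKZ _ F phi l2 cF cphi F0 phi0.
  move: H2; under eq_Rintegral do rewrite D2_mul // mulrDr [phi _ * _]mulrC.
  rewrite (RintD mD1 i1 i2) => H2.
  rewrite (@Rint_eq D1 _ (fun x => v x * (F x * 'D_e2 phi x))); last by move=> x _; rewrite mulrCA mulrA.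
  rewrite [in RHS](@Rint_eq D1 _ (fun x => (G x).2 * (F x * phi x) + v x * ('D_e2 F x * phi x))); last first.
    by move=> x _ /=; ring.
  by rewrite (RintD mD1 i3 i2) opprD -H2 addrK.
Qed.

Lemma weak_grad_cst1 D : measurable D -> weak_grad D (fun=> 1 : R) (fun=> (0, 0)).
Proof.
move=> mD; split; try (apply: continuous_loc_integrable => //; exact: cst_continuous).
move=> phi [sphi [K [cK KD phi0]]]; have cl := compact_closed2 cK.
have tT : test_function setT phi by split => //; exists K.
have Z (psi : R * R -> R) : \int[mu]_(x in D) (0 * psi x) = 0.
  by under eq_Rintegral do rewrite mul0r; rewrite /Rintegral integral0.
rewrite /= !Z !oppr0; split.
  rewrite -(int_D1_test tT) (@eq_Rintegral _ _ _ mu D ('D_e1 phi)); last by move=> x _; rewrite mul1r.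
  rewrite (@Rint_supp D K) ?(@Rint_supp setT K) // => x _ xK; exact: (@derive_off1 _ K _ _ cl phi0).
rewrite -(int_D2_test tT) (@eq_Rintegral _ _ _ mu D ('D_e2 phi)); last by move=> x _; rewrite mul1r.
rewrite (@Rint_supp D K) ?(@Rint_supp setT K) // => x _ xK; exact: (@derive_off1 _ K _ _ cl phi0).
Qed.

Definition grad F (x : R * R) : R * R := ('D_e1 F x, 'D_e2 F x).

(** The product rule applied to the constant 1. Classical integration by parts thus enters only
    through the fact that derivatives of test functions have integral 0. *)
Lemma weak_grad_smooth D F : measurable D -> smooth F -> weak_grad D F (grad F).
Proof.
move=> mD sF; have := @weak_grad_mul D D setT (fun=> 1) (fun=> (0, 0)) F mD mD (@subset_refl _ D) closedT (@subIsetl _ D setT) sF (nsetT _) (weak_grad_cst1 mD).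
under eq_fun do rewrite mulr1.
by under [X in weak_grad _ _ X]eq_fun do rewrite /= !mulr0 !add0r !mul1r.
Qed.

Lemma weak_gradD D v w G H : measurable D -> weak_grad D v G -> weak_grad D w H ->
  weak_grad D (fun x => v x + w x) (fun x => ((G x).1 + (H x).1, (G x).2 + (H x).2)).
Proof.
move=> mD [l0 l1 l2 h] [k0 k1 k2 h']; split; try exact: loc_integrableD.
move=> phi tphi; have [a1 a2] := h _ tphi; have [b1 b2] := h' _ tphi.
have t1 := test_D1 tphi; have t2 := test_D2 tphi.
split.
  under eq_Rintegral do rewrite mulrDl; under [in RHS]eq_Rintegral do rewrite mulrDl.
  rewrite !RintD //; try exact: test_pair_integrable.
  by rewrite a1 b1 opprD.
under eq_Rintegral do rewrite mulrDl; under [in RHS]eq_Rintegral do rewrite mulrDl.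
rewrite !RintD //; try exact: test_pair_integrable.
by rewrite a2 b2 opprD.
Qed.

Lemma weak_gradZ D v G (c : R) : measurable D -> weak_grad D v G ->
  weak_grad D (fun x => c * v x) (fun x => (c * (G x).1, c * (G x).2)).
Proof.
move=> mD h; have := @weak_grad_mul D D setT v G (fun=> c) mD mD (@subset_refl _ D) closedT (@subIsetl _ D setT) (smooth_cst c) (nsetT _) h.
by under [X in weak_grad _ _ X]eq_fun do rewrite /= D1_cst D2_cst !mulr0 !addr0.
Qed.

Lemma weak_gradB D v w G H : measurable D -> weak_grad D v G -> weak_grad D w H ->
  weak_grad D (fun x => v x - w x) (fun x => ((G x).1 - (H x).1, (G x).2 - (H x).2)).
Proof.
move=> mD h1 h2; have := weak_gradD mD h1 (weak_gradZ (-1) mD h2).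
under eq_fun do rewrite mulN1r.
by under [X in weak_grad _ _ X]eq_fun do rewrite /= !mulN1r.
Qed.

End WeakGrad.

(** * Square integrable functions *)

Section L2.
Context d (T : measurableType d) (R : realType) (mu : {measure set T -> \bar R}).
Implicit Types (D E : set T) (a b p : T -> R).

Definition L2 D a := measurable_fun D a /\ (\int[mu]_(x in D) (a x ^+ 2)%:E < +oo)%E.
Definition Q D a : R := \int[mu]_(x in D) (a x ^+ 2).

Lemma Q_ge0 D a : 0 <= Q D a.
Proof. by apply: Rintegral_ge0 => x _; exact: sqr_ge0. Qed.

Section FixD.
Variables (D : set T) (mD : measurable D).

Lemma sqr_meas a : measurable_fun D a -> measurable_fun D (fun x => a x ^+ 2).
Proof. by move=> ma; exact: measurable_funX. Qed.

Lemma intE_abs_integrable p : measurable_fun D p -> (forall x, D x -> 0 <= p x) ->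
  (\int[mu]_(x in D) (p x)%:E < +oo)%E -> mu.-integrable D (EFin \o p).
Proof.
move=> mp p0 ip; apply/integrableP; split; first exact/measurable_EFinP.
rewrite (eq_integral (fun x => (p x)%:E)) // => x /set_mem Dx.
by rewrite /= ger0_norm // p0.
Qed.

Lemma L2_sqr a : L2 D a -> mu.-integrable D (EFin \o (fun x => a x ^+ 2)).
Proof.
by move=> [ma ia]; apply: intE_abs_integrable => //; [exact: sqr_meas|move=> x _; exact: sqr_ge0].
Qed.

Lemma Q_E a : L2 D a -> (Q D a)%:E = (\int[mu]_(x in D) (a x ^+ 2)%:E)%E.
Proof. by move=> /L2_sqr ia; rewrite /Q /Rintegral fineK //; exact: (integrable_fin_num mD ia). Qed.

Lemma integrable_le a p : measurable_fun D a -> (forall x, D x -> `|a x| <= p x) ->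
  mu.-integrable D (EFin \o p) -> mu.-integrable D (EFin \o a).
Proof.
move=> ma ap ip; apply: (le_integrable mD _ _ ip); first exact/measurable_EFinP.
by move=> x Dx; rewrite /= lee_fin (le_trans (ap x Dx)) // ler_norm.
Qed.

Lemma integrable_add a b : mu.-integrable D (EFin \o a) -> mu.-integrable D (EFin \o b) ->
  mu.-integrable D (EFin \o (fun x => a x + b x)).
Proof. by move=> ia ib; exact: (integrableD mD ia ib). Qed.

Lemma integrable_scale (c : R) a : mu.-integrable D (EFin \o a) ->
  mu.-integrable D (EFin \o (fun x => c * a x)).
Proof. by move=> ia; exact: (integrableZl mD c ia). Qed.

Lemma Rint_le a b : mu.-integrable D (EFin \o a) -> mu.-integrable D (EFin \o b) ->
  (forall x, D x -> a x <= b x) -> \int[mu]_(x in D) a x <= \int[mu]_(x in D) b x.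
Proof. by move=> ia ib ab; apply: le_Rintegral => //; exact: mD. Qed.

Lemma integrable_meas a : mu.-integrable D (EFin \o a) -> measurable_fun D a.
Proof. by move=> /integrableP[/measurable_EFinP]. Qed.

Lemma L2_mul a b : L2 D a -> L2 D b -> mu.-integrable D (EFin \o (fun x => a x * b x)).
Proof.
move=> la lb; have [ma _] := la; have [mb _] := lb.
apply: (@integrable_le _ (fun x => a x ^+ 2 + b x ^+ 2)).
- exact: measurable_funM.
- by move=> x _; rewrite ler_norml; have := sqr_ge0 (a x - b x); have := sqr_ge0 (a x + b x);
    have := sqr_ge0 (a x); have := sqr_ge0 (b x); nra.
- by apply: integrable_add; exact: L2_sqr.
Qed.

Lemma L2_le a p : measurable_fun D a -> (forall x, D x -> a x ^+ 2 <= p x) ->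
  mu.-integrable D (EFin \o p) -> L2 D a.
Proof.
move=> ma ap ip; split => //; apply: (@le_lt_trans _ _ (\int[mu]_(x in D) (p x)%:E)%E).
  apply: le_intE => //; [exact: sqr_meas|exact: integrable_meas|by move=> x _; exact: sqr_ge0].
by have := integrable_fin_num mD ip; rewrite fin_numE => /andP[_]; rewrite lt_neqAle leey andbT.
Qed.

Lemma L2D a b : L2 D a -> L2 D b -> L2 D (fun x => a x + b x).
Proof.
move=> la lb; have [ma _] := la; have [mb _] := lb.
apply: (@L2_le _ (fun x => 2 * (a x ^+ 2 + b x ^+ 2))).
- exact: measurable_funD.
- by move=> x _; have := sqr_ge0 (a x - b x); nra.
- by apply: integrable_scale; apply: integrable_add; exact: L2_sqr.
Qed.

Lemma L2_bnd p a (K : R) : measurable_fun D p -> (forall x, D x -> `|p x| <= K) -> L2 D a ->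
  L2 D (fun x => p x * a x).
Proof.
move=> mp pK la; have [ma _] := la.
apply: (@L2_le _ (fun x => K ^+ 2 * a x ^+ 2)).
- exact: measurable_funM.
- move=> x Dx; rewrite exprMn ler_wpM2r ?sqr_ge0 //.
  by rewrite -(ger0_norm (sqr_ge0 (p x))) normrX lerXn2r ?nnegrE // ?pK // (le_trans _ (pK x Dx)).
- by apply: integrable_scale; exact: L2_sqr.
Qed.

Lemma L2Z (c : R) a : L2 D a -> L2 D (fun x => c * a x).
Proof. by move=> la; apply: (@L2_bnd (fun=> c) _ `|c|) => //; exact: measurable_cst. Qed.

Lemma L2B a b : L2 D a -> L2 D b -> L2 D (fun x => a x - b x).
Proof.
by move=> la /(L2Z (-1)) lb; have := L2D la lb; under eq_fun do rewrite mulN1r.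
Qed.

Lemma QD_le a b : L2 D a -> L2 D b -> Q D (fun x => a x + b x) <= 2 * Q D a + 2 * Q D b.
Proof.
move=> la lb; rewrite -mulrDr /Q -RintegralD //; try exact: L2_sqr.
rewrite -RintegralZl //; last by apply: integrable_add; exact: L2_sqr.
apply: Rint_le.
- by apply: L2_sqr; exact: L2D.
- by apply: integrable_scale; apply: integrable_add; exact: L2_sqr.
- by move=> x _; have := sqr_ge0 (a x - b x); nra.
Qed.

Lemma QZ (c : R) a : L2 D a -> Q D (fun x => c * a x) = c ^+ 2 * Q D a.
Proof. by move=> /L2_sqr ia; rewrite /Q -RintegralZl //; apply: eq_Rintegral => x _; rewrite exprMn. Qed.

Lemma Q_bnd p a (K : R) : measurable_fun D p -> (forall x, D x -> `|p x| <= K) -> L2 D a ->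
  Q D (fun x => p x * a x) <= K ^+ 2 * Q D a.
Proof.
move=> mp pK la; rewrite /Q -RintegralZl //; last exact: L2_sqr.
apply: Rint_le.
- by apply: L2_sqr; apply: (@L2_bnd p a K).
- by apply: integrable_scale; exact: L2_sqr.
- move=> x Dx; rewrite exprMn ler_wpM2r ?sqr_ge0 //.
  by rewrite -(ger0_norm (sqr_ge0 (p x))) normrX lerXn2r ?nnegrE // ?pK // (le_trans _ (pK x Dx)).
Qed.

Lemma QB_le a b : L2 D a -> L2 D b -> Q D (fun x => a x - b x) <= 2 * Q D a + 2 * Q D b.
Proof.
move=> la lb; have := QD_le la (L2Z (-1) lb); rewrite (QZ (-1) lb) sqrrN expr1n mul1r.
by under [X in Q D X <= _ -> _]eq_fun do rewrite mulN1r.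
Qed.

Lemma Q_expand a b (l : R) : L2 D a -> L2 D b ->
  Q D (fun x => a x + l * b x) = Q D a + 2 * l * \int[mu]_(x in D) (a x * b x) + l ^+ 2 * Q D b.
Proof.
move=> la lb; have ia := L2_sqr la; have ib := L2_sqr lb; have iab := L2_mul la lb.
rewrite /Q -(RintegralZl _ mD iab) -(RintegralZl _ mD ib).
have i1 := integrable_scale (2 * l) iab; have i2 := integrable_scale (l ^+ 2) ib.
rewrite -(RintegralD mD ia i1) -(RintegralD mD (integrable_add ia i1) i2).
by apply: eq_Rintegral => x _ /=; ring.
Qed.

(** The square integral of a + l b is a nonnegative quadratic polynomial in [l], evaluated at its
    minimum. If [Q D b] is 0 the polynomial is affine, and a suitable [l] would make it negative
    unless the mixed integral vanishes. *)
Lemma CS a b : L2 D a -> L2 D b -> (\int[mu]_(x in D) (a x * b x)) ^+ 2 <= Q D a * Q D b.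
Proof.
move=> la lb; set I := \int[mu]_(x in D) _.
have H l : 0 <= Q D a + 2 * l * I + l ^+ 2 * Q D b by rewrite -Q_expand // Q_ge0.
have [b0|b0] := eqVneq (Q D b) 0; last first.
  have bp : 0 < Q D b by rewrite lt_neqAle eq_sym b0 Q_ge0.
  have := H (- I / Q D b); rewrite -(pmulr_rge0 _ bp).
  suff -> : Q D b * (Q D a + 2 * (- I / Q D b) * I + (- I / Q D b) ^+ 2 * Q D b) = Q D a * Q D b - I ^+ 2 by lra.
  by field.
rewrite b0 mulr0; have [-> |I0] := eqVneq I 0; first by rewrite expr0n.
have := H (- (Q D a + 1) / I); rewrite b0 mulr0 addr0.
have -> : 2 * (- (Q D a + 1) / I) * I = - 2 * (Q D a + 1) by field.
have := Q_ge0 D a; lra.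
Qed.

Lemma CS_sqrt a b : L2 D a -> L2 D b ->
  `|\int[mu]_(x in D) (a x * b x)| <= Num.sqrt (Q D a) * Num.sqrt (Q D b).
Proof.
move=> la lb; rewrite -sqrtrM ?Q_ge0 // -sqrtr_sqr ler_wsqrtr //; exact: CS.
Qed.

Definition cvgL2 (a : nat -> T -> R) b :=
  [/\ forall n, L2 D (a n), L2 D b & Q D (fun x => a n x - b x) @[n --> \oo] --> (0 : R)].

Lemma cvg0_squeeze (u v : nat -> R) : (forall n, 0 <= u n) -> (forall n, u n <= v n) ->
  v @ \oo --> (0 : R) -> u @ \oo --> (0 : R).
Proof.
move=> u0 uv v0; apply: (@squeeze_cvgr _ _ _ _ (fun=> 0) v) => //; last exact: cvg_cst.
by apply: nearW => n; rewrite u0 uv.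
Qed.

Lemma cvg0_sqrt (u : nat -> R) : u @ \oo --> (0 : R) -> (fun n => Num.sqrt (u n)) @ \oo --> (0 : R).
Proof.
move=> u0; rewrite -(sqrtr0 R).
by apply: continuous_cvg => //; exact: sqrt_continuous.
Qed.

Lemma cvg0_norm (u : nat -> R) (l : R) (v : nat -> R) : (forall n, `|u n - l| <= v n) ->
  v @ \oo --> (0 : R) -> u @ \oo --> l.
Proof.
move=> uv v0; apply/subr_cvg0; apply/norm_cvg0P.
by apply: cvg0_squeeze v0 => // n.
Qed.

Lemma cvgL2_pair (a b : nat -> T -> R) a' b' : cvgL2 a a' -> cvgL2 b b' ->
  \int[mu]_(x in D) (a n x * b n x) @[n --> \oo] --> \int[mu]_(x in D) (a' x * b' x).
Proof.
move=> [la la' ca] [lb lb' cb].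
have ld n := L2B (la n) la'; have le n := L2B (lb n) lb'.
apply: (@cvg0_norm _ _ (fun n => Num.sqrt (Q D (fun x => a n x - a' x)) * Num.sqrt (Q D (fun x => b n x - b' x))
  + Num.sqrt (Q D (fun x => a n x - a' x)) * Num.sqrt (Q D b') + Num.sqrt (Q D a') * Num.sqrt (Q D (fun x => b n x - b' x)))).
  move=> n; rewrite -(RintegralB mD (L2_mul (la n) (lb n)) (L2_mul la' lb')).
  have -> : \int[mu]_(x in D) (a n x * b n x - a' x * b' x) =
    \int[mu]_(x in D) ((a n x - a' x) * (b n x - b' x)) + \int[mu]_(x in D) ((a n x - a' x) * b' x)
    + \int[mu]_(x in D) (a' x * (b n x - b' x)).
    rewrite -(RintegralD mD (L2_mul (ld n) (le n)) (L2_mul (ld n) lb')).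
    rewrite -(RintegralD mD (integrable_add (L2_mul (ld n) (le n)) (L2_mul (ld n) lb')) (L2_mul la' (le n))).
    by apply: eq_Rintegral => x _ /=; ring.
  apply: (le_trans (ler_normD _ _)); apply: lerD; last exact: CS_sqrt.
  by apply: (le_trans (ler_normD _ _)); apply: lerD; exact: CS_sqrt.
have sa := cvg0_sqrt ca; have sb := cvg0_sqrt cb.
rewrite -[X in _ --> X](_ : 0 * 0 + 0 * Num.sqrt (Q D b') + Num.sqrt (Q D a') * 0 = 0); last by rewrite !mul0r mulr0 !addr0.
apply: cvgD; [apply: cvgD|]; apply: cvgM => //; exact: cvg_cst.
Qed.

Lemma cvgL2_cst a : L2 D a -> cvgL2 (fun=> a) a.
Proof.
move=> la; split => //; rewrite (_ : (fun n => _) = (fun=> 0)); first exact: cvg_cst.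
by apply/funext => n; rewrite /Q; under eq_Rintegral do rewrite subrr expr0n; rewrite Rintegral_cst // mul0r.
Qed.

Lemma cvgL2_Q (a : nat -> T -> R) b : cvgL2 a b -> Q D (a n) @[n --> \oo] --> Q D b.
Proof.
move=> c; have := cvgL2_pair c c; rewrite /Q.
by under eq_fun do under eq_Rintegral do rewrite -expr2; under [X in _ --> X -> _]eq_Rintegral do rewrite -expr2.
Qed.

Lemma cvgL2D (a : nat -> T -> R) a' (b : nat -> T -> R) b' : cvgL2 a a' -> cvgL2 b b' -> cvgL2 (fun n x => a n x + b n x) (fun x => a' x + b' x).
Proof.
move=> [la la' ca] [lb lb' cb]; split; [by move=> n; exact: L2D|exact: L2D|].
have ld n := L2B (la n) la'; have le n := L2B (lb n) lb'.
apply: (@cvg0_squeeze _ (fun n => 2 * Q D (fun x => a n x - a' x) + 2 * Q D (fun x => b n x - b' x))).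
- by move=> n; exact: Q_ge0.
- move=> n; apply: le_trans (QD_le (ld n) (le n)).
  by rewrite le_eqVlt; apply/orP; left; apply/eqP; apply: eq_Rintegral => x _; congr (_ ^+ 2); ring.
- rewrite -[X in _ --> X](_ : 2 * 0 + 2 * 0 = 0); last by rewrite !mulr0 addr0.
  by apply: cvgD; apply: cvgZr.
Qed.

Lemma cvgL2_bnd p (a : nat -> T -> R) a' (K : R) : measurable_fun D p -> (forall x, D x -> `|p x| <= K) -> cvgL2 a a' ->
  cvgL2 (fun n x => p x * a n x) (fun x => p x * a' x).
Proof.
move=> mp pK [la la' ca]; split; [by move=> n; apply: (@L2_bnd p _ K)|exact: (@L2_bnd p _ K)|].
have ld n := L2B (la n) la'.
apply: (@cvg0_squeeze _ (fun n => K ^+ 2 * Q D (fun x => a n x - a' x))).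
- by move=> n; exact: Q_ge0.
- move=> n; apply: le_trans (Q_bnd mp pK (ld n)).
  by rewrite le_eqVlt; apply/orP; left; apply/eqP; apply: eq_Rintegral => x _; congr (_ ^+ 2); ring.
- by rewrite -[X in _ --> X](mulr0 (K ^+ 2)); apply: cvgZr.
Qed.

Lemma cvgL2Z (c : R) (a : nat -> T -> R) a' : cvgL2 a a' -> cvgL2 (fun n x => c * a n x) (fun x => c * a' x).
Proof. by apply: (@cvgL2_bnd (fun=> c) _ _ `|c|) => //; exact: measurable_cst. Qed.

Lemma cvgL2_eqE (a : nat -> T -> R) b : (forall n, L2 D (a n)) -> L2 D b ->
  (\int[mu]_(x in D) ((a n x - b x) ^+ 2)%:E)%E @[n --> \oo] --> 0%E <-> cvgL2 a b.
Proof.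
move=> la lb.
have E n : (\int[mu]_(x in D) ((a n x - b x) ^+ 2)%:E)%E = (Q D (fun x => a n x - b x))%:E by rewrite (Q_E (L2B (la n) lb)).
under eq_fun do rewrite E; split => [h|[_ _ h]].
  by split => //; exact: (fine_cvg h).
by apply: cvg_EFin => //; exact: nearW.
Qed.

End FixD.

Lemma L2S D E a : measurable D -> measurable E -> E `<=` D -> L2 D a -> L2 E a.
Proof.
move=> mD mE ED [ma ia]; split; first exact: measurable_funS ma.
apply: le_lt_trans ia; apply: le_int_sub => //; [exact: sqr_meas|by move=> x _; exact: sqr_ge0].
Qed.

Lemma QS D E a : measurable D -> measurable E -> E `<=` D -> L2 D a -> Q E a <= Q D a.
Proof.
move=> mD mE ED la; rewrite -lee_fin !Q_E //; last exact: L2S la.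
have [ma _] := la; apply: le_int_sub => //; [exact: sqr_meas|by move=> x _; exact: sqr_ge0].
Qed.

Lemma cvgL2S D E (a : nat -> T -> R) b : measurable D -> measurable E -> E `<=` D -> cvgL2 D a b -> cvgL2 E a b.
Proof.
move=> mD mE ED [la lb c]; split; [by move=> n; exact: L2S (la n)|exact: L2S lb|].
apply: cvg0_squeeze c => n; [exact: Q_ge0|].
by apply: QS => //; exact: L2B.
Qed.

End L2.

(* Specializations to the plane: their domains are sets of [R * R], which the general statements
   see only up to conversion. *)
Module A.
Definition L2_sqr (R : realType) := @L2_sqr _ _ _ (area R).
Definition Q_E (R : realType) := @Q_E _ _ _ (area R).
Definition Rint_le (R : realType) := @Rint_le _ _ _ (area R).
Definition L2_mul (R : realType) := @L2_mul _ _ _ (area R).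
Definition L2_le (R : realType) := @L2_le _ _ _ (area R).
Definition L2D (R : realType) := @L2D _ _ _ (area R).
Definition L2_bnd (R : realType) := @L2_bnd _ _ _ (area R).
Definition L2Z (R : realType) := @L2Z _ _ _ (area R).
Definition L2B (R : realType) := @L2B _ _ _ (area R).
Definition QD_le (R : realType) := @QD_le _ _ _ (area R).
Definition QZ (R : realType) := @QZ _ _ _ (area R).
Definition Q_bnd (R : realType) := @Q_bnd _ _ _ (area R).
Definition QB_le (R : realType) := @QB_le _ _ _ (area R).
Definition CS (R : realType) := @CS _ _ _ (area R).
Definition cvgL2_pair (R : realType) := @cvgL2_pair _ _ _ (area R).
Definition cvgL2_cst (R : realType) := @cvgL2_cst _ _ _ (area R).
Definition cvgL2_Q (R : realType) := @cvgL2_Q _ _ _ (area R).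
Definition cvgL2D (R : realType) := @cvgL2D _ _ _ (area R).
Definition cvgL2_bnd (R : realType) := @cvgL2_bnd _ _ _ (area R).
Definition cvgL2Z (R : realType) := @cvgL2Z _ _ _ (area R).
Definition cvgL2_eqE (R : realType) := @cvgL2_eqE _ _ _ (area R).
Definition L2S (R : realType) := @L2S _ _ _ (area R).
Definition QS (R : realType) := @QS _ _ _ (area R).
Definition cvgL2S (R : realType) := @cvgL2S _ _ _ (area R).
End A.

(** * Uniqueness of weak gradients and the value of the H^1 norm *)

Section Unique.
Variable R : realType.
Local Notation mu := (area R).
Implicit Types (k : R) (n : nat) (x z : R * R) (v w g F phi : R * R -> R) (G H : R * R -> R * R) (D K : set (R * R)).

Definition seg2 (a1 b1 a2 b2 : R) : set (R * R) := [set z | a1 <= z.1 <= b1 /\ a2 <= z.2 <= b2].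

Lemma seg2_compact a1 b1 a2 b2 : compact (seg2 a1 b1 a2 b2).
Proof.
have -> : seg2 a1 b1 a2 b2 = `[a1, b1]%classic `*` `[a2, b2]%classic.
  by apply/seteqP; split => x; rewrite /seg2 /= !in_itv.
by apply: compact_setX; exact: segment_compact.
Qed.

Lemma seg2_measurable a1 b1 a2 b2 : measurable (seg2 a1 b1 a2 b2).
Proof. by apply: closed_measurable2; apply: compact_closed2; exact: seg2_compact. Qed.

Definition kbox (k : R) (n : nat) (x : R * R) : set (R * R) :=
  seg2 x.1 (x.1 + n.+1%:R^-1) (x.2 + k / n.+1%:R) (x.2 + (k + 1) / n.+1%:R).

Lemma kern2_off k n x z : ~ kbox k n x z -> kern2 k n x z = 0.
Proof.
move=> nz; apply/eqP; apply: contra_notT nz => K0.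
have /kern_supp h1 : kern 0 n (x.1 - z.1) != 0 by apply: contraNneq K0 => h; rewrite /kern2 /ker h mul0r.
have /kern_supp h2 : kern k n (x.2 - z.2) != 0 by apply: contraNneq K0 => h; rewrite /kern2 /ker h mulr0.
move: h1 h2; rewrite !opprB mul0r add0r div1r /kbox /seg2 /= ; set h := n.+1%:R^-1 => /andP[h1 h2] /andP[h3 h4].
by split; apply/andP; split; lra.
Qed.

Lemma smooth1_flip (p : R -> R) (c : R) : smooth1 p -> smooth1 (fun t => p (c - t)).
Proof.
move=> sp; have := @smooth1_comp _ p (fun t => -1 * t + c) sp (smooth1_affine (-1) c).
by under eq_fun do rewrite mulN1r addrC.
Qed.

Lemma kern2_smooth_r k n x : smooth (kern2 k n x).
Proof.
by apply: smoothM; [apply: (@smooth_fst _ (fun t => kern 0 n (x.1 - t)))|apply: (@smooth_snd _ (fun t => kern k n (x.2 - t)))];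
  apply: smooth1_flip; exact: kern_smooth.
Qed.

Lemma derive1_flip (p : R -> R) (c t : R) : smooth1 p -> derive1 (fun t => p (c - t)) t = - derive1 p (c - t).
Proof.
move=> sp; have := @derive1_affine_comp _ p (-1) c t sp; rewrite !mulN1r [- t + c]addrC => <-.
by congr (derive1 _ t); apply/funext => s; rewrite mulN1r addrC.
Qed.

Lemma D1_kern2 k n x z : 'D_e1 (kern2 k n x) z = - ker (derive1 (kern 0 n)) (kern k n) x z.
Proof.
have s1 := smooth1_flip x.1 (kern_smooth (0 : R) n); have s2 := smooth1_flip x.2 (kern_smooth k n).
rewrite [LHS](D1_mul z (smooth_fst s1) (smooth_snd s2)) (D1_snd (fun t => kern k n (x.2 - t))) mulr0 add0r (@D1_fst _ (fun t => kern 0 n (x.1 - t)) z s1) derive1_flip; last exact: kern_smooth.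
by rewrite mulrN mulrC.
Qed.

Lemma D2_kern2 k n x z : 'D_e2 (kern2 k n x) z = - ker (kern 0 n) (derive1 (kern k n)) x z.
Proof.
have s1 := smooth1_flip x.1 (kern_smooth (0 : R) n); have s2 := smooth1_flip x.2 (kern_smooth k n).
rewrite [LHS](D2_mul z (smooth_fst s1) (smooth_snd s2)) (D2_fst (fun t => kern 0 n (x.1 - t))) mulr0 addr0 (@D2_snd _ (fun t => kern k n (x.2 - t)) z s2) derive1_flip; last exact: kern_smooth.
by rewrite mulrN.
Qed.

Lemma kern2_test D k n x : kbox k n x `<=` D -> test_function D (kern2 k n x).
Proof.
move=> KD; split; first exact: kern2_smooth_r.
by exists (kbox k n x); split => //; [exact: seg2_compact|move=> z; exact: kern2_off].
Qed.

Definition ae_eq2 D v w := mu.-negligible [set x | D x /\ v x <> w x].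

Lemma ae_eq2S D D' v w : D' `<=` D -> ae_eq2 D v w -> ae_eq2 D' v w.
Proof. by move=> D'D; apply: negligibleS => x [D'x h]; split => //; exact: D'D. Qed.

(** For n >= k and a point of the smaller box, the mollifier samples inside the larger box, so it is
    a test function and the mollification of [g] vanishes there. Its L^1 limit is [g]. The larger
    box extends further only to the right and above because the samples lie there. *)
Lemma du_bois_reymond_box D g (c : R * R) (k : nat) :  measurable D -> loc_integrable D g ->
  (forall phi, test_function D phi -> \int[mu]_(x in D) (g x * phi x) = 0) ->
  seg2 (c.1 - 1 / k.+1%:R) (c.1 + 2 / k.+1%:R) (c.2 - 1 / k.+1%:R) (c.2 + 2 / k.+1%:R) `<=` D ->
  ae_eq2 (seg2 (c.1 - 1 / k.+1%:R) (c.1 + 1 / k.+1%:R) (c.2 - 1 / k.+1%:R) (c.2 + 1 / k.+1%:R)) g (fun=> 0).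
Proof.
move=> mD [mg lg] Hg; set B2 := seg2 _ _ _ _; set B1 := seg2 _ _ _ _ => B2D.
have k0 : 0 < k.+1%:R^-1 :> R by [].
have mB2 : measurable B2 by exact: seg2_measurable.
have mB1 : measurable B1 by exact: seg2_measurable.
have B12 : B1 `<=` B2 by move: k0; rewrite /B1 /B2 /seg2; set h := k.+1%:R^-1 => k0 z /= [/andP[? ?] /andP[? ?]]; split; apply/andP; split => //; lra.
have ib : intg (g \_ B2).
  have := lg B2 (@seg2_compact _ _ _ _) B2D; move/(@integrable_mkcond _ _ _ mu B2 (EFin \o g) mB2).
  by rewrite /intg restrict_EFin.
have [m m0 B2m] := compact_sq (@seg2_compact (c.1 - 1 / k.+1%:R) (c.1 + 2 / k.+1%:R) (c.2 - 1 / k.+1%:R) (c.2 + 2 / k.+1%:R)).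
have b0 x : ~ hbox (- (m + 1)) (m + 1) (- (m + 1)) (m + 1) x -> (g \_ B2) x = 0.
  by move=> nx; rewrite patchE ifN //; apply/negP => /set_mem/B2m/sq_hbox.
have [_ md] := mollL1_box_supp (lexx 0) ib b0.
have mz n x : (k <= n)%N -> B1 x -> moll 0 n (g \_ B2) x = 0.
  move=> kn B1x; rewrite /moll /conv /pair_with.
  have nk : n.+1%:R^-1 <= k.+1%:R^-1 :> R by rewrite lef_pV2 ?posrE // ler_nat.
  have KB2 : kbox 0 n x `<=` B2.
    move: k0 nk B1x; rewrite /B1 /B2 /kbox /seg2 /=; set h := k.+1%:R^-1; set h' := n.+1%:R^-1.
    move=> k0 nk [/andP[? ?] /andP[? ?]] z [/= /andP[? ?] /andP[? ?]].
    by split; apply/andP; split; lra.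
  transitivity (\int[mu]_(z in B2) (g z * kern2 0 n x z)).
    rewrite (@Rint_supp _ setT B2) //; first by apply: Rint_eq => z Bz; rewrite patchE mem_set.
    by move=> z _ nB; rewrite patchE ifN ?mul0r //; apply/negP => /set_mem.
  rewrite -[RHS](Hg _ (@kern2_test D 0 n x (subset_trans KB2 B2D))).
  by apply/esym; apply: Rint_supp => // z _ nB; rewrite kern2_off ?mulr0 // => /KB2.
have mgB1 : measurable_fun B1 g by apply: measurable_funS mg => //; exact: subset_trans B2D.
have z1 : (\int[mu]_(x in B1) (`|g x|)%:E <= 0)%E.
  apply/lee_addgt0Pr => e e0; rewrite add0e.
  have /tends0P/(_ e e0)[|N _ hN] := md.
    by move=> n; apply: intE_ge0 => x _; exact: normr_ge0.
  apply: le_trans (hN (maxn N k) (leq_maxl _ _)).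
  rewrite /mdist /N1.
  have mm := mdist_meas (lexx 0) (maxn N k) ib.
  apply: (@le_trans _ _ (\int[mu]_(x in B1) (`|moll 0 (maxn N k) (g \_ B2) x - (g \_ B2) x|)%:E)%E).
    apply: le_intE => //; first exact: measurableT_comp.
      by apply: measurableT_comp => //; exact: measurable_funS mm.
    by move=> x B1x; rewrite mz ?leq_maxr // sub0r normrN patchE mem_set //; exact: B12.
  apply: le_int_sub => //; first exact: measurableT_comp.
have : (\int[mu]_(x in B1) `|(EFin \o g) x| = 0)%E.
  by apply/eqP; rewrite eq_le; apply/andP; split; [exact: z1|apply: integral_ge0 => x _; rewrite lee_fin normr_ge0].
move/(@ae_eq_integral_abs _ _ _ mu B1 mB1 (EFin \o g)) => -[|N [mN N0 hN]]; first exact/measurable_EFinP.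
exists N; split => // x [B1x gx]; apply: hN => /= h; apply: gx; have := h B1x; by case.
Qed.

(** An open set is covered by countably many boxes with rational centres to which the local
    statement applies; null sets are stable under countable unions. *)
Lemma du_bois_reymond D g : open D -> loc_integrable D g ->
  (forall phi, test_function D phi -> \int[mu]_(x in D) (g x * phi x) = 0) -> ae_eq2 D g (fun=> 0).
Proof.
move=> oD lg Hg; have mD : measurable D by exact: open_measurable2.
pose B (c : R * R) (k : nat) (t : R) := seg2 (c.1 - 1 / k.+1%:R) (c.1 + t / k.+1%:R) (c.2 - 1 / k.+1%:R) (c.2 + t / k.+1%:R).
pose pt (q : rat * rat) : R * R := (ratr q.1, ratr q.2).
pose F n := [set x | exists q, [/\ @unpickle (rat * rat * nat)%type n = Some q, B (pt q.1) q.2 2 `<=` D, B (pt q.1) q.2 1 x & g x <> 0]].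
have : mu.-negligible (\bigcup_n F n).
  apply: negligible_bigcup => n; case E : (@unpickle (rat * rat * nat)%type n) => [q|]; last first.
    by apply: negligibleS (negligible_set0 _) => x [q []]; rewrite E.
  have [BD|nBD] := pselect (B (pt q.1) q.2 2 `<=` D); last first.
    by apply: negligibleS (negligible_set0 _) => x [q' []]; rewrite E => -[<-].
  by apply: negligibleS (du_bois_reymond_box mD lg Hg BD) => x [q' []]; rewrite E => -[<-].
apply: negligibleS => x [Dx gx].
have [r r0 xr] : exists2 r, 0 < r & obox x r `<=` D.
  by apply: nbhs_obox; exact: open_nbhs_nbhs.
have [k _ hk] : \forall k \near \oo, (4 : R) / k.+1%:R <= r.
  have := near_inv_le 3 r0; rewrite (_ : 3 + 1 = 4 :> R) //; lra.
have {}hk := hk k (leqnn k).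
have k0 : 0 < k.+1%:R^-1 :> R by [].
have rq (t : R) : exists q : rat, t - k.+1%:R^-1 < ratr q < t + k.+1%:R^-1.
  have [|q] := @rat_in_itvoo _ (t - k.+1%:R^-1) (t + k.+1%:R^-1); first by rewrite ltrD2l gtrN.
  by rewrite in_itv /= => h; exists q.
have [q1 h1] := rq x.1; have [q2 h2] := rq x.2.
exists (pickle ((q1, q2), k)) => //; exists ((q1, q2), k); rewrite pickleK /B /pt /=.
move: k0 hk h1 h2; rewrite /seg2 /=; set h := k.+1%:R^-1 => k0 hk /andP[? ?] /andP[? ?]; split => //; last first.
  by split; apply/andP; split; lra.
move=> z [/= /andP[? ?] /andP[? ?]]; apply: xr; rewrite /obox /= !ltr_norml.
by split; apply/andP; split; lra.
Qed.

Lemma weak_grad_unique D v G H : open D -> weak_grad D v G -> weak_grad D v H ->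
  ae_eq2 D (fun x => (G x).1) (fun x => (H x).1) /\ ae_eq2 D (fun x => (G x).2) (fun x => (H x).2).
Proof.
move=> oD wG wH; have mD : measurable D by exact: open_measurable2.
have [_ l1 l2 HG] := wG; have [_ k1 k2 HH] := wH.
have st (g h : R * R -> R) : loc_integrable D g -> loc_integrable D h ->
    (forall phi, test_function D phi -> \int[mu]_(x in D) (g x * phi x) = \int[mu]_(x in D) (h x * phi x)) ->
    ae_eq2 D g h.
  move=> lg lh E; have lgh : loc_integrable D (fun x => g x - h x).
    have := loc_integrableD mD lg (loc_integrableZ (-1) mD lh).
    by under eq_fun do rewrite mulN1r.
  have := du_bois_reymond oD lgh.
  suff K phi : test_function D phi -> \int[mu]_(x in D) ((g x - h x) * phi x) = 0.
    by move=> /(_ K); apply: negligibleS => x [Dx gx]; split => //= /eqP; rewrite subr_eq0 => /eqP.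
  move=> tphi; rewrite (@Rint_eq _ D _ (fun x => g x * phi x - h x * phi x)); last by move=> x _; rewrite mulrBl.
  by rewrite RintB // ?E ?subrr //; exact: test_pair_integrable.
split; apply: st => // phi tphi; have [E1 E2] := HG _ tphi; have [F1 F2] := HH _ tphi; apply: oppr_inj.
  by rewrite -E1 -F1.
by rewrite -E2 -F2.
Qed.

Lemma ae_eq2_ae D v w : ae_eq2 D v w -> ae_eq mu D (EFin \o v) (EFin \o w).
Proof.
move=> [N [mN N0 hN]]; exists N; split => // x /= h; apply: hN; split.
  by apply: contrapT => nD; apply: h.
by move=> E; apply: h => _; rewrite E.
Qed.

Lemma ae_intE D v w : measurable D -> measurable_fun D v -> measurable_fun D w -> ae_eq2 D v w ->
  (\int[mu]_(x in D) (v x)%:E = \int[mu]_(x in D) (w x)%:E)%E.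
Proof.
move=> mD mv mw /ae_eq2_ae; apply: ae_eq_integral => //; exact/measurable_EFinP.
Qed.

Lemma ae_eq2_op (op : R -> R -> R) D v v' w w' : ae_eq2 D v v' -> ae_eq2 D w w' ->
  ae_eq2 D (fun x => op (v x) (w x)) (fun x => op (v' x) (w' x)).
Proof.
move=> h1 h2; apply: negligibleS (negligibleU h1 h2) => x [Dx nE].
have [E|n1] := pselect (v x = v' x); last by left.
by right; split => // E'; apply: nE; rewrite E E'.
Qed.

Lemma ae_refl D v : ae_eq2 D v v.
Proof. by apply: negligibleS (negligible_set0 _) => x [_]. Qed.

Definition E1 D v G : \bar R := (\int[mu]_(x in D) (v x ^+ 2 + dot (G x) (G x))%:E)%E.

(** All weak gradients agree almost everywhere, so the infimum defining [H1norm] is over a single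
    value, computed with any of them. *)
Lemma H1normE D v G : open D -> weak_grad D v G -> H1norm D v = (E1 D v G `^ 2^-1)%E.
Proof.
move=> oD wG; have mD : measurable D by exact: open_measurable2.
rewrite /H1norm (_ : [set _ | _ in _] = [set (E1 D v G `^ 2^-1)%E]) ?ereal_inf1 //.
apply/seteqP; split => [_ [H wH <-]|_ ->]; last by exists G.
congr (_ `^ _)%E; have [a1 a2] := weak_grad_unique oD wH wG.
have [[mv _] [mH1 _] [mH2 _] _] := wH; have [_ [mG1 _] [mG2 _] _] := wG.
have md (K : R * R -> R * R) : measurable_fun D (fun x => (K x).1) -> measurable_fun D (fun x => (K x).2) ->
    measurable_fun D (fun x => v x ^+ 2 + dot (K x) (K x)).
  move=> m1 m2; apply: measurable_funD; first exact: sqr_meas.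
  by apply: measurable_funD; exact: measurable_funM.
apply: ae_intE; [by []|exact: md|exact: md|].
apply: (@ae_eq2_op +%R); first exact: ae_refl.
by apply: (@ae_eq2_op +%R); exact: (@ae_eq2_op *%R).
Qed.

Lemma E1_E D v G : measurable D -> weak_grad D v G ->
  (E1 D v G = \int[mu]_(x in D) (v x ^+ 2)%:E + (\int[mu]_(x in D) ((G x).1 ^+ 2)%:E + \int[mu]_(x in D) ((G x).2 ^+ 2)%:E))%E.
Proof.
move=> mD [[mv _] [m1 _] [m2 _] _].
have mv2 := sqr_meas mv; have m12 := sqr_meas m1; have m22 := sqr_meas m2.
rewrite /E1 [LHS](_ : _ = \int[mu]_(x in D) (v x ^+ 2 + ((G x).1 ^+ 2 + (G x).2 ^+ 2))%:E)%E; last first.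
  by apply: eq_integral => x _; rewrite /dot -!expr2.
rewrite (@intDE _ _ _ mu D mD (fun x => v x ^+ 2)) //; first rewrite (@intDE _ _ _ mu D mD (fun x => (G x).1 ^+ 2)) //.
- by move=> x _; exact: sqr_ge0.
- by move=> x _; exact: sqr_ge0.
- exact: measurable_funD.
- by move=> x _; exact: sqr_ge0.
- by move=> x _; rewrite addr_ge0 ?sqr_ge0.
Qed.

Lemma E1_L2 D v G : measurable D -> weak_grad D v G ->
  (E1 D v G < +oo)%E <-> [/\ L2 mu D v, L2 mu D (fun x => (G x).1) & L2 mu D (fun x => (G x).2)].
Proof.
move=> mD wG; have [[mv _] [m1 _] [m2 _] _] := wG; rewrite E1_E //.
have p0 (w : R * R -> R) : (0 <= \int[mu]_(x in D) (w x ^+ 2)%:E)%E by apply: intE_ge0 => x _; exact: sqr_ge0.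
split=> [h|[[_ h0] [_ h1] [_ h2]]]; last by apply: lte_add_pinfty => //; exact: lte_add_pinfty.
split; split => //.
- by apply: le_lt_trans h; rewrite leeDl // adde_ge0.
- by apply: le_lt_trans h; rewrite -[leLHS]add0e leeD // leeDl.
- by apply: le_lt_trans h; rewrite -[leLHS]add0e leeD // leeDr.
Qed.

Lemma half_leE (x : \bar R) (e : R) : (0 <= x)%E -> 0 <= e -> (x `^ 2^-1 <= e%:E)%E = (x <= (e ^+ 2)%:E)%E.
Proof.
case: x => [r| |] //= r0 e0.
- rewrite !lee_fin in r0 *; by rewrite powR12_sqrt // -{1}(ger0_norm e0) -sqrtr_sqr ler_sqrt // sqr_ge0.
- by rewrite ifN ?invr_eq0 ?pnatr_eq0.
Qed.

Lemma half_tends0 (u : nat -> \bar R) : (forall n, 0 <= u n)%E ->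
  (fun n => u n `^ 2^-1)%E @ \oo --> 0%E <-> u @ \oo --> 0%E.
Proof.
move=> u0; have v0 n : (0 <= u n `^ 2^-1)%E by exact: poweR_ge0.
split=> [/(tends0P v0) h|/(tends0P u0) h]; apply/tends0P => // e e0.
  have := h (Num.sqrt e); rewrite sqrtr_gt0 => /(_ e0); apply: filterS => n.
  by rewrite half_leE ?sqrtr_ge0 // sqr_sqrtr // ltW.
have := h (e ^+ 2); rewrite exprn_gt0 // => /(_ isT); apply: filterS => n.
by rewrite half_leE // ltW.
Qed.

End Unique.

(** * Traces *)

Section Trace.
Variable R : realType.
Local Notation mu := (area R).
Local Notation leb := (@lebesgue_measure R).
Implicit Types (l : R) (v w g F : R * R -> R) (G H : R * R -> R * R) (D K : set (R * R)) (phi : nat -> R * R -> R) (h b : R -> R).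

Lemma continuous_L2 F D (m : R) : continuous F -> measurable D -> D `<=` sq m -> L2 mu D F.
Proof.
move=> cF mD Dm; split; first exact: continuous_measurable_funS2.
have c2 : continuous (fun x => F x ^+ 2) by move=> x; apply: cvgM; exact: cF.
have := continuous_integrable c2 mD Dm; move=> /integrableP[_].
rewrite (_ : (\int[mu]_(x in D) _)%E = (\int[mu]_(x in D) (F x ^+ 2)%:E)%E) //.
by apply: eq_integral => x _; rewrite /= ger0_norm // sqr_ge0.
Qed.

(** The H^1 convergence of [has_trace] split into three L^2 convergences relative to a fixed weak
    gradient; in this form sums, products with smooth functions and changes of variables act
    termwise. *)
Definition apx D v G phi := [/\ forall n, smooth (phi n), cvgL2 mu D phi v,
  cvgL2 mu D (fun n => 'D_e1 (phi n)) (fun x => (G x).1) & cvgL2 mu D (fun n => 'D_e2 (phi n)) (fun x => (G x).2)].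

Definition tr_cvg (l : R) h phi b :=
  (\int[leb]_(t in `]0%R, l[) ((phi n (t, h t) - b t) ^+ 2)%:E)%E @[n --> \oo] --> 0%E.

Lemma has_trace_apx D l h v b G (m : R) : open D -> D `<=` sq m -> weak_grad D v G -> has_trace D l h v b ->
  exists2 phi, apx D v G phi & tr_cvg l h phi b.
Proof.
move=> oD Dm wG [mb [phi [sphi c tr]]]; exists phi => //.
have mD : measurable D by exact: open_measurable2.
have wn n := weak_gradB mD (weak_grad_smooth mD (sphi n)) wG.
have E0 n : (0 <= E1 D (fun x => phi n x - v x)%R (fun x => ((grad (phi n) x).1 - (G x).1, (grad (phi n) x).2 - (G x).2)%R))%E.
  by apply: integral_ge0 => x _; rewrite lee_fin addr_ge0 ?sqr_ge0 // /dot -!expr2 addr_ge0 ?sqr_ge0.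
have {}c : (fun n => E1 D (fun x => phi n x - v x)%R (fun x => ((grad (phi n) x).1 - (G x).1, (grad (phi n) x).2 - (G x).2)%R)) @ \oo --> 0%E.
  by apply/half_tends0 => //; under eq_fun do rewrite -H1normE //.
have cs n : continuous (phi n) by exact: smooth_continuous.
have c1 n : continuous ('D_e1 (phi n)) by exact: smooth_continuous (D1_smooth _).
have c2 n : continuous ('D_e2 (phi n)) by exact: smooth_continuous (D2_smooth _).
have ls n := continuous_L2 (cs n) mD Dm; have l1 n := continuous_L2 (c1 n) mD Dm; have l2 n := continuous_L2 (c2 n) mD Dm.
(* Some approximant has error energy at most 1, and smooth functions are square integrable on the
   bounded set [D]; so [v] and [G] are square integrable as well. *)
have [lv [lg1 lg2]] : L2 mu D v /\ L2 mu D (fun x => (G x).1) /\ L2 mu D (fun x => (G x).2).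
  have /(tends0P E0)/(_ 1 ltr01)[N _ hN] := c.
  have /(E1_L2 mD (wn N))[a0 a1 a2] := le_lt_trans (hN N (leqnn N)) (ltry 1).
  split; first by have := A.L2B mD (ls N) a0; under eq_fun do rewrite subKr.
  split; first by have := A.L2B mD (l1 N) a1; under eq_fun do rewrite subKr.
  by have := A.L2B mD (l2 N) a2; under eq_fun do rewrite subKr.
have p0 (w : R * R -> R) : (0 <= \int[mu]_(x in D) (w x ^+ 2)%:E)%E by apply: intE_ge0 => x _; exact: sqr_ge0.
split; first exact: sphi.
- apply/(A.cvgL2_eqE mD ls lv); apply: (tends0_le _ _ c) => n; first exact: p0.
  by rewrite E1_E // leeDl // adde_ge0.
- apply/(A.cvgL2_eqE mD l1 lg1); apply: (tends0_le _ _ c) => n; first exact: p0.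
  by rewrite E1_E // -[leLHS]add0e leeD // leeDl.
- apply/(A.cvgL2_eqE mD l2 lg2); apply: (tends0_le _ _ c) => n; first exact: p0.
  by rewrite E1_E // -[leLHS]add0e leeD // leeDr.
Qed.

Lemma apx_has_trace D l h v b G phi : open D -> weak_grad D v G -> measurable_fun (`]0, l[%classic : set R) b ->
  apx D v G phi -> tr_cvg l h phi b -> has_trace D l h v b.
Proof.
move=> oD wG mb [sphi c0 c1 c2] tr; split => //; exists phi; split => //.
have mD : measurable D by exact: open_measurable2.
have wn n := weak_gradB mD (weak_grad_smooth mD (sphi n)) wG.
under eq_fun do rewrite (H1normE oD (wn _)).
have p0 (w : R * R -> R) : (0 <= \int[mu]_(x in D) (w x ^+ 2)%:E)%E by apply: intE_ge0 => x _; exact: sqr_ge0.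
apply/half_tends0 => [n|].
  by apply: integral_ge0 => x _; rewrite lee_fin addr_ge0 ?sqr_ge0 // /dot -!expr2 addr_ge0 ?sqr_ge0.
under eq_fun do rewrite E1_E //=.
have [ls lv _] := c0; have [l1 lg1 _] := c1; have [l2 lg2 _] := c2.
apply: tends0D => //; [by move=> n; rewrite adde_ge0|exact/(A.cvgL2_eqE mD ls lv)|].
by apply: tends0D => //; [exact/(A.cvgL2_eqE mD l1 lg1)|exact/(A.cvgL2_eqE mD l2 lg2)].
Qed.

Lemma apxS D D' v G phi : measurable D -> measurable D' -> D' `<=` D -> apx D v G phi -> apx D' v G phi.
Proof. by move=> mD mD' D'D [s c0 c1 c2]; split; [exact: s|exact: (A.cvgL2S mD mD' D'D)..]. Qed.

Lemma apxD D v w G H phi (psi : nat -> R * R -> R) : measurable D -> apx D v G phi -> apx D w H psi ->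
  apx D (fun x => v x + w x) (fun x => ((G x).1 + (H x).1, (G x).2 + (H x).2)) (fun n x => phi n x + psi n x).
Proof.
move=> mD [s c0 c1 c2] [t d0 d1 d2]; split.
- by move=> n; exact: smoothD.
- exact: A.cvgL2D.
- have := A.cvgL2D mD c1 d1; congr cvgL2; apply/funext => n; apply/funext => x; rewrite D1_add //.
- have := A.cvgL2D mD c2 d2; congr cvgL2; apply/funext => n; apply/funext => x; rewrite D2_add //.
Qed.

Lemma apx_cst D F (m : R) : measurable D -> D `<=` sq m -> smooth F -> apx D F (grad F) (fun=> F).
Proof.
move=> mD Dm sF; split => //; apply: cvgL2_cst => //; apply: (continuous_L2 _ mD Dm).
- exact: smooth_continuous.
- exact: smooth_continuous (D1_smooth _).
- exact: smooth_continuous (D2_smooth _).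
Qed.

Lemma apx_mul D F v G phi (m : R) : measurable D -> D `<=` sq m -> smooth F -> apx D v G phi ->
  apx D (fun x => F x * v x) (fun x => (F x * (G x).1 + v x * 'D_e1 F x, F x * (G x).2 + v x * 'D_e2 F x))
    (fun n x => F x * phi n x).
Proof.
move=> mD Dm sF [s c0 c1 c2].
have B (E : R * R -> R) : continuous E -> exists K : R, measurable_fun D E /\ forall x, D x -> `|E x| <= K.
  move=> cE; have [K K0 hK] := continuous_sq_bounded m cE.
  by exists K; split; [exact: continuous_measurable_funS2|move=> x Dx; apply: hK; exact: Dm].
have [K [mK hK]] := B F (smooth_continuous sF).
have [K1 [mK1 hK1]] := B _ (smooth_continuous (D1_smooth sF)).
have [K2 [mK2 hK2]] := B _ (smooth_continuous (D2_smooth sF)).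
split.
- by move=> n; exact: smoothM.
- exact: (A.cvgL2_bnd mD mK hK).
- have := A.cvgL2D mD (A.cvgL2_bnd mD mK hK c1) (A.cvgL2_bnd mD mK1 hK1 c0).
  congr cvgL2; first by apply/funext => n; apply/funext => x; rewrite D1_mul // [phi n x * _]mulrC.
  by apply/funext => x /=; rewrite [v x * _]mulrC.
- have := A.cvgL2D mD (A.cvgL2_bnd mD mK hK c2) (A.cvgL2_bnd mD mK2 hK2 c0).
  congr cvgL2; first by apply/funext => n; apply/funext => x; rewrite D2_mul // [phi n x * _]mulrC.
  by apply/funext => x /=; rewrite [v x * _]mulrC.
Qed.

Lemma apxZ D (c : R) v G phi : measurable D -> apx D v G phi ->
  apx D (fun x => c * v x) (fun x => (c * (G x).1, c * (G x).2)) (fun n x => c * phi n x).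
Proof.
move=> mD [s c0 c1 c2]; split.
- by move=> n; apply: smoothM => //; exact: smooth_cst.
- exact: A.cvgL2Z.
- have := A.cvgL2Z mD c c1; congr cvgL2; apply/funext => n; apply/funext => x.
  by rewrite D1_mul // ?D1_cst ?mulr0 ?addr0 //; exact: smooth_cst.
- have := A.cvgL2Z mD c c2; congr cvgL2; apply/funext => n; apply/funext => x.
  by rewrite D2_mul // ?D2_cst ?mulr0 ?addr0 //; exact: smooth_cst.
Qed.

End Trace.

(** * Weak gradients and L^2 convergence under affine maps *)

Section Affine.
Variable R : realType.
Local Notation mu := (area R).
Local Notation leb := (@lebesgue_measure R).
Implicit Types (v w g F : R * R -> R) (G H : R * R -> R * R) (D K : set (R * R)).
Variables (a b c d : R).
Hypotheses (a0 : a != 0) (c0 : c != 0).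
Local Notation T := (aff a b c d).
Let T' := aff a^-1 (- b / a) c^-1 (- d / c).

Lemma affK : cancel T T'.
Proof. by case=> x y; rewrite /T' /aff /=; congr pair; field. Qed.

Lemma affK' : cancel T' T.
Proof. by case=> x y; rewrite /T' /aff /=; congr pair; field. Qed.

Lemma aff_pre_measurable D : measurable D -> measurable (T @^-1` D).
Proof. by move=> mD; rewrite -[X in measurable X]setTI; exact: (@aff_measurable R a b c d measurableT D mD). Qed.

Lemma aff_pre_open D : open D -> open (T @^-1` D).
Proof. by move=> oD; apply: open_comp => // x _; exact: aff_continuous. Qed.

Lemma meas_aff D g : measurable D -> measurable_fun D g -> measurable_fun (T @^-1` D) (g \o T).
Proof.
move=> mD mg; apply: (measurable_comp mD) => //; first by move=> _ [x ? <-].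
by apply: measurable_funTS; exact: aff_measurable.
Qed.

Lemma int_affE D g : measurable D -> measurable_fun D g -> (forall x, 0 <= g x) ->
  (\int[mu]_(x in D) (g x)%:E = `|a * c|%:E * \int[mu]_(x in T @^-1` D) (g (T x))%:E)%E.
Proof.
move=> mD mg g0; rewrite integral_mkcond [in RHS]integral_mkcond (@ge0_int_affine2 _ a b c d) //; last first.
- by move=> x; rewrite patchE; case: ifP => // _; rewrite lee_fin.
- by apply/(measurable_restrictT _ mD)/measurable_EFinP.
Qed.

Lemma integrable_aff D g : measurable D -> mu.-integrable D (EFin \o g) -> mu.-integrable (T @^-1` D) (EFin \o (g \o T)).
Proof.
move=> mD /integrableP[/measurable_EFinP mg ig]; apply/integrableP; split.
  by apply/measurable_EFinP; exact: meas_aff.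
have ac : 0 < `|a * c| by rewrite normr_gt0 mulf_neq0.
have := @int_affE D (fun x => `|g x|) mD (measurableT_comp (@normr_measurable R setT) mg) (fun x => normr_ge0 _).
move=> E; move: ig; rewrite [ltLHS]E; rewrite lt_neqAle => /andP[h _].
rewrite ltey; apply: contra h => /eqP h; rewrite h gt0_muley ?lte_fin //.
Qed.

Lemma Rint_aff D g : measurable D -> mu.-integrable D (EFin \o g) ->
  \int[mu]_(x in D) g x = `|a * c| * \int[mu]_(x in T @^-1` D) g (T x).
Proof.
move=> mD ig; have := integrable_aff mD ig.
have /integrableP[/measurable_EFinP mg _] := ig => ig'.
have mT := aff_pre_measurable mD.
have mn : measurable_fun D (fun x => `|g x|) by exact: (measurableT_comp (@normr_measurable R setT) mg).
have ip : mu.-integrable D (EFin \o (fun x => `|g x|)) by exact: (integrable_abse ig).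
have ip' : mu.-integrable (T @^-1` D) (EFin \o (fun x => `|g (T x)|)) by exact: (integrable_abse ig').
have pos f : mu.-integrable D (EFin \o f) -> (forall x, 0 <= f x) ->
    \int[mu]_(x in D) f x = `|a * c| * \int[mu]_(x in T @^-1` D) f (T x).
  move=> fi f0; have /integrableP[/measurable_EFinP mf _] := fi.
  rewrite /Rintegral int_affE // fineM //.
  by have := @integrable_fin_num _ _ _ mu _ mT _ (integrable_aff mD fi).
have p1 : forall x, 0 <= `|g x| + g x by move=> x; rewrite -lerBlDr sub0r -normrN ler_norm.
have := pos _ (areaD mD ip ig) p1; rewrite (RintD mD ip ig) (RintD mT ip' ig') (pos _ ip (fun x => normr_ge0 _)).
by rewrite mulrDr => /addrI.
Qed.

Lemma loc_integrable_aff D v : measurable D -> loc_integrable D v -> loc_integrable (T @^-1` D) (v \o T).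
Proof.
move=> mD [mv lv]; split; first exact: meas_aff.
move=> K cK KD; have cTK : compact (T @` K).
  by apply: continuous_compact => //; apply: continuous_subspaceT; exact: aff_continuous.
have TKD : T @` K `<=` D by move=> _ [x Kx <-]; exact: KD.
have := integrable_aff (closed_measurable2 (compact_closed2 cTK)) (lv _ cTK TKD).
congr (mu.-integrable _ _); apply/seteqP; split => x; last by move=> Kx; exists x.
by move=> [y Ky /(can_inj affK) <-].
Qed.

Lemma weak_grad_aff D v G : open D -> weak_grad D v G ->
  weak_grad (T @^-1` D) (v \o T) (fun x => (a * (G (T x)).1, c * (G (T x)).2)).
Proof.
move=> oD [l0 l1 l2 H]; have mD : measurable D by exact: open_measurable2.
have mT := aff_pre_measurable mD.
split; first exact: loc_integrable_aff.
- exact: (loc_integrableZ a mT (loc_integrable_aff mD l1)).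
- exact: (loc_integrableZ c mT (loc_integrable_aff mD l2)).
move=> phi tphi; have [sphi [K [cK KD phi0]]] := tphi.
have tpsi : test_function D (phi \o T').
  split; first exact: smooth_aff.
  exists (T @` K); split.
  - by apply: continuous_compact => //; apply: continuous_subspaceT; exact: aff_continuous.
  - by move=> _ [x Kx <-]; exact: KD.
  - by move=> x nx; apply: phi0 => Kx; apply: nx; exists (T' x) => //; exact: affK'.
have [H1 H2] := H _ tpsi.
have ac : `|a * c| != 0 by rewrite normr_eq0 mulf_neq0.
have R1 w : loc_integrable D w -> forall psi, test_function D psi ->
    \int[mu]_(x in D) (w x * psi x) = `|a * c| * \int[mu]_(x in T @^-1` D) (w (T x) * psi (T x)).
  by move=> lw psi tps; rewrite -(@Rint_aff D (fun x => w x * psi x)) //; exact: test_pair_integrable.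
have Z w (s : R) : mu.-integrable (T @^-1` D) (EFin \o w) -> s * \int[mu]_(x in T @^-1` D) w x = \int[mu]_(x in T @^-1` D) (s * w x).
  by move=> iw; rewrite RintZ.
have tp w psi : loc_integrable D w -> test_function D psi ->
    mu.-integrable (T @^-1` D) (EFin \o (fun x => w (T x) * psi (T x))).
  by move=> lw tps; exact: (integrable_aff mD (test_pair_integrable mD lw tps)).
have TK x : aff a^-1 (- b / a) c^-1 (- d / c) (T x) = x by exact: affK.
split; apply: (mulfI ac).
- have -> : \int[mu]_(x in T @^-1` D) ((v \o T) x * 'D_e1 phi x) =
     a * \int[mu]_(x in T @^-1` D) (v (T x) * 'D_e1 (phi \o T') (T x)).
    rewrite Z; last exact: tp (test_D1 tpsi).
    by apply: Rint_eq => x _ /=; rewrite D1_aff // TK mulrCA mulVKf.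
  rewrite mulrCA -(R1 _ l0 _ (test_D1 tpsi)) H1 (R1 _ l1 _ tpsi) -!mulrN mulrCA; congr (_ * _).
  rewrite mulrN Z; last exact: (tp _ _ l1 tpsi).
  by congr (- _); apply: Rint_eq => x _ /=; rewrite /T' TK mulrA.
- have -> : \int[mu]_(x in T @^-1` D) ((v \o T) x * 'D_e2 phi x) =
     c * \int[mu]_(x in T @^-1` D) (v (T x) * 'D_e2 (phi \o T') (T x)).
    rewrite Z; last exact: tp (test_D2 tpsi).
    by apply: Rint_eq => x _ /=; rewrite D2_aff // TK mulrCA mulVKf.
  rewrite mulrCA -(R1 _ l0 _ (test_D2 tpsi)) H2 (R1 _ l2 _ tpsi) -!mulrN mulrCA; congr (_ * _).
  rewrite mulrN Z; last exact: (tp _ _ l2 tpsi).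
  by congr (- _); apply: Rint_eq => x _ /=; rewrite /T' TK mulrA.
Qed.

Lemma L2_aff D v : measurable D -> L2 mu D v -> L2 mu (T @^-1` D) (v \o T).
Proof.
move=> mD lv; have [mv _] := lv; split; first exact: meas_aff.
have := integrable_aff mD (L2_sqr lv); move=> /integrableP[_].
rewrite (_ : (\int[mu]_(x in T @^-1` D) _)%E = (\int[mu]_(x in T @^-1` D) ((v \o T) x ^+ 2)%:E)%E) //.
by apply: eq_integral => x _; rewrite /= ger0_norm // sqr_ge0.
Qed.

Lemma Q_aff D v : measurable D -> L2 mu D v -> Q mu D v = `|a * c| * Q mu (T @^-1` D) (v \o T).
Proof. by move=> mD lv; rewrite /Q (Rint_aff mD (L2_sqr lv)). Qed.

Lemma cvgL2_aff D (u : nat -> R * R -> R) v : measurable D -> cvgL2 mu D u v ->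
  cvgL2 mu (T @^-1` D) (fun n => u n \o T) (v \o T).
Proof.
move=> mD [lu lv cv]; split; [by move=> n; exact: L2_aff|exact: L2_aff|].
have ac : `|a * c| != 0 by rewrite normr_eq0 mulf_neq0.
rewrite -[X in _ --> X](mulr0 `|a * c|^-1).
rewrite (_ : (fun n => _) = (fun n => `|a * c|^-1 * Q mu D (fun x => u n x - v x))); first exact: cvgZr.
apply/funext => n; by rewrite (Q_aff mD (A.L2B mD (lu n) lv)) mulKf.
Qed.

Lemma apx_aff D v G (phi : nat -> R * R -> R) : measurable D -> apx D v G phi ->
  apx (T @^-1` D) (v \o T) (fun x => (a * (G (T x)).1, c * (G (T x)).2)) (fun n => phi n \o T).
Proof.
move=> mD [s h0 h1 h2]; have mT := aff_pre_measurable mD; split.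
- by move=> n; exact: smooth_aff.
- exact: cvgL2_aff.
- have := A.cvgL2Z mT a (cvgL2_aff mD h1); congr (cvgL2 _ _ _); apply/funext => n; apply/funext => x.
  by rewrite D1_aff.
- have := A.cvgL2Z mT c (cvgL2_aff mD h2); congr (cvgL2 _ _ _); apply/funext => n; apply/funext => x.
  by rewrite D2_aff.
Qed.

Lemma int_itv_aff (l1 l2 : R) (g : R -> R) : 0 < a -> measurable_fun setT g -> (forall t, 0 <= g t) ->
  (\int[leb]_(t in `](a * l1 + b)%R, (a * l2 + b)%R[) (g t)%:E = a%:E * \int[leb]_(t in `]l1, l2[) (g (a * t + b)%R)%:E)%E.
Proof.
move=> ap mg g0; rewrite integral_mkcond [in RHS]integral_mkcond (@ge0_int_affine1 _ a b) //; last first.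
- by move=> x; rewrite patchE; case: ifP => // _; rewrite lee_fin.
- by apply/(measurable_restrictT _ (measurable_itv _))/measurable_EFinP; exact: measurable_funS mg.
rewrite gtr0_norm //; congr (_ * _)%E; apply: eq_integral => x _; rewrite !patchE.
rewrite (_ : (a * x + b \in `](a * l1 + b), (a * l2 + b)[%classic) = (x \in `]l1, l2[%classic)) //.
by apply/idP/idP; rewrite !inE /= !in_itv /= !ltrD2r !ltr_pM2l.
Qed.

End Affine.

(** * Mollification above a graph; trace and Poincare inequalities *)

Section Window.
Variable R : realType.
Local Notation mu := (area R).
Local Notation leb := (@lebesgue_measure R).
Implicit Types (a b M m k : R) (n : nat) (x z : R * R) (v w g F : R * R -> R) (G H : R * R -> R * R) (D K W V : set (R * R)).

Lemma L2_integrable D v m : measurable D -> D `<=` sq m -> L2 mu D v -> mu.-integrable D (EFin \o v).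
Proof.
move=> mD Dm lv; have [mv _] := lv.
apply: (@area_le _ D v (fun x => v x ^+ 2 + 1)) => //.
- by move=> x _; rewrite ler_norml; have := sqr_ge0 (v x - 1); have := sqr_ge0 (v x + 1); nra.
- apply: areaD => //; first exact: (L2_sqr lv).
  by apply: (@continuous_integrable _ (fun=> 1) D m) => //; exact: cst_continuous.
Qed.

Lemma intg_restrict D v : measurable D -> mu.-integrable D (EFin \o v) -> intg (v \_ D).
Proof.
move=> mD; move/(@integrable_mkcond _ _ _ mu D (EFin \o v) mD); by rewrite /intg restrict_EFin.
Qed.

Lemma patch_out D v x : ~ D x -> (v \_ D) x = 0.
Proof. by move=> nD; rewrite patchE ifN //; apply/negP => /set_mem. Qed.

Lemma patch_in D v x : D x -> (v \_ D) x = v x.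
Proof. by move=> Dx; rewrite patchE mem_set. Qed.

Lemma N2_restrict D v : measurable D -> N2 (v \_ D) = (\int[mu]_(x in D) (v x ^+ 2)%:E)%E.
Proof.
move=> mD; rewrite /N2 [RHS]integral_mkcond; apply: eq_integral => x _; rewrite !patchE.
by case: ifP => // _; rewrite expr0n.
Qed.

(** If the support box of the kernel lies in [D], the kernel as a function of the integration
    variable is a test function, and the weak gradient moves the derivative from the kernel to
    [v]. *)
Lemma moll_window k n D v G x : 0 <= k -> measurable D -> weak_grad D v G -> intg (v \_ D) ->
  kbox k n x `<=` D ->
  'D_e1 (moll k n (v \_ D)) x = moll k n ((fun z => (G z).1) \_ D) x /\
  'D_e2 (moll k n (v \_ D)) x = moll k n ((fun z => (G z).2) \_ D) x.
Proof.
move=> k0 mD wG iv KD; have [_ _ _ H] := wG.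
have [H1 H2] := H _ (kern2_test KD).
have s0 := kern_smooth (0 : R) n; have sk := kern_smooth k n.
have c0 := kern_csupp n (lexx (0 : R)); have ck := kern_csupp n k0.
have E w (q : R * R -> R) : \int[mu]_z ((w \_ D) z * q z) = \int[mu]_(z in D) (w z * q z).
  rewrite (@Rint_supp _ setT D) //; first by apply: Rint_eq => z Dz; rewrite patch_in.
  by move=> z _ nD; rewrite patch_out ?mul0r.
have tp := kern2_test KD; have [l0 _ _ _] := wG.
have N (q' q : R * R -> R) : test_function D q -> (forall z, q z = - q' z) ->
    \int[mu]_(z in D) (v z * q' z) = - \int[mu]_(z in D) (v z * q z).
  move=> tq qq; rewrite -mulN1r -RintZ //; last exact: test_pair_integrable.
  by apply: Rint_eq => z _; rewrite qq mulrN mulN1r opprK.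
split.
  rewrite (@derive_val _ _ _ _ _ _ _ (conv_D1 iv x s0 c0 sk ck)) /conv /pair_with E (N _ _ (test_D1 tp) (D1_kern2 k n x)).
  by rewrite H1 opprK /moll /conv /pair_with E.
rewrite (@derive_val _ _ _ _ _ _ _ (conv_D2 iv x s0 c0 sk ck)) /conv /pair_with E (N _ _ (test_D2 tp) (D2_kern2 k n x)).
by rewrite H2 opprK /moll /conv /pair_with E.
Qed.

Lemma cvgL2_moll k D V v m : 0 <= k -> measurable D -> D `<=` sq m -> measurable V -> V `<=` D -> L2 mu D v ->
  cvgL2 mu V (fun n => moll k n (v \_ D)) v.
Proof.
move=> k0 mD Dm mV VD lv; have iv := L2_integrable mD Dm lv; have ib := intg_restrict mD iv.
have lm n : L2 mu V (moll k n (v \_ D)).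
  by apply: (continuous_L2 _ mV (subset_trans VD Dm)); apply: smooth_continuous; exact: moll_smooth.
have lvV : L2 mu V v by exact: (A.L2S mD mV VD lv).
apply/(A.cvgL2_eqE mV lm lvV).
have b0 x : ~ hbox (- (m + 1)) (m + 1) (- (m + 1)) (m + 1) x -> (v \_ D) x = 0.
  by move=> nx; rewrite patch_out // => /Dm/sq_hbox.
have n2 : (N2 (v \_ D) < +oo)%E by rewrite N2_restrict //; have [] := lv.
have c := moll_N2_cvg k0 ib b0 n2.
apply: (tends0_le _ _ c) => n; first by apply: intE_ge0 => x _; exact: sqr_ge0.
have md := mdist_meas k0 n ib.
rewrite (_ : (\int[mu]_(x in V) _)%E = (\int[mu]_(x in V) ((moll k n (v \_ D) x - (v \_ D) x) ^+ 2)%:E)%E); last first.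
  by apply: eq_integral => x /set_mem Vx; rewrite patch_in //; exact: VD.
apply: le_int_sub => //; first exact: sqr_meas.
by move=> x _; exact: sqr_ge0.
Qed.

(** Over the horizontal reach 1 / (n+1) the graph rises by at most kap / (n+1), less than the
    vertical shift (kap+1) / (n+1). Even from points on the graph the samples lie strictly above
    it. *)
Lemma kbox_window kap (h : R -> R) a b M b' M' : 0 <= kap -> (forall s t, `|h s - h t| <= kap * `|s - t|) ->
  b < b' -> M < M' -> exists n0, forall n, (n0 <= n)%N -> forall x, a <= x.1 <= b -> h x.1 <= x.2 <= M -> 
    kbox (kap + 1) n x `<=` [set z | a <= z.1 < b' /\ h z.1 < z.2 < M'].
Proof.
move=> k0 hl bb MM.
have e0 : 0 < Num.min (b' - b) (M' - M) / 2 by rewrite divr_gt0 // lt_min !subr_gt0 bb MM.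
have [n0 _ hn0] := near_inv_le (kap + 1) e0; exists n0 => n nn x /andP[x1 x1'] /andP[x2 x2'] z.
have := hn0 n nn; rewrite ler_pdivlMr // /kbox /seg2 /=.
have hh : 0 < n.+1%:R^-1 :> R by [].
move: hh; set t := n.+1%:R^-1 => hh e2 [/andP[z1 z1'] /andP[z2 z2']].
have [m1 m2] : Num.min (b' - b) (M' - M) <= b' - b /\ Num.min (b' - b) (M' - M) <= M' - M by rewrite !ge_min !lexx orbT.
have kt : 0 <= kap * t by rewrite mulr_ge0 // ltW.
have zx : `|z.1 - x.1| <= t by rewrite ger0_norm; lra.
have := hl z.1 x.1; have : kap * `|z.1 - x.1| <= kap * t by rewrite ler_wpM2l.
move=> q1 q2; have := le_trans q2 q1; rewrite ler_norml => /andP[q3 q4].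
by split; apply/andP; split; lra.
Qed.

(** Support boxes fit into [D] only from index [n0] on; the sequence is shifted by [n0] so that its
    gradient is the mollified weak gradient for every index. *)
Lemma apx_moll k D V v G m : 0 <= k -> measurable D -> D `<=` sq m -> measurable V -> V `<=` D ->
  weak_grad D v G -> L2 mu D v -> L2 mu D (fun x => (G x).1) -> L2 mu D (fun x => (G x).2) ->
  forall n0, (forall n, (n0 <= n)%N -> forall x, V x -> kbox k n x `<=` D) ->
  apx V v G (fun n => moll k (n + n0) (v \_ D)).
Proof.
move=> k0 mD Dm mV VD wG lv l1 l2 n0 hn0.
have ib := intg_restrict mD (L2_integrable mD Dm lv).
have sh (u : nat -> R * R -> R) w : cvgL2 mu V u w -> cvgL2 mu V (fun n => u (n + n0)%N) w.
  by move=> [lu lw c]; split => //; rewrite -(cvg_shiftn n0) in c.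
have eqV (u u' : nat -> R * R -> R) w : (forall n, L2 mu V (u' n)) -> (forall n x, V x -> u' n x = u n x) -> cvgL2 mu V u w -> cvgL2 mu V u' w.
  move=> lu' uu [lu lw c]; split; [exact: lu'|exact: lw|].
  rewrite (_ : (fun n => _) = (fun n => Q mu V (fun x => u n x - w x))) //.
  by apply/funext => n; apply: Rint_eq => x Vx; rewrite uu.
have sm n : smooth (moll k n (v \_ D)) by exact: moll_smooth.
split.
- by move=> n; exact: sm.
- exact: (sh _ _ (cvgL2_moll k0 mD Dm mV VD lv)).
- apply: (eqV _ _ _ _ _ (sh _ _ (cvgL2_moll k0 mD Dm mV VD l1))).
    by move=> n; apply: (continuous_L2 _ mV (subset_trans VD Dm)); apply: smooth_continuous; exact: D1_smooth.
  by move=> n x Vx; exact: (proj1 (moll_window k0 mD wG ib (hn0 _ (leq_addl n n0) x Vx))).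
- apply: (eqV _ _ _ _ _ (sh _ _ (cvgL2_moll k0 mD Dm mV VD l2))).
    by move=> n; apply: (continuous_L2 _ mV (subset_trans VD Dm)); apply: smooth_continuous; exact: D2_smooth.
  by move=> n x Vx; exact: (proj2 (moll_window k0 mD wG ib (hn0 _ (leq_addl n n0) x Vx))).
Qed.

Lemma periodicE v (T : R) x : periodic v (T, 0) -> v (x.1 + T, x.2) = v x.
Proof. by move=> pv; case: x => s t; rewrite -[in RHS](pv (s, t)) /= -{1}[t]addr0. Qed.

Lemma moll_periodic k n D v (T : R) x : 0 <= k -> measurable D -> intg (v \_ D) -> periodic v (T, 0) ->
  kbox k n x `<=` D -> kbox k n (x.1 + T, x.2) `<=` D ->
  moll k n (v \_ D) (x.1 + T, x.2) = moll k n (v \_ D) x.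
Proof.
move=> k0 mD ib pv K1 K2; rewrite /moll /conv /pair_with.
have ii := bmeas_integrable ib (kern2_bmeas k0 n (x.1 + T, x.2)).
have := @Rint_aff R 1 T 1 0 (oner_neq0 _) (oner_neq0 _) setT _ measurableT ii.
rewrite mulr1 normr1 mul1r preimage_setT => ->.
apply: Rint_eq => z _; rewrite /aff /kern2 /ker /= !mul1r addr0.
have -> : x.1 + T - (z.1 + T) = x.1 - z.1 by ring.
have [Kz|nK] := pselect (kbox k n x z); last first.
  by rewrite -/(ker (kern 0 n) (kern k n) x z) -/(kern2 k n x z) (kern2_off nK) !mulr0.
rewrite !patch_in; [|exact: K1|].
  by rewrite (periodicE z pv).
apply: K2; move: Kz; rewrite /kbox /seg2 /=; set t := n.+1%:R^-1 => -[/andP[? ?] ?]; split => //.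
by apply/andP; split; lra.
Qed.

(* Integrating the derivative of [g(x2) phi^2]: different weights [g] give the trace and
   Poincare inequalities below. *)
Lemma strip_parts a b (h : R -> R) M m (g : R -> R) F : continuous h -> (forall t, m <= h t) ->
  (forall t, a < t < b -> h t < M) -> smooth1 g -> smooth F ->
  \int[mu]_(x in strip a b h M) (derive1 g x.2 * F x ^+ 2 + 2 * g x.2 * F x * 'D_e2 F x) =
  \int[leb]_(t in `]a, b[) (g M * F (t, M) ^+ 2 - g (h t) * F (t, h t) ^+ 2).
Proof.
move=> ch hm hM sg sF.
have sG : smooth (fun x => g x.2 * (F x * F x)) by apply: smoothM; [exact: smooth_snd|exact: smoothM].
rewrite [RHS](_ : _ = \int[leb]_(t in `]a, b[) (g (t, M).2 * (F (t, M) * F (t, M)) - g (t, h t).2 * (F (t, h t) * F (t, h t)))); last first.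
  by apply: eq_Rintegral => t _; rewrite !expr2.
rewrite -(@strip_D2 _ (fun x => g x.2 * (F x * F x)) _ _ _ _ _ m ch hm hM (fun x => smooth_D2 x sG)); last first.
  exact/smooth_continuous/D2_smooth.
apply: Rint_eq => x _; rewrite (D2_mul x (smooth_snd sg) (smoothM sF sF)) D2_mul // D2_snd //; ring.
Qed.

(** Reduces each weighted inequality to a pointwise one, in which the mixed term is split between
    F^2 and the square of its vertical derivative. *)
Lemma strip_parts_ge a b (h : R -> R) M m (g : R -> R) F (p : R -> R) (C : R) : continuous h -> (forall t, m <= h t) ->
  (forall t, a < t < b -> h t < M) -> smooth1 g -> smooth F -> continuous p ->
  (forall x, strip a b h M x -> p x.2 * F x ^+ 2 - C * 'D_e2 F x ^+ 2 <= derive1 g x.2 * F x ^+ 2 + 2 * g x.2 * F x * 'D_e2 F x) ->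
  \int[mu]_(x in strip a b h M) (p x.2 * F x ^+ 2) - C * Q mu (strip a b h M) ('D_e2 F) <=
  \int[leb]_(t in `]a, b[) (g M * F (t, M) ^+ 2 - g (h t) * F (t, h t) ^+ 2).
Proof.
move=> ch hm hM sg sF cp ineq; rewrite -(strip_parts ch hm hM sg sF).
have mS : measurable (strip a b h M) by exact: strip_measurable.
have [r Sr] := @strip_sq _ a b h M m hm.
have c2 : continuous (fun x : R * R => x.2) by move=> x; exact: cvg_snd.
have cF := smooth_continuous sF; have cD := smooth_continuous (D2_smooth sF).
have cg : continuous (fun x : R * R => g x.2) by exact: (smooth_continuous (smooth_snd sg)).
have cg' : continuous (fun x : R * R => derive1 g x.2) by exact: (smooth_continuous (smooth_snd (smooth1_derive1 sg))).
have cp2 : continuous (fun x : R * R => p x.2) by move=> x; apply: continuous_comp; [exact: c2|exact: cp].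
have I1 : mu.-integrable (strip a b h M) (EFin \o (fun x => p x.2 * F x ^+ 2)).
  apply: (continuous_integrable _ mS Sr) => x; apply: cvgM; first exact: cp2.
  by apply: cvgM; exact: cF.
have I2 : mu.-integrable (strip a b h M) (EFin \o (fun x => 'D_e2 F x ^+ 2)).
  by apply: (continuous_integrable _ mS Sr) => x; apply: cvgM; exact: cD.
rewrite /Q -RintZ // -RintB //; last exact: areaZ.
apply: (A.Rint_le mS).
- by apply: areaB => //; exact: areaZ.
- apply: (continuous_integrable _ mS Sr) => x; apply: cvgD.
    by apply: cvgM; [exact: cg'|apply: cvgM; exact: cF].
  by apply: cvgM; [apply: cvgM; [apply: cvgM; [exact: cvg_cst|exact: cg]|exact: cF]|exact: cD].
- by move=> x Sx; exact: ineq.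
Qed.

Lemma continuous_itv_integrable (q : R -> R) a b : continuous q -> leb.-integrable `]a, b[ (EFin \o q).
Proof.
move=> cq; have ic : leb.-integrable `[a, b] (EFin \o q).
  by apply: continuous_compact_integrable; [exact: segment_compact|exact: continuous_subspaceT].
by apply: (integrableS _ _ _ ic) => //; apply: subset_itvW.
Qed.

Definition tr2 a b (h : R -> R) F : R := \int[leb]_(t in `]a, b[) (F (t, h t) ^+ 2).

Lemma graph_continuous (h : R -> R) F : continuous h -> continuous F -> continuous (fun t => F (t, h t)).
Proof.
move=> ch cF t; apply: (@continuous_comp _ _ _ (fun t : R => (t, h t)) F); last exact: cF.
exact: (cvg_pair cvg_id (ch t)).
Qed.

Lemma sqr_continuous (q : R -> R) : continuous q -> continuous (fun t => q t ^+ 2).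
Proof. by move=> cq t; apply: cvgM; exact: cq. Qed.

Lemma tr2_integrable a b (h : R -> R) F : continuous h -> continuous F ->
  leb.-integrable `]a, b[ (EFin \o (fun t => F (t, h t) ^+ 2)).
Proof.
by move=> ch cF; apply: continuous_itv_integrable; apply: sqr_continuous; exact: graph_continuous.
Qed.

Lemma tr2E a b (h : R -> R) F : continuous h -> continuous F ->
  (tr2 a b h F)%:E = (\int[leb]_(t in `]a, b[) (F (t, h t) ^+ 2)%:E)%E.
Proof.
move=> ch cF; rewrite /tr2 /Rintegral fineK //.
exact: (integrable_fin_num _ (tr2_integrable a b ch cF)).
Qed.

Lemma bdry_le a b (q : R -> R) (h : R -> R) F (C : R) : continuous q -> continuous h -> continuous F ->
  (forall t, a < t < b -> q t <= C * F (t, h t) ^+ 2) ->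
  \int[leb]_(t in `]a, b[) q t <= C * tr2 a b h F.
Proof.
move=> cq ch cF qC; have it := tr2_integrable a b ch cF; rewrite /tr2 -RintegralZl //.
apply: le_Rintegral => //.
- exact: continuous_itv_integrable.
- by have := @integrableZl _ _ _ leb _ (measurable_itv _) C _ it.
Qed.

Section Ineq.
Variables (a b m : R) (h : R -> R).
Hypotheses (ch : continuous h) (hm : forall t, m <= h t).

Lemma cst_p (c : R) M F : continuous F -> 
  \int[mu]_(x in strip a b h M) ((fun=> c) x.2 * F x ^+ 2) = c * Q mu (strip a b h M) F.
Proof.
move=> cF; have mS : measurable (strip a b h M) by exact: strip_measurable.
have [r Sr] := @strip_sq _ a b h M m hm.
by rewrite /Q RintZ //; apply: (continuous_integrable _ mS Sr) => x; apply: cvgM; exact: cF.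
Qed.

(** The weight x2 - M vanishes at the top, so only the trace on the graph remains. Completing a
    square keeps half of F^2, whence the factor 4. *)
Lemma poincare_bottom M F : (forall t, a < t < b -> h t < M) -> smooth F ->
  Q mu (strip a b h M) F <= 4 * (M - m) ^+ 2 * Q mu (strip a b h M) ('D_e2 F) + 2 * (M - m) * tr2 a b h F.
Proof.
move=> hM sF; have cF := smooth_continuous sF.
have sg : smooth1 (fun s : R => 1 * s + (- M)) by exact: smooth1_affine.
have g' (s : R) : derive1 (fun s : R => 1 * s + (- M)) s = 1.
  by rewrite derive1E; apply: derive_val; exact: is_derive_affine.
have := @strip_parts_ge a b h M m _ F (fun=> 2^-1) (2 * (M - m) ^+ 2) ch hm hM sg sF (@cst_continuous _ _ _).
move=> /(_ _)/wrap[x Sx|].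
  rewrite g' mul1r /=; case: Sx => x1 /andP[x2 x3]; have := hm x.1 => mh.
  have y1 : 0 <= x.2 - m by lra.
  have y2 : 0 <= M - x.2 by lra.
  have := sqr_ge0 (2^-1 * F x + (x.2 - M) * 'D_e2 F x) => sq1.
  have : (x.2 - M) ^+ 2 <= (M - m) ^+ 2 by rewrite -sqrrN opprB lerXn2r ?nnegrE; lra.
  have := sqr_ge0 ('D_e2 F x); nra.
rewrite cst_p // mul1r => H.
have : \int[leb]_(t in `]a, b[) ((M - M) * F (t, M) ^+ 2 - (1 * h t - M) * F (t, h t) ^+ 2) <= (M - m) * tr2 a b h F.
  apply: bdry_le => //.
    move=> t; apply: cvgB.
      by apply: cvgM; [exact: cvg_cst|apply: sqr_continuous; apply: (graph_continuous (@cst_continuous _ _ M) cF)].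
    apply: cvgM; last by apply: sqr_continuous; exact: graph_continuous.
    by apply: cvgB; [apply: cvgM; [exact: cvg_cst|exact: ch]|exact: cvg_cst].
  move=> t tab; rewrite subrr mul0r sub0r -mulNr mul1r opprB ler_wpM2r ?sqr_ge0 //.
  by have := hm t; lra.
lra.
Qed.

(** The weight x2 - m is nonnegative on the graph, where its boundary term has the favourable sign;
    only the trace at the top remains. *)
Lemma poincare_top M F : (forall t, a < t < b -> h t < M) -> smooth F ->
  Q mu (strip a b h M) F <= 4 * (M - m) ^+ 2 * Q mu (strip a b h M) ('D_e2 F) + 2 * (M - m) * tr2 a b (fun=> M) F.
Proof.
move=> hM sF; have cF := smooth_continuous sF.
have sg : smooth1 (fun s : R => 1 * s + (- m)) by exact: smooth1_affine.
have g' (s : R) : derive1 (fun s : R => 1 * s + (- m)) s = 1.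
  by rewrite derive1E; apply: derive_val; exact: is_derive_affine.
have := @strip_parts_ge a b h M m _ F (fun=> 2^-1) (2 * (M - m) ^+ 2) ch hm hM sg sF (@cst_continuous _ _ _).
move=> /(_ _)/wrap[x Sx|].
  rewrite g' mul1r /=; case: Sx => x1 /andP[x2 x3]; have := hm x.1 => mh.
  have y1 : 0 <= x.2 - m by lra.
  have y2 : 0 <= M - x.2 by lra.
  have := sqr_ge0 (2^-1 * F x + (x.2 - m) * 'D_e2 F x) => sq1.
  have : (x.2 - m) ^+ 2 <= (M - m) ^+ 2 by rewrite lerXn2r ?nnegrE; lra.
  have := sqr_ge0 ('D_e2 F x); nra.
rewrite cst_p // mul1r => H.
have : \int[leb]_(t in `]a, b[) ((M - m) * F (t, M) ^+ 2 - (1 * h t - m) * F (t, h t) ^+ 2) <= (M - m) * tr2 a b (fun=> M) F.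
  apply: bdry_le => //.
    move=> t; apply: cvgB.
      by apply: cvgM; [exact: cvg_cst|apply: sqr_continuous; apply: (graph_continuous (@cst_continuous _ _ M) cF)].
    apply: cvgM; last by apply: sqr_continuous; exact: graph_continuous.
    by apply: cvgB; [apply: cvgM; [exact: cvg_cst|exact: ch]|exact: cvg_cst].
    exact: cst_continuous.
  move=> t tab; rewrite lerBlDr lerDl mulr_ge0 ?sqr_ge0 // mul1r subr_ge0; exact: hm.
lra.
Qed.

Definition low (d s : R) : R := 1 - step (d^-1 * s + 1).

Lemma low_smooth d : smooth1 (low d).
Proof.
apply: smooth1B; first exact: smooth1_cst.
by apply: (@smooth1_comp _ (@step R)); [exact: step_smooth|exact: smooth1_affine].
Qed.

Lemma derive1_low d s : derive1 (low d) s = - (d^-1 * dstep (d^-1 * s + 1)).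
Proof.
rewrite derive1E; apply: derive_val.
have hs : is_derive s 1 (fun s => step (d^-1 * s + 1)) (d^-1 * dstep (d^-1 * s + 1)).
  have := @derive1_affine_comp _ (@step R) d^-1 1 s (@step_smooth R); rewrite -/(@dstep R) => <-.
  apply: smooth1_derive; apply: (@smooth1_comp _ (@step R)); [exact: step_smooth|exact: smooth1_affine].
by rewrite -sub0r; apply: is_deriveB.
Qed.

Lemma low1 d s : 0 < d -> s <= - d -> low d s = 1.
Proof. by move=> d0 sd; rewrite /low step_le0 ?subr0 // mulrC -lerBrDr sub0r ler_pdivrMr // mulN1r. Qed.

Lemma low0 d s : 0 < d -> 0 <= s -> low d s = 0.
Proof. by move=> d0 s0; rewrite /low step_ge1 ?subrr // lerDr mulr_ge0 // invr_ge0 ltW. Qed.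

Lemma low_ge0 d s : 0 <= low d s. Proof. by rewrite subr_ge0 step_le1. Qed.
Lemma low_le1 d s : low d s <= 1. Proof. by rewrite lerBlDr lerDl step_ge0. Qed.

Lemma low_bound d : 0 < d -> exists2 C : R, 0 < C & forall s, `|derive1 (low d) s| <= C.
Proof.
move=> d0; have [K K0 hK] := @dstep_bounded R; exists (d^-1 * K); first by rewrite mulr_gt0 // invr_gt0.
move=> s; rewrite derive1_low normrN ger0_norm; first by rewrite ler_pM2l ?invr_gt0.
by rewrite mulr_ge0 ?dstep_ge0 // invr_ge0 ltW.
Qed.

(** The weight [low d] is 1 on the graph and 0 at height 0, and [low d] - 1 is 0 on the graph and -1
    at height 0, so each isolates one of the two traces. The gap [d] between graph and height 0
    bounds the derivative of the weights. *)
Lemma trace_bound d : 0 < d -> exists2 C : R, 0 < C & forall F, (forall t, h t < - d) -> smooth F ->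
  tr2 a b h F <= C * (Q mu (strip a b h 0) F + Q mu (strip a b h 0) ('D_e2 F)) /\
  tr2 a b (fun=> 0) F <= C * (Q mu (strip a b h 0) F + Q mu (strip a b h 0) ('D_e2 F)).
Proof.
move=> d0; have [K K0 hK] := low_bound d0; exists (K + 1); first lra.
move=> F hd sF; have cF := smooth_continuous sF.
have h0 (t : R) : a < t < b -> h t < 0 by move=> _; have := hd t; lra.
have q0 := Q_ge0 mu (strip a b h 0) F; have q1 := Q_ge0 mu (strip a b h 0) ('D_e2 F).
have point (g g' : R -> R) (x : R * R) : (forall s, `|g s| <= 1) -> (forall s, `|g' s| <= K) ->
    - (K + 1) * F x ^+ 2 - 1 * 'D_e2 F x ^+ 2 <= g' x.2 * F x ^+ 2 + 2 * g x.2 * F x * 'D_e2 F x.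
  move=> /(_ x.2) + /(_ x.2); rewrite !ler_norml => /andP[? ?] /andP[? ?].
  have : 0 <= (K + g' x.2) * F x ^+ 2 by rewrite mulr_ge0 ?sqr_ge0 //; lra.
  have := sqr_ge0 (F x + g x.2 * 'D_e2 F x).
  have : 0 <= (1 - g x.2 ^+ 2) * 'D_e2 F x ^+ 2 by rewrite mulr_ge0 ?sqr_ge0 //; nra.
  nra.
split.
  have lb s : `|low d s| <= 1 by rewrite ger0_norm ?low_ge0 // low_le1.
  have := @strip_parts_ge a b h 0 m (low d) F (fun=> - (K + 1)) 1 ch hm h0 (low_smooth d) sF (@cst_continuous _ _ _).
  move=> /(_ (fun x _ => point _ _ x lb hK)); rewrite cst_p // low0 //.
  have -> : \int[leb]_(t in `]a, b[) (0 * F (t, 0) ^+ 2 - low d (h t) * F (t, h t) ^+ 2) = - tr2 a b h F.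
    rewrite /tr2 -mulN1r -RintegralZl //; last exact: tr2_integrable.
    by apply: eq_Rintegral => t _; rewrite low1 // ?ltW // mul0r sub0r mul1r mulN1r.
  move: q0 q1 (mulr_ge0 (ltW K0) q1); set A := Q mu _ F; set B := Q mu _ ('D_e2 F); set T := tr2 _ _ _ _; lra.
have lb s : `|- low d s + 1| <= 1.
  by have := low_ge0 d s; have := low_le1 d s; rewrite ler_norml => *; apply/andP; split; lra.
have sg : smooth1 (fun s => low d s - 1) by apply: smooth1B; [exact: low_smooth|exact: smooth1_cst].
have sg' s : derive1 (fun s => low d s - 1) s = derive1 (low d) s.
  rewrite derive1E; apply: derive_val; rewrite -[X in is_derive _ _ _ X]subr0; apply: is_deriveB.
  exact: (smooth1_derive (low_smooth d)).
have hK' s : `|derive1 (fun s => low d s - 1) s| <= K by rewrite sg'.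
have lb' s : `|low d s - 1| <= 1 by rewrite -normrN opprB addrC.
have := @strip_parts_ge a b h 0 m _ F (fun=> - (K + 1)) 1 ch hm h0 sg sF (@cst_continuous _ _ _).
move=> /(_ (fun x _ => point _ _ x lb' hK')); rewrite cst_p // low0 //.
have -> : \int[leb]_(t in `]a, b[) ((0 - 1) * F (t, 0) ^+ 2 - (low d (h t) - 1) * F (t, h t) ^+ 2) = - tr2 a b (fun=> 0) F.
  rewrite /tr2 -[RHS]mulN1r -RintegralZl //; last exact: (tr2_integrable _ _ (@cst_continuous _ _ _)).
  by apply: eq_Rintegral => t _; rewrite low1 // ?ltW // subrr mul0r subr0 sub0r.
move: q0 q1 (mulr_ge0 (ltW K0) q1); set A := Q mu _ F; set B := Q mu _ ('D_e2 F); set T := tr2 _ _ _ _; lra.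
Qed.

End Ineq.

(** The weight (s - M) sg(s), with [sg] rising from 0 at c to 1 at d, vanishes at both ends, so no
    trace occurs; the price is F^2 in the band where [sg] varies. The lemma carries square
    integrability upwards from a band near the wall. *)
Lemma upper_bound a b c d M : c < d -> d < M -> exists2 C : R, 0 < C & forall F, smooth F ->
  Q mu (strip a b (fun=> d) M) F <= C * (Q mu (strip a b (fun=> c) d) F + Q mu (strip a b (fun=> c) M) ('D_e2 F)).
Proof.
move=> cd dM; have [K K0 hK] := @dstep_bounded R.
pose t := (d - c)^-1; have t0 : 0 < t by rewrite invr_gt0 subr_gt0.
pose B := 2 * ((M - c) * t * K) + 4 * (M - c) ^+ 2 + 1.
have Mc : 0 < M - c by lra.
have B1 : 0 < (M - c) * t * K by rewrite !mulr_gt0.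
exists B; first by rewrite /B; have := sqr_ge0 (M - c); lra.
move=> F sF; have cF := smooth_continuous sF.
pose sg := fun s : R => step (t * s + - (t * c)).
have ssg : smooth1 sg by apply: (@smooth1_comp _ (@step R)); [exact: step_smooth|exact: smooth1_affine].
have dsg s : derive1 sg s = t * dstep (t * s + - (t * c)) by rewrite /sg derive1_affine_comp //; exact: step_smooth.
pose g := fun s => (1 * s + - M) * sg s.
have g1 : smooth1 g by apply: smooth1M => //; exact: smooth1_affine.
have dg s : derive1 g s = sg s + (s - M) * (t * dstep (t * s + - (t * c))).
  rewrite derive1E; apply: derive_val; have := smooth1_derive ssg s; rewrite dsg => hs.
  have ha := is_derive_affine 1 (- M) s.
  apply: is_derive_eq; rewrite /GRing.scale /= mul1r mulr1 addrC //.
(* A lower bound for the coefficient of F^2: half of [sg] survives the completed square, and s - M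
   >= -(M - c) bounds the term with the derivative of [sg] from below. *)
pose p := fun s => 2^-1 * sg s - (M - c) * t * dstep (t * s + - (t * c)).
have cp : continuous p.
  apply: smooth1_continuous; apply: smooth1B; apply: smooth1M => //; try exact: smooth1_cst.
  by apply: (@smooth1_comp _ (@dstep R)); [exact: dstep_smooth|exact: smooth1_affine].
have cc : continuous (fun _ : R => c) by exact: cst_continuous.
have cdd : continuous (fun _ : R => d) by exact: cst_continuous.
have := @strip_parts_ge a b (fun=> c) M c g F p (2 * (M - c) ^+ 2) cc (fun=> lexx _) (fun _ _ => lt_trans cd dM) g1 sF cp.
move=> /(_ _)/wrap[x [_ /andP[x2 x3]]|].
  rewrite dg /p /g mul1r.
  have s0 : 0 <= sg x.2 by exact: step_ge0.
  have s1 : sg x.2 <= 1 by exact: step_le1.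
  have e0 : 0 <= dstep (t * x.2 + - (t * c)) by exact: dstep_ge0.
  move: s0 s1 e0; set S := sg x.2; set E := dstep _ => s0 s1 e0.
  have te : 0 <= t * E by rewrite mulr_ge0 // ltW.
  have i1 : 0 <= (x.2 - c) * (t * E) * F x ^+ 2 by rewrite mulr_ge0 ?sqr_ge0 // mulr_ge0 //; lra.
  have sq1 : 0 <= S * (2^-1 * F x + (x.2 - M) * 'D_e2 F x) ^+ 2 by rewrite mulr_ge0 // sqr_ge0.
  have sq2 : 0 <= ((M - c) ^+ 2 - S * (x.2 - M) ^+ 2) * 'D_e2 F x ^+ 2.
    rewrite mulr_ge0 ?sqr_ge0 // subr_ge0; apply: (@le_trans _ _ ((x.2 - M) ^+ 2)).
      by rewrite ler_piMl // sqr_ge0.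
    by rewrite -sqrrN opprB lerXn2r ?nnegrE; lra.
  nra.
have -> : \int[leb]_(t in `]a, b[) (g M * F (t, M) ^+ 2 - g c * F (t, c) ^+ 2) = 0.
  rewrite (_ : (fun t => _) = (fun=> 0)) ?Rintegral_cst ?mul0r //.
  by apply/funext => s; rewrite /g mul1r subrr !mul0r /sg subrr step_le0 // mulr0 mul0r subrr.
move=> H; pose S := strip a b (fun=> c) M.
pose S1 := strip a b (fun=> d) M; pose S2 := strip a b (fun=> c) d.
have mS : measurable S by exact: strip_measurable.
have mS1 : measurable S1 by exact: strip_measurable.
have mS2 : measurable S2 by exact: strip_measurable.
have S1S : S1 `<=` S by move=> x [? /andP[? ?]]; split => //; apply/andP; split; lra.
have S2S : S2 `<=` S by move=> x [? /andP[? ?]]; split => //; apply/andP; split; lra.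
have [r Sr] := @strip_sq _ a b (fun=> c) M c (fun=> lexx _).
have c2 : continuous (fun x : R * R => x.2) by move=> x; exact: cvg_snd.
have cF2 : continuous (fun x => F x ^+ 2) by move=> x; apply: cvgM; exact: cF.
have iF D : measurable D -> D `<=` S -> mu.-integrable D (EFin \o (fun x => F x ^+ 2)).
  by move=> mD DS; apply: (continuous_integrable cF2 mD (subset_trans DS Sr)).
have ind D : measurable D -> D `<=` S -> mu.-integrable S (EFin \o ((fun x => F x ^+ 2) \_ D)) /\
    \int[mu]_(x in S) ((fun x => F x ^+ 2) \_ D) x = Q mu D F.
  move=> mD DS; split; last first.
    rewrite (@Rint_supp _ S D) //; first by apply: Rint_eq => x Dx; rewrite patch_in.
    by move=> x _ nD; rewrite patch_out.
  have := intg_restrict mD (iF D mD DS); apply: integrableS => //.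
have [i1 q1] := ind _ mS1 S1S; have [i2 q2] := ind _ mS2 S2S.
have : 2^-1 * Q mu S1 F - (M - c) * t * K * Q mu S2 F <= \int[mu]_(x in S) (p x.2 * F x ^+ 2).
  rewrite -q1 -q2 -RintZ // -RintZ // -RintB //; try exact: areaZ.
  apply: (A.Rint_le mS).
  - by apply: areaB => //; exact: areaZ.
  - apply: (continuous_integrable _ mS Sr) => x; apply: cvgM; last exact: cF2.
    by apply: continuous_comp; [exact: c2|exact: cp].
  move=> x [x1 /andP[x2 x3]].
  have F0 := sqr_ge0 (F x).
  have [dx|xd|dx] := ltgtP d x.2.
  - rewrite patch_in; last by split => //; apply/andP; split.
    rewrite patch_out; last by move=> [_ /andP[_]]; lra.
    rewrite mulr0 subr0 ler_wpM2r // /p /sg step_ge1; last first.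
      by rewrite -mulrBr -ler_pdivrMl // mulr1 invrK; lra.
    by rewrite dstep_out ?mulr0 ?subr0 ?mulr1 //; right; rewrite -mulrBr -ler_pdivrMl // mulr1 invrK; lra.
  - rewrite patch_out; last by move=> [_ /andP[]]; lra.
    rewrite patch_in; last by split => //; apply/andP; split.
    rewrite mulr0 sub0r -mulNr ler_wpM2r // /p.
    have : 0 <= 2^-1 * sg x.2 by rewrite mulr_ge0 ?invr_ge0 ?step_ge0.
    have : (M - c) * t * dstep (t * x.2 + - (t * c)) <= (M - c) * t * K by rewrite ler_pM2l ?mulr_gt0.
    lra.
  - rewrite patch_out; last by rewrite /S1 /strip /= -dx ltxx => -[].
    rewrite patch_out; last by rewrite /S2 /strip /= -dx ltxx andbF => -[].
    have E0 : dstep (t * x.2 + - (t * c)) = 0.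
      by apply: dstep_out; right; rewrite -mulrBr -ler_pdivrMl // mulr1 invrK; lra.
    by rewrite !mulr0 subrr mulr_ge0 // /p E0 mulr0 subr0 mulr_ge0 ?invr_ge0 // step_ge0.
have := Q_ge0 mu S2 F; have := Q_ge0 mu S ('D_e2 F); move: H; rewrite -/S /B.
have := sqr_ge0 (M - c); set X := (M - c) ^+ 2; set Y := (M - c) * t * K in B1 *.
set A1 := Q mu S1 F; set A2 := Q mu S2 F; set A3 := Q mu S _ => X0 H0 p1 p2 H2.
have : 0 <= (2 * Y + 1) * A3 by rewrite mulr_ge0 //; lra.
have : 0 <= (4 * X + 1) * A2 by rewrite mulr_ge0 //; lra.
lra.
Qed.

End Window.

(** * Periodic unfolding *)

Section Columns.
Variable R : realType.
Local Notation mu := (area R).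
Implicit Types (a b c : R) (v w g : R * R -> R).

Definition vline (c : R) : set (R * R) := [set x | x.1 = c].

Lemma vlineE c : vline c = [set c] `*` setT.
Proof. by apply/seteqP; split => [x /= h|x [h _]]. Qed.

Lemma vline_measurable c : measurable (vline c).
Proof. by rewrite vlineE; apply: measurable_rect. Qed.

Lemma vline_null c : mu (vline c) = 0%E.
Proof. by rewrite vlineE product_measure1E //= lebesgue_measure_set1 mul0e. Qed.

Variable E : set (R * R).
Hypothesis mE : measurable E.

Definition col a b : set (R * R) := [set x | a < x.1 < b /\ E x].

Lemma col_measurable a b : measurable (col a b).
Proof.
have -> : col a b = [set x : R * R | a < x.1] `&` [set x : R * R | x.1 < b] `&` E.
  by apply/seteqP; split => x; [move=> [/andP[? ?] ?]|move=> [[/= h1 h2] h3]; split => //; apply/andP].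
by apply: measurableI => //; apply: measurableI; apply: open_measurable2; have [? []] := @half_open R a; have [? []] := @half_open R b.
Qed.

Lemma col_empty a b : b <= a -> col a b = set0.
Proof. by move=> ba; apply/seteqP; split => // x [/andP[? ?] _]; exfalso; lra. Qed.

Lemma colS a b a' b' : a' <= a -> b <= b' -> col a b `<=` col a' b'.
Proof. by move=> h1 h2 x [/andP[? ?] ?]; split => //; apply/andP; split; lra. Qed.

Lemma col_setD a b c : a <= b -> b <= c -> col a c `\` vline b = col a b `|` col b c.
Proof.
move=> ab bc; apply/seteqP; split => x.
  move=> [[/andP[x1 x2] Ex] /= nb]; have [h|h|//] := ltgtP x.1 b.
    by left; split => //; apply/andP.
  by right; split => //; apply/andP.
move=> [] [/andP[x1 x2] Ex]; split.
- by split => //; apply/andP; split; lra.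
- by rewrite /vline /= => h; lra.
- by split => //; apply/andP; split; lra.
- by rewrite /vline /= => h; lra.
Qed.

Lemma col_disj a b c : [disjoint col a b & col b c].
Proof. by apply/disj_setPS => x [[/andP[? ?] _] [/andP[? ?] _]]; lra. Qed.

Lemma col_split_ge0 a b c g : a <= b -> b <= c -> measurable_fun (col a c) g -> (forall x, 0 <= g x) ->
  (\int[mu]_(x in col a c) (g x)%:E = \int[mu]_(x in col a b) (g x)%:E + \int[mu]_(x in col b c) (g x)%:E)%E.
Proof.
move=> ab bc mg g0; have mg' : measurable_fun (col a c) (EFin \o g) by exact/measurable_EFinP.
rewrite (@ge0_negligible_integral _ _ _ mu _ _ _ (vline_measurable b) (col_measurable a c) mg'); last 2 first.
- by move=> x _; rewrite lee_fin.
- exact: vline_null.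
rewrite col_setD // ge0_integral_setU //; [exact: col_measurable|exact: col_measurable| | |exact: col_disj].
  by rewrite -col_setD //; apply: measurable_funS mg' => //; exact: col_measurable.
by move=> x _; rewrite lee_fin.
Qed.

Lemma col_split a b c g : a <= b -> b <= c -> mu.-integrable (col a c) (EFin \o g) ->
  \int[mu]_(x in col a c) g x = \int[mu]_(x in col a b) g x + \int[mu]_(x in col b c) g x.
Proof.
move=> ab bc ig; have iU : mu.-integrable (col a b `|` col b c) (EFin \o g).
  rewrite -col_setD //; apply: (@integrableS _ _ _ mu _ _ _ _ _ _ ig) => //; first exact: col_measurable.
  by apply: measurableD; [exact: col_measurable|exact: vline_measurable].
rewrite -(@Rintegral_setU _ _ _ mu _ _ _ (col_measurable a b) (col_measurable b c) iU (col_disj a b c)).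
rewrite -col_setD // /Rintegral; congr fine.
exact: (@negligible_integral _ _ _ mu _ _ _ (vline_measurable b) (col_measurable a c) ig (vline_null b)).
Qed.

Lemma L2_col_split a b c g : a <= b -> b <= c -> measurable_fun (col a c) g -> L2 mu (col a b) g -> L2 mu (col b c) g ->
  L2 mu (col a c) g.
Proof.
move=> ab bc mg [_ i1] [_ i2]; split => //; rewrite (@col_split_ge0 a b c (fun x => g x ^+ 2)) //.
- exact: lte_add_pinfty.
- exact: sqr_meas.
- by move=> x; exact: sqr_ge0.
Qed.

Variable T : R.
Hypothesis T0 : 0 < T.
Hypothesis ET : forall x, E (x.1 + T, x.2) <-> E x.

Lemma ETn (k : nat) x : E (x.1 + T * k%:R, x.2) <-> E x.
Proof.
elim: k x => [|k IH] x; first by rewrite mulr0 addr0 -surjective_pairing.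
rewrite -natr1 mulrDr mulr1 -(IH x) -(ET (x.1 + T * k%:R, x.2)) /= addrA //.
Qed.

Definition shift (s : R) g : R * R -> R := fun x => g (x.1 + s, x.2).

Lemma shiftE s g : shift s g = g \o aff 1 s 1 0.
Proof. by apply/funext => x; rewrite /shift /aff /= !mul1r addr0. Qed.

Lemma col_pre a b (k : nat) : aff 1 (T * k%:R) 1 0 @^-1` (col (a + T * k%:R) (b + T * k%:R)) = col a b.
Proof.
apply/seteqP; split => x; rewrite /col /aff /= !mul1r addr0 !ltrD2r => -[? ?]; split => //; exact/(ETn k).
Qed.

Lemma Rint_shift a b (k : nat) g : mu.-integrable (col (a + T * k%:R) (b + T * k%:R)) (EFin \o g) ->
  mu.-integrable (col a b) (EFin \o (shift (T * k%:R) g)) /\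
  \int[mu]_(x in col (a + T * k%:R) (b + T * k%:R)) g x = \int[mu]_(x in col a b) shift (T * k%:R) g x.
Proof.
move=> ig; have mC := col_measurable (a + T * k%:R) (b + T * k%:R).
have n1 := oner_neq0 R; split.
  by have := @integrable_aff R 1 (T * k%:R) 1 0 n1 n1 _ _ mC ig; rewrite col_pre -shiftE.
by rewrite (@Rint_aff R 1 (T * k%:R) 1 0 n1 n1 _ _ mC ig) col_pre mulr1 normr1 mul1r shiftE.
Qed.

(** Periodicity only almost everywhere: the representative of a weak gradient is arbitrary, so that
    of a periodic function need not be periodic pointwise. *)
Definition ae_periodic g := forall k : nat, ae_eq2 E (shift (T * k%:R) g) g.

Lemma colE a b : col a b `<=` E. Proof. by move=> x []. Qed.

Lemma shift_meas a b (k : nat) g : measurable_fun (col (a + T * k%:R) (b + T * k%:R)) g ->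
  measurable_fun (col a b) (shift (T * k%:R) g).
Proof.
move=> mg; have n1 := oner_neq0 R.
by have := @meas_aff R 1 (T * k%:R) 1 0 _ _ (col_measurable _ _) mg; rewrite col_pre -shiftE.
Qed.

Lemma L2_shift a b (k : nat) g : measurable_fun E g -> ae_periodic g ->
  L2 mu (col (a + T * k%:R) (b + T * k%:R)) g <-> L2 mu (col a b) g.
Proof.
move=> mg pg; have mC := col_measurable (a + T * k%:R) (b + T * k%:R); have mC' := col_measurable a b.
have n1 := oner_neq0 R.
have m1 : measurable_fun (col (a + T * k%:R) (b + T * k%:R)) g by apply: measurable_funS mg => //; exact: colE.
have m2 : measurable_fun (col a b) g by apply: measurable_funS mg => //; exact: colE.
have := @int_affE R 1 (T * k%:R) 1 0 n1 n1 _ (fun x => g x ^+ 2) mC (sqr_meas m1) (fun x => sqr_ge0 _).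
rewrite col_pre mulr1 normr1 mul1e.
have -> : (\int[mu]_(x in col a b) (g (aff 1 (T * k%:R) 1 0 x) ^+ 2)%:E = \int[mu]_(x in col a b) (g x ^+ 2)%:E)%E.
  apply: (@ae_intE _ _ (fun x => g (aff 1 (T * k%:R) 1 0 x) ^+ 2)) => //; last 2 first.
  - exact: sqr_meas.
  - have := ae_eq2S (@colE a b) (pg k); apply: negligibleS => x [Cx h]; split => // h'; apply: h.
    by rewrite -h' shiftE.
  - by apply: sqr_meas; have := shift_meas m1; rewrite shiftE.
by move=> H; split => -[_ h]; split => //; move: h; rewrite H.
Qed.

Lemma L2_cols (N : nat) g : measurable_fun E g -> ae_periodic g -> L2 mu (col 0 T) g -> L2 mu (col 0 (T * N%:R)) g.
Proof.
move=> mg pg l0; have mC a b : measurable_fun (col a b) g by apply: measurable_funS mg => //; exact: colE.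
elim: N => [|N IH].
  by rewrite mulr0; split; [exact: mC|rewrite col_empty // integral_set0 ltry].
apply: (@L2_col_split _ (T * N%:R)) => //.
- by rewrite mulr_ge0 // ltW.
- by apply: ler_wpM2l; rewrite ?ler_nat // ltW.
- have := proj2 (L2_shift 0 T N mg pg) l0; rewrite add0r.
  by rewrite -natr1 mulrDr mulr1 addrC.
Qed.

(** The extra period on the left makes room for open windows that contain the line x1 = 0. *)
Lemma L2_cols_left (N : nat) g : measurable_fun E g -> ae_periodic g -> L2 mu (col 0 T) g -> L2 mu (col (- T) (T * N%:R)) g.
Proof.
move=> mg pg l0; have := L2_cols N.+1 mg pg l0.
rewrite -[X in col X _](subrr T) -{2}[T]mulr1 => h.
apply: (proj1 (L2_shift (- T) (T * N%:R) 1 mg pg)).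
by rewrite mulr1 addNr; move: h; rewrite mulr1 subrr -natr1 mulrDr mulr1.
Qed.

Lemma Rint_cols (N : nat) g : mu.-integrable (col 0 (T * N%:R)) (EFin \o g) ->
  \int[mu]_(x in col 0 (T * N%:R)) g x = \sum_(k < N) \int[mu]_(x in col (T * k%:R) (T * k.+1%:R)) g x.
Proof.
elim: N => [|N IH] ig.
  by rewrite big_ord0 mulr0 col_empty // Rintegral_set0.
have h1 : 0 <= T * N%:R by rewrite mulr_ge0 // ltW.
have h2 : T * N%:R <= T * N.+1%:R by apply: ler_wpM2l; rewrite ?ler_nat // ltW.
rewrite big_ord_recr /= -IH; first exact: col_split.
apply: (@integrableS _ _ _ mu _ _ _ _ _ _ ig); [exact: col_measurable|exact: col_measurable|exact: colS].
Qed.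

(** Translates each period back to the first one; the periodic factor is unchanged up to a null set,
    and the other one is replaced by its translate. With the sum moved inside, this is what converts
    a test over N periods into a test over one cell. *)
Lemma Rint_unfold (N : nat) g w : mu.-integrable (col 0 (T * N%:R)) (EFin \o (fun x => g x * w x)) -> ae_periodic g ->
  measurable_fun E g -> measurable_fun E w ->
  \int[mu]_(x in col 0 (T * N%:R)) (g x * w x) = \sum_(k < N) \int[mu]_(x in col 0 T) (g x * shift (T * k%:R) w x).
Proof.
move=> ig pg mg mw; rewrite Rint_cols //; apply: eq_bigr => k _.
have i1 : mu.-integrable (col (0 + T * k%:R) (T + T * k%:R)) (EFin \o (fun x => g x * w x)).
  apply: (@integrableS _ _ _ mu _ _ _ _ _ _ ig); [exact: col_measurable|exact: col_measurable|].
  apply: colS; first by rewrite add0r mulr_ge0 // ltW.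
  by rewrite -[X in X + _]mulr1 -mulrDr addrC natr1; apply: ler_wpM2l; rewrite ?ler_nat // ltW.
have [i2 e] := Rint_shift i1; move: e; rewrite add0r -[X in X + _]mulr1 -mulrDr addrC natr1 => ->.
have mC a b h : measurable_fun E h -> measurable_fun (col a b) h by move=> mh; apply: measurable_funS mh => //; exact: colE.
rewrite /Rintegral; congr fine.
apply: (@ae_intE _ _ (shift (T * k%:R) (fun x => g x * w x)) (fun x => g x * shift (T * k%:R) w x)).
- exact: col_measurable.
- by apply: shift_meas; apply: measurable_funM; exact: mC.
- by apply: measurable_funM; [exact: mC|apply: shift_meas; exact: mC].
- have := ae_eq2S (@colE 0 T) (pg k); apply: negligibleS => x [Cx h]; split => // h'; apply: h.
  by rewrite /shift /= -/(shift (T * k%:R) g x) h'.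
Qed.

Lemma Rint_period (N : nat) g : mu.-integrable (col 0 (T * N%:R)) (EFin \o g) -> ae_periodic g -> measurable_fun E g ->
  \int[mu]_(x in col 0 (T * N%:R)) g x = N%:R * \int[mu]_(x in col 0 T) g x.
Proof.
move=> ig pg mg; have := @Rint_unfold N g (fun=> 1).
rewrite (@Rint_eq _ _ (fun x => g x * 1) g) => [|x _]; last by rewrite mulr1.
move=> ->; [|by under [X in EFin \o X]eq_fun do rewrite mulr1|exact: pg|exact: mg|exact: measurable_cst].
rewrite (eq_bigr (fun=> \int[mu]_(x in col 0 T) g x)) => [|k _]; last by apply: Rint_eq => x _; rewrite /shift mulr1.
by rewrite sumr_const card_ord mulr_natl.
Qed.

End Columns.

(** * Smooth approximation above a periodic graph *)

Lemma exhaust_le d (T : measurableType d) (R : realType) (mu : {measure set T -> \bar R}) (D : set T) (A : nat -> set T)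
    (v : T -> R) (B : R) : measurable D -> (forall n, measurable (A n)) ->
  nondecreasing_seq A -> \bigcup_n A n = D -> measurable_fun D v -> (forall x, D x -> 0 <= v x) ->
  (forall n, \int[mu]_(x in A n) (v x)%:E <= B%:E)%E -> (\int[mu]_(x in D) (v x)%:E <= B%:E)%E.
Proof.
move=> mD mA ndA AD mv v0 AB; have AnD n : A n `<=` D by rewrite -AD; exact: bigcup_sup.
have mA' n : measurable_fun (A n) (fun x => (v x)%:E).
  by apply/measurable_EFinP; apply: measurable_funS mv => //; exact: AnD.
have v0' n x : A n x -> (0 <= (v x)%:E)%E by move=> Ax; rewrite lee_fin; apply: v0; exact: AnD Ax.
have := @ge0_nondecreasing_set_cvg_integral _ _ _ A (fun x => (v x)%:E) mu ndA mA mA' v0'; rewrite AD => c.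
rewrite -(cvg_lim (@ereal_hausdorff _) c); apply: lime_le; first by apply/cvg_ex; eexists; exact: c.
by apply: nearW.
Qed.

Section L2Limit.
Variable R : realType.
Local Notation mu := (area R).
Implicit Types (v w u : R * R -> R) (D : set (R * R)).

Lemma cvg_lb (u : nat -> R) (l c : R) : u @ \oo --> l -> (forall n, c <= u n) -> c <= l.
Proof.
move=> ul cu; rewrite -(cvg_lim (@norm_hausdorff _ _) ul); apply: limr_ge; first by apply/cvg_ex; exists l.
exact: nearW.
Qed.

(* An L^1 limit of functions bounded in L^2 is in L^2: test the limit against its own truncations. *)
Lemma L2_of_L1_limit D (r : R) (u : nat -> R * R -> R) v (B : R) : measurable D -> D `<=` sq r ->
  (forall n, L2 mu D (u n)) -> mu.-integrable D (EFin \o v) -> (forall n, Q mu D (u n) <= B) ->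
  \int[mu]_(x in D) `|u n x - v x| @[n --> \oo] --> (0 : R) -> L2 mu D v.
Proof.
move=> mD Dr lu iv uB c; have mv : measurable_fun D v by have /integrableP[/measurable_EFinP] := iv.
split => //; pose A (m : nat) := D `&` v @^-1` `[- m%:R, m%:R].
have mA m : measurable (A m) by exact: (mv mD _ (measurable_itv _)).
have AD m : A m `<=` D by move=> x [].
have An m x : A m x -> `|v x| <= m%:R by move=> [_]; rewrite /= in_itv /= ler_norml.
apply: (@le_lt_trans _ _ B%:E); last exact: ltry.
have mvA m : measurable_fun (A m) v by apply: measurable_funS mv => //; exact: AD.
have Ar m : A m `<=` sq r by exact: subset_trans Dr.
apply: (@exhaust_le _ _ _ mu D A (fun x => v x ^+ 2)) => //.
- move=> m n mn; apply/subsetPset => x [Dx]; rewrite /= !in_itv /= -ler_norml => h; split => //.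
  by rewrite /= in_itv /= -ler_norml (le_trans h) // ler_nat.
- apply/seteqP; split => [x [m _ []]//|x Dx]; exists (Num.truncn `|v x|).+1 => //; split => //.
  by rewrite /= in_itv /= -ler_norml ltW // truncnS_gt.
- exact: sqr_meas.
- by move=> x _; exact: sqr_ge0.
move=> m; have lw : L2 mu (A m) v.
  apply: (@A.L2_le R (A m) (mA m) _ (fun=> m%:R ^+ 2)) => //.
  - exact: mvA.
  - by move=> x Ax; rewrite -(ger0_norm (sqr_ge0 _)) normrX lerXn2r ?nnegrE ?An.
  - by apply: (@continuous_integrable _ _ (A m) r) => //; exact: cst_continuous.
rewrite -(A.Q_E (mA m) lw) lee_fin.
have luA n : L2 mu (A m) (u n) by exact: (A.L2S mD (mA m) (@AD m) (lu n)).
have iu n : mu.-integrable D (EFin \o (fun x => `|u n x - v x|)).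
  have := areaB mD (L2_integrable mD Dr (lu n)) iv => /(@integrable_abse _ _ _ mu D).
  by [].
have iuA n : mu.-integrable (A m) (EFin \o (fun x => `|u n x - v x|)).
  exact: (@integrableS _ _ _ mu _ _ _ mD (mA m) (@AD m) (iu n)).
have E n : Q mu (A m) v <= 2^-1 * B + 2^-1 * Q mu (A m) v + m%:R * \int[mu]_(x in D) `|u n x - v x|.
  have i1 := areaZ 2^-1 (mA m) (L2_sqr (luA n)); have i2 := areaZ 2^-1 (mA m) (L2_sqr lw); have i3 := areaZ m%:R (mA m) (iuA n).
  apply: (@le_trans _ _ (2^-1 * Q mu (A m) (u n) + 2^-1 * Q mu (A m) v + m%:R * \int[mu]_(x in A m) `|u n x - v x|)); last first.
    apply: lerD; last first.
      rewrite ler_wpM2l // -lee_fin /Rintegral !fineK ?(@integrable_fin_num _ _ _ mu _ mD _ (iu n)) ?(@integrable_fin_num _ _ _ mu _ (mA m) _ (iuA n)) //.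
      apply: (@le_int_sub _ _ _ mu D mD (fun x => `|u n x - v x|) (A m) (mA m) _ (fun x _ => normr_ge0 _) (@AD m)).
      by have /integrableP[/measurable_EFinP] := iu n.
    rewrite lerD2r ler_pM2l ?invr_gt0 //; apply: le_trans (uB n); exact: (A.QS mD (mA m) (@AD m) (lu n)).
  rewrite /Q -(RintZ 2^-1 (mA m) (L2_sqr (luA n))) -(RintZ 2^-1 (mA m) (L2_sqr lw)) -(RintZ m%:R (mA m) (iuA n)).
  rewrite -(RintD (mA m) i1 i2) -(RintD (mA m) (areaD (mA m) i1 i2) i3).
  apply: (A.Rint_le (mA m)); [exact: (L2_sqr lw)|exact: (areaD (mA m) (areaD (mA m) i1 i2) i3)|].
  move=> x Ax; have : (v x - u n x) * v x <= m%:R * `|u n x - v x|.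
    by rewrite (le_trans (ler_norm _)) // normrM distrC mulrC ler_wpM2r // An.
  by have := sqr_ge0 (u n x - v x); nra.
have : Q mu (A m) v <= 2^-1 * B + 2^-1 * Q mu (A m) v + m%:R * 0.
  apply: (@cvg_lb (fun n => 2^-1 * B + 2^-1 * Q mu (A m) v + m%:R * \int[mu]_(x in D) `|u n x - v x|)) => //.
  by apply: cvgD; [exact: cvg_cst|apply: cvgZr].
lra.
Qed.

End L2Limit.

Section Profile.
Variable R : realType.
Local Notation mu := (area R).
Variables (f : R -> R) (T kap delta : R).
Hypotheses (T0 : 0 < T) (fT : periodic f T) (fge : forall t, -1 <= f t) (d0 : 0 < delta) (fd : forall t, f t < - delta).
Hypotheses (kap0 : 0 <= kap) (flip : forall s t, `|f s - f t| <= kap * `|s - t|).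
Implicit Types (v : R * R -> R) (G : R * R -> R * R) (M : R) (N : nat).

Lemma f_continuous : continuous f.
Proof.
have k1 : 0 < kap + 1 by rewrite ltr_wpDl.
move=> t; apply/cvgrPdist_le => e e0.
near=> s; apply: (le_trans (flip t s)).
have : `|t - s| <= e / (kap + 1) by near: s; apply: cvgr_dist_le; [exact: cvg_id|rewrite divr_gt0].
rewrite ler_pdivlMr // => h; apply: le_trans h; by rewrite mulrC ler_wpM2l // lerDl.
Unshelve. all: by end_near. Qed.

Local Notation E := (above f).
Local Notation Om N M := (strip 0 (T * N%:R) f M).

Definition band (h : R -> R) M : set (R * R) := [set x | h x.1 < x.2 < M].

Lemma band_measurable (h : R -> R) M : continuous h -> measurable (band h M).
Proof.
move=> ch; have -> : band h M = above h `&` [set x : R * R | x.2 < M].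
  by apply/seteqP; split => x; [move=> /andP[]|move=> [? ?]; apply/andP].
apply: measurableI; first by apply: open_measurable2; exact: above_open.
by apply: open_measurable2; have [_ []] := @half_open R M.
Qed.

Lemma above_measurable : measurable E.
Proof. by apply: open_measurable2; apply: above_open; exact: f_continuous. Qed.

Lemma aboveT x : E (x.1 + T, x.2) <-> E x.
Proof. by rewrite /above /= fT. Qed.

Lemma bandT (h : R -> R) M x : periodic h T -> band h M (x.1 + T, x.2) <-> band h M x.
Proof. by move=> hT; rewrite /band /= hT. Qed.

Lemma periodic_shift v (k : nat) : periodic v (T, 0) -> shift (T * k%:R) v = v.
Proof.
move=> pv; apply/funext => x; rewrite /shift; elim: k => [|k IH]; first by rewrite mulr0 addr0 -surjective_pairing.
by rewrite -natr1 mulrDr mulr1 addrA -[RHS]IH; exact: (periodicE (x.1 + T * k%:R, x.2) pv).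
Qed.

Lemma above_pre (k : nat) : aff 1 (T * k%:R) 1 0 @^-1` E = E.
Proof.
by apply/seteqP; split => x; rewrite /aff /= !mul1r addr0 => h; apply/(ETn aboveT k).
Qed.

Lemma weak_grad_shift v G (k : nat) : weak_grad E v G ->
  weak_grad E (shift (T * k%:R) v) (fun x => (shift (T * k%:R) (fun x => (G x).1) x, shift (T * k%:R) (fun x => (G x).2) x)).
Proof.
move=> wG; have n1 := oner_neq0 R.
have := @weak_grad_aff R 1 (T * k%:R) 1 0 n1 n1 _ _ _ (above_open f_continuous) wG.
rewrite above_pre -shiftE; congr (weak_grad _ _ _); apply/funext => x.
by rewrite /aff /shift !mul1r addr0.
Qed.

(** The translated gradient is a weak gradient of the translate, which is [v] itself, and weak
    gradients are unique almost everywhere. *)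
Lemma grad_ae_periodic v G : periodic v (T, 0) -> weak_grad E v G ->
  ae_periodic E T (fun x => (G x).1) /\ ae_periodic E T (fun x => (G x).2).
Proof.
move=> pv wG; split => k; have := weak_grad_shift k wG; rewrite periodic_shift // => wk;
  by have [] := weak_grad_unique (above_open f_continuous) wk wG.
Qed.

Lemma ae_periodicS (A B : set (R * R)) g : A `<=` B -> ae_periodic B T g -> ae_periodic A T g.
Proof. by move=> AB h k; exact: ae_eq2S (h k). Qed.

Lemma v_ae_periodic v : periodic v (T, 0) -> ae_periodic E T v.
Proof. by move=> pv k; rewrite periodic_shift //; exact: ae_refl. Qed.

Lemma integrable_cover (A B C : set (R * R)) v : measurable A -> measurable B -> measurable C -> A `<=` B `|` C ->
  measurable_fun A v -> mu.-integrable B (EFin \o v) -> mu.-integrable C (EFin \o v) -> mu.-integrable A (EFin \o v).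
Proof.
move=> mA mB mC ABC mv iB iC.
suff : intg (v \_ A) by move=> h; apply/(@integrable_mkcond _ _ _ mu A (EFin \o v) mA); rewrite restrict_EFin.
have := intg_restrict mB iB; have := intg_restrict mC iC => /(@integrable_abse _ _ _ mu setT) iC' /(@integrable_abse _ _ _ mu setT) iB'.
apply: (@area_le _ setT _ (fun x => `|(v \_ B) x| + `|(v \_ C) x|)) => //.
- exact/(measurable_restrictT _ mA).
- move=> x _; have [Ax|nA] := pselect (A x); last by rewrite (patch_out _ nA) normr0 addr_ge0.
  rewrite patch_in //; have [Bx|nB] := pselect (B x); first by rewrite patch_in // lerDl.
  have [|Cx] := ABC x Ax; first by [].
  by rewrite [X in _ + `|X|]patch_in // lerDr.
- by apply: areaD.
Qed.

Lemma L2_cover (A B C : set (R * R)) v : measurable A -> measurable B -> measurable C -> A `<=` B `|` C ->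
  measurable_fun A v -> L2 mu B v -> L2 mu C v -> L2 mu A v.
Proof.
move=> mA mB mC ABC mv lB lC; apply: (@A.L2_le R A mA _ (fun x => v x ^+ 2)) => //.
by apply: (integrable_cover mA mB mC ABC (sqr_meas mv)); exact: L2_sqr.
Qed.

Lemma moll_eq k n (b b' : R * R -> R) x : (forall z, kbox k n x z -> b z = b' z) -> moll k n b x = moll k n b' x.
Proof.
move=> bb; rewrite /moll /conv /pair_with; apply: Rint_eq => z _.
have [Kz|nK] := pselect (kbox k n x z); first by rewrite bb.
by have -> : ker (kern 0 n) (kern k n) x z = 0 by [exact: (kern2_off nK)]; rewrite !mulr0.
Qed.

Lemma Q_moll_le k n (D V : set (R * R)) g (r : R) : 0 <= k -> measurable D -> D `<=` sq r -> measurable V -> V `<=` sq r ->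
  L2 mu D g -> Q mu V (moll k n (g \_ D)) <= Q mu D g.
Proof.
move=> k0 mD Dr mV Vr lg; have ib := intg_restrict mD (L2_integrable mD Dr lg).
have cm : continuous (moll k n (g \_ D)) by apply: smooth_continuous; exact: moll_smooth.
rewrite -lee_fin (A.Q_E mV (continuous_L2 cm mV Vr)) (A.Q_E mD lg) -(N2_restrict g mD).
apply: le_trans (moll_N2 k0 n ib); apply: le_int_sub => //.
- by apply: sqr_meas; exact: continuous_measurable2.
- by move=> x _; exact: sqr_ge0.
Qed.

Section Fun.
Variables (v : R * R -> R) (G : R * R -> R * R).
Hypotheses (pv : periodic v (T, 0)) (wG : weak_grad E v G).
Hypotheses (lG1 : L2 mu (col E 0 T) (fun x => (G x).1)) (lG2 : L2 mu (col E 0 T) (fun x => (G x).2)).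
Hypothesis lP : L2 mu (strip 0 T f 0) v.

Let cf := f_continuous.
Let mE := above_measurable.

Lemma band_sub M : band f M `<=` E. Proof. by move=> x /andP[]. Qed.

Lemma L2_Om_left (g : R * R -> R) N M : measurable_fun E g -> ae_periodic E T g -> L2 mu (strip 0 T f M) g ->
  L2 mu (strip (- T) (T * N%:R) f M) g.
Proof.
move=> mg pg lg; have mB := band_measurable M cf.
have bT x : band f M (x.1 + T, x.2) <-> band f M x by apply: bandT.
apply: (@L2_cols_left _ (band f M) mB T T0 bT N g) => //.
- by apply: measurable_funS mg => //; exact: band_sub.
- exact: (ae_periodicS (@band_sub M) pg).
Qed.

Lemma L2_Om (g : R * R -> R) N M : measurable_fun E g -> ae_periodic E T g -> L2 mu (strip 0 T f M) g ->
  L2 mu (Om N M) g.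
Proof.
move=> mg pg lg; have mB := band_measurable M cf.
have bT x : band f M (x.1 + T, x.2) <-> band f M x by apply: bandT.
apply: (@L2_cols _ (band f M) mB T T0 bT N g) => //.
- by apply: measurable_funS mg => //; exact: band_sub.
- exact: (ae_periodicS (@band_sub M) pg).
Qed.

Lemma G_L2 M : L2 mu (strip 0 T f M) (fun x => (G x).1) /\ L2 mu (strip 0 T f M) (fun x => (G x).2).
Proof.
have S1 : strip 0 T f M `<=` col E 0 T by move=> x [? /andP[? ?]].
have mC := col_measurable mE 0 T; have mS := @strip_measurable _ 0 T f M cf.
by split; [exact: (A.L2S mC mS S1 lG1)|exact: (A.L2S mC mS S1 lG2)].
Qed.

Lemma meas_v : measurable_fun E v. Proof. by have [[]] := wG. Qed.
Lemma meas_G1 : measurable_fun E (fun x => (G x).1). Proof. by have [_ []] := wG. Qed.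
Lemma meas_G2 : measurable_fun E (fun x => (G x).2). Proof. by have [_ _ []] := wG. Qed.

Lemma v_integrable M : 0 < M -> mu.-integrable (strip (- T) (T * 2) f M) (EFin \o v).
Proof.
move=> M0; have mS M' := @strip_measurable _ (- T) (T * 2) f M' cf.
have [r hr] := @strip_sq _ (- T) (T * 2) f 0 (-1) fge.
(* Two overlapping pieces: below height 0 the function is square integrable, by translating the
   assumption on P, and above height -delta the rectangle is a compact subset of the domain, where
   [v] is integrable. *)
have i1 : mu.-integrable (strip (- T) (T * 2) f 0) (EFin \o v).
  apply: (L2_integrable (mS 0) hr).
  by have := L2_Om_left 2 meas_v (v_ae_periodic pv) lP.
have i2 : mu.-integrable (seg2 (- T) (T * 2) (- delta) M) (EFin \o v).
  have [[_ lv] _ _ _] := wG; apply: lv; first exact: seg2_compact.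
  by move=> x [_ /andP[h _]]; rewrite /above /=; apply: lt_le_trans h; exact: fd.
apply: (@integrable_cover _ _ _ v (mS M) (mS 0) (@seg2_measurable _ _ _ _ _) _ _ i1 i2).
  move=> x [/andP[x1 x2] /andP[x3 x4]]; have [h|h] := ltP x.2 0.
    by left; split; apply/andP; split.
  right; split; apply/andP; split; [exact: ltW|exact: ltW| |exact: ltW].
  by apply: le_trans h; rewrite oppr_le0 ltW.
by apply: measurable_funS meas_v => //; move=> x [_ /andP[]].
Qed.

Lemma strip_sqf a b M : exists r, strip a b f M `<=` sq r.
Proof. exact: (@strip_sq _ a b f M (-1) fge). Qed.

Lemma kbox_strip b b' M M' : b < b' -> M < M' -> exists n0, forall n, (n0 <= n)%N -> forall x, 0 <= x.1 <= b -> f x.1 <= x.2 <= M ->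
  kbox (kap + 1) n x `<=` strip (- T) b' f M'.
Proof.
move=> bb MM; have [n0 h] := @kbox_window _ kap f 0 b M b' M' kap0 flip bb MM; exists n0 => n nn x x1 x2 z Kz.
have [/andP[z1 z2] z3] := h n nn x x1 x2 z Kz; split => //; apply/andP; split => //.
by apply: lt_le_trans z1; rewrite oppr_lt0.
Qed.

(** Above height 0, [v] is known only to be locally integrable with square integrable gradient. Its
    mollifications satisfy [upper_bound] uniformly in the index, starting from a band inside P, and
    [L2_of_L1_limit] transfers the resulting bound to [v]. *)
Lemma v_L2 M : 0 < M -> L2 mu (strip 0 T f M) v.
Proof.
move: T0 d0 => T0' d0' M0; pose W := strip (- T) (T * 2) f (M + 1); pose P' := strip (- T) (T * 2) f 0.
have k1 : 0 <= kap + 1 by rewrite addr_ge0.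
have mW : measurable W by exact: strip_measurable.
have mP : measurable P' by exact: strip_measurable.
have [r Wr] := strip_sqf (- T) (T * 2) (M + 1).
have PW : P' `<=` W by move=> x [x1 /andP[x2 x3]]; split => //; apply/andP; split => //; lra.
have M1 : 0 < M + 1 by lra.
have iv := v_integrable M1.
have lP' : L2 mu P' v by exact: (L2_Om_left 2 meas_v (v_ae_periodic pv) lP).
have [pG1 pG2] := grad_ae_periodic pv wG.
have lGW : L2 mu W (fun x => (G x).2) by exact: (L2_Om_left 2 meas_G2 pG2 (proj2 (G_L2 _))).
have TT : T < T * 2 by lra.
have [n0 hn0] := @kbox_strip T (T * 2) M (M + 1) TT (ltac:(lra)).
have [n1 hn1] := @kbox_strip T (T * 2) (- (delta / 2)) 0 TT (ltac:(lra)).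
pose phi n := moll (kap + 1) (n + maxn n0 n1) (v \_ W).
pose S := strip 0 T (fun=> - delta) M; pose U := strip 0 T (fun=> - (delta / 2)) M.
pose L := strip 0 T (fun=> - delta) (- (delta / 2)).
have [d1 d2] : - delta < - (delta / 2) /\ - (delta / 2) < M by split; lra.
have [C C0 hC] := @upper_bound R 0 T _ _ _ d1 d2.
have mS : measurable S by apply: strip_measurable; exact: cst_continuous.
have mU : measurable U by apply: strip_measurable; exact: cst_continuous.
have mL : measurable L by apply: strip_measurable; exact: cst_continuous.
have SW : S `<=` W.
  move=> x [/andP[x1 x2] /andP[x3 x4]]; have := fd x.1 => fx; split; apply/andP; split; lra.
have US : U `<=` S by move=> x [x1 /andP[x3 x4]]; split => //; apply/andP; split; lra.
have LS : L `<=` S by move=> x [x1 /andP[x3 x4]]; split => //; apply/andP; split; lra.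
have ib := intg_restrict mW iv.
have sphi n : smooth (phi n) by exact: moll_smooth.
have QS n : Q mu S ('D_e2 (phi n)) <= Q mu W (fun x => (G x).2).
  apply: le_trans (Q_moll_le (n + maxn n0 n1) k1 mW Wr mS (subset_trans SW Wr) lGW).
  rewrite le_eqVlt; apply/orP; left; apply/eqP; apply: Rint_eq => x Sx; congr (_ ^+ 2).
  have nn : (n0 <= n + maxn n0 n1)%N by rewrite (leq_trans _ (leq_addl _ _)) // leq_maxl.
  have [[/andP[x1 x2] /andP[x3 x4]] fx] := (Sx, fd x.1).
  by apply: (proj2 (moll_window k1 mW (weak_grad_restrict mE mW _ wG) ib (hn0 _ nn x _ _)));
    [move=> y [_ /andP[]]|apply/andP; split; lra|apply/andP; split; lra].
have QL n : Q mu L (phi n) <= Q mu P' v.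
  apply: le_trans (Q_moll_le (n + maxn n0 n1) k1 mP (subset_trans PW Wr) mL (subset_trans LS (subset_trans SW Wr)) lP').
  rewrite le_eqVlt; apply/orP; left; apply/eqP; apply: Rint_eq => x Lx; congr (_ ^+ 2).
  have nn : (n1 <= n + maxn n0 n1)%N by rewrite (leq_trans _ (leq_addl _ _)) // leq_maxr.
  have [[/andP[x1 x2] /andP[x3 x4]] fx] := (Lx, fd x.1).
  apply: moll_eq => z Kz; have Pz : P' z by apply: (hn1 _ nn x _ _ z Kz); apply/andP; split; lra.
  by rewrite !patch_in //; exact: PW.
have QU n : Q mu U (phi n) <= C * (Q mu P' v + Q mu W (fun x => (G x).2)).
  apply: le_trans (hC _ (sphi n)) _; rewrite ler_pM2l //; apply: lerD; [exact: QL|exact: QS].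
have iU : mu.-integrable U (EFin \o v).
  by apply: (@integrableS _ _ _ mu _ _ _ mW mU (subset_trans US SW) iv).
have lU : L2 mu U v.
  apply: (L2_of_L1_limit mU (subset_trans US (subset_trans SW Wr)) _ iU QU).
    by move=> n; apply: (continuous_L2 _ mU (subset_trans US (subset_trans SW Wr))); exact: smooth_continuous.
  have b0 x : ~ hbox (- (r + 1)) (r + 1) (- (r + 1)) (r + 1) x -> (v \_ W) x = 0.
    by move=> nx; rewrite patch_out // => /Wr/sq_hbox.
  have [_ /fine_cvg c] := mollL1_box_supp k1 ib b0.
  rewrite -(cvg_shiftn (maxn n0 n1)) in c; apply: cvg0_squeeze c => n /=.
    by apply: Rintegral_ge0.
  have id : intg (fun x => moll (kap + 1) (n + maxn n0 n1) (v \_ W) x - (v \_ W) x).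
    apply: intgB => //; apply/(N1_integrable _); split.
      exact: (continuous_measurable2 (smooth_continuous (sphi n))).
    by apply: le_lt_trans (moll_N1 k1 _ ib) _; have /N1_integrable[] := ib.
  have ida := @integrable_abse _ _ _ mu _ _ id.
  rewrite /mdist /N1 -[leRHS]/(Rintegral mu setT (fun x => `|moll (kap + 1) (n + maxn n0 n1) (v \_ W) x - (v \_ W) x|)).
  apply: (@le_trans _ _ (\int[mu]_(x in U) `|moll (kap + 1) (n + maxn n0 n1) (v \_ W) x - (v \_ W) x|)).
    rewrite le_eqVlt; apply/orP; left; apply/eqP; apply: Rint_eq => x Ux; rewrite [(v \_ W) x]patch_in //.
    by apply: SW; exact: US.
  have idU := @integrableS _ _ _ mu _ _ _ measurableT mU (@subsetT _ _) ida.
  rewrite /Rintegral; apply: fine_le.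
  - exact: (@integrable_fin_num _ _ _ mu _ mU _ idU).
  - exact: (@integrable_fin_num _ _ _ mu _ measurableT _ ida).
  - apply: (@le_int_sub _ _ _ mu setT measurableT (fun x => `|moll (kap + 1) (n + maxn n0 n1) (v \_ W) x - (v \_ W) x|) U mU _ (fun x _ => normr_ge0 _) (@subsetT _ _)).
    by have /integrableP[/measurable_EFinP] := ida.
have mO := @strip_measurable _ 0 T f M cf.
apply: (@L2_cover _ _ U v mO (@strip_measurable _ 0 T f 0 cf) mU _ _ lP lU).
  move=> x [/andP[x1 x2] /andP[x3 x4]]; have [h|h] := ltP x.2 0; [left|right]; split; apply/andP; split => //.
  by apply: lt_le_trans h; rewrite oppr_lt0 divr_gt0.
by apply: measurable_funS meas_v => //; move=> x [_ /andP[]].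
Qed.

End Fun.
End Profile.

Section Density.
Variable R : realType.
Local Notation mu := (area R).
Local Notation leb := (@lebesgue_measure R).
Variables (f : R -> R) (T kap delta : R).
Hypotheses (T0 : 0 < T) (fT : periodic f T) (fge : forall t, -1 <= f t) (d0 : 0 < delta) (fd : forall t, f t < - delta).
Hypotheses (kap0 : 0 <= kap) (flip : forall s t, `|f s - f t| <= kap * `|s - t|).
Implicit Types (M : R) (N : nat).
Variables (v : R * R -> R) (G : R * R -> R * R).
Local Notation E := (above f).
Hypotheses (pv : periodic v (T, 0)) (wG : weak_grad E v G).
Hypotheses (lG1 : L2 mu (col E 0 T) (fun x => (G x).1)) (lG2 : L2 mu (col E 0 T) (fun x => (G x).2)).
Hypothesis lP : L2 mu (strip 0 T f 0) v.
Local Notation Om N M := (strip 0 (T * N%:R) f M).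

Let cf := f_continuous kap0 flip.
Let mE := above_measurable kap0 flip.

Lemma vG_L2_left N M : 0 < M -> let W := strip (- T) (T * N%:R) f M in
  [/\ L2 mu W v, L2 mu W (fun x => (G x).1) & L2 mu W (fun x => (G x).2)].
Proof.
move=> M0 W; have [p1 p2] := grad_ae_periodic fT kap0 flip pv wG.
have [g1 g2] := G_L2 kap0 flip lG1 lG2 M.
split; apply: (L2_Om_left T0 fT kap0 flip) => //.
- exact: meas_v wG.
- exact: v_ae_periodic.
- exact: (v_L2 T0 fT fge d0 fd kap0 flip pv wG lG1 lG2 lP M0).
- exact: meas_G1 wG.
- exact: meas_G2 wG.
Qed.

(* The closure of the window is included so that the approximants are periodic on the graph too. *)
Lemma density N M : 0 < M -> exists2 phi, apx (Om N M) v G phi &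
  forall n x, 0 <= x.1 -> x.1 + T <= T * N%:R -> f x.1 <= x.2 <= M -> phi n (x.1 + T, x.2) = phi n x.
Proof.
move=> M0; pose W := strip (- T) (T * N.+1%:R) f (M + 1).
have k1 : 0 <= kap + 1 by rewrite addr_ge0.
have M1 : 0 < M + 1 by rewrite addr_gt0.
have [l0 l1 l2] := vG_L2_left N.+1 M1.
have mW : measurable W by exact: strip_measurable.
have mV : measurable (Om N M) by exact: strip_measurable.
have [r Wr] := strip_sqf fge (- T) (T * N.+1%:R) (M + 1).
have TN : T * N%:R < T * N.+1%:R by rewrite ltr_pM2l // ltr_nat.
have MM : M < M + 1 by rewrite ltrDl.
have [n0 hn0] := kbox_strip T0 kap0 flip TN MM.
have VW : Om N M `<=` W.
  move=> x [/andP[x1 x2] /andP[x3 x4]]; split; apply/andP; split => //.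
  - by apply: lt_trans x1; rewrite oppr_lt0.
  - exact: lt_trans TN.
  - exact: lt_trans MM.
have WE : W `<=` E by move=> x [_ /andP[]].
exists (fun n => moll (kap + 1) (n + n0) (v \_ W)).
  apply: (apx_moll k1 mW Wr mV VW (weak_grad_restrict mE mW WE wG) l0 l1 l2) => n nn x [/andP[x1 x2] /andP[x3 x4]].
  by apply: hn0 => //; apply/andP; split; exact: ltW.
move=> n x x1 x2 x3; apply: (moll_periodic k1 mW (intg_restrict mW (L2_integrable mW Wr l0)) pv).
  apply: hn0; [exact: leq_addl|apply/andP; split => //|by []].
  by apply: le_trans x2; rewrite lerDl ltW.
apply: hn0; [exact: leq_addl|apply/andP; split => //=|by rewrite /= fT].
by rewrite addr_ge0 // ltW.
Qed.

(** The trace bound applied to the difference of two approximating sequences: the boundary limit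
    depends on the function alone, so a trace given by one sequence may be computed with a more
    convenient one. *)
Lemma tr_cvg_change b (h : R -> R) (phi psi : nat -> R * R -> R) : h = f \/ h = (fun=> 0) ->
  measurable_fun (`]0, T[%classic : set R) b ->
  apx (strip 0 T f 0) v G phi -> apx (strip 0 T f 0) v G psi -> tr_cvg T h psi b -> tr_cvg T h phi b.
Proof.
move=> hf mb aphi apsi tr.
have mS := @strip_measurable _ 0 T f 0 cf.
have [C C0 hC] := @trace_bound _ 0 T (-1) f cf fge delta d0.
have [s a0 a1 a2] := aphi; have [t b0 b1 b2] := apsi.
have ad := apxD mS aphi (apxZ (-1) mS apsi).
have [sd d0' _ d2] := ad.
have ch : continuous h by case: hf => ->; [exact: cf|exact: cst_continuous].
have q0 : Q mu (strip 0 T f 0) (fun x => phi n x + -1 * psi n x) @[n --> \oo] --> (0 : R).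
  have [_ _ c] := d0'; move: c; rewrite /Q; under eq_fun do under eq_Rintegral do rewrite [-1 * v _]mulN1r subrr subr0.
  by [].
have q2 : Q mu (strip 0 T f 0) ('D_e2 (fun x => phi n x + -1 * psi n x)) @[n --> \oo] --> (0 : R).
  have [_ _ c] := d2; move: c; rewrite /Q; under eq_fun do under eq_Rintegral do rewrite /= [-1 * (G _).2]mulN1r subrr subr0.
  by [].
have T1 n : tr2 0 T h (fun x => phi n x + -1 * psi n x) <= C * (Q mu (strip 0 T f 0) (fun x => phi n x + -1 * psi n x)
    + Q mu (strip 0 T f 0) ('D_e2 (fun x => phi n x + -1 * psi n x))).
  by have [h1 h2] := hC _ fd (sd n); case: hf => ->.
have cd n : continuous (fun x => phi n x + -1 * psi n x) by exact: smooth_continuous.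
have tz : ((tr2 0 T h (fun x => phi n x + -1 * psi n x))%:E @[n --> \oo] --> 0)%E.
  apply: cvg_EFin; first exact: nearW.
  apply: (cvg0_squeeze _ T1).
    by move=> n; apply: Rintegral_ge0 => x _; exact: sqr_ge0.
  by rewrite -[X in _ --> X](mulr0 C) -[in X in _ --> X](addr0 0); apply: cvgZr; exact: cvgD.
have mphi (q : R * R -> R) : continuous q -> measurable_fun (`]0, T[%classic : set R) (fun t => q (t, h t)).
  move=> cq; apply: measurable_funTS; apply: continuous_measurable_fun; exact: graph_continuous.
apply: (@tends0_le _ _ (fun n => (2%:E * ((tr2 0 T h (fun x => (phi n x + -1 * psi n x)%R))%:E + \int[leb]_(t in `]0%R, T[) ((psi n (t, h t) - b t) ^+ 2)%:E))%E)).
- by move=> n; apply: intE_ge0 => x _; exact: sqr_ge0.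
- move=> n; rewrite tr2E //; apply: int_sqr_add.
  + exact: measurable_itv.
  + by apply: measurable_funB => //; apply: mphi; exact: smooth_continuous.
  + exact: (mphi _ (cd n)).
  + by apply: measurable_funB => //; apply: mphi; exact: smooth_continuous.
  + by move=> x _; rewrite mulN1r addrA subrK.
- apply: tends0Z; apply: tends0D => //.
  + by move=> n; rewrite lee_fin; apply: Rintegral_ge0 => x _; exact: sqr_ge0.
  + by move=> n; apply: intE_ge0 => x _; exact: sqr_ge0.
Qed.

Lemma itv_split_le (q : R -> R) (a b c : R) : a <= b -> b <= c -> measurable_fun setT q -> (forall t, 0 <= q t) ->
  (\int[leb]_(t in `]a, c[) (q t)%:E <= \int[leb]_(t in `]a, b[) (q t)%:E + \int[leb]_(t in `]b, c[) (q t)%:E)%E.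
Proof.
move=> ab bc mq q0; have mq' D : measurable_fun D (EFin \o q) by apply/measurable_EFinP; exact: measurable_funTS.
rewrite (@ge0_negligible_integral _ _ _ leb _ _ _ (measurable_set1 b) (measurable_itv _) (mq' _)); last 2 first.
- by move=> x _; rewrite lee_fin.
- exact: lebesgue_measure_set1.
have mU : measurable (`]a, b[%classic `|` `]b, c[%classic : set R) by apply: measurableU; exact: measurable_itv.
have p0 (D : set R) t : D t -> (0 <= (EFin \o q) t)%E by rewrite lee_fin.
rewrite -[leRHS](@ge0_integral_setU _ _ _ leb _ _ (measurable_itv _) (measurable_itv _) _ (mq' _) (p0 _)).
  apply: ge0_subset_integral; [by apply: measurableD|exact: mU|exact: mq'|exact: p0|].
  move=> x [/= /[!in_itv]/= /andP[x1 x2] nb]; have [h|h|h] := ltgtP x b.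
  - by left; rewrite x1.
  - by right; rewrite x2.
  - by exfalso; apply: nb.
apply/disj_setPS => x [/= /[!in_itv]/= /andP[_ h1] /andP[h2 _]].
by have := lt_trans h1 h2; rewrite ltxx.
Qed.

(** For periodic approximants and a periodic limit the boundary error repeats in every period, so
    over N periods it is at most N times the error over one. *)
Lemma tr_cvg_periods N b (phi : nat -> R * R -> R) (M : R) : 0 < M -> (forall n, continuous (phi n)) ->
  (forall n x, 0 <= x.1 -> x.1 + T <= T * N%:R -> f x.1 <= x.2 <= M -> phi n (x.1 + T, x.2) = phi n x) ->
  continuous b -> periodic b T -> tr_cvg T f phi b -> tr_cvg (T * N%:R) f phi b.
Proof.
move=> M0 cphi pphi cb pb tr.
pose q n t : R := (phi n (t, f t) - b t) ^+ 2.
have cq n : continuous (q n).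
  by apply: sqr_continuous => t; apply: cvgB; [exact: (graph_continuous cf (cphi n))|exact: cb].
have mq n D : measurable_fun D (q n) by apply: measurable_funTS; exact: continuous_measurable_fun.
have q0 n t : 0 <= q n t by exact: sqr_ge0.
have qT n t : 0 <= t -> t + T <= T * N%:R -> q n (t + T) = q n t.
  move=> t0 tT; rewrite /q pb fT (pphi n (t, f t)) //=.
  by rewrite lexx /= (le_trans _ (ltW M0)) // ltW // (lt_trans (fd t)) // oppr_lt0.
have per n k : (k < N)%N -> (\int[leb]_(t in `](T * k%:R)%R, (T * k.+1%:R)%R[) (q n t)%:E = \int[leb]_(t in `]0%R, T[) (q n t)%:E)%E.
  elim: k => [|k IH] kN; first by rewrite mulr0 mulr1.
  rewrite -(IH (ltnW kN)).
  have := @int_itv_aff R 1 T (oner_neq0 R) (T * k%:R) (T * k.+1%:R) (q n) ltr01 (mq n _) (q0 n).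
  rewrite !mul1r mul1e -{2 4}[T]mulr1 -!mulrDr !natr1 => ->.
  apply: eq_integral => t; rewrite inE /= in_itv /= => /andP[t1 t2]; rewrite mul1r qT //.
    by apply: le_trans (ltW t1); rewrite mulr_ge0 // ltW.
  apply: (@le_trans _ _ (T * k.+2%:R)); first by rewrite -[k.+2%:R]natr1 mulrDr mulr1 lerD2r ltW.
  by rewrite ler_pM2l // ler_nat.
have tot n k : (k <= N)%N -> (\int[leb]_(t in `]0%R, (T * k%:R)%R[) (q n t)%:E <= k%:R%:E * \int[leb]_(t in `]0%R, T[) (q n t)%:E)%E.
  elim: k => [|k IH] kN; first by rewrite mulr0 set_itvoo0 integral_set0 mul0e.
  apply: (le_trans (@itv_split_le (q n) 0 (T * k%:R) (T * k.+1%:R) _ _ (mq n _) (q0 n))).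
  - by rewrite mulr_ge0 // ltW.
  - by rewrite ler_pM2l // ler_nat.
  - rewrite per // -natr1 EFinD ge0_muleDl ?lee_fin // mul1e leeD2r // IH //; exact: ltnW.
apply: (@tends0_le _ _ (fun n => (N%:R%:E * \int[leb]_(t in `]0%R, T[) (q n t)%:E)%E)).
- by move=> n; apply: intE_ge0 => x _; exact: q0.
- by move=> n; exact: tot.
- exact: tends0Z.
Qed.

End Density.

(** * The Wirtinger inequality *)

Section Wirtinger.
Variable R : realType.
Local Notation leb := (@lebesgue_measure R).
Implicit Types (a b p q l e t c : R) (F psi dpsi : R -> R).

Lemma ftc_on F (F' : R -> R) a b : a < b -> (forall t, a <= t <= b -> is_derive t 1 F (F' t)) -> 
  (forall t, a <= t <= b -> {for t, continuous F'}) ->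
  leb.-integrable `]a, b[ (EFin \o F') /\ \int[leb]_(t in `]a, b[) F' t = F b - F a.
Proof.
move=> ab dF cF'.
have cF t : a <= t <= b -> {for t, continuous F}.
  by move=> tab; apply/differentiable_continuous/derivable1_diffP; have [] := dF t tab.
have wF : {within `[a, b], continuous F'}.
  by apply: continuous_in_subspaceT => t; rewrite inE /= in_itv /=; exact: cF'.
have iF : leb.-integrable `[a, b] (EFin \o F') by apply: continuous_compact_integrable => //; exact: segment_compact.
have aab : a <= a <= b by rewrite lexx ltW.
have bab : a <= b <= b by rewrite lexx ltW.
have h : \int[leb]_(t in `[a, b]) F' t = F b - F a.
  rewrite /Rintegral (@continuous_FTC2 _ _ F) //.
  - split; [|exact/cvg_at_right_filter/cF|exact/cvg_at_left_filter/cF].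
    by move=> t; rewrite in_itv /= => /andP[t1 t2]; have [] := dF t (ltac:(by rewrite !ltW)).
  - move=> t; rewrite in_itv /= => /andP[t1 t2]; rewrite derive1E.
    by apply: (@derive_val _ _ _ _ _ _ _ (dF t _)); rewrite !ltW.
split; first by apply: integrableS iF => //; exact: subset_itv_oo_cc.
rewrite -h -Rintegral_itv_obnd_cbnd; last by apply: integrableS iF => //; exact: subset_itv_oc_cc.
rewrite Rintegral_itv_bndo_bndc //; apply: integrableS iF => //; exact: subset_itv_oo_cc.
Qed.

Lemma is_derive_tan_scale l e t : cos (l * (t - e)) != 0 ->
  is_derive t 1 (fun t => tan (l * (t - e))) (l * (1 + tan (l * (t - e)) ^+ 2)).
Proof.
move=> c0.
have h1 : is_derive t 1 (fun t => l * (t - e)) l.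
  have := is_derive_affine l (- (l * e)) t; congr (is_derive _ _ _ _).
  by apply/funext => s; rewrite mulrBr.
have h2 := is_derive_tan c0.
have := @is_derive1_comp _ (@tan R) (fun t => l * (t - e)) t _ _ h2 h1.
by rewrite -(cos2_tan2 c0) mulrC.
Qed.

Lemma cos_window l e t : 0 < l < 1 -> e - pi / 2 <= t <= e + pi / 2 -> cos (l * (t - e)) != 0.
Proof.
move=> /andP[l0 l1] /andP[t1 t2]; rewrite gt_eqF // cos_gt0_pihalf //.
have p0 : 0 < pi / 2 :> R by rewrite divr_gt0 ?pi_gt0.
have lp : l * (pi / 2) < pi / 2 by rewrite gtr_pMl.
have k1 : l * (t - e) <= l * (pi / 2) by rewrite ler_pM2l // lerBlDl.
have k2 : l * (- (pi / 2)) <= l * (t - e) by rewrite ler_pM2l //; lra.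
by apply/andP; split; lra.
Qed.

Lemma itvD a b (F H : R -> R) : leb.-integrable `]a, b[ (EFin \o F) -> leb.-integrable `]a, b[ (EFin \o H) ->
  \int[leb]_(t in `]a, b[) (F t + H t) = \int[leb]_(t in `]a, b[) F t + \int[leb]_(t in `]a, b[) H t.
Proof. by move=> i1 i2; apply: RintegralD => //; exact: measurable_itv. Qed.

Lemma itvB a b (F H : R -> R) : leb.-integrable `]a, b[ (EFin \o F) -> leb.-integrable `]a, b[ (EFin \o H) ->
  \int[leb]_(t in `]a, b[) (F t - H t) = \int[leb]_(t in `]a, b[) F t - \int[leb]_(t in `]a, b[) H t.
Proof. by move=> i1 i2; apply: RintegralB => //; exact: measurable_itv. Qed.

Lemma itvZ a b c F : leb.-integrable `]a, b[ (EFin \o F) ->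
  \int[leb]_(t in `]a, b[) (c * F t) = c * \int[leb]_(t in `]a, b[) F t.
Proof. by move=> i1; apply: RintegralZl => //; exact: measurable_itv. Qed.

(** Integrates the derivative of l g psi^2 with g(t) = tan(l (t - e)). As g' = l (1 + g^2), the
    difference of the integrands is the square of psi' + l g psi. The bound l < 1 keeps the cosine
    positive on a window of half-length pi / 2, ends included. *)
Lemma tan_ineq l e p q psi dpsi : 0 < l < 1 -> p <= q -> e - pi / 2 <= p -> q <= e + pi / 2 ->
  (forall t : R, is_derive t 1 psi (dpsi t)) -> continuous dpsi ->
  l ^+ 2 * \int[leb]_(t in `]p, q[) (psi t ^+ 2) <= \int[leb]_(t in `]p, q[) (dpsi t ^+ 2)
    + l * tan (l * (q - e)) * psi q ^+ 2 - l * tan (l * (p - e)) * psi p ^+ 2.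
Proof.
move=> l01 pq ep qe dps cdps; move: pq; rewrite le_eqVlt => /predU1P[<-|pq].
  by rewrite set_itvoo0 !Rintegral_set0 mulr0 add0r subrr.
have cps : continuous psi by move=> t; apply/differentiable_continuous/derivable1_diffP; have [] := dps t.
pose g t := tan (l * (t - e)).
pose F t := l * g t * psi t ^+ 2.
pose F' t := l * (l * (1 + g t ^+ 2)) * psi t ^+ 2 + l * g t * (2 * psi t * dpsi t).
have win t : p <= t <= q -> e - pi / 2 <= t <= e + pi / 2 by move=> /andP[? ?]; apply/andP; split; lra.
have dg t : p <= t <= q -> is_derive t 1 g (l * (1 + g t ^+ 2)).
  by move=> /win tw; apply: is_derive_tan_scale; exact: cos_window.
have cg t : p <= t <= q -> {for t, continuous g}.
  by move=> tpq; apply/differentiable_continuous/derivable1_diffP; have [] := dg t tpq.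
have dF t : p <= t <= q -> is_derive t 1 F (F' t).
  move=> /dg hg; have hp := dps t.
  rewrite /F; under eq_fun do rewrite expr2.
  apply: is_derive_eq; rewrite /F' /GRing.scale /=; ring.
have cF' t : p <= t <= q -> {for t, continuous F'}.
  move=> tpq; have c1 := cg t tpq.
  apply: cvgD.
    apply: cvgM; last by apply: cvgM; exact: cps.
    apply: cvgM; first exact: cvg_cst.
    apply: cvgM; first exact: cvg_cst.
    by apply: cvgD; [exact: cvg_cst|apply: cvgM; exact: c1].
  apply: cvgM; first by apply: cvgM; [exact: cvg_cst|exact: c1].
  by apply: cvgM; [apply: cvgM; [exact: cvg_cst|exact: cps]|exact: cdps].
have [iF eF] := ftc_on pq dF cF'.
have i1 := continuous_itv_integrable p q (sqr_continuous cps).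
have i2 := continuous_itv_integrable p q (sqr_continuous cdps).
have mpq : measurable (`]p, q[%classic : set R) by exact: measurable_itv.
rewrite -addrA -[X in _ + X]eF -(itvD i2 iF) -(itvZ (l ^+ 2) i1).
apply: le_Rintegral => //.
- exact: (@integrable_scale _ _ _ leb _ mpq _ _ i1).
- exact: (@integrable_add _ _ _ leb _ mpq _ _ i2 iF).
- move=> t _; rewrite /F'; have := sqr_ge0 (dpsi t + l * g t * psi t); nra.
Qed.

Lemma itv_split F a b c : a <= b -> b <= c -> continuous F ->
  \int[leb]_(t in `]a, c[) F t = \int[leb]_(t in `]a, b[) F t + \int[leb]_(t in `]b, c[) F t.
Proof.
move=> ab bc cF; have iF x y := continuous_itv_integrable x y cF.
have eU : `]a, c[%classic `\ b = `]a, b[%classic `|` `]b, c[%classic :> set R.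
  apply/seteqP; split => x.
    move=> [/= /[!in_itv]/= /andP[x1 x2] nb]; have [h|h|h] := ltgtP x b.
    - by left; rewrite x1.
    - by right; rewrite x2.
    - by exfalso; apply: nb.
  move=> [] /= /[!in_itv]/= /andP[x1 x2]; split; rewrite ?x1 ?x2 ?andbT //=.
  - exact: lt_le_trans bc.
  - by move=> h; move: x2; rewrite h ltxx.
  - exact: le_lt_trans x1.
  - by move=> h; move: x1; rewrite h ltxx.
have mb : measurable ([set b] : set R) by exact: measurable_set1.
have iU : leb.-integrable (`]a, b[%classic `|` `]b, c[%classic) (EFin \o F).
  by rewrite -eU; apply: (integrableS _ _ _ (iF a c)) => //; exact: measurableD.
have dis : [disjoint `]a, b[%classic & `]b, c[%classic : set R].
  apply/disj_setPS => x [/= /[!in_itv]/= /andP[_ h1] /andP[h2 _]].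
  by have := lt_trans h1 h2; rewrite ltxx.
rewrite -(@Rintegral_setU _ _ _ leb _ _ _ (measurable_itv _) (measurable_itv _) iU dis) -eU /Rintegral; congr fine.
apply: (@negligible_integral _ _ _ leb _ _ _ mb (measurable_itv _) (iF a c)).
exact: lebesgue_measure_set1.
Qed.

(** The limit l -> 1 by a single choice l = 1 - t with t A = (A - B) / 4: then l^2 A >= A - (A - B)
    / 2, which exceeds B if A does. *)
Lemma shrink (A B : R) : (forall l, 0 < l < 1 -> l ^+ 2 * A <= B) -> A <= B.
Proof.
move=> h; rewrite leNgt; apply/negP => BA.
have B0 : 0 <= A.
  have := h 2^-1 (ltac:(apply/andP; split; lra)); lra.
have A0 : 0 < A.
  rewrite lt_neqAle B0 andbT; apply/negP => /eqP A0; have := h 2^-1 (ltac:(apply/andP; split; lra)); rewrite -A0; lra.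
have B1 : 0 <= B by have := h 2^-1 (ltac:(apply/andP; split; lra)); nra.
pose t := (A - B) / (4 * A).
have tA : t * A = (A - B) / 4 by rewrite /t; field; rewrite gt_eqF.
have t0 : 0 < t by rewrite divr_gt0 //; lra.
have t1 : t < 1 by rewrite /t ltr_pdivrMr; lra.
have := h (1 - t) (ltac:(apply/andP; split; lra)); have := sqr_ge0 t; nra.
Qed.

(** Some [a] satisfies psi(a + pi) = psi(a); subtracting this common value produces two zeros at
    distance pi, and [tan_ineq] is applied on three windows delimited by them. The bound then passes
    from this constant to the mean, which minimizes the square integral. *)
Lemma wirtinger psi dpsi c : (forall t : R, is_derive t 1 psi (dpsi t)) -> continuous dpsi -> psi 0 = psi (2 * pi) ->
  c * (2 * pi) = \int[leb]_(t in `]0, 2 * pi[) psi t ->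
  \int[leb]_(t in `]0, 2 * pi[) ((psi t - c) ^+ 2) <= \int[leb]_(t in `]0, 2 * pi[) (dpsi t ^+ 2).
Proof.
move=> dps cdps per hc; have p0 := @pi_gt0 R.
have cps : continuous psi by move=> t; apply/differentiable_continuous/derivable1_diffP; have [] := dps t.
(* By periodicity psi(t + pi) - psi(t) takes opposite values at 0 and at pi, so it vanishes
   somewhere between them. *)
have [a a0p ea] : exists2 a, 0 <= a <= pi & psi (a + pi) = psi a.
  have cd : continuous (fun t => psi (t + pi) - psi t).
    move=> t; apply: cvgB; last exact: cps.
    apply: (@continuous_comp _ _ _ (fun t => t + pi) psi); last exact: cps.
    by apply: cvgD; [exact: cvg_id|exact: cvg_cst].
  have [|a] := @IVT R (fun t => psi (t + pi) - psi t) 0 pi 0 (ltW p0) (continuous_subspaceT cd).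
    rewrite add0r (_ : pi + pi = 2 * pi); last by lra.
    rewrite -per -[psi 0 - psi pi]opprB; set d := psi pi - psi 0.
    rewrite ge_min le_max; have [d0|/ltW d0] := leP 0 d.
      by rewrite [- d <= 0]oppr_le0 d0 orbT.
    by rewrite [0 <= - d]oppr_ge0 d0 orbT.
  by rewrite in_itv /= => aa /eqP; rewrite subr_eq0 => /eqP h; exists a.
have /andP[a0 ap] := a0p.
pose k := psi a.
have dk t : is_derive t 1 (fun t => psi t - k) (dpsi t).
  by rewrite -[X in is_derive _ _ _ X]subr0; apply: is_deriveB.
have ck : continuous (fun t => psi t - k) by move=> t; apply: cvgB; [exact: cps|exact: cvg_cst].
have main : \int[leb]_(t in `]0, 2 * pi[) ((psi t - k) ^+ 2) <= \int[leb]_(t in `]0, 2 * pi[) (dpsi t ^+ 2).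
  apply: shrink => l l01.
  have split3 (F : R -> R) : continuous F -> \int[leb]_(t in `]0, 2 * pi[) F t = \int[leb]_(t in `]0, a[) F t +
      (\int[leb]_(t in `]a, a + pi[) F t + \int[leb]_(t in `](a + pi), 2 * pi[) F t).
    move=> cF; rewrite (itv_split a0 _ cF); last by lra.
    by congr (_ + _); apply: itv_split cF; lra.
  rewrite (split3 _ (sqr_continuous ck)) (split3 _ (sqr_continuous cdps)).
  have t1 := @tan_ineq l (a - pi / 2) 0 a _ _ l01 a0 (ltac:(lra)) (ltac:(lra)) dk cdps.
  have t2 := @tan_ineq l (a + pi / 2) a (a + pi) _ _ l01 (ltac:(lra)) (ltac:(lra)) (ltac:(lra)) dk cdps.
  have t3 := @tan_ineq l (a + pi + pi / 2) (a + pi) (2 * pi) _ _ l01 (ltac:(lra)) (ltac:(lra)) (ltac:(lra)) dk cdps.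
  (* The boundary terms at a and a + pi vanish with psi - k. Those at 0 and 2 pi cancel: the outer
     windows are centred so that the two tangents coincide, and psi has equal values there. *)
  move: t1 t2 t3; rewrite ea subrr expr0n /= !mulr0 !addr0 !subr0 -per.
  have -> : 2 * pi - (a + pi + pi / 2) = - (a - pi / 2) :> R by lra.
  have -> : 0 - (a - pi / 2) = - (a - pi / 2) :> R by lra.
  lra.
apply: le_trans main.
have i0 := continuous_itv_integrable 0 (2 * pi) cps.
have cc : continuous (fun t => psi t - c) by move=> t; apply: cvgB; [exact: cps|exact: cvg_cst].
have m0 : measurable (`]0, 2 * pi[%classic : set R) by exact: measurable_itv.
have i1 := continuous_itv_integrable 0 (2 * pi) (sqr_continuous cc).
have i2 := continuous_itv_integrable 0 (2 * pi) cc.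
have ic (x : R) := continuous_itv_integrable 0 (2 * pi) (@cst_continuous R R x).
have len (x : R) : \int[leb]_(t in `]0, 2 * pi[) (fun=> x) t = x * (2 * pi).
  have := @ftc1 R (fun t => x * t + 0) (fun=> x) 0 (2 * pi) (ltac:(by rewrite mulr_gt0)) (is_derive_affine x 0) (@cst_continuous R R x).
  by move=> ->; rewrite mulr0 !addr0 subr0.
have z : \int[leb]_(t in `]0, 2 * pi[) (psi t - c) = 0.
  by rewrite (itvB i0 (ic c)) len -hc subrr.
have -> : \int[leb]_(t in `]0, 2 * pi[) ((psi t - k) ^+ 2) = \int[leb]_(t in `]0, 2 * pi[) ((psi t - c) ^+ 2)
   + 2 * (c - k) * \int[leb]_(t in `]0, 2 * pi[) (psi t - c) + \int[leb]_(t in `]0, 2 * pi[) (fun=> (c - k) ^+ 2) t.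
  rewrite -(itvZ _ i2) -(itvD i1 (@integrable_scale _ _ _ leb _ m0 _ _ i2)).
  rewrite -(itvD (@integrable_add _ _ _ leb _ m0 _ _ i1 (@integrable_scale _ _ _ leb _ m0 _ _ i2)) (ic _)).
  by apply: eq_Rintegral => t _; ring.
by rewrite z mulr0 addr0 len lerDl mulr_ge0 ?sqr_ge0 // mulr_ge0 // ltW.
Qed.

(** Slices of approximants have their mean only close to the prescribed constant; the last term is
    the exact cost of replacing the mean by [c]. *)
Lemma wirtinger_gen psi dpsi c : (forall t : R, is_derive t 1 psi (dpsi t)) -> continuous dpsi -> psi 0 = psi (2 * pi) ->
  \int[leb]_(t in `]0, 2 * pi[) ((psi t - c) ^+ 2) <= \int[leb]_(t in `]0, 2 * pi[) (dpsi t ^+ 2) +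
    (\int[leb]_(t in `]0, 2 * pi[) psi t - c * (2 * pi)) ^+ 2 / (2 * pi).
Proof.
move=> dps cdps per; have p0 : 0 < 2 * pi :> R by rewrite mulr_gt0 ?pi_gt0.
set I := \int[leb]_(t in `]0, 2 * pi[) psi t; pose m := I / (2 * pi).
have mI : m * (2 * pi) = I by rewrite /m mulfVK // gt_eqF.
have cps : continuous psi by move=> t; apply/differentiable_continuous/derivable1_diffP; have [] := dps t.
have W := wirtinger dps cdps per mI.
have cm : continuous (fun t => psi t - m) by move=> t; apply: cvgB; [exact: cps|exact: cvg_cst].
have i1 := continuous_itv_integrable 0 (2 * pi) (sqr_continuous cm).
have i2 := continuous_itv_integrable 0 (2 * pi) cps.
have ic (x : R) := continuous_itv_integrable 0 (2 * pi) (@cst_continuous R R x).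
have len (x : R) : \int[leb]_(t in `]0, 2 * pi[) (fun=> x) t = x * (2 * pi).
  have := @ftc1 R (fun t => x * t + 0) (fun=> x) 0 (2 * pi) p0 (is_derive_affine x 0) (@cst_continuous R R x).
  by move=> ->; rewrite mulr0 !addr0 subr0.
have e : \int[leb]_(t in `]0, 2 * pi[) ((psi t - c) ^+ 2) = \int[leb]_(t in `]0, 2 * pi[) ((psi t - m) ^+ 2)
   + 2 * (m - c) * \int[leb]_(t in `]0, 2 * pi[) psi t + \int[leb]_(t in `]0, 2 * pi[) (fun=> c ^+ 2 - m ^+ 2) t.
  have mitv : measurable (`]0, 2 * pi[%classic : set R) by exact: measurable_itv.
  have i3 := @integrable_scale _ _ _ leb _ mitv (2 * (m - c)) _ i2.
  rewrite -(itvZ _ i2) -(itvD i1 i3).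
  rewrite -(itvD (@integrable_add _ _ _ leb _ mitv _ _ i1 i3) (ic _)).
  by apply: eq_Rintegral => t _; ring.
rewrite e len -/I -addrA; apply: lerD; first exact: W.
rewrite -mI le_eqVlt; apply/orP; left; apply/eqP; move: p0; generalize m; generalize (2 * pi : R) => q y q0.
by field; rewrite gt_eqF.
Qed.

Lemma slice_ge0 a b c d (F : R * R -> R) : continuous F ->
  (forall t, c < t < d -> 0 <= \int[leb]_(s in `]a, b[) F (s, t)) ->
  0 <= \int[area R]_(x in strip a b (fun=> c) d) F x.
Proof.
move=> cF h; have mS := @strip_measurable R a b (fun=> c) d (@cst_continuous R R c).
have [r Sr] := @strip_sq R a b (fun=> c) d c (fun=> lexx c).
rewrite Rintegral_mkcond (fubini21 (bbs_restrict cF mS Sr)).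
apply: Rintegral_ge0 => t _.
have [tcd|tcd] := boolP (c < t < d); last first.
  apply: Rintegral_ge0 => s _; rewrite patch_out // => -[_ /= st]; by rewrite st in tcd.
have := h t tcd; rewrite [X in 0 <= X -> _]Rintegral_mkcond; congr (0 <= _).
apply: eq_Rintegral => s _; rewrite /patch.
case: ifPn => sA; case: ifPn => sB //.
- exfalso; move/negP: sB; apply; rewrite inE; split => //=.
  by move: sA; rewrite inE /= in_itv.
- exfalso; move/negP: sA; apply; rewrite inE /= in_itv /=.
  by move: sB; rewrite inE => -[].
Qed.

End Wirtinger.

(** * Smooth approximations of the positive part *)

Section Ramp.
Variable R : realType.
Implicit Types (n : nat) (y : R).

(** A smooth version of max(y, 0). Its derivative [dramp] is bounded uniformly in n and converges at
    every point to the indicator of y > 0, so dominated convergence applies. *)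
Definition ramp n y : R := y * step (n.+1%:R * y).
Definition dramp n y : R := step (n.+1%:R * y) + n.+1%:R * y * dstep (n.+1%:R * y).

Lemma ramp_smooth n : smooth1 (ramp n).
Proof.
apply: smooth1M; first exact: smooth1_id.
have := smooth1_comp (@step_smooth R) (smooth1_affine (n.+1%:R : R) 0).
by under eq_fun do rewrite addr0.
Qed.

Lemma derive1_ramp n : derive1 (ramp n) = dramp n.
Proof.
apply/funext => y; rewrite derive1E.
have h1 : is_derive y 1 (fun y => n.+1%:R * y) (n.+1%:R : R).
  by have := is_derive_affine (n.+1%:R : R) 0 y; under eq_fun do rewrite addr0.
have h2 : is_derive y 1 (fun y => step (n.+1%:R * y)) (n.+1%:R * dstep (n.+1%:R * y)).
  have := @is_derive1_comp _ (@step R) (fun y => n.+1%:R * y) y _ _ (is_derive_step _) h1.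
  by rewrite mulrC.
have h3 : is_derive y 1 (fun y : R => y) 1 by exact: is_derive_id.
apply: derive_val; rewrite /ramp; apply: is_derive_eq; rewrite /dramp /GRing.scale /=; ring.
Qed.

Lemma ramp_le0 n y : y <= 0 -> ramp n y = 0.
Proof. by move=> y0; rewrite /ramp step_le0 ?mulr0 // pmulr_rle0. Qed.

Lemma dramp_le0 n y : y <= 0 -> dramp n y = 0.
Proof. by move=> y0; have h : n.+1%:R * y <= 0 by [rewrite pmulr_rle0]; rewrite /dramp step_le0 // dstep_out ?mulr0 ?addr0 //; left. Qed.

Lemma dramp_ge n y : 1 <= n.+1%:R * y -> dramp n y = 1.
Proof. by move=> y1; rewrite /dramp step_ge1 // dstep_out ?mulr0 ?addr0 //; right. Qed.

Lemma dramp_ge1 n y : 1 <= y -> dramp n y = 1.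
Proof.
by move=> y1; apply: dramp_ge; rewrite (le_trans y1) // ler_peMl ?(le_trans ler01) // ler1n.
Qed.

Lemma dramp_bound : exists2 K : R, 0 < K & forall n y, `|dramp n y| <= K.
Proof.
have [K K0 hK] := @dstep_bounded R; exists (1 + K); first by rewrite addr_gt0.
move=> n y; rewrite /dramp; set z := n.+1%:R * y.
have [z0|z0] := leP z 0.
  by rewrite step_le0 // dstep_out ?mulr0 ?addr0 ?normr0; [rewrite addr_ge0 // ltW|left].
have [z1|/ltW z1] := leP 1 z.
  by rewrite step_ge1 // dstep_out ?mulr0 ?addr0 ?normr1; [rewrite lerDl ltW|right].
rewrite ger0_norm; last by rewrite addr_ge0 ?step_ge0 // mulr_ge0 ?dstep_ge0 // ltW.
apply: lerD; first exact: step_le1.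
by rewrite -[leRHS]mul1r ler_pM ?dstep_ge0 // ltW.
Qed.

Lemma dramp_cvg y : dramp n y @[n --> \oo] --> (if 0 < y then 1 else 0 : R).
Proof.
have [y0|y0] := ltP 0 y; last by under eq_fun do rewrite dramp_le0 //; exact: cvg_cst.
apply: cvg_near_cst; near=> n; apply: dramp_ge.
rewrite -ler_pdivrMr // mul1r; apply: ltW; rewrite -[n.+1%:R]natr1.
apply: (@lt_trans _ _ (n%:R : R)); last by rewrite ltrDl.
near: n; exact: nbhs_infty_gtr.
Unshelve. all: by end_near.
Qed.
End Ramp.

(** * Exponential decay of cell functions *)

Section Misc.
Variable R : realType.
Local Notation mu := (area R).
Local Notation leb := (@lebesgue_measure R).
Implicit Types (v w g F : R * R -> R) (G H : R * R -> R * R) (D A : set (R * R)).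

Lemma sqr_continuous2 F : continuous F -> continuous (fun x => F x ^+ 2).
Proof. by move=> cF x; rewrite /=; under eq_fun do rewrite expr2; apply: cvgM; exact: cF. Qed.

Lemma loc_integrable_eq D v w : (forall x, D x -> v x = w x) -> loc_integrable D v -> loc_integrable D w.
Proof.
move=> vw [mv iv]; split; first by apply: eq_measurable_fun mv => x; rewrite inE => /vw.
move=> K cK KD; have mK : measurable K by exact: closed_measurable2 (compact_closed2 cK).
apply: (@eq_integrable _ _ _ mu K mK (EFin \o v) (EFin \o w) _ (iv K cK KD)) => x; rewrite inE => Kx.
by rewrite /= vw //; exact: KD.
Qed.

Lemma weak_grad_eq D v w G H : (forall x, D x -> v x = w x) -> (forall x, D x -> G x = H x) ->
  weak_grad D v G -> weak_grad D w H.
Proof.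
move=> vw GH [l0 l1 l2 h]; split.
- exact: loc_integrable_eq vw l0.
- by apply: loc_integrable_eq l1 => x /GH ->.
- by apply: loc_integrable_eq l2 => x /GH ->.
- move=> phi tp; have [h1 h2] := h phi tp; split.
    rewrite -(@Rint_eq _ D (fun x => v x * 'D_e1 phi x)) ?h1; last by move=> x /vw ->.
    by congr (- _); apply: Rint_eq => x /GH ->.
  rewrite -(@Rint_eq _ D (fun x => v x * 'D_e2 phi x)) ?h2; last by move=> x /vw ->.
  by congr (- _); apply: Rint_eq => x /GH ->.
Qed.

Lemma weak_grad_snd D (g : R -> R) : measurable D -> smooth1 g ->
  weak_grad D (fun x => g x.2) (fun x => (0, derive1 g x.2)).
Proof.
move=> mD sg; apply: (weak_grad_eq (fun x _ => erefl) _ (weak_grad_smooth mD (smooth_snd sg))) => x _.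
by rewrite /grad D1_snd D2_snd.
Qed.

Lemma L2_supp D A w : measurable D -> measurable A -> A `<=` D -> measurable_fun D w ->
  (forall x, D x -> ~ A x -> w x = 0) -> L2 mu A w -> L2 mu D w.
Proof.
move=> mD mA AD mw w0 [_ iw]; split => //.
by rewrite (int_supp AD) // => x Dx Ax; rewrite (w0 x) // expr0n.
Qed.

Lemma measurable_snd_fun D (g : R -> R) : measurable D -> continuous g -> measurable_fun D (fun x : R * R => g x.2).
Proof.
move=> mD cg; apply: continuous_measurable_funS2 => // x; apply: continuous_comp; [exact: cvg_snd|exact: cg].
Qed.

Lemma trace_smooth0 D (l : R) (h : R -> R) v F : open D -> smooth F -> (forall x, D x -> v x = F x) ->
  (forall t, F (t, h t) = 0) -> has_trace D l h v (fun=> 0).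
Proof.
move=> oD sF vF F0; have mD := open_measurable2 oD.
split; first exact: measurable_cst.
exists (fun=> F); split => //.
  have w0 : weak_grad D (fun x => F x - v x) (fun=> (0, 0)).
    have := weak_gradZ 0 mD (weak_grad_cst1 mD); apply: weak_grad_eq => x Dx /=; last by rewrite mulr0.
    by rewrite mul0r vF // subrr.
  have -> : H1norm D (fun x => F x - v x) = 0%E; last exact: cvg_cst.
  rewrite (H1normE oD w0) (_ : E1 _ _ _ = 0%E) ; last first.
    rewrite /E1 -(@integral0 _ _ _ mu D); apply: eq_integral => x; rewrite inE => Dx.
    by rewrite /dot /= vF // subrr expr0n /= !mulr0 !addr0.
  by rewrite /= powR12_sqrt // sqrtr0.
rewrite (_ : (fun=> _) = (fun=> 0%E)); first exact: cvg_cst.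
apply/funext => n; rewrite (eq_integral (fun=> 0%E)) ?integral0 // => t _.
by rewrite F0 subrr expr0n.
Qed.

Lemma hline_null (c : R) : mu [set x : R * R | x.2 = c] = 0%E.
Proof.
have -> : [set x : R * R | x.2 = c] = setT `*` [set c].
  by apply/seteqP; split => x /=; [move=> ->; split|move=> []].
by rewrite product_measure1E //= lebesgue_measure_set1 mule0.
Qed.

Lemma Rint_hline D (c : R) v : measurable D -> mu.-integrable D (EFin \o v) ->
  \int[mu]_(x in D) v x = \int[mu]_(x in D `\` [set x | x.2 = c]) v x.
Proof.
move=> mD iv; rewrite /Rintegral; congr fine.
apply: (@negligible_integral _ _ _ mu _ _ _ _ mD iv (hline_null c)).
apply: closed_measurable2.
have -> : [set x : R * R | x.2 = c] = snd @^-1` [set c] by [].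
by apply: closed_comp; [move=> x _; exact: cvg_snd|exact: closed_eq].
Qed.

Lemma tr_cvgL2 (l : R) (h b : R -> R) (phi : nat -> R * R -> R) : continuous h -> (forall n, continuous (phi n)) ->
  measurable_fun (`]0, l[%classic : set R) b -> tr_cvg l h phi b ->
  cvgL2 leb `]0, l[ (fun n t => phi n (t, h t)) b.
Proof.
move=> ch cp mb tr; have mI : measurable (`]0, l[%classic : set (measurableTypeR R)) by exact: measurable_itv.
have lp n : L2 leb `]0, l[ (fun t => phi n (t, h t)).
  split; first by apply: measurable_funTS; apply: continuous_measurable_fun; exact: graph_continuous.
  by rewrite -tr2E // ltry.
have d0 n : (0 <= \int[leb]_(t in `]0%R, l[) ((phi n (t, h t) - b t) ^+ 2)%:E)%E by apply: intE_ge0 => t _; exact: sqr_ge0.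
have [n _ /(_ n (leqnn n)) hn] := (tends0P d0).1 tr 1 ltr01.
have lb : L2 leb `]0, l[ b.
  have ld : L2 leb `]0, l[ (fun t => phi n (t, h t) - b t).
    split; last by apply: le_lt_trans hn _; rewrite ltry.
    by apply: measurable_funB => //; have [] := lp n.
  have := L2B mI (lp n) ld; congr (L2 _ _ _); apply/funext => t; by rewrite opprB addrC subrK.
by apply/(cvgL2_eqE mI lp lb).
Qed.

End Misc.

(** * Flux, slice means and Wirtinger's inequality on the cell *)

Section Cell.
Variable R : realType.
Local Notation mu := (area R).
Local Notation leb := (@lebesgue_measure R).
Variables (f : R -> R) (kap delta : R).
Local Notation T := (2 * pi).
Hypotheses (fT : periodic f T) (fge : forall t, -1 <= f t) (d0 : 0 < delta) (fd : forall t, f t < - delta).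
Hypotheses (kap0 : 0 <= kap) (flip : forall s t, `|f s - f t| <= kap * `|s - t|).
Implicit Types (M c s y : R) (n : nat).
Variables (v : R * R -> R) (G : R * R -> R * R).
Local Notation E := (above f).
Hypotheses (pv : periodic v (T, 0)) (wG : weak_grad E v G).
Local Notation G1 := (fun x => (G x).1).
Local Notation G2 := (fun x => (G x).2).
Hypotheses (lG1 : L2 mu (col E 0 T) G1) (lG2 : L2 mu (col E 0 T) G2).
Hypothesis lP : L2 mu (strip 0 T f 0) v.
Hypothesis test : forall phi H, periodic phi (T, 0) -> weak_grad E phi H ->
  L2 mu (col E 0 T) (fun x => (H x).1) -> L2 mu (col E 0 T) (fun x => (H x).2) ->
  has_trace (cell_P f) T f phi (fun=> 0) -> \int[mu]_(x in col E 0 T) dot (G x) (H x) = 0.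
Variables (b : R -> R) (psi : nat -> R * R -> R) (vbar : R).
Hypotheses (mb : measurable_fun (`]0, T[%classic : set R) b) (apsi : apx (strip 0 T f 0) v G psi)
  (trb : tr_cvg T (fun=> 0) psi b) (vbarE : vbar * T = \int[leb]_(t in `]0, T[) b t).

Let T0 : 0 < T :> R. Proof. by rewrite mulr_gt0 ?pi_gt0. Qed.
Let cf : continuous f := f_continuous kap0 flip.
Let mE : measurable E := above_measurable kap0 flip.
Let mC : measurable (col E 0 T). Proof. exact: col_measurable. Qed.
Let mR c M : measurable (strip 0 T (fun=> c) M). Proof. by apply: strip_measurable; exact: cst_continuous. Qed.

Let RC c M : 0 <= c -> strip 0 T (fun=> c) M `<=` col E 0 T.
Proof.
move=> c0 x [x1 /= /andP[x2 _]]; split=> //; rewrite /above /=.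
by apply: lt_trans (fd _) _; apply: lt_trans x2; apply: lt_le_trans c0; rewrite oppr_lt0.
Qed.

Lemma cell_P_open : open (cell_P f).
Proof. exact: (@strip_open R 0 T f 0 cf). Qed.

Lemma test_vert (g : R -> R) : smooth1 g -> (forall y, y <= 0 -> g y = 0) ->
  L2 mu (col E 0 T) (fun x => derive1 g x.2) -> \int[mu]_(x in col E 0 T) ((G x).2 * derive1 g x.2) = 0.
Proof.
move=> sg g0 lg.
have := test (phi := fun x => g x.2) (H := fun x => (0, derive1 g x.2)).
have -> : \int[mu]_(x in col E 0 T) dot (G x) (0, derive1 g x.2) = \int[mu]_(x in col E 0 T) ((G x).2 * derive1 g x.2).
  by apply: Rint_eq => x _; rewrite /dot /= mulr0 add0r.
apply => //.
- by move=> x /=; rewrite addr0.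
- exact: weak_grad_snd.
- split; first exact: measurable_cst.
  by under eq_integral do rewrite expr0n; rewrite integral0 ltry.
- apply: (@trace_smooth0 _ _ _ _ _ (fun=> 0) cell_P_open); [exact: smooth_cst| |by []].
  by move=> x [_ /andP[_ /ltW]]; exact: g0.
Qed.

Lemma G2_int c M : 0 <= c -> mu.-integrable (strip 0 T (fun=> c) M) (EFin \o G2).
Proof.
move=> c0; have [r hr] := @strip_sq R 0 T (fun=> c) M c (fun=> lexx c).
exact: (L2_integrable (mR c M) hr (A.L2S mC (mR c M) (RC c0) lG2)).
Qed.

(** A difference of two ramps, started at 0 and at s, vanishes below height 0 and is constant above
    s + 1, hence admissible. Its derivative tends to the indicator of 0 < y <= s, and the line y = s
    is a null set. *)
Lemma flux s : 0 < s -> \int[mu]_(x in strip 0 T (fun=> 0) s) (G x).2 = 0.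
Proof.
move=> s0; have [K K0 hK] := @dramp_bound R.
pose g n (y : R) := ramp n y - ramp n (1 * y + - s).
pose g' n (y : R) := dramp n y - dramp n (y - s).
have sg n : smooth1 (g n).
  apply: smooth1B; first exact: ramp_smooth.
  by apply: (@smooth1_comp R (ramp n) (fun y => 1 * y + - s)); [exact: ramp_smooth|exact: smooth1_affine].
have dg n y : derive1 (g n) y = g' n y.
  rewrite derive1E; apply: derive_val; apply: is_deriveB.
    by have := smooth1_derive (ramp_smooth R n) y; rewrite (derive1_ramp R n).
  have := smooth1_derive (smooth1_comp (ramp_smooth R n) (smooth1_affine 1 (- s))) y.
  by rewrite derive1_affine_comp ?derive1_ramp ?mul1r //; exact: ramp_smooth.
pose D := strip 0 T (fun=> 0) (s + 1).
have mD : measurable D by exact: mR.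
have DC : D `<=` col E 0 T by exact: RC.
have g0 n y : y <= 0 -> g n y = 0.
  by move=> y0; rewrite /g !ramp_le0 ?subrr // mul1r; move: s0 y0; lra.
have g'0 n x : col E 0 T x -> ~ D x -> g' n x.2 = 0.
  move=> [x1 x2] nD; rewrite /g'; have [y0|y0] := leP x.2 0.
    by rewrite !dramp_le0 ?subrr //; move: s0 y0; lra.
  have [y1|y1] := ltP x.2 (s + 1); last by rewrite !dramp_ge1 ?subrr //; move: s0 y1; lra.
  by exfalso; apply: nD; split => //=; rewrite y0.
have bg n y : `|g' n y| <= 2 * K.
  by rewrite (le_trans (ler_normB _ _)) // mulr2n mulrDl mul1r lerD.
have cg n : continuous (g' n).
  have -> : g' n = derive1 (g n) by apply/funext => y; rewrite dg.
  exact: smooth1_continuous (smooth1_derive1 (sg n)).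
have mg n A : measurable A -> measurable_fun A (fun x : R * R => g' n x.2) by move=> mA; exact: measurable_snd_fun.
have [r hr] := @strip_sq R 0 T (fun=> 0) (s + 1) 0 (fun=> lexx 0).
have lg n : L2 mu (col E 0 T) (fun x => derive1 (g n) x.2).
  have -> : (fun x : R * R => derive1 (g n) x.2) = (fun x => g' n x.2) by apply/funext => x; rewrite dg.
  apply: (L2_supp mC mD DC (mg n _ mC) (g'0 n)).
  apply: (@continuous_L2 R (fun x => g' n x.2) D r) => // x.
  by apply: continuous_comp; [exact: cvg_snd|exact: cg].
have z n : \int[mu]_(x in D) ((G x).2 * g' n x.2) = 0.
  rewrite -(test_vert (sg n) (g0 n) (lg n)).
  under [RHS]eq_Rintegral do rewrite dg.
  by rewrite [RHS](Rint_supp DC) // => x Cx nD; rewrite (g'0 n x Cx nD) mulr0.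
have iG : mu.-integrable D (EFin \o G2) by exact: G2_int.
have mG : measurable_fun D G2 := integrable_meas iG.
pose lim (y : R) : R := (if 0 < y then 1 else 0) - (if 0 < y - s then 1 else 0).
have cl y : g' n y @[n --> \oo] --> lim y by apply: cvgB; exact: dramp_cvg.
have mlim : measurable_fun D (fun x => (G x).2 * lim x.2).
  apply: (@measurable_fun_cvg _ _ R D (fun n x => (G x).2 * g' n x.2)) => //.
    by move=> n; apply: measurable_funM => //; exact: mg.
  by move=> x _; apply: cvgM; [exact: cvg_cst|exact: cl].
have [il _ c] := @dct _ _ _ mu D mD (fun n x => (G x).2 * g' n x.2) (fun x => (G x).2 * lim x.2)
  (fun x => 2 * K * `|(G x).2|) (fun n => measurable_funM mG (mg n D mD)) mlim
  (areaZ _ mD (@integrable_abse _ _ _ mu D _ iG)) 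
  (fun n x _ => ltac:(by rewrite normrM mulrC; apply: ler_wpM2r)) 
  (fun x _ => cvgM (cvg_cst _) (cl x.2)).
have z0 : \int[mu]_(x in D) ((G x).2 * lim x.2) = 0.
  have ze : (fun n => \int[mu]_(x in D) ((G x).2 * g' n x.2)) = (fun=> 0) by apply/funext => n.
  by rewrite ze in c; rewrite -(cvg_lim (@norm_hausdorff _ _) c) lim_cst.
have SD : strip 0 T (fun=> 0) s `<=` D.
  by move=> x [x1 /andP[x2 x3]]; split => //=; rewrite x2 /=; move: x3; lra.
have mS : measurable (strip 0 T (fun=> 0) s) by exact: mR.
rewrite -[RHS]z0 (Rint_hline s mD il).
have sub : strip 0 T (fun=> 0) s `<=` D `\` [set x | x.2 = s].
  by move=> x Sx; split; [exact: SD|case: Sx => _ /andP[_ xs] /= e; rewrite e ltxx in xs].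
rewrite [RHS](Rint_supp sub); last first.
  move=> x [[x1 /andP[/= x2 x3]] /eqP ns] nS; rewrite /lim x2.
  have [xs|xs] := leP x.2 s; last by rewrite subr_gt0 xs subrr mulr0.
  by exfalso; apply: nS; split => //=; rewrite x2 lt_neqAle ns xs.
apply: (@Rint_eq R _ G2 (fun x => (G x).2 * lim x.2)) => x [x1 /andP[/= x2 x3]].
by rewrite /lim x2 subr_gt0 ltNge (ltW x3) subr0 mulr1.
Qed.

Lemma strip_Rc c M : 0 <= c -> strip 0 T (fun=> c) M `<=` strip 0 T f M.
Proof.
move=> c0 x [x1 /andP[x2 x3]]; split => //; rewrite x3 andbT.
by apply: lt_trans (fd _) _; apply: lt_trans x2; apply: lt_le_trans c0; rewrite oppr_lt0.
Qed.

Lemma strip_le h M M' : M <= M' -> strip 0 T h M `<=` strip 0 T h M'.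
Proof. by move=> MM x [x1 /andP[x2 x3]]; split => //; rewrite x2 (lt_le_trans x3). Qed.

(** Slices are null sets, so the claim concerns approximants, with an error uniform in the height.
    At height 0 the mean converges by the trace on Gamma; from there to height t it changes by the
    integral of the vertical derivative, whose limit is the vanishing flux. *)
Lemma slice_mean M phi : 0 < M -> apx (strip 0 T f M) v G phi -> exists2 eta : nat -> R, eta @ \oo --> (0 : R) &
  forall n t, 0 < t < M -> (\int[leb]_(s in `]0, T[) phi n (s, t) - vbar * T) ^+ 2 <= eta n.
Proof.
move=> M0 aphi; have mD : measurable (strip 0 T f M) by exact: strip_measurable.
have mP : measurable (strip 0 T f 0) by exact: strip_measurable.
have [sphi a0 _ a2] := aphi.
have cphi n : continuous (phi n) by exact: smooth_continuous.
have tr : tr_cvg T (fun=> 0) phi b.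
  apply: (tr_cvg_change fge d0 fd kap0 flip (or_intror erefl) mb _ apsi trb).
  exact: (apxS mD mP (@strip_le _ _ _ (ltW M0)) aphi).
have mI : measurable (`]0, T[%classic : set (measurableTypeR R)) by exact: measurable_itv.
have l1 : L2 leb `]0, T[ (fun=> 1).
  split; first exact: measurable_cst.
  by rewrite -(@tr2E R 0 T _ (fun=> 1) (@cst_continuous R R 0) (@cst_continuous (R * R)%type R 1)) ltry.
have cT := tr_cvgL2 (@cst_continuous R R 0) cphi mb tr.
have c1 := cvgL2_pair mI cT (cvgL2_cst mI l1).
pose W := strip 0 T (fun=> 0) M; have mW : measurable W by exact: mR.
have WD : W `<=` strip 0 T f M by apply: strip_Rc.
pose q n := Q mu W (fun x => 'D_e2 (phi n) x - (G x).2).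
have q0 : q @ \oo --> (0 : R) by have [_ _] := A.cvgL2S mD mW WD a2.
have [r hr] := @strip_sq R 0 T (fun=> 0) M 0 (fun=> lexx 0).
have lone : L2 mu W (fun=> 1) by apply: (continuous_L2 _ mW hr); exact: cst_continuous.
pose u n := \int[leb]_(s in `]0, T[) phi n (s, 0) - vbar * T.
have u0 : u @ \oo --> (0 : R).
  suff : u @ \oo --> \int[leb]_(t in `]0, T[) b t - \int[leb]_(t in `]0, T[) b t by rewrite subrr.
  rewrite /u vbarE; apply: cvgB; last exact: cvg_cst.
  by move: c1; under eq_fun do under eq_Rintegral do rewrite mulr1; under [X in _ --> X]eq_Rintegral do rewrite mulr1.
exists (fun n => 2 * (u n * u n) + 2 * (Q mu W (fun=> 1) * q n)).
  rewrite -[X in _ --> X](addr0 0); apply: cvgD.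
    rewrite -[X in _ --> X](mulr0 2); apply: cvgZr; rewrite -[X in _ --> X](mulr0 0); exact: cvgM.
  by rewrite -[X in _ --> X](mulr0 2); apply: cvgZr; rewrite -[X in _ --> X](mulr0 (Q mu W (fun=> 1))); exact: cvgZr.
move=> n t /andP[t0 tM].
have it (z : R) : leb.-integrable `]0, T[ (EFin \o (fun s => phi n (s, z))).
  by apply: continuous_itv_integrable; exact: (graph_continuous (@cst_continuous R R z) (cphi n)).
pose S := strip 0 T (fun=> 0) t; have mS : measurable S by exact: mR.
have SW : S `<=` W by apply: strip_le; exact: ltW.
have SD : S `<=` strip 0 T f M by move=> x /SW /WD.
have e1' : \int[leb]_(s in `]0, T[) phi n (s, t) - vbar * T = u n + \int[mu]_(x in S) 'D_e2 (phi n) x.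
  have cD2 : continuous ('D_e2 (phi n)) by apply: smooth_continuous; exact: D2_smooth.
  rewrite (@strip_D2 R (phi n) ('D_e2 (phi n)) 0 T (fun=> 0) t 0 (@cst_continuous R R 0) (fun=> lexx 0) (fun _ _ => t0)
    (fun x => smooth_D2 x (sphi n)) cD2).
  by rewrite (itvB (it t) (it 0)) /u; lra.
have [lD lG] : L2 mu S ('D_e2 (phi n)) /\ L2 mu S G2.
  by have [h1 h2 _] := A.cvgL2S mD mS SD a2; split.
have lone' := A.L2S mW mS SW lone.
have iS g : L2 mu S g -> mu.-integrable S (EFin \o g).
  by have [r' hr'] := @strip_sq R 0 T (fun=> 0) t 0 (fun=> lexx 0); apply: (L2_integrable mS hr').
have e2' : \int[mu]_(x in S) 'D_e2 (phi n) x = \int[mu]_(x in S) (1 * ('D_e2 (phi n) x - (G x).2)).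
  under [RHS]eq_Rintegral do rewrite mul1r.
  by rewrite (RintB mS (iS _ lD) (iS _ lG)) (flux t0) subr0.
rewrite e1' e2'; set I := \int[mu]_(x in S) _.
have I2 : I ^+ 2 <= Q mu W (fun=> 1) * q n.
  apply: le_trans (A.CS mS lone' (A.L2B mS lD lG)) _.
  apply: ler_pM; [exact: Q_ge0|exact: Q_ge0|exact: (A.QS mW mS SW lone)|].
  by apply: (A.QS mW mS SW); have [h1 h2 _] := A.cvgL2S mD mW WD a2; exact: (A.L2B mW (h1 n) h2).
have := sqr_ge0 (u n - I); nra.
Qed.

(** Each slice of an approximant satisfies [wirtinger_gen] with the error of [slice_mean]. The
    weight depends on the height alone, so it multiplies these inequalities before they are
    integrated in height; then the approximants pass to the limit. *)
Lemma wirtinger_strip c M (p : R -> R) (K : R) : 0 <= c -> c < M -> continuous p -> (forall y, 0 <= p y <= K) ->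
  mu.-integrable (strip 0 T (fun=> c) M) (EFin \o (fun x => p x.2 * (v x - vbar) ^+ 2)) /\
  \int[mu]_(x in strip 0 T (fun=> c) M) (p x.2 * (v x - vbar) ^+ 2) <=
  \int[mu]_(x in strip 0 T (fun=> c) M) (p x.2 * (G x).1 ^+ 2).
Proof.
move=> c0 cM cp pK; have M0 : 0 < M by exact: le_lt_trans cM.
have [phi] := density T0 fT fge d0 fd kap0 flip pv wG lG1 lG2 lP 1 M0; rewrite mulr1 => aphi pphi.
have [eta eta0 heta] := slice_mean M0 aphi.
pose W := strip 0 T (fun=> c) M; have mW : measurable W by exact: mR.
have mD : measurable (strip 0 T f M) by exact: strip_measurable.
have WD : W `<=` strip 0 T f M by apply: strip_Rc.
have [sphi a0 a1 _] := apxS mD mW WD aphi.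
have cphi n : continuous (phi n) by exact: smooth_continuous.
have cD n : continuous ('D_e1 (phi n)) by apply: smooth_continuous; exact: D1_smooth.
have [r hr] := @strip_sq R 0 T (fun=> c) M c (fun=> lexx c).
have cp2 : continuous (fun x : R * R => p x.2) by move=> x; apply: continuous_comp; [exact: cvg_snd|exact: cp].
have mp : measurable_fun W (fun x : R * R => p x.2) by exact: continuous_measurable_funS2.
have bp (x : R * R) : W x -> `|p x.2| <= K by move=> _; have /andP[? ?] := pK x.2; rewrite ger0_norm.
have lv : cvgL2 mu W (fun=> (fun=> - vbar)) (fun=> - vbar).
  by apply: A.cvgL2_cst => //; apply: (continuous_L2 _ mW hr); exact: cst_continuous.
have w0 := A.cvgL2D mW a0 lv.
have pw0 := A.cvgL2_bnd mW mp bp w0.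
have pa1 := A.cvgL2_bnd mW mp bp a1.
have lim1 := A.cvgL2_pair mW pw0 w0; have lim2 := A.cvgL2_pair mW pa1 a1.
have ev : (fun x => p x.2 * (v x - vbar) * (v x - vbar)) = (fun x => p x.2 * (v x - vbar) ^+ 2).
  by apply/funext => x; rewrite expr2 mulrA.
have eG : (fun x => p x.2 * (G x).1 * (G x).1) = (fun x => p x.2 * (G x).1 ^+ 2).
  by apply/funext => x; rewrite expr2 mulrA.
rewrite {1}ev in lim1; rewrite {1}eG in lim2.
split.
  have [_ h1 _] := pw0; have [_ h2 _] := w0; have := A.L2_mul mW h1 h2; by rewrite ev.
pose P := \int[mu]_(x in W) p x.2.
have lim3 : (fun n => eta n / T ^+ 2 * P) @ \oo --> (0 : R).
  rewrite -[X in _ --> X](mul0r (T ^- 2 * P)); under eq_fun do rewrite -mulrA.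
  exact: cvgMl.
have := cvg_lb (cvgB (cvgD lim2 lim3) lim1) (c := 0); rewrite addr0 subr_ge0; apply => n.
pose F x := p x.2 * ('D_e1 (phi n) x ^+ 2 + eta n / T ^+ 2 - (phi n x - vbar) ^+ 2).
have cF : continuous F.
  move=> x; apply: cvgM; first exact: cp2.
  apply: cvgB; first by apply: cvgD; [exact: (sqr_continuous2 (cD n))|exact: cvg_cst].
  by apply: (@sqr_continuous2 R (fun x => phi n x - vbar)) => z; apply: cvgB; [exact: cphi|exact: cvg_cst].
have slice t : c < t < M -> 0 <= \int[leb]_(s in `]0, T[) F (s, t).
  move=> /andP[ct tM]; have t0 : 0 < t by exact: le_lt_trans ct.
  have dps (s : R) : is_derive s 1 (fun s => phi n (s, t)) ('D_e1 (phi n) (s, t)).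
    exact/(is_derive_e1 (phi n) (s, t))/smooth_D1.
  have sc (g : R * R -> R) : continuous g -> continuous (fun s => g (s, t)).
    exact: (graph_continuous (@cst_continuous R R t)).
  have := wirtinger_gen vbar dps (sc _ (cD n)) _.
  have -> : phi n (0, t) = phi n (2 * pi, t).
    have h := pphi n (0, t); rewrite /= add0r in h; rewrite h //.
    by rewrite (ltW tM) andbT ltW // (lt_trans (fd _)) // (lt_trans _ t0) // oppr_lt0.
  move=> /(_ erefl).
  have := heta n t (ltac:(by rewrite t0)).
  have i1 := continuous_itv_integrable 0 T (sqr_continuous (sc _ (cD n))).
  have i2 : leb.-integrable `]0, T[ (EFin \o (fun s => (phi n (s, t) - vbar) ^+ 2)).
    apply: continuous_itv_integrable; apply: sqr_continuous => z.
    by apply: cvgB; [exact: (sc _ (cphi n))|exact: cvg_cst].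
  have ic : leb.-integrable `]0, T[ (EFin \o (fun=> eta n / T ^+ 2)).
    by apply: continuous_itv_integrable; exact: cst_continuous.
  have mI : measurable (`]0, T[%classic : set (measurableTypeR R)) by exact: measurable_itv.
  have i12 := @integrable_add _ _ _ leb _ mI _ _ i1 ic.
  have -> : \int[leb]_(s in `]0, T[) F (s, t) = p t * (\int[leb]_(s in `]0, T[) ('D_e1 (phi n) (s, t) ^+ 2) + eta n / T
      - \int[leb]_(s in `]0, T[) ((phi n (s, t) - vbar) ^+ 2)).
    have iB : leb.-integrable `]0, T[ (EFin \o (fun s => 'D_e1 (phi n) (s, t) ^+ 2 + eta n / T ^+ 2 - (phi n (s, t) - vbar) ^+ 2)).
      have := @integrable_add _ _ _ leb _ mI _ _ i12 (@integrable_scale _ _ _ leb _ mI (-1) _ i2).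
      by congr (_.-integrable _ (EFin \o _)); apply/funext => s; rewrite mulN1r.
    rewrite (itvZ (p t) iB) (itvB i12 i2) (itvD i1 ic).
    have := @ftc1 R (fun s => eta n / T ^+ 2 * s + 0) (fun=> eta n / T ^+ 2) 0 T T0 (is_derive_affine _ 0) (@cst_continuous R R _).
    move=> ->; congr (_ * (_ + _ - _)); rewrite mulr0 !addr0 subr0; move: T0; generalize (2 * pi : R) => q q0.
    by field; rewrite gt_eqF.
  set I1 := \int[leb]_(s in _) _; set I2 := \int[leb]_(s in _) _; set I3 := \int[leb]_(s in _) _ => h1 h2.
  apply: mulr_ge0; first by have /andP[] := pK t.
  rewrite subr_ge0; apply: le_trans h2 _; rewrite lerD2l ler_pM2r ?invr_gt0 //.
have := slice_ge0 cF slice.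
have [_ [l1 l2 _]] := (sphi n, a1); have [l3 l4 _] := w0; have [l5 l6 _] := pw0; have [l7 l8 _] := pa1.
have j1 := A.L2_mul mW (l7 n) (l1 n); have j2 := A.L2_mul mW (l5 n) (l3 n).
have j3 : mu.-integrable W (EFin \o (fun x => p x.2)) by exact: (continuous_integrable cp2 mW hr).
have j4 := areaZ (eta n / T ^+ 2) mW j3.
rewrite (_ : \int[mu]_(x in _) F x = \int[mu]_(x in W) (p x.2 * 'D_e1 (phi n) x * 'D_e1 (phi n) x) + eta n / T ^+ 2 * P
  - \int[mu]_(x in W) (p x.2 * (phi n x - vbar) * (phi n x - vbar))) //.
rewrite -(RintZ _ mW j3) -(RintD mW j1 j4) -(RintB mW (areaD mW j1 j4) j2).
by apply: Rint_eq => x _; rewrite /F; ring.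
Qed.

End Cell.

Section Misc.
Variable R : realType.
Local Notation mu := (area R).
Implicit Types (g a p : R * R -> R) (D A : set (R * R)).

Lemma bnd_integrable D p a (K : R) : measurable D -> measurable_fun D p -> (forall x, D x -> `|p x| <= K) ->
  mu.-integrable D (EFin \o a) -> mu.-integrable D (EFin \o (fun x => p x * a x)).
Proof.
move=> mD mp pK ia; have ma := integrable_meas ia.
apply: (@area_le R D _ (fun x => K * `|a x|) mD (measurable_funM mp ma)).
  by move=> x Dx; rewrite normrM ler_wpM2r // pK.
exact: areaZ mD (@integrable_abse _ _ _ mu D _ ia).
Qed.

Lemma integrableI D A a : measurable D -> measurable A -> A `<=` D -> mu.-integrable D (EFin \o a) ->
  mu.-integrable A (EFin \o a).
Proof. by move=> mD mA AD; exact: (@integrableS _ _ _ mu _ _ _ mD mA AD). Qed.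

Lemma Rint_E D a : measurable D -> mu.-integrable D (EFin \o a) ->
  (\int[mu]_(x in D) a x)%:E = (\int[mu]_(x in D) (a x)%:E)%E.
Proof. by move=> mD ia; rewrite fineK //; exact: (@integrable_fin_num _ _ _ mu _ mD _ ia). Qed.

Lemma Rint_sub D A a : measurable D -> measurable A -> A `<=` D -> (forall x, D x -> 0 <= a x) ->
  mu.-integrable D (EFin \o a) -> \int[mu]_(x in A) a x <= \int[mu]_(x in D) a x.
Proof.
move=> mD mA AD a0 ia; rewrite -lee_fin (Rint_E mA (integrableI mD mA AD ia)) (Rint_E mD ia).
exact: (@le_int_sub _ _ _ mu D mD a A mA (integrable_meas ia) a0 AD).
Qed.

Lemma Q_add_Rint D a p : measurable D -> L2 mu D a -> L2 mu D p ->
  mu.-integrable D (EFin \o (fun x => a x ^+ 2 + p x ^+ 2)) /\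
  \int[mu]_(x in D) (a x ^+ 2 + p x ^+ 2) = Q mu D a + Q mu D p.
Proof.
move=> mD la lp; have i1 := A.L2_sqr la; have i2 := A.L2_sqr lp.
by split; [exact: areaD|exact: RintD].
Qed.

Lemma tr_cvg_eq (l : R) (h h' b b' : R -> R) (phi psi : nat -> R * R -> R) :
  (forall n t, 0 < t < l -> phi n (t, h t) - b t = psi n (t, h' t) - b' t) -> tr_cvg l h phi b -> tr_cvg l h' psi b'.
Proof.
move=> e; rewrite /tr_cvg => c; set u := (X in X @ _ --> _) in c; set w := (X in X @ _ --> _).
suff -> : w = u by [].
by apply/funext => n; apply: eq_integral => t; rewrite inE /= in_itv /= => tl; rewrite e.
Qed.

End Misc.

Section Weight.
Variable R : realType.
Implicit Types (s y : R).

(* The weight of the decay estimate: [1/2 wt' <= wt], and [wt] grows like [exp (2 y)] up to [y = s]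
   while staying bounded. *)
Definition wt s y : R := (expR (- 2 * y + 0) + expR (- 2 * s))^-1.

Let den_gt0 s y : 0 < expR (- 2 * y + 0) + expR (- 2 * s).
Proof. by rewrite addr_gt0 ?expR_gt0. Qed.

Lemma wt_gt0 s y : 0 < wt s y. Proof. by rewrite invr_gt0. Qed.

Lemma wt_le s y : wt s y <= expR (2 * s).
Proof. by rewrite -[2 * s]opprK expRN -mulNr lef_pV2 ?posrE ?expR_gt0 // lerDr expR_ge0. Qed.

Lemma wt_le_id s y : wt s y <= expR (2 * y).
Proof. by rewrite -[2 * y]opprK expRN -mulNr lef_pV2 ?posrE ?expR_gt0 // addr0 lerDl expR_ge0. Qed.

Lemma wt_ge s y : s <= y -> expR (2 * s) <= 2 * wt s y.
Proof.
move=> sy; rewrite /wt addr0; set a := expR (- 2 * y); set b := expR (- 2 * s).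
have ab : a <= b by rewrite ler_expR; lra.
have a0 : 0 < a by exact: expR_gt0.
have b0 : 0 < b by exact: expR_gt0.
have -> : expR (2 * s) = b^-1 by rewrite -expRN mulNr opprK.
by rewrite ler_pdivlMr ?addr_gt0 // mulrC ler_pdivrMr //; lra.
Qed.

Lemma wt_smooth s : smooth1 (wt s).
Proof.
apply: smooth1V; first by move=> y; rewrite gt_eqF.
apply: smooth1D; last exact: smooth1_cst.
by apply: (@smooth1_comp R (@expR R) (fun y => - 2 * y + 0)); [exact: smooth1_expR|exact: smooth1_affine].
Qed.

Lemma derive1_wt s y : derive1 (wt s) y = 2 * (wt s y - expR (- 2 * s) * wt s y ^+ 2).
Proof.
have hk : is_derive y 1 (fun y => expR (- 2 * y + 0) + expR (- 2 * s)) (- 2 * expR (- 2 * y + 0)).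
  have h1 := @is_derive1_comp _ (@expR R) (fun y => - 2 * y + 0) y _ _ (is_derive_expR _) (is_derive_affine (- 2 : R) 0 y).
  have h2 := is_deriveD h1 (@is_derive_cst R _ _ (expR (- 2 * s)) y 1).
  by apply: (is_derive_eq h2); rewrite addr0 mulrC.
have n0 : expR (- 2 * y + 0) + expR (- 2 * s) != 0 by rewrite gt_eqF.
rewrite derive1E; have := @is_deriveV R _ y _ 1 n0 hk => h; rewrite /wt; apply: (@derive_val _ _ _ _ _ _ _ (is_derive_eq h _)).
rewrite /GRing.scale /= expr2; move: n0; set a := expR _; set c := expR _ => n0; field; exact: n0.
Qed.

Lemma derive1_wt_ge0 s y : 0 <= derive1 (wt s) y.
Proof.
rewrite derive1_wt pmulr_rge0 // subr_ge0 expr2 mulrA ler_piMl //; first exact/ltW/wt_gt0.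
by rewrite ler_pdivrMr // mul1r lerDr expR_ge0.
Qed.

Lemma derive1_wt_le s y : derive1 (wt s) y <= 2 * wt s y.
Proof. by rewrite derive1_wt ler_pM2l // gerBl mulr_ge0 ?expR_ge0 // sqr_ge0. Qed.

End Weight.

(** * The weighted energy estimate *)

Section Decay.
Variable R : realType.
Local Notation mu := (area R).
Local Notation leb := (@lebesgue_measure R).
Variables (f : R -> R) (kap delta : R).
Local Notation T := (2 * pi).
Hypotheses (fT : periodic f T) (fge : forall t, -1 <= f t) (d0 : 0 < delta) (fd : forall t, f t < - delta).
Hypotheses (kap0 : 0 <= kap) (flip : forall s t, `|f s - f t| <= kap * `|s - t|).
Implicit Types (M c s y : R) (n : nat).
Variables (v : R * R -> R) (G : R * R -> R * R).
Local Notation E := (above f).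
Hypotheses (pv : periodic v (T, 0)) (wG : weak_grad E v G).
Local Notation G1 := (fun x => (G x).1).
Local Notation G2 := (fun x => (G x).2).
Hypotheses (lG1 : L2 mu (col E 0 T) G1) (lG2 : L2 mu (col E 0 T) G2).
Hypothesis lP : L2 mu (strip 0 T f 0) v.
Hypothesis test : forall phi H, periodic phi (T, 0) -> weak_grad E phi H ->
  L2 mu (col E 0 T) (fun x => (H x).1) -> L2 mu (col E 0 T) (fun x => (H x).2) ->
  has_trace (cell_P f) T f phi (fun=> 0) -> \int[mu]_(x in col E 0 T) dot (G x) (H x) = 0.
Variables (b : R -> R) (psi : nat -> R * R -> R) (vbar : R).
Hypotheses (mb : measurable_fun (`]0, T[%classic : set R) b) (apsi : apx (strip 0 T f 0) v G psi)
  (trb : tr_cvg T (fun=> 0) psi b) (vbarE : vbar * T = \int[leb]_(t in `]0, T[) b t).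

Let T0 : 0 < T :> R. Proof. by rewrite mulr_gt0 ?pi_gt0. Qed.
Let cf : continuous f := f_continuous kap0 flip.
Let mE : measurable E := above_measurable kap0 flip.
Let mC : measurable (col E 0 T). Proof. exact: col_measurable. Qed.
Let mR c M : measurable (strip 0 T (fun=> c) M). Proof. by apply: strip_measurable; exact: cst_continuous. Qed.

Definition upper c : set (R * R) := col (above (fun=> c)) 0 T.

Lemma upper_measurable c : measurable (upper c).
Proof.
apply: col_measurable; apply: open_measurable2; apply: above_open; exact: cst_continuous.
Qed.

Lemma upper_cell c : 0 <= c -> upper c `<=` col E 0 T.
Proof.
move=> c0 x [x1 x2]; split=> //; rewrite /above /= in x2 *.
by apply: lt_trans (fd _) _; apply: lt_trans x2; apply: lt_le_trans c0; rewrite oppr_lt0.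
Qed.

Lemma upperS c s : c <= s -> upper s `<=` upper c.
Proof. by move=> cs x [x1 x2]; split=> //; rewrite /above /= in x2 *; exact: le_lt_trans x2. Qed.

Let mU c : measurable (upper c) := @upper_measurable c.
Let lU1 c (c0 : 0 <= c) : L2 mu (upper c) G1 := A.L2S mC (mU c) (upper_cell c0) lG1.
Let lU2 c (c0 : 0 <= c) : L2 mu (upper c) G2 := A.L2S mC (mU c) (upper_cell c0) lG2.
Let mv c (c0 : 0 <= c) : measurable_fun (upper c) (fun x => v x - vbar).
Proof.
apply: measurable_funB => //; apply: measurable_funS (meas_v wG) => //.
by move=> x /(upper_cell c0)[].
Qed.

(** By exhaustion with strips of finite height. Finiteness of the left side over the unbounded cell
    is part of the conclusion, hence the extended integral. *)
Lemma wirtinger_upperE c (p : R -> R) (K : R) : 0 <= c -> continuous p -> (forall y, 0 <= p y <= K) ->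
  (\int[mu]_(x in upper c) (p x.2 * (v x - vbar) ^+ 2)%:E <= (\int[mu]_(x in upper c) (p x.2 * (G x).1 ^+ 2))%:E)%E.
Proof.
move=> c0 cp pK.
have mp D : measurable D -> measurable_fun D (fun x : R * R => p x.2) by move=> mD; exact: measurable_snd_fun.
have bp (x : R * R) : `|p x.2| <= K by have /andP[? ?] := pK x.2; rewrite ger0_norm.
have iG : mu.-integrable (upper c) (EFin \o (fun x => p x.2 * (G x).1 ^+ 2)).
  exact: (bnd_integrable (mU c) (mp _ (mU c)) (fun x _ => bp x) (A.L2_sqr (lU1 c0))).
have p0 y : 0 <= p y by have /andP[] := pK y.
pose W n := strip 0 T (fun=> c) (c + n.+1%:R).
apply: (@exhaust_le _ _ _ mu (upper c) W) => //.
- exact: mU.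
- by move=> n; exact: mR.
- by move=> m n mn; apply/subsetPset; apply: strip_le; rewrite lerD2l ler_nat.
- apply/seteqP; split => x; first by move=> [n _ [x1 /andP[x2 _]]]; split.
  move=> [x1 x2]; 
  exists (Num.bound `|x.2 - c|) => //; split => //; rewrite x2 /= -ltrBlDl.
  by apply: le_lt_trans (ler_norm _) _; apply: lt_trans (archi_boundP (normr_ge0 _)) _; rewrite ltr_nat.
- apply: measurable_funM; first exact: mp.
  by apply: sqr_meas; exact: mv.
- by move=> x _; rewrite mulr_ge0 ?sqr_ge0.
- move=> n; have cn : c < c + n.+1%:R by rewrite ltrDl.
  have [i1 le1] := wirtinger_strip fT fge d0 fd kap0 flip pv wG lG1 lG2 lP test mb apsi trb vbarE c0 cn cp pK.
  rewrite -(Rint_E (mR _ _) i1) lee_fin; apply: le_trans le1 _.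
  apply: (Rint_sub (mU c) (mR _ _)) => //.
    by move=> x [x1 /andP[x2 _]]; split.
  by move=> x _; rewrite mulr_ge0 ?sqr_ge0.
Qed.

Lemma wirtinger_upper c : 0 <= c -> L2 mu (upper c) (fun x => v x - vbar) /\
  Q mu (upper c) (fun x => v x - vbar) <= Q mu (upper c) G1.
Proof.
move=> c0; have := @wirtinger_upperE c (fun=> 1) 1 c0 (@cst_continuous R R 1) (fun=> ltac:(by rewrite ler01 lexx)).
under eq_integral do rewrite mul1r; under eq_Rintegral do rewrite mul1r.
move=> h; have l : L2 mu (upper c) (fun x => v x - vbar).
  by split; [exact: mv|apply: le_lt_trans h _; rewrite ltry].
by split => //; rewrite -lee_fin (A.Q_E (mU c) l).
Qed.

Lemma wirtinger_upper_weight (p : R -> R) (K : R) : continuous p -> (forall y, 0 <= p y <= K) ->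
  \int[mu]_(x in upper 0) (p x.2 * (v x - vbar) ^+ 2) <= \int[mu]_(x in upper 0) (p x.2 * (G x).1 ^+ 2).
Proof.
move=> cp pK; have := @wirtinger_upperE 0 p K (lexx 0) cp pK; rewrite -lee_fin -Rint_E //.
have [l _] := wirtinger_upper (lexx 0).
apply: (bnd_integrable (mU 0) (K := K) _ _ (A.L2_sqr l)); first exact: measurable_snd_fun.
by move=> x _; have /andP[? ?] := pK x.2; rewrite ger0_norm.
Qed.

Section Large.
Variables (K s : R).
Hypotheses (K0 : 0 < K) (hK : forall y, dstep y <= K) (s1 : 1 <= s).
Let g y := step y * wt s y.
Let p y := step y * derive1 (wt s) y.
Let B := (K + 2) * expR (2 * s).
Let w x := v x - vbar.

Let dgE y : derive1 g y = p y + wt s y * dstep y.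
Proof.
rewrite derive1E; apply: derive_val; apply: is_deriveM; first exact: is_derive_step.
by apply: smooth1_derive; exact: wt_smooth.
Qed.

Let sg : smooth1 g. Proof. by apply: smooth1M; [exact: step_smooth|exact: wt_smooth]. Qed.

Let pB y : 0 <= p y <= 2 * expR (2 * s).
Proof.
rewrite /p mulr_ge0 ?step_ge0 ?derive1_wt_ge0 //=.
apply: le_trans (_ : 1 * (2 * expR (2 * s)) <= _); last by rewrite mul1r.
apply: ler_pM; rewrite ?step_ge0 ?derive1_wt_ge0 ?step_le1 //.
by apply: le_trans (derive1_wt_le _ _) _; rewrite ler_pM2l // wt_le.
Qed.

Let qB y : 0 <= wt s y * dstep y <= K * expR 2 /\ wt s y * dstep y <= K * expR (2 * s).
Proof.
have w0 := ltW (wt_gt0 s y); rewrite mulr_ge0 ?dstep_ge0 //=; split; last first.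
  by rewrite mulrC; apply: ler_pM; rewrite ?dstep_ge0 // wt_le.
have [y0|y0] := leP y 0; first by rewrite dstep_out ?mulr0; [rewrite mulr_ge0 ?expR_ge0 // ltW|left].
have [y1|y1] := leP 1 y; first by rewrite dstep_out ?mulr0; [rewrite mulr_ge0 ?expR_ge0 // ltW|right].
rewrite mulrC; apply: ler_pM; rewrite ?dstep_ge0 //.
by apply: le_trans (wt_le_id _ _) _; rewrite ler_expR; lra.
Qed.

Let gB y : `|g y| <= B.
Proof.
rewrite /g ger0_norm; last by apply: mulr_ge0; [exact: step_ge0|exact/ltW/wt_gt0].
apply: le_trans (_ : 1 * expR (2 * s) <= _).
  by apply: ler_pM; rewrite ?step_ge0 ?step_le1 ?(ltW (wt_gt0 _ _)) ?wt_le.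
by rewrite ler_pM2r ?expR_gt0 //; move: K0; lra.
Qed.

Let dgB y : `|derive1 g y| <= B.
Proof.
have /andP[h1 h2] := pB y; have [/andP[h3 _] h4] := qB y.
by rewrite dgE ger0_norm ?addr_ge0 // /B mulrDl addrC lerD.
Qed.

Let g_le0 y : y <= 0 -> g y = 0 /\ derive1 g y = 0.
Proof. by move=> y0; rewrite dgE /g /p step_le0 // dstep_out ?mul0r ?mulr0 ?addr0 //; left. Qed.

Let pm (q : R -> R) D : continuous q -> measurable D -> measurable_fun D (fun x : R * R => q x.2).
Proof. by move=> cq mD; exact: measurable_snd_fun. Qed.

Let cg : continuous g. Proof. exact: smooth1_continuous. Qed.
Let cdg : continuous (derive1 g). Proof. exact: smooth1_continuous (smooth1_derive1 sg). Qed.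
Let cp : continuous p.
Proof.
apply: smooth1_continuous; apply: smooth1M; first exact: step_smooth.
by apply: smooth1_derive1; exact: wt_smooth.
Qed.

Let U := upper 0.
Let mU0 : measurable U := @upper_measurable 0.
Let UC : U `<=` col E 0 T := upper_cell (lexx 0).
Let lw : L2 mu U w := (wirtinger_upper (lexx 0)).1.

Let offU x : col E 0 T x -> ~ U x -> x.2 <= 0.
Proof. by move=> [x1 x2] nU; rewrite leNgt; apply/negP => x3; apply: nU; split. Qed.

(** The test function is g(y2) (v - vbar). The step contained in [g] makes it vanish on P, hence on
    the wall, and the bounds on [g] and its derivative keep its gradient square integrable. *)
Lemma decay_test : mu.-integrable U (EFin \o (fun x => g x.2 * ((G x).1 ^+ 2 + (G x).2 ^+ 2) + derive1 g x.2 * (w x * (G x).2))) /\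
  \int[mu]_(x in U) (g x.2 * ((G x).1 ^+ 2 + (G x).2 ^+ 2) + derive1 g x.2 * (w x * (G x).2)) = 0.
Proof.
have l1 := lU1 (lexx 0); have l2 := lU2 (lexx 0).
split.
  apply: areaD => //.
    exact: (bnd_integrable mU0 (pm cg mU0) (fun x _ => gB x.2) (Q_add_Rint mU0 l1 l2).1).
  exact: (bnd_integrable mU0 (pm cdg mU0) (fun x _ => dgB x.2) (A.L2_mul mU0 lw l2)).
pose F (x : R * R) : R := g x.2; have sF : smooth F by exact: smooth_snd.
pose H x := (F x * (G x).1, F x * (G x).2 + w x * derive1 g x.2).
have wGw : weak_grad E w G.
  apply: weak_grad_eq (weak_gradB mE wG (weak_gradZ vbar mE (weak_grad_cst1 mE))) => x _ /=; first by rewrite mulr1.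
  by rewrite !mulr0 !subr0; case: (G x).
have wH : weak_grad E (fun x => F x * w x) H.
  have h := @weak_grad_mul R E E setT w G F mE mE (@subset_refl _ E) closedT (fun x h => h.1) sF (@nsetT R (fun x => F x = 0)) wGw.
  by apply: (weak_grad_eq (fun x _ => erefl) _ h) => x _; rewrite /H /F D1_snd D2_snd // mulr0 addr0.
have mw : measurable_fun (col E 0 T) w.
  apply: measurable_funB => //; apply: measurable_funS (meas_v wG) => //.
  by move=> x [].
have := test (phi := fun x => F x * w x) (H := H).
have -> : \int[mu]_(x in col E 0 T) dot (G x) (H x) = \int[mu]_(x in U) (g x.2 * ((G x).1 ^+ 2 + (G x).2 ^+ 2) + derive1 g x.2 * (w x * (G x).2)).
  rewrite (Rint_supp UC).
    by apply: Rint_eq => x _; rewrite /dot /H /F /=; ring.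
  move=> x Cx /(offU Cx)/g_le0[h1 h2]; rewrite /dot /H /F h1 h2 /=; ring.
apply.
- by move=> x; rewrite /w pv /F /= addr0.
- exact: wH.
- exact: (A.L2_bnd mC (pm cg mC) (fun x _ => gB x.2) lG1).
- apply: A.L2D => //; first exact: (A.L2_bnd mC (pm cg mC) (fun x _ => gB x.2) lG2).
  apply: (L2_supp mC mU0 UC).
  + by apply: measurable_funM => //; exact: pm.
  + by move=> x Cx /(offU Cx)/g_le0[_ h2]; rewrite h2 mulr0.
  + have := A.L2_bnd mU0 (pm cdg mU0) (fun x _ => dgB x.2) lw; congr (L2 _ _ _).
    by apply/funext => x; rewrite mulrC.
- apply: (@trace_smooth0 _ _ _ _ _ (fun=> 0)); [exact: cell_P_open kap0 flip|exact: smooth_cst| |by []].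
  by move=> x [_ /andP[_ /ltW]]/g_le0[h1 _]; rewrite /F h1 mul0r.
Qed.

(** To the vanishing integral of [decay_test] are added half of Wirtinger's inequality with weight
    [p] and a term in [c] that dominates the derivative of the step. Since wt' / 2 = wt - e^(-2s)
    wt^2, the integrand becomes a sum of nonnegative multiples of squares and of e^(-2s) wt^2 [step]
    |G|^2. Above height s the factor e^(-2s) wt^2 is at least e^(2s) / 4. *)
Lemma decay_large : expR (2 * s) * (Q mu (upper s) G1 + Q mu (upper s) G2) <=
  4 * (K * expR 2) * (Q mu U G1 + Q mu U G2).
Proof.
have [j1 J1] := decay_test.
have l1 := lU1 (lexx 0); have l2 := lU2 (lexx 0).
have s0 : 0 <= s by apply: le_trans s1.
have bp (x : R * R) : U x -> `|p x.2| <= 2 * expR (2 * s) by move=> _; have /andP[? ?] := pB x.2; rewrite ger0_norm.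
have j2 := bnd_integrable mU0 (pm cp mU0) bp (A.L2_sqr lw).
have j3 := bnd_integrable mU0 (pm cp mU0) bp (A.L2_sqr l1).
have [j4 J4] := Q_add_Rint mU0 lw l2.
have W := wirtinger_upper_weight cp pB.
have [_ W1] := wirtinger_upper (lexx 0).
pose c := K * expR 2.
pose r x := (g x.2 * ((G x).1 ^+ 2 + (G x).2 ^+ 2) + derive1 g x.2 * (w x * (G x).2))
  + (2^-1 * (p x.2 * w x ^+ 2 - p x.2 * (G x).1 ^+ 2) + c / 2 * (w x ^+ 2 + (G x).2 ^+ 2)).
have jb := areaB mU0 j2 j3.
have j5 := areaZ 2^-1 mU0 jb; have j6 := areaZ (c / 2) mU0 j4.
have j7 := areaD mU0 j5 j6.
have jr : mu.-integrable U (EFin \o r) by exact: areaD mU0 j1 j7.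
have rI : \int[mu]_(x in U) r x <= c * (Q mu U G1 + Q mu U G2).
  rewrite /r (RintD mU0 j1 j7) J1 add0r (RintD mU0 j5 j6) (RintZ _ mU0 jb) (RintZ _ mU0 j4) (RintB mU0 j2 j3) J4.
  have c0 : 0 <= c by rewrite mulr_ge0 ?expR_ge0 // ltW.
  move: W W1; rewrite -/w -/U; set x1 := \int[mu]_(x in _) _; set x2 := \int[mu]_(x in _) _.
  by have := Q_ge0 mu U G2; have := Q_ge0 mu U G1; set q1 := Q _ _ _; set q2 := Q _ _ _; set q3 := Q _ _ _; nra.
have rge x : expR (- 2 * s) * wt s x.2 ^+ 2 * step x.2 * ((G x).1 ^+ 2 + (G x).2 ^+ 2) <= r x.
  have [/andP[h3 h4] _] := qB x.2; have /andP[h5 _] := pB x.2.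
  rewrite -subr_ge0.
  have -> : r x - expR (- 2 * s) * wt s x.2 ^+ 2 * step x.2 * ((G x).1 ^+ 2 + (G x).2 ^+ 2) =
    2^-1 * p x.2 * (w x + (G x).2) ^+ 2 + 2^-1 * (wt s x.2 * dstep x.2) * (w x + (G x).2) ^+ 2
    + 2^-1 * (c - wt s x.2 * dstep x.2) * (w x ^+ 2 + (G x).2 ^+ 2).
    rewrite /r dgE /g /p derive1_wt; by field.
  by rewrite !addr_ge0 // mulr_ge0 ?addr_ge0 ?sqr_ge0 // mulr_ge0 // subr_ge0.
have r0 x : 0 <= r x.
  apply: le_trans (rge x); rewrite mulr_ge0 ?addr_ge0 ?sqr_ge0 // mulr_ge0 ?step_ge0 //.
  by rewrite mulr_ge0 ?expR_ge0 ?sqr_ge0.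
have sU : upper s `<=` U by exact: upperS.
have [js JS] := Q_add_Rint (mU s) (lU1 s0) (lU2 s0).
rewrite -JS -(RintZ _ (mU s) js).
rewrite -mulrA -ler_pdivrMl // -(RintZ _ (mU s) (areaZ _ (mU s) js)).
apply: le_trans rI; apply: le_trans (Rint_sub mU0 (mU s) sU (fun x _ => r0 x) jr).
apply: (A.Rint_le (mU s)).
- exact: areaZ _ (mU s) (areaZ _ (mU s) js).
- exact: integrableI mU0 (mU s) sU jr.
move=> x [_ /= /ltW sx]; apply: le_trans (rge x).
rewrite step_ge1 ?mulr1; last by apply: le_trans s1 _.
rewrite mulrA ler_wpM2r ?addr_ge0 ?sqr_ge0 //.
have h := wt_ge sx; have e0 := expR_gt0 (2 * s).
have -> : expR (- 2 * s) = (expR (2 * s))^-1 by rewrite mulNr expRN.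
rewrite [leRHS]mulrC ler_pdivlMr //; move: h e0; set a := expR _; set d := wt _ _; nra.
Qed.

End Large.

Lemma decay : exists2 C, 0 <= C & forall s, 0 <= s -> Q mu (upper s) G1 + Q mu (upper s) G2 <= C * expR (- 2 * s).
Proof.
have [K K0 hK] := @dstep_bounded R; pose X := Q mu (upper 0) G1 + Q mu (upper 0) G2.
have X0 : 0 <= X by rewrite addr_ge0 ?Q_ge0.
have e20 := expR_gt0 (2 : R); have KE : 0 <= K * expR 2 by rewrite mulr_ge0 // ltW.
(* The second summand covers heights s < 1, where e^(2s) <= e^2 and the total energy suffices. *)
exists (4 * (K * expR 2) * X + expR 2 * X).
  by rewrite addr_ge0 // mulr_ge0 ?mulr_ge0 // ltW.
move=> s s0; rewrite mulNr expRN ler_pdivlMr ?expR_gt0 // mulrC.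
have [s1|s1] := leP 1 s.
  by apply: le_trans (decay_large K0 hK s1) _; rewrite lerDl mulr_ge0 // ltW.
apply: le_trans (_ : expR 2 * X <= _); last by rewrite lerDr mulr_ge0 // mulr_ge0.
apply: ler_pM; [exact: expR_ge0|by rewrite addr_ge0 ?Q_ge0|by rewrite ler_expR; lra|].
by apply: lerD; apply: (A.QS (mU 0) (mU s) (upperS s0)); [exact: lU1|exact: lU2].
Qed.

(** Let X be the Dirichlet integral of [v] and I the integral of its vertical derivative over P.
    Testing with v + min(y2, 0), which vanishes on the wall, gives X = -I. Integrating in y2 gives I
    = T vbar - |P|. By Cauchy-Schwarz I^2 <= |P| X = -|P| I, so -I <= |P|, that is, T vbar >= 0. *)
Lemma vbar_ge0 : has_trace (cell_P f) T f v (fun t => - f t) -> 0 <= vbar.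
Proof.
move=> tv; pose P := strip 0 T f 0; have mP : measurable P by exact: strip_measurable.
have oP : open P by exact: strip_open.
have [r hr] := @strip_sq R 0 T f 0 (-1) fge.
have PC : P `<=` col E 0 T by move=> x [x1 /andP[x2 _]].
have PE : P `<=` E by move=> x /PC[].
have wP := weak_grad_restrict mE mP PE wG.
have [chi achi tchi] := has_trace_apx oP hr wP tv.
have [schi a0 _ a2] := achi.
have cchi n : continuous (chi n) by exact: smooth_continuous.
have lone : L2 mu P (fun=> 1) by apply: (continuous_L2 _ mP hr); exact: cst_continuous.
have lG : L2 mu P G2 by case: a2.
have iP g : L2 mu P g -> mu.-integrable P (EFin \o g) by exact: L2_integrable mP hr.
have mI : measurable (`]0, T[%classic : set (measurableTypeR R)) by exact: measurable_itv.
have l1 : L2 leb `]0, T[ (fun=> 1).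
  split; first exact: measurable_cst.
  by rewrite -(@tr2E R 0 T _ (fun=> 1) (@cst_continuous R R 0) (@cst_continuous (R * R)%type R 1)) ltry.
have mf : measurable_fun (`]0, T[%classic : set R) (fun t => - f t).
  by apply: measurable_funTS; apply: continuous_measurable_fun => t; apply: cvgN; exact: cf.
have trg : tr_cvg T (fun=> 0) chi b := tr_cvg_change fge d0 fd kap0 flip (or_intror erefl) mb achi apsi trb.
have cb := cvgL2_pair mI (tr_cvgL2 (@cst_continuous R R 0) cchi mb trg) (cvgL2_cst mI l1).
have ct := cvgL2_pair mI (tr_cvgL2 cf cchi mf tchi) (cvgL2_cst mI l1).
have cP := A.cvgL2_pair mP a2 (A.cvgL2_cst mP lone).
have ifg (h : R -> R) n : continuous h -> leb.-integrable `]0, T[ (EFin \o (fun t => chi n (t, h t))).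
  by move=> ch; apply: continuous_itv_integrable; exact: graph_continuous.
have neg t : 0 < t < T -> f t < 0 by move=> _; apply: lt_trans (fd t) _; rewrite oppr_lt0.
have IG : \int[mu]_(x in P) (G x).2 = vbar * T - \int[leb]_(t in `]0, T[) (- f t).
  have e n : \int[mu]_(x in P) ('D_e2 (chi n) x * 1) = \int[leb]_(t in `]0, T[) (chi n (t, 0) * 1) - \int[leb]_(t in `]0, T[) (chi n (t, f t) * 1).
    under eq_Rintegral do rewrite mulr1; under [X in _ = X - _]eq_Rintegral do rewrite mulr1.
    under [X in _ = _ - X]eq_Rintegral do rewrite mulr1.
    have cD2 : continuous ('D_e2 (chi n)) by apply: smooth_continuous; exact: D2_smooth.
    rewrite (@strip_D2 R (chi n) ('D_e2 (chi n)) 0 T f 0 (-1) cf fge neg (fun x => smooth_D2 x (schi n)) cD2).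
    exact: itvB (ifg _ n (@cst_continuous R R 0)) (ifg _ n cf).
  have c2 : (fun n => \int[leb]_(t in `]0, T[) (chi n (t, 0) * 1) - \int[leb]_(t in `]0, T[) (chi n (t, f t) * 1)) @ \oo -->
    \int[leb]_(t in `]0, T[) (b t * 1) - \int[leb]_(t in `]0, T[) (- f t * 1) by apply: cvgB.
  rewrite vbarE; under [LHS]eq_Rintegral do rewrite -[(G _).2]mulr1.
  under [X in _ = X - _]eq_Rintegral do rewrite -[b _]mulr1.
  under [X in _ = _ - X]eq_Rintegral do rewrite -[- f _]mulr1.
  rewrite -(cvg_lim (@norm_hausdorff _ _) c2) -(cvg_lim (@norm_hausdorff _ _) cP).
  by under [in LHS]eq_fun do rewrite e.
have area : Q mu P (fun=> 1) = \int[leb]_(t in `]0, T[) (- f t).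
  rewrite /Q; under eq_Rintegral do rewrite expr1n.
  have ds (x : R * R) : is_derive x e2 (fun x : R * R => x.2) 1.
    by apply/(is_derive_e2 (fun x : R * R => x.2) x) => /=; exact: is_derive_id.
  rewrite (@strip_D2 R (fun x => x.2) (fun=> 1) 0 T f 0 (-1) cf fge neg ds (@cst_continuous (R * R)%type R 1)).
  by apply: eq_Rintegral => t _; rewrite sub0r.
pose X := Q mu (col E 0 T) G1 + Q mu (col E 0 T) G2.
have X0 : 0 <= X by rewrite addr_ge0 ?Q_ge0.
suff XG : X = - \int[mu]_(x in P) (G x).2.
  have h1 : (\int[mu]_(x in P) (1 * (G x).2)) ^+ 2 <= Q mu P (fun=> 1) * X.
    apply: le_trans (A.CS mP lone lG) _; apply: ler_wpM2l; first exact: Q_ge0.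
    by apply: le_trans (A.QS mC mP PC lG2) _; rewrite lerDr Q_ge0.
  move: h1; under eq_Rintegral do rewrite mul1r.
  have q0 := Q_ge0 mu P (fun=> 1).
  rewrite -(pmulr_lge0 _ T0); move: XG IG q0; rewrite -area; set I := Rintegral _ _ _; set q := Q _ _ _; set V := vbar * T.
  move=> XI hI {}q0 h; move: X0 h; rewrite XI => X0' h; rewrite leNgt; apply/negP => V0.
  have I0 : I < 0 by lra.
  nra.
have [K K0 hK] := @dramp_bound R; pose D := strip 0 T f 1.
have mD : measurable D by exact: strip_measurable.
have DC : D `<=` col E 0 T by move=> x [x1 /andP[x2 _]].
have PD : P `<=` D by apply: strip_le.
pose q n (y : R) := 1 - dramp n y.
have cd n : continuous (dramp n : R -> R).
  by rewrite -derive1_ramp; apply: smooth1_continuous; apply: smooth1_derive1; exact: ramp_smooth.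
have cq n : continuous (q n) by move=> y; apply: cvgB; [exact: cvg_cst|exact: cd].
have qb n y : `|q n y| <= 1 + K by rewrite (le_trans (ler_normB _ _)) // normr1 lerD2l.
have mq n (A : set (R * R)) : measurable A -> measurable_fun A (fun x : R * R => q n x.2) by move=> mA; exact: measurable_snd_fun.
have q0 n x : col E 0 T x -> ~ D x -> q n x.2 = 0.
  move=> [x1 x2] nD; rewrite /q dramp_ge1 ?subrr // leNgt; apply/negP => x3; apply: nD; split => //.
  by rewrite x3 andbT.
have lGD := A.L2S mC mD DC lG2.
have [r1 hr1] := @strip_sq R 0 T f 1 (-1) fge.
have lq n : L2 mu (col E 0 T) (fun x => q n x.2).
  apply: (L2_supp mC mD DC (mq n _ mC) (q0 n)); apply: (@continuous_L2 R (fun x => q n x.2) D r1) => // x.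
  by apply: continuous_comp; [exact: cvg_snd|exact: cq].
have z n : X + \int[mu]_(x in D) ((G x).2 * q n x.2) = 0.
  (* A smooth version of min(y2, 0): it equals y2 below height 0, which cancels the value -y2 of [v]
     on the wall, and it vanishes above height 1. *)
  pose F (x : R * R) : R := 1 * x.2 + 0 - ramp n x.2.
  have s1 : smooth1 (fun y : R => 1 * y + 0 - ramp n y).
    by apply: smooth1B; [exact: smooth1_affine|exact: ramp_smooth].
  have sF : smooth F := smooth_snd s1.
  have dF y : derive1 (fun y : R => 1 * y + 0 - ramp n y) y = q n y.
    rewrite derive1E; apply: derive_val; apply: is_deriveB; first exact: is_derive_affine.
    by have := smooth1_derive (ramp_smooth R n) y; rewrite derive1_ramp.
  pose H x := ((G x).1, (G x).2 + q n x.2).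
  have wH0 := weak_gradD mE wG (weak_grad_smooth mE sF).
  have wH : weak_grad E (fun x => v x + F x) H.
    apply: (weak_grad_eq (fun x _ => erefl) _ wH0) => x _.
    have -> : grad F x = (0, q n x.2).
      rewrite /grad -(dF x.2) -(D2_snd x s1) /F.
      by rewrite (D1_snd (fun y : R => 1 * y + 0 - ramp n y) x).
    by rewrite /H /= addr0.
  have h := test (phi := fun x => v x + F x) (H := H).
  have iq := A.L2_mul mC lG2 (lq n).
  have [ia Ia] := Q_add_Rint mC lG1 lG2.
  rewrite /X -Ia -(Rint_supp DC (g := fun x => (G x).2 * q n x.2)); last first.
    by move=> x Cx nD; rewrite q0 // mulr0.
  rewrite -(RintD mC ia iq) -[RHS]h //.
  - by apply: Rint_eq => x _; rewrite /dot /H /=; ring.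
  - by move=> x; rewrite pv /F /= [x.2 + 0]addr0.
  - by have l2 := A.L2D mC lG2 (lq n).
  - apply: (apx_has_trace oP (weak_grad_restrict mE mP PE wH0) _ (apxD mP achi (apx_cst mP hr sF))).
      exact: measurable_cst.
    apply: tr_cvg_eq tchi => k t _.
    by rewrite /F /= ramp_le0 ?ltW ?(lt_trans (fd t)) ?oppr_lt0 // mul1r addr0 !subr0 opprK.
have mG := integrable_meas (L2_integrable mD hr1 lGD).
have iG : mu.-integrable D (EFin \o G2) := L2_integrable mD hr1 lGD.
pose lim (y : R) : R := 1 - (if 0 < y then 1 else 0).
have cl y : q n y @[n --> \oo] --> lim y by apply: cvgB; [exact: cvg_cst|exact: dramp_cvg].
have mlim : measurable_fun D (fun x => (G x).2 * lim x.2).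
  apply: (@measurable_fun_cvg _ _ R D (fun n x => (G x).2 * q n x.2)) => //.
    by move=> n; apply: measurable_funM => //; exact: mq.
  by move=> x _; apply: cvgM; [exact: cvg_cst|exact: cl].
have [il _ c] := @dct _ _ _ mu D mD (fun n x => (G x).2 * q n x.2) (fun x => (G x).2 * lim x.2)
  (fun x => (1 + K) * `|(G x).2|) (fun n => measurable_funM mG (mq n D mD)) mlim
  (areaZ _ mD (@integrable_abse _ _ _ mu D _ iG)) 
  (fun n x _ => ltac:(by rewrite normrM mulrC; apply: ler_wpM2r)) 
  (fun x _ => cvgM (cvg_cst _) (cl x.2)).
have ze : (fun n => \int[mu]_(x in D) ((G x).2 * q n x.2)) = (fun=> - X).
  by apply/funext => n; apply/eqP; rewrite -addr_eq0 addrC z.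
rewrite ze in c.
have -> : X = - \int[mu]_(x in D) ((G x).2 * lim x.2).
  by rewrite -(cvg_lim (@norm_hausdorff _ _) c) lim_cst ?opprK.
congr (- _); rewrite (Rint_hline 0 mD il).
have sub : P `<=` D `\` [set x | x.2 = 0].
  by move=> x Px; split; [exact: PD|case: Px => _ /andP[_ xs] /= e; rewrite e ltxx in xs].
rewrite (Rint_supp sub); last first.
  move=> x [[x1 /andP[/= x2 x3]] /eqP ns] nS; rewrite /lim.
  have [xs|xs] := ltP 0 x.2; first by rewrite subrr mulr0.
  by exfalso; apply: nS; split => //=; rewrite x2 lt_neqAle ns xs.
apply: (@Rint_eq R P _ G2) => x [x1 /andP[/= x2 x3]].
by rewrite /lim ltNge (ltW x3) subr0 mulr1.
Qed.
End Decay.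

(** * Functions with vanishing traces *)

Section ZeroTrace.
Variable R : realType.
Local Notation mu := (area R).
Local Notation leb := (@lebesgue_measure R).
Implicit Types (h : R -> R) (U V F : R * R -> R) (H G : R * R -> R * R) (phi psi : nat -> R * R -> R).

Lemma graph_L2 l h F : continuous h -> continuous F -> L2 leb `]0, l[ (fun t => F (t, h t)).
Proof.
move=> ch cF; split; first by apply: measurable_funTS; apply: continuous_measurable_fun; exact: graph_continuous.
by rewrite -tr2E // ltry.
Qed.

Lemma tr_cvg0E l h phi : continuous h -> (forall n, continuous (phi n)) ->
  tr_cvg l h phi (fun=> 0) <-> tr2 0 l h (phi n) @[n --> \oo] --> (0 : R).
Proof.
move=> ch cp; have e n : (\int[leb]_(t in `]0%R, l[) ((phi n (t, h t) - 0) ^+ 2)%:E)%E = (tr2 0 l h (phi n))%:E.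
  by rewrite tr2E //; apply: eq_integral => t _; rewrite subr0.
rewrite /tr_cvg; under eq_fun do rewrite e; split => [c|c]; last by apply: cvg_EFin => //; exact: nearW.
have {}c : (fun n => (tr2 0 l h (phi n))%:E) @ \oo --> (0 : R)%:E by exact: c.
exact: (fine_cvg c).
Qed.

Lemma tr2_le l h F (G : R * R -> R) : continuous h -> continuous F -> continuous G ->
  tr2 0 l h (fun x => F x + G x) <= 2 * tr2 0 l h F + 2 * tr2 0 l h G.
Proof.
move=> ch cF cG; have mI : measurable (`]0, l[%classic : set (measurableTypeR R)) by exact: measurable_itv.
exact: (@QD_le _ _ _ leb _ mI _ _ (graph_L2 l ch cF) (graph_L2 l ch cG)).
Qed.

Lemma tr2Z l h F (c : R) : continuous h -> continuous F -> tr2 0 l h (fun x => c * F x) = c ^+ 2 * tr2 0 l h F.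
Proof.
move=> ch cF; have mI : measurable (`]0, l[%classic : set (measurableTypeR R)) by exact: measurable_itv.
exact: (@QZ _ _ _ leb _ mI c _ (graph_L2 l ch cF)).
Qed.

Lemma tr2_ge0 l h F : 0 <= tr2 0 l h F.
Proof. by apply: Rintegral_ge0 => t _; exact: sqr_ge0. Qed.

Lemma tr0D l h phi psi : continuous h -> (forall n, smooth (phi n)) -> (forall n, smooth (psi n)) ->
  tr_cvg l h phi (fun=> 0) -> tr_cvg l h psi (fun=> 0) -> tr_cvg l h (fun n x => phi n x + psi n x) (fun=> 0).
Proof.
move=> ch sp sq; have cp n := smooth_continuous (sp n); have cq n := smooth_continuous (sq n).
move=> /(tr_cvg0E _ ch cp) c1 /(tr_cvg0E _ ch cq) c2; apply/tr_cvg0E => //.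
  by move=> n x; apply: cvgD; [exact: cp|exact: cq].
apply: (@cvg0_squeeze _ _ (fun n => 2 * tr2 0 l h (phi n) + 2 * tr2 0 l h (psi n))).
- by move=> n; exact: tr2_ge0.
- by move=> n; exact: tr2_le.
- by rewrite -[X in _ --> X](addr0 0); apply: cvgD; rewrite -[X in _ --> X](mulr0 2); exact: cvgZr.
Qed.

Lemma tr0Z l h phi (c : R) : continuous h -> (forall n, smooth (phi n)) ->
  tr_cvg l h phi (fun=> 0) -> tr_cvg l h (fun n x => c * phi n x) (fun=> 0).
Proof.
move=> ch sp; have cp n := smooth_continuous (sp n).
move=> /(tr_cvg0E _ ch cp) c1; apply/tr_cvg0E => //.
  by move=> n x; apply: cvgM; [exact: cvg_cst|exact: cp].
under eq_fun do rewrite tr2Z //.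
suff: (fun n => c ^+ 2 * tr2 0 l h (phi n)) @ \oo --> c ^+ 2 * 0 by rewrite mulr0.
exact: cvgZr.
Qed.

Section Band.
Variables (f : R -> R) (m l M : R).
Hypotheses (cf : continuous f) (fm : forall t, m <= f t) (fM : forall t, f t < M).
Local Notation Om := (strip 0 l f M).

Let mO : measurable Om. Proof. exact: strip_measurable. Qed.
Let mB : measurable (band f M). Proof. exact: band_measurable. Qed.
Let sqO : exists r, Om `<=` sq r. Proof. exact: strip_sq fm. Qed.

Definition zero_trace h U H := exists2 phi, apx Om U H phi & tr_cvg l h phi (fun=> 0).

Lemma zero_traceD h U V H G : continuous h -> zero_trace h U H -> zero_trace h V G ->
  zero_trace h (fun x => U x + V x) (fun x => ((H x).1 + (G x).1, (H x).2 + (G x).2)).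
Proof.
move=> ch [phi a1 t1] [psi a2 t2]; exists (fun n x => phi n x + psi n x); first exact: apxD.
by apply: tr0D => //; [case: a1|case: a2].
Qed.

Lemma zero_traceZ h U H (c : R) : continuous h -> zero_trace h U H ->
  zero_trace h (fun x => c * U x) (fun x => (c * (H x).1, c * (H x).2)).
Proof.
move=> ch [phi a1 t1]; exists (fun n x => c * phi n x); first exact: apxZ.
by apply: tr0Z => //; case: a1.
Qed.

(** The rough space in the variables x / eps, with l = L / eps and M = 1 / eps, and with the traces
    unfolded into approximating sequences, which may differ between the wall and the top. *)
Definition rs U H := [/\ periodic U (l, 0), weak_grad (band f M) U H, zero_trace f U H & zero_trace (fun=> M) U H].

Lemma rs_L2 U H : rs U H -> [/\ L2 mu Om U, L2 mu Om (fun x => (H x).1) & L2 mu Om (fun x => (H x).2)].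
Proof. by move=> [_ _ [phi [_ [_ l0 _] [_ l1 _] [_ l2 _]] _] _]. Qed.

Lemma rsB U V H G : rs U H -> rs V G -> rs (fun x => U x - V x) (fun x => ((H x).1 - (G x).1, (H x).2 - (G x).2)).
Proof.
move=> [p1 w1 b1 t1] [p2 w2 b2 t2].
have e (A B : R * R -> R) : (fun x => A x + -1 * B x) = (fun x => A x - B x) by apply/funext => x; rewrite mulN1r.
have eG : (fun x => ((H x).1 + -1 * (G x).1, (H x).2 + -1 * (G x).2)) = (fun x => ((H x).1 - (G x).1, (H x).2 - (G x).2)).
  by apply/funext => x; rewrite !mulN1r.
split.
- by move=> x; rewrite p1 p2.
- exact: weak_gradB.
- by have := zero_traceD cf b1 (zero_traceZ (-1) cf b2); rewrite e eG.
- by have := zero_traceD (@cst_continuous R R M) t1 (zero_traceZ (-1) (@cst_continuous R R M) t2); rewrite e eG.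
Qed.

Lemma poincare_zero U H : zero_trace f U H -> Q mu Om U <= 4 * (M - m) ^+ 2 * Q mu Om (fun x => (H x).2).
Proof.
move=> [phi [sp a0 _ a2] tr]; have cp n := smooth_continuous (sp n).
have /(tr_cvg0E _ cf cp) c := tr.
have c1 := A.cvgL2_Q mO a0; have c2 := A.cvgL2_Q mO a2.
rewrite -subr_ge0.
have c3 : (fun n => 4 * (M - m) ^+ 2 * Q mu Om ('D_e2 (phi n)) + 2 * (M - m) * tr2 0 l f (phi n) - Q mu Om (phi n)) @ \oo -->
   4 * (M - m) ^+ 2 * Q mu Om (fun x => (H x).2) + 2 * (M - m) * 0 - Q mu Om U.
  by apply: cvgB => //; apply: cvgD; apply: cvgZr.
rewrite mulr0 addr0 in c3; apply: cvg_lb c3 _ => n; rewrite subr_ge0.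
exact: (poincare_bottom cf fm).
Qed.

Lemma poincare_layer U H (d : R) : 0 < d -> (forall t, f t <= M - d) -> zero_trace (fun=> M) U H ->
  Q mu (strip 0 l (fun=> M - d) M) U <= 4 * d ^+ 2 * Q mu (strip 0 l (fun=> M - d) M) (fun x => (H x).2).
Proof.
set A := strip 0 l (fun=> M - d) M.
move=> d0 fd [phi [sp a0 _ a2] tr]; have cp n := smooth_continuous (sp n).
have cM := @cst_continuous R R M; have cd := @cst_continuous R R (M - d).
have mA : measurable A by exact: strip_measurable.
have AO : A `<=` Om by move=> x [x1 /andP[x2 x3]]; split => //; rewrite x3 andbT (le_lt_trans (fd _)).
have /(tr_cvg0E _ cM cp) c := tr.
have c1 := A.cvgL2_Q mA (A.cvgL2S mO mA AO a0); have c2 := A.cvgL2_Q mA (A.cvgL2S mO mA AO a2).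
rewrite -subr_ge0.
have c3 : (fun n => 4 * d ^+ 2 * Q mu A ('D_e2 (phi n)) + 2 * d * tr2 0 l (fun=> M) (phi n) - Q mu A (phi n)) @ \oo -->
   4 * d ^+ 2 * Q mu A (fun x => (H x).2) + 2 * d * 0 - Q mu A U.
  by apply: cvgB => //; apply: cvgD; apply: cvgZr.
rewrite mulr0 addr0 in c3; apply: cvg_lb c3 _ => n; rewrite subr_ge0.
have dM : forall t : R, 0 < t < l -> M - d < M by move=> t _; rewrite gtrBl.
have := @poincare_top R 0 l (M - d) (fun=> M - d) cd (fun=> lexx _) M (phi n) dM (sp n).
by have -> : M - (M - d) = d by lra.
Qed.

Lemma ibp_cvg U H phi (g : R -> R) : smooth1 g -> apx Om U H phi ->
  (\int[leb]_(t in `]0, l[) (g M * phi n (t, M) - g (f t) * phi n (t, f t))) @[n --> \oo] --> (0 : R) ->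
  \int[mu]_(x in Om) (g x.2 * (H x).2 + derive1 g x.2 * U x) = 0.
Proof.
move=> sg [sp a0 _ a2] c; have [r hr] := sqO.
have cg := smooth1_continuous sg; have cdg := smooth1_continuous (smooth1_derive1 sg).
have c2 (q : R -> R) : continuous q -> continuous (fun x : R * R => q x.2).
  by move=> cq x; apply: continuous_comp; [exact: cvg_snd|exact: cq].
have lq q : continuous q -> L2 mu Om (fun x => q x.2) by move=> cq; exact: (continuous_L2 (c2 _ cq) mO hr).
have l1 := A.cvgL2_pair mO (A.cvgL2_cst mO (lq _ cg)) a2.
have l2 := A.cvgL2_pair mO (A.cvgL2_cst mO (lq _ cdg)) a0.
have [_ L0 _] := a0; have [_ L2' _] := a2.
rewrite (RintD mO (A.L2_mul mO (lq _ cg) L2') (A.L2_mul mO (lq _ cdg) L0)).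
have c3 : (fun n => \int[mu]_(x in Om) (g x.2 * 'D_e2 (phi n) x) + \int[mu]_(x in Om) (derive1 g x.2 * phi n x)) @ \oo -->
  \int[mu]_(x in Om) (g x.2 * (H x).2) + \int[mu]_(x in Om) (derive1 g x.2 * U x) by apply: cvgD.
suff e n : \int[mu]_(x in Om) (g x.2 * 'D_e2 (phi n) x) + \int[mu]_(x in Om) (derive1 g x.2 * phi n x) =
    \int[leb]_(t in `]0, l[) (g M * phi n (t, M) - g (f t) * phi n (t, f t)).
  have E1 := cvg_lim (@norm_hausdorff _ _) c; have E2 := cvg_lim (@norm_hausdorff _ _) c3.
  by rewrite -[LHS]E2 -[RHS]E1; under [in LHS]eq_fun do rewrite e.
have cD : continuous ('D_e2 (phi n)) by apply: smooth_continuous; exact: D2_smooth.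
have cp := smooth_continuous (sp n).
rewrite -(RintD mO (A.L2_mul mO (lq _ cg) (continuous_L2 cD mO hr)) (A.L2_mul mO (lq _ cdg) (continuous_L2 cp mO hr))).
have sF : smooth (fun x => g x.2 * phi n x) by apply: smoothM => //; exact: smooth_snd.
have cD' : continuous ('D_e2 (fun x => g x.2 * phi n x)) by apply: smooth_continuous; exact: D2_smooth.
rewrite -(@strip_D2 R (fun x => g x.2 * phi n x) ('D_e2 (fun x => g x.2 * phi n x)) 0 l f M m cf fm (fun t _ => fM t) (fun x => smooth_D2 x sF) cD').
apply: Rint_eq => x _; rewrite D2_mul //; last exact: smooth_snd.
by rewrite D2_snd // [_ * phi n x]mulrC.
Qed.

Lemma trace_int h phi (q : R -> R) : continuous h -> continuous q -> (forall n, smooth (phi n)) -> tr_cvg l h phi (fun=> 0) ->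
  \int[leb]_(t in `]0, l[) (q t * phi n (t, h t)) @[n --> \oo] --> (0 : R).
Proof.
move=> ch cq sp tr; have cp n := smooth_continuous (sp n).
have mI : measurable (`]0, l[%classic : set (measurableTypeR R)) by exact: measurable_itv.
have lq : L2 leb `]0, l[ q.
  have := @graph_L2 l h (fun x => q x.1) ch; apply => x; by apply: continuous_comp; [exact: cvg_fst|exact: cq].
have c := tr_cvgL2 ch cp (measurable_cst _) tr.
have := cvgL2_pair mI (cvgL2_cst mI lq) c.
under [X in _ --> X]eq_Rintegral do rewrite mulr0.
by rewrite Rintegral_cst ?mul0r //; exact: mI.
Qed.

(** No single sequence is known to have vanishing traces on both boundaries. A cutoff splits [g]
    into a part that vanishes at the top, treated with the sequence for the wall, and a part that
    vanishes on the graph, treated with the sequence for the top. *)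
Lemma ibp_zero U H (g : R -> R) (d : R) : 0 < d -> (forall t, f t <= M - d) -> zero_trace f U H -> zero_trace (fun=> M) U H ->
  smooth1 g -> \int[mu]_(x in Om) (g x.2 * (H x).2 + derive1 g x.2 * U x) = 0.
Proof.
move=> d0 fd [phi ap tp] [psi aq tq] sg.
pose k (y : R) := step (d^-1 * y + (1 - d^-1 * M)).
have sk : smooth1 k by apply: (@smooth1_comp R (@step R) (fun y => d^-1 * y + (1 - d^-1 * M))); [exact: step_smooth|exact: smooth1_affine].
have kf t : k (f t) = 0.
  have h1 : 1 <= d^-1 * (M - f t) by rewrite ler_pdivlMl // mulr1; have := fd t; lra.
  by rewrite /k step_le0 //; move: h1; rewrite mulrBr; lra.
have kM : k M = 1 by rewrite /k step_ge1 // addrC subrK.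
pose g1 y := g y * (1 - k y); pose g2 y := g y * k y.
have s1 : smooth1 g1 by apply: smooth1M => //; apply: smooth1B => //; exact: smooth1_cst.
have s2 : smooth1 g2 by apply: smooth1M.
have cgf : continuous (fun t => - g (f t)).
  by move=> t; apply: cvgN; apply: continuous_comp; [exact: cf|exact: smooth1_continuous].
have i1 : \int[mu]_(x in Om) (g1 x.2 * (H x).2 + derive1 g1 x.2 * U x) = 0.
  apply: (ibp_cvg s1 ap); have [sp _ _ _] := ap; have := trace_int cf cgf sp tp; apply: cvg_trans.
  apply: near_eq_cvg; apply: nearW => n; apply: eq_Rintegral => t _.
  by rewrite /g1 kM kf subrr !mulr0 mul0r subr0 mulr1 sub0r mulNr.
have i2 : \int[mu]_(x in Om) (g2 x.2 * (H x).2 + derive1 g2 x.2 * U x) = 0.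
  apply: (ibp_cvg s2 aq); have [sp _ _ _] := aq.
  have := trace_int (@cst_continuous R R M) (@cst_continuous R R (g M)) sp tq; apply: cvg_trans.
  apply: near_eq_cvg; apply: nearW => n; apply: eq_Rintegral => t _.
  by rewrite /g2 kM kf mulr0 mul0r subr0 mulr1.
have [r hr] := sqO; have [_ [_ L0 _] _ [_ L2' _]] := ap.
have ig (q : R -> R) : smooth1 q -> mu.-integrable Om (EFin \o (fun x => q x.2 * (H x).2 + derive1 q x.2 * U x)).
  move=> sq; have c2 (p : R -> R) : continuous p -> L2 mu Om (fun x : R * R => p x.2).
    move=> cp; apply: (@continuous_L2 R (fun x : R * R => p x.2) Om r) => // x.
    by apply: continuous_comp; [exact: cvg_snd|exact: cp].
  have j1 := A.L2_mul mO (c2 _ (smooth1_continuous sq)) L2'.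
  have j2 := A.L2_mul mO (c2 _ (smooth1_continuous (smooth1_derive1 sq))) L0.
  exact: areaD mO j1 j2.
transitivity (\int[mu]_(x in Om) ((g1 x.2 * (H x).2 + derive1 g1 x.2 * U x) + (g2 x.2 * (H x).2 + derive1 g2 x.2 * U x))); last first.
  by rewrite (RintD mO (ig _ s1) (ig _ s2)) i1 i2 addr0.
apply: Rint_eq => x _.
have -> : derive1 g x.2 = derive1 g1 x.2 + derive1 g2 x.2.
  have eg : g = (fun y => g1 y + g2 y) by apply/funext => y; rewrite /g1 /g2; ring.
  rewrite [in LHS]eg derive1E; apply: derive_val; apply: is_deriveD; exact: smooth1_derive.
by rewrite /g1 /g2; ring.
Qed.

End Band.
End ZeroTrace.

(** * Testing the cell problem over several periods *)

Section Periods.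
Variable R : realType.
Local Notation mu := (area R).
Local Notation leb := (@lebesgue_measure R).
Variables (f : R -> R) (kap delta : R).
Local Notation T := (2 * pi).
Hypotheses (fT : periodic f T) (fge : forall t, -1 <= f t) (d0 : 0 < delta) (fd : forall t, f t < - delta).
Hypotheses (kap0 : 0 <= kap) (flip : forall s t, `|f s - f t| <= kap * `|s - t|).
Variables (v : R * R -> R) (G : R * R -> R * R).
Local Notation E := (above f).
Hypotheses (pv : periodic v (T, 0)) (wG : weak_grad E v G).
Hypotheses (lG1 : L2 mu (col E 0 T) (fun x => (G x).1)) (lG2 : L2 mu (col E 0 T) (fun x => (G x).2)).
Hypothesis test : forall phi H, periodic phi (T, 0) -> weak_grad E phi H ->
  L2 mu (col E 0 T) (fun x => (H x).1) -> L2 mu (col E 0 T) (fun x => (H x).2) ->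
  has_trace (cell_P f) T f phi (fun=> 0) -> \int[mu]_(x in col E 0 T) dot (G x) (H x) = 0.

Let T0 : 0 < T :> R. Proof. by rewrite mulr_gt0 ?pi_gt0. Qed.
Let cf : continuous f := f_continuous kap0 flip.
Let mE : measurable E := above_measurable kap0 flip.
Let ET : forall x, E (x.1 + T, x.2) <-> E x := @aboveT R f T fT.
Let mC a b : measurable (col E a b). Proof. exact: col_measurable. Qed.

Variables (N : nat) (N0 : (0 < N)%N) (Phi : R * R -> R) (Psi : R * R -> R * R) (chi : nat -> R * R -> R).
Local Notation l := (T * N%:R).
Hypotheses (pPhi : periodic Phi (l, 0)) (wPhi : weak_grad E Phi Psi).
Hypotheses (l1 : L2 mu (col E 0 l) (fun x => (Psi x).1)) (l2 : L2 mu (col E 0 l) (fun x => (Psi x).2)).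
Hypotheses (achi : apx (strip 0 l f 0) Phi Psi chi) (tchi : tr_cvg l f chi (fun=> 0)).

Let sh (k : nat) x : R * R := (shift (T * k%:R) (fun x => (Psi x).1) x, shift (T * k%:R) (fun x => (Psi x).2) x).

Let TS (k : nat) : T * k.+1%:R = T * k%:R + T :> R.
Proof. by rewrite -[k.+1]addn1 natrD mulrDr mulr1. Qed.

Let inN (k : nat) : (k < N)%N -> 0 <= T * k%:R :> R /\ T + T * k%:R <= l :> R.
Proof.
move=> kN; split; first by rewrite mulr_ge0 ?ler0n ?ltW.
by rewrite addrC -TS ler_pM2l // ler_nat.
Qed.

Let fTn k t : f (t + T * k%:R) = f t.
Proof. by elim: k => [|k IH]; rewrite ?mulr0 ?addr0 // TS addrA fT. Qed.

Lemma shift_piece k : (k < N)%N -> [/\ weak_grad E (shift (T * k%:R) Phi) (sh k),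
  L2 mu (col E 0 T) (fun x => (sh k x).1), L2 mu (col E 0 T) (fun x => (sh k x).2) &
  zero_trace f T 0 f (shift (T * k%:R) Phi) (sh k)].
Proof.
move=> kN; have [k0 kl] := inN kN.
have lsh (g : R * R -> R) : L2 mu (col E 0 l) g -> L2 mu (col E 0 T) (shift (T * k%:R) g).
  move=> lg; have sub : col E (0 + T * k%:R) (T + T * k%:R) `<=` col E 0 l by apply: colS; rewrite ?add0r.
  have := L2_aff (T * k%:R) 0 (@oner_neq0 R) (@oner_neq0 R) (mC _ _) (A.L2S (mC _ _) (mC _ _) sub lg).
  by rewrite (col_pre ET) shiftE.
split; [exact: (weak_grad_shift fT kap0 flip k wPhi)|exact: (lsh _ l1)|exact: (lsh _ l2)|].
exists (fun n => shift (T * k%:R) (chi n)).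
  have mS a b : measurable (strip a b f 0) by exact: strip_measurable.
  have sub : strip (T * k%:R) (T + T * k%:R) f 0 `<=` strip 0 l f 0.
    by move=> x [/andP[x1 x2] x3]; split => //; rewrite (le_lt_trans k0) // (lt_le_trans x2).
  have := apx_aff (T * k%:R) 0 (@oner_neq0 R) (@oner_neq0 R) (mS _ _) (apxS (mS _ _) (mS _ _) sub achi).
  have -> : aff 1 (T * k%:R) 1 0 @^-1` strip (T * k%:R) (T + T * k%:R) f 0 = strip 0 T f 0.
    apply/seteqP; split => x; rewrite /strip /aff /= !mul1r addr0 fTn ltrD2r -{1}[T * k%:R]add0r ltrD2r //.
  have -> : (fun n => chi n \o aff 1 (T * k%:R) 1 0) = (fun n => shift (T * k%:R) (chi n)) by apply/funext => n; rewrite shiftE.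
  rewrite -shiftE; congr (apx _ _ _ _); apply/funext => x.
  by rewrite /sh /shift /aff /= !mul1r addr0.
have [schi _ _ _] := achi; have cchi n := smooth_continuous (schi n).
pose q n (t : R) : R := (chi n (t, f t) - 0) ^+ 2.
have cq n : continuous (q n).
  by apply: sqr_continuous => t; apply: cvgB; [exact: (graph_continuous cf (cchi n))|exact: cvg_cst].
have mq n D : measurable_fun D (q n) by apply: measurable_funTS; exact: continuous_measurable_fun.
apply: tends0_le tchi => n; first by apply: intE_ge0 => t _; exact: sqr_ge0.
have q0 t : 0 <= q n t by exact: sqr_ge0.
have := @int_itv_aff R 1 (T * k%:R) (@oner_neq0 R) 0 T (q n) ltr01 (mq n _) q0.
rewrite mulr0 add0r mul1r mul1e => e.
have -> : (\int[leb]_(t in `]0%R, T[) ((shift (T * k%:R) (chi n) (t, f t) - 0) ^+ 2)%:E = \int[leb]_(t in `]0%R, T[) (q n (1 * t + T * k%:R))%:E)%E.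
  by apply: eq_integral => t _; rewrite /q /shift /= mul1r fTn.
rewrite -e; apply: (@le_int_sub _ _ _ leb _ (measurable_itv _) (q n) _ (measurable_itv _) (mq n _) (fun t _ => q0 t)).
move=> t /= /[!in_itv]/= /andP[t1 t2]; rewrite (le_lt_trans k0) //=; exact: lt_le_trans kl.
Qed.

Let S n x := \sum_(k < n) shift (T * k%:R) Phi x.
Let SG n x : R * R := (\sum_(k < n) (sh k x).1, \sum_(k < n) (sh k x).2).

Lemma shift_sums n : (n <= N)%N -> [/\ weak_grad E (S n) (SG n),
  L2 mu (col E 0 T) (fun x => (SG n x).1), L2 mu (col E 0 T) (fun x => (SG n x).2) &
  zero_trace f T 0 f (S n) (SG n)].
Proof.
elim: n => [|n IH] nN.
  (* The empty sum is obtained as 0 times a translate, which already belongs to all the spaces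
     concerned. *)
  have [h1 h2 h3 h4] := shift_piece N0.
  have eS : (fun x => 0 * shift (T * 0%:R) Phi x) = S 0 by apply/funext => x; rewrite /S big_ord0 mul0r.
  have eG : (fun x => (0 * (sh 0 x).1, 0 * (sh 0 x).2)) = SG 0 by apply/funext => x; rewrite /SG !big_ord0 !mul0r.
  have e1' : (fun x => 0 * (sh 0 x).1) = (fun x => (SG 0 x).1) by apply/funext => x; rewrite /SG /= big_ord0 mul0r.
  have e2' : (fun x => 0 * (sh 0 x).2) = (fun x => (SG 0 x).2) by apply/funext => x; rewrite /SG /= big_ord0 mul0r.
  split.
  - by have := weak_gradZ 0 mE h1; rewrite eS eG.
  - by have := A.L2Z (mC 0 T) 0 h2; rewrite e1'.
  - by have := A.L2Z (mC 0 T) 0 h3; rewrite e2'.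
  - by have := zero_traceZ cf 0 cf h4; rewrite eS eG.
have [a1 a2 a3 a4] := IH (ltnW nN); have [h1 h2 h3 h4] := shift_piece nN.
have eS : (fun x => S n x + shift (T * n%:R) Phi x) = S n.+1 by apply/funext => x; rewrite /S big_ord_recr.
have eG : (fun x => ((SG n x).1 + (sh n x).1, (SG n x).2 + (sh n x).2)) = SG n.+1.
  by apply/funext => x; rewrite /SG !big_ord_recr.
have e1' : (fun x => (SG n x).1 + (sh n x).1) = (fun x => (SG n.+1 x).1) by apply/funext => x; rewrite /SG /= big_ord_recr.
have e2' : (fun x => (SG n x).2 + (sh n x).2) = (fun x => (SG n.+1 x).2) by apply/funext => x; rewrite /SG /= big_ord_recr.
split.
- by have := weak_gradD mE a1 h1; rewrite eS eG.
- by have := A.L2D (mC 0 T) a2 h2; rewrite e1'.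
- by have := A.L2D (mC 0 T) a3 h3; rewrite e2'.
- by have := zero_traceD cf cf a4 h4; rewrite eS eG.
Qed.

Lemma shift_sum_periodic : periodic (S N) (T, 0).
Proof.
move=> x; rewrite /S /shift /=.
pose a k := Phi (x.1 + T * k%:R, x.2).
rewrite (eq_bigr (fun k : 'I_N => a k.+1)); last first.
  by move=> k _; rewrite /a addr0 -addrA TS [T + _]addrC.
(* A shift by one period permutes the translates cyclically: the last one returns to the first
   because [l] is a period of [Phi]. *)
have aN : a N = a 0 by rewrite /a (periodicE _ pPhi) mulr0 addr0; case: (x).
apply: (addrI (a 0)); rewrite -[RHS]addrC -aN -(big_ord_recr N (idx := 0) (op := +%R) (fun k : 'I_N.+1 => a k)) /=.
by rewrite aN big_ord_recl.
Qed.

(** The sum of the translates has period T and vanishing trace, so the cell equation applies to it;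
    unfolding turns this one-cell integral back into the integral over N periods. *)
Lemma test_periods : \int[mu]_(x in col E 0 l) dot (G x) (Psi x) = 0.
Proof.
have [w s1 s2 [phi aphi tphi]] := shift_sums (leqnn N).
have oP : open (strip 0 T f 0) by exact: strip_open.
have mP : measurable (strip 0 T f 0) by exact: strip_measurable.
have PE : strip 0 T f 0 `<=` E by move=> x [_ /andP[]].
have := test shift_sum_periodic w s1 s2 (apx_has_trace oP (weak_grad_restrict mE mP PE w) (measurable_cst _) aphi tphi).
have [p1 p2] := grad_ae_periodic fT kap0 flip pv wG.
have mG1 := meas_G1 wG; have mG2 := meas_G2 wG.
have g1 := L2_cols mE T0 ET N mG1 p1 lG1; have g2 := L2_cols mE T0 ET N mG2 p2 lG2.
have i1 := A.L2_mul (mC _ _) g1 l1; have i2 := A.L2_mul (mC _ _) g2 l2.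
have I1 : \int[mu]_(x in col E 0 l) ((G x).1 * (Psi x).1) = _ := Rint_unfold mE T0 ET i1 p1 mG1 (meas_G1 wPhi).
have I2 : \int[mu]_(x in col E 0 l) ((G x).2 * (Psi x).2) = _ := Rint_unfold mE T0 ET i2 p2 mG2 (meas_G2 wPhi).
have sumI n : (n <= N)%N -> mu.-integrable (col E 0 T) (EFin \o (fun x => dot (G x) (SG n x))) /\
  \int[mu]_(x in col E 0 T) dot (G x) (SG n x) = \sum_(k < n) \int[mu]_(x in col E 0 T) ((G x).1 * (sh k x).1) +
    \sum_(k < n) \int[mu]_(x in col E 0 T) ((G x).2 * (sh k x).2).
  elim: n => [|n IH] nN.
    have [_ t1 t2 _] := shift_sums nN.
    have j := areaD (mC _ _) (A.L2_mul (mC _ _) lG1 t1) (A.L2_mul (mC _ _) lG2 t2).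
    split; first exact: j.
    have := RintZ 0 (mC _ _) j; rewrite mul0r !big_ord0 addr0 => h; rewrite -[RHS]h.
    by apply: Rint_eq => x _; rewrite /dot /SG /= !big_ord0 !mulr0 addr0 mul0r.
  have [_ t1 t2 _] := shift_sums nN; have [_ h2 h3 _] := shift_piece nN.
  have j1 := A.L2_mul (mC _ _) lG1 h2; have j2 := A.L2_mul (mC _ _) lG2 h3; have j3 := areaD (mC _ _) j1 j2.
  split; first exact: areaD (mC _ _) (A.L2_mul (mC _ _) lG1 t1) (A.L2_mul (mC _ _) lG2 t2).
  have [i3 I3] := IH (ltnW nN); rewrite !big_ord_recr /=.
  transitivity (\int[mu]_(x in col E 0 T) (dot (G x) (SG n x) + ((G x).1 * (sh n x).1 + (G x).2 * (sh n x).2))).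
    by apply: Rint_eq => x _; rewrite /dot /SG /= !big_ord_recr /=; ring.
  by rewrite (RintD (mC _ _) i3 j3) (RintD (mC _ _) j1 j2) I3; ring.
have [_ ->] := sumI N (leqnn N) => e.
rewrite -[RHS]e -I1 -I2.
exact: (RintD (mC _ _) i1 i2).
Qed.

End Periods.

(** * The energy identity *)

Section Elementary.
Variable R : realType.
Implicit Types (k B s t d : R).

Lemma sqr_le_bound k B : `|k| <= B -> k ^+ 2 <= B ^+ 2.
Proof. by rewrite ler_norml => /andP[h1 h2]; nra. Qed.

Lemma young1 k B s t : `|k| <= B -> k * (s * t) <= 4^-1 * t ^+ 2 + B ^+ 2 * s ^+ 2.
Proof.
by move=> /sqr_le_bound h; have := sqr_ge0 (2^-1 * t - k * s); have := ler_wpM2r (sqr_ge0 s) h; nra.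
Qed.

(** The coefficient of s^2 is matched to Poincare's inequality in a layer of thickness d: its
    constant 4 d^2 times 1 / (16 d^2) is 1 / 4. *)
Lemma young2 k B s t d : 0 < d -> `|k| <= B ->
  - (k * (s * t)) <= (16 * d ^+ 2)^-1 * s ^+ 2 + 4 * B ^+ 2 * d ^+ 2 * t ^+ 2.
Proof.
move=> d0 /sqr_le_bound h; have dn : d != 0 by rewrite gt_eqF.
have e : (16 * d ^+ 2)^-1 * s ^+ 2 + k * (s * t) + 4 * d ^+ 2 * (k ^+ 2 * t ^+ 2) = ((4 * d)^-1 * s + 2 * d * (k * t)) ^+ 2.
  by field.
have g : d ^+ 2 * (k ^+ 2 * t ^+ 2) <= d ^+ 2 * (B ^+ 2 * t ^+ 2).
  by rewrite ler_wpM2l ?sqr_ge0 // ler_wpM2r ?sqr_ge0.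
have := sqr_ge0 ((4 * d)^-1 * s + 2 * d * (k * t)); rewrite -e.
set a := (16 * d ^+ 2)^-1 * _; move: g; nra.
Qed.

Lemma add4_le (a b x y z t : R) : a <= x + y -> - b <= z + t -> a - b <= x + z + (y + t).
Proof. by move=> *; lra. Qed.

Lemma absorb (q1 q2 qA x1 x2 x3 D : R) : 0 <= q1 -> qA <= q2 -> x1 <= 4^-1 * qA -> x2 <= D -> x3 <= 4 * D ->
  q1 + q2 <= 4^-1 * qA + x1 + (x2 + x3) -> q1 + q2 <= 10 * D.
Proof. by move=> *; lra. Qed.

Lemma sum_bound (r1 r2 h1 h2 t1 t2 t3 t23 g1 g2 b D : R) : r1 <= 2 * h1 + 2 * t1 -> r2 <= 2 * h2 + 2 * t23 ->
  t23 <= 2 * t2 + 2 * t3 -> t1 <= g1 -> t2 <= g2 -> t3 <= b * D -> g1 + g2 <= D -> h1 + h2 <= 10 * b * D ->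
  0 <= g1 -> 0 <= g2 -> r1 + r2 <= (24 * b + 6) * D.
Proof.
have -> : (24 * b + 6) * D = 24 * (b * D) + 6 * D by ring.
have -> : 10 * b * D = 10 * (b * D) by ring.
by move: (b * D) => y *; lra.
Qed.

Lemma sum_bound0 (r q t m b D : R) : r <= 2 * q + 2 * t -> q <= 4 * m * (10 * b * D) -> t <= D ->
  r <= 80 * m * b * D + 2 * D.
Proof.
have -> : 4 * m * (10 * b * D) = 40 * (m * b * D) by ring.
have -> : 80 * m * b * D = 80 * (m * b * D) by ring.
by move: (m * b * D) => y *; lra.
Qed.
End Elementary.

Section Key.
Variable R : realType.
Local Notation mu := (area R).
Variables (f : R -> R) (kap delta : R).
Local Notation T := (2 * pi).
Hypotheses (fT : periodic f T) (fge : forall t, -1 <= f t) (d0 : 0 < delta) (fd : forall t, f t < - delta).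
Hypotheses (kap0 : 0 <= kap) (flip : forall s t, `|f s - f t| <= kap * `|s - t|).
Variables (v : R * R -> R) (G : R * R -> R * R).
Local Notation E := (above f).
Local Notation G1 := (fun x => (G x).1).
Local Notation G2 := (fun x => (G x).2).
Hypotheses (pv : periodic v (T, 0)) (wG : weak_grad E v G).
Hypotheses (lG1 : L2 mu (col E 0 T) G1) (lG2 : L2 mu (col E 0 T) G2).
Hypothesis lP : L2 mu (strip 0 T f 0) v.
Hypothesis test : forall phi H, periodic phi (T, 0) -> weak_grad E phi H ->
  L2 mu (col E 0 T) (fun x => (H x).1) -> L2 mu (col E 0 T) (fun x => (H x).2) ->
  has_trace (cell_P f) T f phi (fun=> 0) -> \int[mu]_(x in col E 0 T) dot (G x) (H x) = 0.
Variables (vbar k2 : R).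
Hypothesis decay_v : forall s, 0 <= s -> L2 mu (upper s) (fun x => v x - vbar) /\
  Q mu (upper s) (fun x => v x - vbar) <= k2 * expR (- 2 * s).
Hypothesis decay_G : forall s, 0 <= s -> Q mu (upper s) G1 + Q mu (upper s) G2 <= k2 * expR (- 2 * s).

Let T0 : 0 < T :> R. Proof. by rewrite mulr_gt0 ?pi_gt0. Qed.
Let cf : continuous f := f_continuous kap0 flip.
Let mE : measurable E := above_measurable kap0 flip.
Let ET : forall x, E (x.1 + T, x.2) <-> E x := @aboveT R f T fT.

Variables (N : nat) (N0 : (0 < N)%N) (M d B : R).
Hypotheses (dp : 0 < d) (d1 : d <= 1) (dM : d <= M) (hB : forall y : R, 2 / d * dstep y <= B).
Local Notation l := (T * N%:R).
Local Notation Om := (strip 0 l f M).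
Local Notation A := (strip 0 l (fun=> M - d) M).
Let f0 t : f t < 0. Proof. by apply: lt_trans (fd t) _; rewrite oppr_lt0. Qed.
Let Md : 0 <= M - d. Proof. by rewrite subr_ge0. Qed.
Let M0 : 0 < M. Proof. exact: lt_le_trans dM. Qed.
Let fM t : f t < M. Proof. exact: lt_trans M0. Qed.
Let fMd t : f t <= M - d. Proof. exact: le_trans (ltW (f0 t)) Md. Qed.
Let mO : measurable Om. Proof. exact: strip_measurable. Qed.
Let mA : measurable A. Proof. by apply: strip_measurable; exact: cst_continuous. Qed.
Let AO : A `<=` Om.
Proof. by move=> x [x1 /andP[x2 x3]]; split => //; rewrite x3 andbT (le_lt_trans (fMd _)). Qed.
Let mB : measurable (band f M). Proof. exact: band_measurable. Qed.
Let BE : band f M `<=` E. Proof. by move=> x /andP[]. Qed.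
Let OC : Om `<=` col E 0 l. Proof. by move=> x [x1 /andP[]]. Qed.
Let mC : measurable (col E 0 l). Proof. exact: col_measurable. Qed.
Let sqO : exists r, Om `<=` sq r. Proof. exact: strip_sq fge. Qed.

(** The size of the cutoff layer: the decay estimate from height M - d in each of the N periods,
    where d <= 1 costs the factor e^2. *)
Let Dc := N%:R * (k2 * expR 2 * expR (- 2 * M)).

Lemma Q_layer (g : R * R -> R) : measurable_fun E g -> ae_periodic E T g -> L2 mu (upper (M - d)) g ->
  L2 mu A g /\ Q mu A g <= N%:R * Q mu (upper (M - d)) g.
Proof.
move=> mg pg lg; pose E' := above (fun=> M - d : R).
have mE' : measurable E' by apply: open_measurable2; apply: above_open; exact: cst_continuous.
have ET' x : E' (x.1 + T, x.2) <-> E' x by [].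
have EE : E' `<=` E by move=> x; exact: le_lt_trans (fMd _).
have mg' : measurable_fun E' g by apply: measurable_funS mg.
have pg' := ae_periodicS EE pg.
have lN := L2_cols mE' T0 ET' N mg' pg' lg.
have mCN : measurable (col E' 0 l) by exact: col_measurable.
have AC : A `<=` col E' 0 l by move=> x [x1 /andP[x2 _]].
split; first exact: A.L2S mCN mA AC lN.
apply: le_trans (A.QS mCN mA AC lN) _.
rewrite /Q -(Rint_period mE' T0 ET' (A.L2_sqr lN)) //.
- by move=> k; apply: (ae_eq2_op (fun a b : R => a ^+ 2) (pg' k) (pg' k)).
- exact: sqr_meas.
Qed.

Let edM : N%:R * (k2 * expR (- 2 * (M - d))) <= Dc.
Proof.
have [_ h] := decay_v Md; have h0 := le_trans (Q_ge0 _ _ _) h.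
have k20 : 0 <= k2 by rewrite -(pmulr_lge0 _ (expR_gt0 (- 2 * (M - d)))).
rewrite /Dc ler_wpM2l ?ler0n // -mulrA ler_wpM2l // -expRD ler_expR.
move: d1; lra.
Qed.

Lemma layer_bounds : [/\ L2 mu A (fun x => v x - vbar), L2 mu A G1, L2 mu A G2,
  Q mu A (fun x => v x - vbar) <= Dc & Q mu A G1 + Q mu A G2 <= Dc].
Proof.
have mv := meas_v wG; have mG1 := meas_G1 wG; have mG2 := meas_G2 wG.
have [p1 p2] := grad_ae_periodic fT kap0 flip pv wG.
have U0 : upper (M - d) `<=` col E 0 T by move=> x [x1 x2]; split => //; exact: le_lt_trans (fMd _) x2.
have mU := @upper_measurable R (M - d).
have mC1 : measurable (col E 0 T) by exact: col_measurable.
have [lv qv] := decay_v Md.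
have l1 := A.L2S mC1 mU U0 lG1; have l2 := A.L2S mC1 mU U0 lG2.
have pw : ae_periodic E T (fun x => v x - vbar).
  by move=> k; apply: (ae_eq2_op (fun a b : R => a - vbar) (v_ae_periodic f pv k) (v_ae_periodic f pv k)).
have mw : measurable_fun E (fun x => v x - vbar) by exact: measurable_funB.
have [a1 b1] := Q_layer mw pw lv; have [a2 b2] := Q_layer mG1 p1 l1; have [a3 b3] := Q_layer mG2 p2 l2.
split => //.
  by apply: le_trans b1 _; apply: le_trans edM; rewrite ler_wpM2l ?ler0n.
apply: le_trans (lerD b2 b3) _; rewrite -mulrDr; apply: le_trans edM; rewrite ler_wpM2l ?ler0n //.
exact: decay_G.
Qed.

(** Rises from 0 to 1 in the lower half of the layer. In the upper half it is 1, which leaves room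
    to extend functions multiplied by 1 - chi by zero beyond height M. *)
Let chi (y : R) : R := step (2 / d * y + - (2 / d * (M - d))).
Let schi : smooth1 chi.
Proof. by apply: (@smooth1_comp R (@step R) (fun y => 2 / d * y + - (2 / d * (M - d)))); [exact: step_smooth|exact: smooth1_affine]. Qed.
Let d20 : 0 < 2 / d. Proof. by rewrite divr_gt0. Qed.
Let dchiE y : derive1 chi y = 2 / d * dstep (2 / d * y + - (2 / d * (M - d))).
Proof. by rewrite derive1_affine_comp //; exact: step_smooth. Qed.
Let chi_low y : y <= M - d -> chi y = 0 /\ derive1 chi y = 0.
Proof.
move=> yM; have h : 2 / d * y + - (2 / d * (M - d)) <= 0 by rewrite -mulrBr pmulr_rle0 // subr_le0.
by rewrite dchiE /chi step_le0 // dstep_out ?mulr0 //; left.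
Qed.
Let chi_high y : M - d / 2 <= y -> chi y = 1 /\ derive1 chi y = 0.
Proof.
move=> yM; have h : 1 <= 2 / d * y + - (2 / d * (M - d)).
  rewrite -mulrBr; apply: (@le_trans _ _ (2 / d * (d / 2))); last by rewrite ler_pM2l //; lra.
  by rewrite le_eqVlt; apply/orP; left; apply/eqP; field; rewrite gt_eqF.
by rewrite dchiE /chi step_ge1 // dstep_out ?mulr0 //; right.
Qed.
Let dchi_bound y : `|derive1 chi y| <= B.
Proof. by rewrite dchiE ger0_norm ?hB // mulr_ge0 ?dstep_ge0 // ltW. Qed.
Let chi01 y : 0 <= chi y <= 1. Proof. by rewrite step_ge0 step_le1. Qed.

Variables (p : R -> R) (c : R) (psi : nat -> R * R -> R).
Hypotheses (sp : smooth1 p) (pM : p M = - vbar) (ddp : forall y, derive1 (derive1 p) y = - c).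
Hypotheses (apsi : apx (strip 0 T f 0) v G psi) (tpsi : tr_cvg T f psi (fun t => - p (f t))).
Variables (U : R * R -> R) (GU : R * R -> R * R).
Hypotheses (rU : rs f l M U GU)
  (eqU : forall Phi Psi, rs f l M Phi Psi -> \int[mu]_(x in Om) dot (GU x) (Psi x) = c * \int[mu]_(x in Om) Phi x).

(** The corrected approximation F0 + F1 v is p + v - chi (v - vbar): near the top [v] gives way to
    its mean, and [pM] makes p + vbar vanish at height M. *)
Let F0y y := p y + vbar * chi y.
Let F1y y := 1 - chi y.
Let sF0y : smooth1 F0y. Proof. by apply: smooth1D => //; apply: smooth1M => //; exact: smooth1_cst. Qed.
Let sF1y : smooth1 F1y. Proof. by apply: smooth1B => //; exact: smooth1_cst. Qed.
Let dF0 y : derive1 F0y y = derive1 p y + vbar * derive1 chi y.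
Proof.
have h1 := smooth1_derive sp y; have h2 := smooth1_derive schi y.
rewrite derive1E; apply: derive_val; rewrite /F0y; apply: is_derive_eq; rewrite /GRing.scale /=; ring.
Qed.
Let dF1 y : derive1 F1y y = - derive1 chi y.
Proof.
have h2 := smooth1_derive schi y.
rewrite derive1E; apply: derive_val; rewrite /F1y; apply: is_derive_eq; rewrite /GRing.scale /=; ring.
Qed.
Let F0 (x : R * R) : R := F0y x.2.
Let F1 (x : R * R) : R := F1y x.2.
Let sF0 : smooth F0 := smooth_snd sF0y.
Let sF1 : smooth F1 := smooth_snd sF1y.
Let D1F0 x : 'D_e1 F0 x = 0. Proof. exact: (D1_snd F0y). Qed.
Let D1F1 x : 'D_e1 F1 x = 0. Proof. exact: (D1_snd F1y). Qed.
Let D2F0 x : 'D_e2 F0 x = derive1 p x.2 + vbar * derive1 chi x.2. Proof. by rewrite -dF0; exact: (D2_snd x sF0y). Qed.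
Let D2F1 x : 'D_e2 F1 x = - derive1 chi x.2. Proof. by rewrite -dF1; exact: (D2_snd x sF1y). Qed.

Let w x := F0 x + F1 x * v x.
Let Gw x : R * R := ((grad F0 x).1 + (F1 x * (G x).1 + v x * 'D_e1 F1 x), (grad F0 x).2 + (F1 x * (G x).2 + v x * 'D_e2 F1 x)).

Lemma corrected_rs : rs f l M w Gw.
Proof.
have [phi aphi pphi] := density T0 fT fge d0 fd kap0 flip pv wG lG1 lG2 lP N M0.
have [sphi _ _ _] := aphi; have cphi n := smooth_continuous (sphi n).
have mS a b Y : measurable (strip a b f Y) by exact: strip_measurable.
have sub : strip 0 T f 0 `<=` Om.
  move=> x [/andP[x1 x2] /andP[x3 x4]]; split; apply/andP; split => //; last exact: lt_trans M0.
  by apply: lt_le_trans x2 _; rewrite -{1}[T]mulr1 ler_pM2l // ler1n.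
have cp : continuous p by exact: smooth1_continuous.
have cpf : continuous (fun t => - p (f t)) by move=> t; apply: cvgN; apply: continuous_comp; [exact: cf|exact: cp].
have mpf : measurable_fun (`]0, T[%classic : set R) (fun t => - p (f t)).
  by apply: measurable_funTS; exact: continuous_measurable_fun.
have t1 := tr_cvg_change fge d0 fd kap0 flip (or_introl erefl) mpf (apxS (mS _ _ _) (mS _ _ _) sub aphi) apsi tpsi.
have ppf : periodic (fun t => - p (f t)) T by move=> t; rewrite fT.
have tN := tr_cvg_periods T0 fT d0 fd kap0 flip M0 cphi pphi cpf ppf t1.
have [r hr] := sqO.
have aw := apxD mO (apx_cst mO hr sF0) (apx_mul mO hr sF1 aphi).
split.
- move=> x; have pN : v (x + (l, 0)) = v x.
    by rewrite -[in RHS](periodic_shift N pv) /shift; congr v; apply: injective_projections; rewrite /= ?addr0.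
  by rewrite /w /F0 /F1 pN /= addr0.
- have := weak_gradD mB (weak_grad_smooth mB sF0) (weak_grad_mul mB mB (@subset_refl _ (band f M)) closedT (fun x h => h.1) sF1 (@nsetT R (fun x => F1 x = 0)) (weak_grad_restrict mE mB BE wG)).
  exact.
- exists (fun n x => F0 x + F1 x * phi n x) => //.
  apply: tr_cvg_eq tN => n t _; rewrite /F0 /F1 /F0y /F1y /=.
  have [-> _] := chi_low (fMd t); ring.
- exists (fun n x => F0 x + F1 x * phi n x) => //.
  (* At height M every approximant equals p M + vbar = 0, so the boundary error is that of the zero
     sequence. *)
  apply: (@tr_cvg_eq R l (fun=> M) (fun=> M) (fun=> 0) (fun=> 0) (fun _ _ => 0)).
    move=> n t _; rewrite /F0 /F1 /F0y /F1y /= pM.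
    have [-> _] : chi M = 1 /\ derive1 chi M = 0 by apply: chi_high; move: dp; lra.
    ring.
  apply/tr_cvg0E; [exact: cst_continuous|by move=> _; exact: cst_continuous|].
  rewrite /tr2; under eq_fun do under eq_Rintegral do rewrite expr0n.
  rewrite Rintegral_cst ?mul0r; [exact: cvg_cst|exact: measurable_itv].
Qed.

Let Phi x := U x - w x.
Let H x : R * R := ((GU x).1 - (Gw x).1, (GU x).2 - (Gw x).2).
Local Notation H1 := (fun x => (H x).1).
Local Notation H2 := (fun x => (H x).2).

Let rPhi : rs f l M Phi H. Proof. exact: rsB rU corrected_rs. Qed.

Let Psi x : R * R := (F1 x * (H x).1 + Phi x * 'D_e1 F1 x, F1 x * (H x).2 + Phi x * 'D_e2 F1 x).

Let offO x : col E 0 l x -> ~ Om x -> M <= x.2.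
Proof. by move=> [x1 x2] nO; rewrite leNgt; apply/negP => x3; apply: nO; split => //; apply/andP. Qed.

Let F1_high x : M - d / 2 <= x.2 -> F1 x = 0 /\ derive1 chi x.2 = 0.
Proof. by move=> /chi_high[h1 h2]; rewrite /F1 /F1y h1 subrr. Qed.

Let Mhigh y : M <= y -> M - d / 2 <= y.
Proof. by move=> My; move: dp My; lra. Qed.

Let mchi (D : set (R * R)) : measurable D -> measurable_fun D (fun x : R * R => derive1 chi x.2).
Proof. by move=> mD; apply: measurable_snd_fun => //; apply: smooth1_continuous; exact: smooth1_derive1. Qed.

Let mchi0 (D : set (R * R)) : measurable D -> measurable_fun D (fun x : R * R => chi x.2).
Proof. by move=> mD; apply: measurable_snd_fun => //; exact: smooth1_continuous. Qed.

Let mF1 (D : set (R * R)) : measurable D -> measurable_fun D F1.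
Proof. by move=> mD; exact: smooth_measurable. Qed.

Let F1_le x : `|F1 x| <= 1.
Proof. by have /andP[h1 h2] := chi01 x.2; rewrite /F1 /F1y ger0_norm; lra. Qed.

(** The factor [F1] vanishes above M - d / 2, so its product with [Phi] extends by zero to the
    unbounded domain and is admissible in [test_periods]. The integrand is [G] paired with the
    gradient of this product. *)
Lemma cell_test_zero : \int[mu]_(x in Om) (F1 x * ((G x).1 * (H x).1 + (G x).2 * (H x).2) - derive1 chi x.2 * (Phi x * (G x).2)) = 0.
Proof.
have [pPhi wPhi [phi aphi tphi] _] := rPhi.
have [lPhi lH1 lH2] := rs_L2 rPhi; have [r hr] := sqO.
pose Z : set (R * R) := [set x | x.2 <= M - d / 2].
have cZ : closed Z.
  have -> : Z = snd @^-1` [set t | t <= M - d / 2] by [].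
  by apply: closed_comp; [move=> x _; exact: cvg_snd|exact: closed_le].
have EZ : E `&` Z `<=` band f M.
  by move=> x [x1 x2]; apply/andP; split => //; apply: le_lt_trans x2 _; move: dp; lra.
have F1Z x : ~ Z x -> F1 x = 0 by move=> nZ; apply: (F1_high _).1; apply: ltW; rewrite ltNge; apply/negP.
have wP := weak_grad_mul mB mE BE cZ EZ sF1 F1Z wPhi.
have sub : strip 0 l f 0 `<=` Om by move=> x [x1 /andP[x2 x3]]; split => //; rewrite x2 (lt_trans x3).
have mP0 : measurable (strip 0 l f 0) by exact: strip_measurable.
have aP := apxS mO mP0 sub (apx_mul mO hr sF1 aphi).
have tP : tr_cvg l f (fun n x => F1 x * phi n x) (fun=> 0).
  by apply: tr_cvg_eq tphi => n t _; rewrite /F1 /F1y /= (chi_low (fMd t)).1 !subr0 mul1r.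
have [_ [_ k1 _] [_ k2' _] [_ k3 _]] := apx_mul mO hr sF1 aphi.
have off x : col E 0 l x -> ~ Om x -> Psi x = (0, 0).
  have alg (a1 a2 a3 : R) : (0 * a1 + a3 * 0, 0 * a2 + a3 * - 0) = (0, 0) :> R * R by congr pair; ring.
  by move=> Cx /(offO Cx) /Mhigh /F1_high[h1 h2]; rewrite /Psi D1F1 D2F1 h1 h2; exact: alg.
have l1 : L2 mu (col E 0 l) (fun x => (Psi x).1).
  apply: (L2_supp mC mO OC _ _ k2'); last by move=> x Cx nO; exact: (congr1 fst (off x Cx nO)).
  by apply: measurable_funS (meas_G1 wP) => // x [].
have l2 : L2 mu (col E 0 l) (fun x => (Psi x).2).
  apply: (L2_supp mC mO OC _ _ k3); last by move=> x Cx nO; exact: (congr1 snd (off x Cx nO)).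
  by apply: measurable_funS (meas_G2 wP) => // x [].
have pP : periodic (fun x => F1 x * Phi x) (l, 0) by move=> x; rewrite pPhi /F1 /= addr0.
have := test_periods fT kap0 flip pv wG lG1 lG2 test N0 pP wP l1 l2 aP tP.
rewrite (Rint_supp OC); last first.
  by move=> x Cx nO; have e := off x Cx nO; rewrite /Psi in e; rewrite e /dot /= !mulr0 addr0.
have alg (a1 a2 a3 a4 a5 a6 a7 : R) : a1 * (a2 * a3 + a4 * a5) - a6 * (a7 * a4) = a2 * (a1 * a3 + a7 * 0) + a4 * (a1 * a5 + a7 * - a6) by ring.
move=> h; rewrite -[RHS]h; apply: Rint_eq => x _; rewrite /dot D1F1 D2F1.
exact: (alg (F1 x) (G x).1 (H x).1 (G x).2 (H x).2 (derive1 chi x.2) (Phi x)).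
Qed.

Let GwE x : Gw x = (F1 x * (G x).1, derive1 p x.2 + F1 x * (G x).2 - derive1 chi x.2 * (v x - vbar)).
Proof. by rewrite /Gw /grad /= D1F0 D1F1 D2F0 D2F1; congr pair; ring. Qed.

Let HE x : (GU x).1 = (H x).1 + F1 x * (G x).1 /\
  (GU x).2 = (H x).2 + (derive1 p x.2 + F1 x * (G x).2 - derive1 chi x.2 * (v x - vbar)).
Proof. by rewrite /H GwE /= !subrK. Qed.

Let offA x : Om x -> ~ A x -> chi x.2 = 0 /\ derive1 chi x.2 = 0.
Proof.
move=> [x1 /andP[x2 x3]] nA; apply: chi_low; rewrite leNgt; apply/negP => x4; apply: nA.
by split => //; apply/andP.
Qed.

Lemma energy : Q mu Om H1 + Q mu Om H2 <= 10 * B ^+ 2 * Dc.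
Proof.
have [lPhi lH1 lH2] := rs_L2 rPhi; have [lU lU1 lU2] := rs_L2 rU.
have [la1 la2 la3 q1 q2] := layer_bounds.
have [_ _ zb zt] := rPhi; have [r hr] := sqO.
have cdp : continuous (derive1 p) by apply: smooth1_continuous; exact: smooth1_derive1.
have lp' : L2 mu Om (fun x => derive1 p x.2).
  apply: (@continuous_L2 R (fun x => derive1 p x.2) Om r) => // x.
  by apply: continuous_comp; [exact: cvg_snd|exact: cdp].
have ib := ibp_zero cf fge fM dp fMd zb zt (smooth1_derive1 sp).
have iL := L2_integrable mO hr lPhi.
have i1 := A.L2_mul mO lp' lH2.
have I1 : \int[mu]_(x in Om) (derive1 p x.2 * (H x).2) = c * \int[mu]_(x in Om) Phi x.
  move: ib; under eq_Rintegral do rewrite ddp.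
  rewrite (RintD mO i1 (areaZ (- c) mO iL)) (RintZ _ mO iL) mulNr => /eqP; rewrite subr_eq0 => /eqP -> //.
have I2 := eqU rPhi.
have I3 := cell_test_zero.
have [j0 J0] := Q_add_Rint mO lH1 lH2.
have lG1N : L2 mu Om G1 /\ L2 mu Om G2.
  have [g1 g2] := G_L2 kap0 flip lG1 lG2 M.
  have [p1 p2] := grad_ae_periodic fT kap0 flip pv wG.
  by split; apply: (L2_Om T0 fT kap0 flip) => //; [exact: meas_G1 wG|exact: meas_G2 wG].
have [lg1 lg2] := lG1N.
have lv : L2 mu Om (fun x => derive1 chi x.2 * (v x - vbar)).
  apply: (L2_supp mO mA AO); last exact: (A.L2_bnd mA (mchi mA) (fun x _ => dchi_bound x.2) la1).
    apply: measurable_funM; first exact: mchi.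
    by apply: measurable_funB => //; apply: measurable_funS (meas_v wG) => // x [_ /andP[]].
  by move=> x Ox /(offA Ox)[_ ->]; rewrite mul0r.
have i2 := areaD mO (A.L2_mul mO lU1 lH1) (A.L2_mul mO lU2 lH2).
have i3 : mu.-integrable Om (EFin \o (fun x => F1 x * ((G x).1 * (H x).1 + (G x).2 * (H x).2) - derive1 chi x.2 * (Phi x * (G x).2))).
  apply: areaB mO _ _.
    exact: (bnd_integrable mO (mF1 mO) (fun x _ => F1_le x) (areaD mO (A.L2_mul mO lg1 lH1) (A.L2_mul mO lg2 lH2))).
  exact: (bnd_integrable mO (mchi mO) (fun x _ => dchi_bound x.2) (A.L2_mul mO lPhi lg2)).
pose q x := derive1 chi x.2 * ((v x - vbar) * (H x).2 - Phi x * (G x).2).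
have i4 : mu.-integrable Om (EFin \o q).
  have := areaB mO (A.L2_mul mO lv lH2) (bnd_integrable mO (mchi mO) (fun x _ => dchi_bound x.2) (A.L2_mul mO lPhi lg2)).
  by congr (_.-integrable _ (EFin \o _)); apply/funext => x; rewrite /q; ring.
(* By [HE], [H] is [GU] without p', F1 G and the cutoff term. Paired with [H], the terms in [GU] and
   p' cancel by the rough equation and integration by parts, and F1 G leaves by [cell_test_zero]
   only a term in the derivative of chi. What remains is [q], supported in the layer. *)
have EQ : Q mu Om H1 + Q mu Om H2 = \int[mu]_(x in A) q x.
  have alg (a1 a2 a3 a4 a5 a6 a7 a8 a9 : R) : a2 ^+ 2 + a3 ^+ 2 = ((a2 + a1 * a4) * a2 + (a3 + (a6 + a1 * a5 - a7 * a8)) * a3 - a6 * a3)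
    - (a1 * (a4 * a2 + a5 * a3) - a7 * (a9 * a5)) + a7 * (a8 * a3 - a9 * a5) by ring.
  rewrite -J0 -(Rint_supp AO); last by move=> x Ox /(offA Ox)[_ h]; rewrite /q h mul0r.
  transitivity (\int[mu]_(x in Om) (((GU x).1 * (H x).1 + (GU x).2 * (H x).2 - derive1 p x.2 * (H x).2)
     - (F1 x * ((G x).1 * (H x).1 + (G x).2 * (H x).2) - derive1 chi x.2 * (Phi x * (G x).2)) + q x)).
    apply: Rint_eq => x _; have [-> ->] := HE x; rewrite /q.
    exact: (alg (F1 x) (H x).1 (H x).2 (G x).1 (G x).2 (derive1 p x.2) (derive1 chi x.2) (v x - vbar) (Phi x)).
  have j1 := areaB mO i2 i1.
  rewrite (RintD mO (areaB mO j1 i3) i4) (RintB mO j1 i3) (RintB mO i2 i1) I3 I1.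
  by rewrite /dot in I2; rewrite I2 subrr subr0 add0r.
have LA s : L2 mu Om s -> L2 mu A s by exact: A.L2S mO mA AO.
have lH2A := LA _ lH2; have lPA := LA _ lPhi.
have pl := poincare_layer cf dp fMd zt.
have sH2 := A.L2_sqr lH2A; have sP := A.L2_sqr lPA; have sw := A.L2_sqr la1; have sG := A.L2_sqr la3.
have [d_pos dle] := (dp, d1); have B0 : 0 <= B by apply: le_trans (dchi_bound 0).
(* With this [a1], Poincare's inequality in the layer bounds the term in [Phi] by a quarter of the
   vertical energy of [H]; [young1] contributes another quarter. Half of the energy stays on the
   left, so the remaining 5 B^2 Dc become 10 B^2 Dc. *)
pose a1 := (16 * d ^+ 2)^-1; pose a2 := B ^+ 2; pose a3 := 4 * B ^+ 2 * d ^+ 2.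
have z1 := areaZ 4^-1 mA sH2; have z2 := areaZ a1 mA sP; have z3 := areaZ a2 mA sw; have z4 := areaZ a3 mA sG.
have UB : \int[mu]_(x in A) q x <= 4^-1 * Q mu A H2 + a1 * Q mu A Phi + (a2 * Q mu A (fun x => v x - vbar) + a3 * Q mu A G2).
  rewrite -(RintZ _ mA sH2) -(RintZ _ mA sP) -(RintZ _ mA sw) -(RintZ _ mA sG).
  rewrite -(RintD mA z1 z2) -(RintD mA z3 z4) -(RintD mA (areaD mA z1 z2) (areaD mA z3 z4)).
  apply: (A.Rint_le mA).
  - exact: integrableI mO mA AO i4.
  - exact: areaD mA (areaD mA z1 z2) (areaD mA z3 z4).
  move=> x _; rewrite /q; have := dchi_bound x.2; set k := derive1 chi x.2 => hk.
  rewrite mulrBr; exact: (add4_le (young1 (v x - vbar) (H x).2 hk) (young2 (Phi x) (G x).2 dp hk)).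
have P1 : a1 * Q mu A Phi <= 4^-1 * Q mu A H2.
  apply: le_trans (ler_wpM2l _ pl) _; first by rewrite invr_ge0 mulr_ge0 ?sqr_ge0.
  rewrite /a1 mulrA le_eqVlt; apply/orP; left; apply/eqP; congr (_ * _); field.
  by rewrite gt_eqF.
have W3 : a3 * Q mu A G2 <= 4 * B ^+ 2 * Dc.
  have B4 : 0 <= 4 * B ^+ 2 by apply: mulr_ge0 => //; exact: sqr_ge0.
  rewrite /a3; apply: ler_pM; [by apply: mulr_ge0 => //; exact: sqr_ge0|exact: Q_ge0| |].
    by rewrite ler_piMr // expr_le1 // ltW.
  by apply: le_trans q2; rewrite lerDr Q_ge0.
have W2 : a2 * Q mu A (fun x => v x - vbar) <= B ^+ 2 * Dc by rewrite ler_wpM2l ?sqr_ge0.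
have W3' : a3 * Q mu A G2 <= 4 * (B ^+ 2 * Dc) by rewrite [4 * _]mulrA.
rewrite (_ : 10 * B ^+ 2 * Dc = 10 * (B ^+ 2 * Dc)); last by rewrite [RHS]mulrA.
apply: (absorb (Q_ge0 mu Om H1) (A.QS mO mA AO lH2) P1 W2 W3'); by rewrite EQ.
Qed.

Let Rr x := U x - (p x.2 + v x).
Let Rg x : R * R := ((GU x).1 - (G x).1, (GU x).2 - (derive1 p x.2 + (G x).2)).

Lemma remainder_grad : weak_grad (band f M) Rr Rg.
Proof.
have [_ wU _ _] := rU.
apply: (weak_grad_eq (fun x _ => erefl) _ (weak_gradB mB wU (weak_gradD mB (weak_grad_snd mB sp) (weak_grad_restrict mE mB BE wG)))).
by move=> x _; rewrite /Rg /= add0r.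
Qed.

Lemma Q_supp (g : R * R -> R) : measurable_fun Om g -> (forall x, Om x -> ~ A x -> g x = 0) -> L2 mu A g ->
  L2 mu Om g /\ Q mu Om g = Q mu A g.
Proof.
move=> mg g0 lg; split; first exact: (L2_supp mO mA AO).
by apply: (Rint_supp AO) => x Ox nA; rewrite g0 // expr0n.
Qed.

(** The remainder is [Phi] minus chi (v - vbar). The subtracted term and its gradient live in the
    layer and are controlled by [Dc]. Poincare's inequality over the full height, at most M + 1,
    bounds [Phi] itself. *)
Lemma remainder_bounds : [/\ L2 mu Om Rr, L2 mu Om (fun x => (Rg x).1), L2 mu Om (fun x => (Rg x).2),
  Q mu Om (fun x => (Rg x).1) + Q mu Om (fun x => (Rg x).2) <= (24 * B ^+ 2 + 6) * Dc &
  Q mu Om Rr <= 80 * (M + 1) ^+ 2 * B ^+ 2 * Dc + 2 * Dc].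
Proof.
have [lPhi lH1 lH2] := rs_L2 rPhi.
have [la1 la2 la3 q1 q2] := layer_bounds; have en := energy.
have [_ _ zb _] := rPhi; have po := poincare_zero cf fge fM zb.
have chiB x : A x -> `|chi x.2| <= 1 by move=> _; have /andP[h1 h2] := chi01 x.2; rewrite ger0_norm.
have mEO (g : R * R -> R) : measurable_fun E g -> measurable_fun Om g by move=> mg; apply: measurable_funS mg => // x /OC[].
have mw : measurable_fun Om (fun x => v x - vbar) by apply: measurable_funB => //; apply: mEO; exact: meas_v wG.
have mG1 := mEO _ (meas_G1 wG); have mG2 := mEO _ (meas_G2 wG).
pose t0 x := chi x.2 * (v x - vbar); pose t1 x := chi x.2 * (G x).1.
pose t2 x := chi x.2 * (G x).2; pose t3 x := derive1 chi x.2 * (v x - vbar).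
have off (a : R) : 0 * a = 0 by exact: mul0r.
have [L0 E0] : L2 mu Om t0 /\ Q mu Om t0 = Q mu A t0.
  apply: Q_supp; [by apply: measurable_funM => //; exact: mchi0| |exact: (A.L2_bnd mA (mchi0 mA) chiB la1)].
  by move=> x Ox /(offA Ox)[h _]; rewrite /t0 h; exact: off.
have [L1 E1] : L2 mu Om t1 /\ Q mu Om t1 = Q mu A t1.
  apply: Q_supp; [by apply: measurable_funM => //; exact: mchi0| |exact: (A.L2_bnd mA (mchi0 mA) chiB la2)].
  by move=> x Ox /(offA Ox)[h _]; rewrite /t1 h; exact: off.
have [L2' E2] : L2 mu Om t2 /\ Q mu Om t2 = Q mu A t2.
  apply: Q_supp; [by apply: measurable_funM => //; exact: mchi0| |exact: (A.L2_bnd mA (mchi0 mA) chiB la3)].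
  by move=> x Ox /(offA Ox)[h _]; rewrite /t2 h; exact: off.
have [L3 E3] : L2 mu Om t3 /\ Q mu Om t3 = Q mu A t3.
  apply: Q_supp; [by apply: measurable_funM => //; exact: mchi| |].
    by move=> x Ox /(offA Ox)[_ h]; rewrite /t3 h; exact: off.
  exact: (A.L2_bnd mA (mchi mA) (fun x _ => dchi_bound x.2) la1).
have b0 := A.Q_bnd mA (mchi0 mA) chiB la1; have b1 := A.Q_bnd mA (mchi0 mA) chiB la2.
have b2 := A.Q_bnd mA (mchi0 mA) chiB la3; have b3 := A.Q_bnd mA (mchi mA) (fun x _ => dchi_bound x.2) la1.
rewrite expr1n mul1r -/t0 -E0 in b0; rewrite expr1n mul1r -/t1 -E1 in b1; rewrite expr1n mul1r -/t2 -E2 in b2.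
rewrite -/t3 -E3 in b3.
have alg0 (a1 a2 a3 a4 a5 : R) : a1 - (a2 + a3 * a4 + (1 - a4) * a5) - a4 * (a5 - a3) = a1 - (a2 + a5) by ring.
have alg1 (a1 a2 a3 : R) : a1 - (1 - a3) * a2 - a3 * a2 = a1 - a2 by ring.
have alg2 (a1 a2 a3 a4 a5 : R) : a1 - (a4 + (1 - a3) * a2 - a5) - (a3 * a2 + a5) = a1 - (a4 + a2) by ring.
have e0 : (fun x => Phi x - t0 x) = Rr by apply/funext => x; exact: (alg0 (U x) (p x.2) vbar (chi x.2) (v x)).
have HG x : H x = ((GU x).1 - F1 x * (G x).1, (GU x).2 - (derive1 p x.2 + F1 x * (G x).2 - derive1 chi x.2 * (v x - vbar))).
  by rewrite /H GwE.
have e1' : (fun x => (H x).1 - t1 x) = (fun x => (Rg x).1).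
  by apply/funext => x; rewrite HG; exact: (alg1 (GU x).1 (G x).1 (chi x.2)).
have e2' : (fun x => (H x).2 - (t2 x + t3 x)) = (fun x => (Rg x).2).
  by apply/funext => x; rewrite HG; exact: (alg2 (GU x).2 (G x).2 (chi x.2) (derive1 p x.2) (derive1 chi x.2 * (v x - vbar))).
have L23 := A.L2D mO L2' L3.
have c0 := A.QB_le mO lPhi L0; have c1 := A.QB_le mO lH1 L1; have c2 := A.QB_le mO lH2 L23; have c3 := A.QD_le mO L2' L3.
have l0 := A.L2B mO lPhi L0; have l1 := A.L2B mO lH1 L1; have l2 := A.L2B mO lH2 L23.
rewrite e0 in c0 l0; rewrite e1' in c1 l1; rewrite e2' in c2 l2.
have b3' : B ^+ 2 * Q mu A (fun x => v x - vbar) <= B ^+ 2 * Dc by rewrite ler_wpM2l ?sqr_ge0.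
split => //.
  exact: (sum_bound c1 c2 c3 b1 b2 (le_trans b3 b3') q2 en (Q_ge0 mu A G1) (Q_ge0 mu A G2)).
have po' : Q mu Om Phi <= 4 * (M + 1) ^+ 2 * (10 * B ^+ 2 * Dc).
  apply: le_trans po _; rewrite opprK ler_wpM2l //; first by apply: mulr_ge0 => //; exact: sqr_ge0.
  by apply: le_trans en; rewrite lerDr Q_ge0.
exact: (sum_bound0 c0 po' (le_trans b0 q1)).
Qed.

End Key.

(** * Scaling between the cell and the rough domain *)

Lemma comb_bound (R : realType) (k k' x y z X Y Z : R) : 0 <= x -> 0 <= y -> X <= k * z -> Y <= k' * z ->
  Z <= 2 * x * X + 2 * y * Y -> Z <= 2 * (x * k + y * k') * z.
Proof. by move=> x0 y0 h h' hz; have := ler_wpM2l x0 h; have := ler_wpM2l y0 h'; move: hz; nra. Qed.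

Section CellFunctions.
Variable R : realType.
Local Notation mu := (area R).
Local Notation leb := (@lebesgue_measure R).
Variables (f : R -> R) (kap delta : R).
Local Notation T := (2 * pi).
Local Notation E := (above f).
Hypotheses (fT : periodic f T) (fge : forall t, -1 <= f t) (d0 : 0 < delta) (fd : forall t, f t < - delta).
Hypotheses (kap0 : 0 <= kap) (flip : forall s t, `|f s - f t| <= kap * `|s - t|).
Implicit Types (v w : R * R -> R) (G H : R * R -> R * R).

Let T0 : 0 < T :> R. Proof. by rewrite mulr_gt0 ?pi_gt0. Qed.
Let cf : continuous f := f_continuous kap0 flip.
Let mE : measurable E := above_measurable kap0 flip.
Let mC : measurable (col E 0 T). Proof. exact: col_measurable. Qed.
Let mP : measurable (strip 0 T f 0). Proof. exact: strip_measurable. Qed.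
Let oP : open (strip 0 T f 0). Proof. exact: strip_open. Qed.
Let PE : strip 0 T f 0 `<=` E. Proof. by move=> x [_ /andP[]]. Qed.

Definition orthogonal G := forall phi H, periodic phi (T, 0) -> weak_grad E phi H ->
  L2 mu (col E 0 T) (fun x => (H x).1) -> L2 mu (col E 0 T) (fun x => (H x).2) ->
  has_trace (cell_P f) T f phi (fun=> 0) -> \int[mu]_(x in col E 0 T) dot (G x) (H x) = 0.

Definition decays v G vbar k := forall s, 0 <= s -> [/\ L2 mu (upper s) (fun x => v x - vbar),
  Q mu (upper s) (fun x => v x - vbar) <= k * expR (- 2 * s) &
  Q mu (upper s) (fun x => (G x).1) + Q mu (upper s) (fun x => (G x).2) <= k * expR (- 2 * s)].

Definition bottom_trace v G (q : R -> R) :=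
  exists2 psi, apx (strip 0 T f 0) v G psi & tr_cvg T f psi (fun t => q (f t)).

(** What the energy argument uses of a cell function: [vbar] is the constant towards which it
    decays, [k] the decay constant, and [q] the wall datum as a function of the height alone. All
    fields pass to linear combinations, so the combination of beta and gamma is treated as one
    function. *)
Record cell_fun v G vbar k q : Prop := CellFun {
  cell_per : periodic v (T, 0);
  cell_grad : weak_grad E v G;
  cell_L1 : L2 mu (col E 0 T) (fun x => (G x).1);
  cell_L2 : L2 mu (col E 0 T) (fun x => (G x).2);
  cell_P_L2 : L2 mu (strip 0 T f 0) v;
  cell_orth : orthogonal G;
  cell_decay : decays v G vbar k;
  cell_trace : bottom_trace v G q }.

Lemma L2_dot G : measurable_fun E (fun x => (G x).1) -> measurable_fun E (fun x => (G x).2) ->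
  (\int[mu]_(x in col E 0 T) (dot (G x) (G x))%:E < +oo)%E ->
  L2 mu (col E 0 T) (fun x => (G x).1) /\ L2 mu (col E 0 T) (fun x => (G x).2).
Proof.
move=> m1 m2 h; have CE : col E 0 T `<=` E by move=> x [].
have m1' : measurable_fun (col E 0 T) (fun x => (G x).1) by exact: measurable_funS m1.
have m2' : measurable_fun (col E 0 T) (fun x => (G x).2) by exact: measurable_funS m2.
have md : measurable_fun (col E 0 T) (fun x => dot (G x) (G x)).
  by apply: measurable_funD; apply: measurable_funM.
split; split => //; apply: le_lt_trans h; apply: (@le_intE _ _ _ mu _ mC) => //.
- exact: sqr_meas.
- by move=> x _; exact: sqr_ge0.
- by move=> x _; rewrite /dot -!expr2 lerDl sqr_ge0.
- exact: sqr_meas.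
- by move=> x _; exact: sqr_ge0.
- by move=> x _; rewrite /dot -!expr2 lerDr sqr_ge0.
Qed.

Lemma dot_finite H : L2 mu (col E 0 T) (fun x => (H x).1) -> L2 mu (col E 0 T) (fun x => (H x).2) ->
  (\int[mu]_(x in col E 0 T) (dot (H x) (H x))%:E < +oo)%E.
Proof.
move=> h1 h2; have [i _] := Q_add_Rint mC h1 h2.
have := Rint_E mC i; under [X in _ = X]eq_integral do rewrite !expr2 -/(dot _ _).
by move=> <-; rewrite ltry.
Qed.

Lemma cell_solution_fun g v m (q : R -> R) : (forall t, g (t, f t) = q (f t)) ->
  cell_solution f g v -> Gamma_average f v m ->
  exists G k, 0 <= k /\ cell_fun v G m k q.
Proof.
move=> gq [[pv [G wG fG]] tv test] [b [mb tb] mE'].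
have [l1 l2] := L2_dot (meas_G1 wG) (meas_G2 wG) fG.
have [r hr] := @strip_sq R 0 T f 0 (-1) fge.
have wP := weak_grad_restrict mE mP PE wG.
have [psi apsi tpsi] := has_trace_apx oP hr wP tv.
have [phi aphi tphi] := has_trace_apx oP hr wP (conj mb tb).
have lP : L2 mu (strip 0 T f 0) v by case: apsi => _ [].
have orth : orthogonal G.
  move=> F H pF wH h1 h2 tF; apply: (test _ _ tF _ _ wG wH); split => //.
  by exists H; [exact: wH|exact: (dot_finite h1 h2)].
have vE : m * T = \int[leb]_(t in `]0, T[) b t.
  by rewrite mE' mulrC mulrA mulfV ?mul1r // gt_eqF.
have [k k0 hk] := decay fT fge d0 fd kap0 flip pv wG l1 l2 lP orth mb aphi tphi vE.
exists G, k; split => //; split => //.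
  move=> s s0; have [a1 a2] := wirtinger_upper fT fge d0 fd kap0 flip pv wG l1 l2 lP orth mb aphi tphi vE s0.
  have h := hk s s0; split => //; apply: le_trans a2 _; apply: le_trans h; by rewrite lerDl Q_ge0.
exists psi => //; apply: tr_cvg_eq tpsi => n t _; by rewrite gq.
Qed.

(** Ensures 1 + eps beta_bar >= 1 for every positive eps, so the coefficients of the approximation
    are finite and uniformly controlled. *)
Lemma beta_average_ge0 v m : cell_solution f (fun y => - y.2) v -> Gamma_average f v m -> 0 <= m.
Proof.
move=> [[pv [G wG fG]] tv test] [b [mb tb] mE'].
have [l1 l2] := L2_dot (meas_G1 wG) (meas_G2 wG) fG.
have [r hr] := @strip_sq R 0 T f 0 (-1) fge.
have wP := weak_grad_restrict mE mP PE wG.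
have [phi aphi tphi] := has_trace_apx oP hr wP (conj mb tb).
have orth : orthogonal G.
  move=> F H pF wH h1 h2 tF; apply: (test _ _ tF _ _ wG wH); split => //.
  by exists H; [exact: wH|exact: (dot_finite h1 h2)].
have vE : m * T = \int[leb]_(t in `]0, T[) b t.
  by rewrite mE' mulrC mulrA mulfV ?mul1r // gt_eqF.
exact: (vbar_ge0 fge d0 fd kap0 flip pv wG l1 l2 orth mb aphi tphi vE tv).
Qed.

Lemma tr_cvgD (l : R) (h b c : R -> R) (phi psi : nat -> R * R -> R) : continuous h ->
  (forall n, continuous (phi n)) -> (forall n, continuous (psi n)) ->
  measurable_fun (`]0, l[%classic : set R) b -> measurable_fun (`]0, l[%classic : set R) c ->
  tr_cvg l h phi b -> tr_cvg l h psi c -> tr_cvg l h (fun n x => phi n x + psi n x) (fun t => b t + c t).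
Proof.
move=> ch cp cq mb mc t1 t2.
have mg (F : R * R -> R) : continuous F -> measurable_fun (`]0, l[%classic : set R) (fun t => F (t, h t)).
  by move=> cF; apply: measurable_funTS; apply: continuous_measurable_fun; exact: graph_continuous.
apply: (@tends0_le _ _ (fun n => (2%:E * (\int[leb]_(t in `]0%R, l[) ((phi n (t, h t) - b t) ^+ 2)%:E +
   \int[leb]_(t in `]0%R, l[) ((psi n (t, h t) - c t) ^+ 2)%:E))%E)).
- by move=> n; apply: intE_ge0 => x _; exact: sqr_ge0.
- move=> n; apply: int_sqr_add.
  + exact: measurable_itv.
  + by apply: measurable_funB; apply: measurable_funD => //; apply: mg.
  + by apply: measurable_funB => //; apply: mg.
  + by apply: measurable_funB => //; apply: mg.
  + by move=> x _; ring.
- apply: tends0Z; apply: tends0D => //.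
  + by move=> n; apply: intE_ge0 => x _; exact: sqr_ge0.
  + by move=> n; apply: intE_ge0 => x _; exact: sqr_ge0.
Qed.

Lemma tr_cvgZ (l : R) (h b : R -> R) (a : R) (phi : nat -> R * R -> R) : continuous h ->
  (forall n, continuous (phi n)) -> measurable_fun (`]0, l[%classic : set R) b ->
  tr_cvg l h phi b -> tr_cvg l h (fun n x => a * phi n x) (fun t => a * b t).
Proof.
move=> ch cp mb t1.
have mI : measurable (`]0, l[%classic : set (measurableTypeR R)) by exact: measurable_itv.
apply: tends0_le (tends0Z (a ^+ 2) t1) => n; first by apply: intE_ge0 => t _; exact: sqr_ge0.
rewrite -(@intZE _ _ _ leb _ mI) ?sqr_ge0 //.
- by rewrite le_eqVlt; apply/orP; left; apply/eqP; apply: eq_integral => t _; congr EFin; ring.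
- apply: sqr_meas; apply: measurable_funB => //.
  by apply: measurable_funTS; apply: continuous_measurable_fun; exact: graph_continuous.
- by move=> x _; exact: sqr_ge0.
Qed.

Lemma Q_comb D (a b : R) v w : measurable D -> L2 mu D v -> L2 mu D w ->
  L2 mu D (fun x => a * v x + b * w x) /\ Q mu D (fun x => a * v x + b * w x) <= 2 * a ^+ 2 * Q mu D v + 2 * b ^+ 2 * Q mu D w.
Proof.
move=> mD lv lw; have l1 := A.L2Z mD a lv; have l2 := A.L2Z mD b lw.
split; first exact: (A.L2D mD l1 l2).
by apply: le_trans (A.QD_le mD l1 l2) _; rewrite (A.QZ mD _ lv) (A.QZ mD _ lw) !mulrA.
Qed.

(** The decay constant is quadratic in the coefficients; with both of order eps it is O(eps^2). *)
Lemma cell_fun_comb (a b : R) v G m k q w H m' k' q' : 0 <= k -> 0 <= k' -> continuous q -> continuous q' ->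
  cell_fun v G m k q -> cell_fun w H m' k' q' ->
  cell_fun (fun x => a * v x + b * w x) (fun x => (a * (G x).1 + b * (H x).1, a * (G x).2 + b * (H x).2))
    (a * m + b * m') (2 * (a ^+ 2 * k + b ^+ 2 * k')) (fun y => a * q y + b * q' y).
Proof.
move=> k0 k0' cq cq' [pv wv v1 v2 vP ov dv [phi aphi tphi]] [pw ww w1 w2 wP ow dw [psi apsi tpsi]].
split.
- by move=> x; rewrite pv pw.
- exact: weak_gradD mE (weak_gradZ a mE wv) (weak_gradZ b mE ww).
- exact: (Q_comb a b mC v1 w1).1.
- exact: (Q_comb a b mC v2 w2).1.
- exact: (Q_comb a b mP vP wP).1.
- move=> F K pF wF f1 f2 tF; have o1 := ov _ _ pF wF f1 f2 tF; have o2 := ow _ _ pF wF f1 f2 tF.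
  have i1 := areaD mC (A.L2_mul mC v1 f1) (A.L2_mul mC v2 f2).
  have i2 := areaD mC (A.L2_mul mC w1 f1) (A.L2_mul mC w2 f2).
  have e := RintD mC (areaZ a mC i1) (areaZ b mC i2).
  rewrite (RintZ _ mC i1) (RintZ _ mC i2) in e; rewrite /dot in o1 o2; rewrite o1 o2 !mulr0 addr0 in e.
  by rewrite -[RHS]e; apply: Rint_eq => x _; rewrite /dot /=; ring.
- move=> s s0; have [a1 a2 a3] := dv s s0; have [b1 b2 b3] := dw s s0.
  have mU := @upper_measurable R s; have UC := upper_cell d0 fd s0.
  have [c1 c2] := Q_comb a b mU a1 b1.
  have [g1 g2] := Q_comb a b mU (A.L2S mC mU UC v1) (A.L2S mC mU UC w1).
  have [h1 h2] := Q_comb a b mU (A.L2S mC mU UC v2) (A.L2S mC mU UC w2).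
  have eV : (fun x => a * (v x - m) + b * (w x - m')) = (fun x => a * v x + b * w x - (a * m + b * m')).
    by apply/funext => x; ring.
  rewrite eV in c1 c2.
  have sa := sqr_ge0 a; have sb := sqr_ge0 b.
  split => //; first exact: (comb_bound sa sb a2 b2 c2).
  apply: (comb_bound sa sb a3 b3); apply: le_trans (lerD g2 h2) _.
  by rewrite !mulrDr addrACA.
- exists (fun n x => a * phi n x + b * psi n x).
    exact: apxD mP (apxZ a mP aphi) (apxZ b mP apsi).
  have [sphi _ _ _] := aphi; have [spsi _ _ _] := apsi.
  have cphi n := smooth_continuous (sphi n); have cpsi n := smooth_continuous (spsi n).
  have mq (p : R -> R) : continuous p -> measurable_fun (`]0, T[%classic : set R) (fun t => p (f t)).
    by move=> cp; apply: measurable_funTS; apply: continuous_measurable_fun => t; apply: continuous_comp; [exact: cf|exact: cp].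
  have cZ (e : R) (F : R * R -> R) : continuous F -> continuous (fun x => e * F x).
    by move=> cF x; apply: cvgM; [exact: cvg_cst|exact: cF].
  have mqZ (e : R) (p : R -> R) : continuous p -> measurable_fun (`]0, T[%classic : set R) (fun t => e * p (f t)).
    by move=> cp; apply: measurable_funM => //; exact: mq.
  exact: (tr_cvgD cf (fun n => cZ a _ (cphi n)) (fun n => cZ b _ (cpsi n)) (mqZ a _ cq) (mqZ b _ cq')
    (tr_cvgZ a cf cphi (mq _ cq) tphi) (tr_cvgZ b cf cpsi (mq _ cq') tpsi)).
Qed.

End CellFunctions.

(** * The rough problem in cell variables *)

Section Scaling.
Variable R : realType.
Local Notation mu := (area R).
Local Notation leb := (@lebesgue_measure R).
Variables (f : R -> R) (L eps : R) (N : nat).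
Local Notation l := (2 * pi * N%:R).
Local Notation M := (eps^-1).
Hypotheses (cf : continuous f) (fge : forall t, -1 <= f t) (f0 : forall t, f t < 0).
Hypotheses (e0 : 0 < eps) (lE : eps * l = L).
Implicit Types (u Phi F : R * R -> R) (G Psi : R * R -> R * R).

Let en : eps != 0. Proof. by rewrite gt_eqF. Qed.
Let en' : eps^-1 != 0. Proof. by rewrite invr_eq0. Qed.
Let dn := aff eps 0 eps 0.
Let up := aff eps^-1 0 eps^-1 0.
Local Notation Om := (strip 0 l f M).
Local Notation Oe := (Omega_eps L f eps).
Local Notation Xe := (ext_Omega_eps f eps).

Let upK x : dn (up x) = x.
Proof. by rewrite /dn /up /aff /= !addr0 !mulVKf //; case: x. Qed.
Let dnK x : up (dn x) = x.
Proof. by rewrite /dn /up /aff /= !addr0 !mulKf //; case: x. Qed.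

Let up_Om : up @^-1` Om = Oe.
Proof.
apply/seteqP; split => x; rewrite /strip /Omega_eps /up /aff /= !addr0 ![eps^-1 * _]mulrC.
- move=> [/andP[x1 x2] /andP[x3 x4]]; split; apply/andP; split.
  + by rewrite -(pmulr_lgt0 _ (_ : 0 < eps^-1)) // invr_gt0.
  + by rewrite -lE mulrC -ltr_pdivrMr.
  + by rewrite mulrC -ltr_pdivlMr.
  + by move: x4; rewrite -[X in _ < X]mul1r ltr_pM2r // invr_gt0.
- move=> [/andP[x1 x2] /andP[x3 x4]]; split; apply/andP; split.
  + by rewrite divr_gt0.
  + by rewrite ltr_pdivrMr // mulrC lE.
  + by rewrite ltr_pdivlMr // [X in X < _]mulrC.
  + by rewrite -[X in _ < X]mul1r ltr_pM2r // invr_gt0.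
Qed.

Let up_band : up @^-1` (band f M) = Xe.
Proof.
apply/seteqP; split => x; rewrite /band /ext_Omega_eps /up /aff /= !addr0 ![eps^-1 * _]mulrC.
- move=> /andP[x3 x4]; apply/andP; split.
  + by rewrite mulrC -ltr_pdivlMr.
  + by move: x4; rewrite -[X in _ < X]mul1r ltr_pM2r // invr_gt0.
- move=> /andP[x3 x4]; apply/andP; split.
  + by rewrite ltr_pdivlMr // [X in X < _]mulrC.
  + by rewrite -[X in _ < X]mul1r ltr_pM2r // invr_gt0.
Qed.

Let dn_pre (D : set (R * R)) : dn @^-1` (up @^-1` D) = D.
Proof. by apply/seteqP; split => x /=; rewrite dnK. Qed.

Let oB : open (band f M).
Proof.
have -> : band f M = above f `&` [set x | x.2 < M].
  by apply/seteqP; split => x; [move=> /andP[]|move=> [x1 x2]; apply/andP].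
apply: openI; first exact: above_open.
exact: (half_open M).2.2.
Qed.

Let oO : open Om. Proof. exact: strip_open. Qed.
Let oX : open Xe. Proof. by rewrite -up_band; exact: aff_pre_open. Qed.
Let oOe : open Oe. Proof. by rewrite -up_Om; exact: aff_pre_open. Qed.
Let mX : measurable Xe := open_measurable2 oX.
Let mOe : measurable Oe := open_measurable2 oOe.
Let mO : measurable Om := open_measurable2 oO.
Let OX : Oe `<=` Xe. Proof. by move=> x []. Qed.

Let sqOe : exists r, Oe `<=` sq r.
Proof.
exists (L + eps + 1) => x [/andP[x1 x2] /andP[x3 x4]].
have h : - eps <= eps * f (x.1 / eps) by rewrite -[- eps]mulr1 mulNr -mulrN ler_pM2l.
have L0 : 0 < L by exact: lt_trans x2.
by split; rewrite ler_norml; apply/andP; split; move: e0 x1 x2 x3 x4 h L0; lra.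
Qed.

Let heps (t : R) : R := eps * f (t / eps).
Let ch : continuous heps.
Proof.
have c2 : continuous (fun t : R => t / eps) by move=> t; apply: cvgM; [exact: cvg_id|exact: cvg_cst].
have c3 : continuous (fun t : R => f (t / eps)) by move=> t; apply: continuous_comp; [exact: c2|exact: cf].
by move=> t; apply: cvgM; [exact: cvg_cst|exact: c3].
Qed.

Lemma tr_scale (h k : R -> R) (phi : nat -> R * R -> R) : continuous h -> (forall n, continuous (phi n)) ->
  (forall t, eps * k t = h (eps * t)) ->
  tr_cvg L h phi (fun=> 0) <-> tr_cvg l k (fun n => phi n \o dn) (fun=> 0).
Proof.
move=> chh cp hk.
have e n : (\int[leb]_(t in `]0%R, L[) ((phi n (t, h t) - 0) ^+ 2)%:E =
   eps%:E * \int[leb]_(t in `]0%R, l[) (((phi n \o dn) (t, k t) - 0) ^+ 2)%:E)%E.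
  pose g t : R := (phi n (t, h t) - 0) ^+ 2.
  have cg : continuous g.
    apply: sqr_continuous => t; apply: cvgB; last exact: cvg_cst.
    exact: (graph_continuous chh (cp n)).
  have mg : measurable_fun setT g by exact: continuous_measurable_fun.
  have := @int_itv_aff R eps 0 en 0 l g e0 mg (fun t => sqr_ge0 _).
  rewrite mulr0 !addr0 lE => ->; congr (_ * _)%E; apply: eq_integral => t _.
  by rewrite /g /dn /aff /= !addr0 hk.
rewrite /tr_cvg; split => c.
- have := tends0Z eps^-1 c; under eq_fun do rewrite e muleA -EFinM mulVf // mul1e.
  exact.
- under eq_fun do rewrite e; exact: tends0Z.
Qed.

Lemma rough_rs u G : rough_space L f eps u -> weak_grad Xe u G ->
  rs f l M (u \o dn) (fun y => (eps * (G (dn y)).1, eps * (G (dn y)).2)).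
Proof.
move=> [[pu _ _] tb tt] wu; have [r hr] := sqOe.
have wO := weak_grad_restrict mX mOe OX wu.
have [phi aphi tphi] := has_trace_apx oOe hr wO tb.
have [psi apsi tpsi] := has_trace_apx oOe hr wO tt.
have [sphi _ _ _] := aphi; have [spsi _ _ _] := apsi.
have a1 := apx_aff 0 0 en en mOe aphi; have a2 := apx_aff 0 0 en en mOe apsi.
rewrite -/dn -up_Om dn_pre in a1 a2.
have w1 := weak_grad_aff 0 0 en en oX wu; rewrite -/dn -up_band dn_pre in w1.
split => //.
- move=> y; have e : dn (y + (l, 0)) = dn y + (L, 0).
    by rewrite /dn /aff /= !addr0 mulrDr lE; apply: injective_projections; rewrite /= ?addr0.
  by rewrite /= e pu.
- exists (fun n => phi n \o dn) => //.
  apply: (tr_scale ch (fun n => smooth_continuous (sphi n)) _).1 tphi => t.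
  by rewrite /heps mulrAC mulfV // mul1r.
- exists (fun n => psi n \o dn) => //.
  apply: (tr_scale (@cst_continuous R R 1) (fun n => smooth_continuous (spsi n)) _).1 tpsi => t.
  by rewrite mulfV.
Qed.

Lemma rs_rough Phi Psi : rs f l M Phi Psi -> let G x := (eps^-1 * (Psi (up x)).1, eps^-1 * (Psi (up x)).2) in
  rough_space L f eps (Phi \o up) /\ weak_grad Xe (Phi \o up) G.
Proof.
move=> [pP wP [phi aphi tphi] [psi apsi tpsi]] G.
have [sphi _ _ _] := aphi; have [spsi _ _ _] := apsi.
have w1 := weak_grad_aff 0 0 en' en' oB wP; rewrite -/up up_band in w1.
have wO := weak_grad_restrict mX mOe OX w1.
have a1 := apx_aff 0 0 en' en' mO aphi; have a2 := apx_aff 0 0 en' en' mO apsi.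
rewrite -/up up_Om in a1 a2.
have back n (q : nat -> R * R -> R) : (q n \o up) \o dn = q n by apply/funext => x; rewrite /= dnK.
have cu (q : nat -> R * R -> R) n : smooth (q n) -> continuous (q n \o up).
  by move=> sq; apply: smooth_continuous; exact: smooth_aff.
split => //; split.
- split.
  + move=> x; have e : up (x + (L, 0)) = up x + (l, 0).
      by rewrite /up /aff /= !addr0 mulrDr -lE mulKf //; apply: injective_projections; rewrite /= ?addr0.
    by rewrite /= e pP.
  + by exists G.
  + rewrite (H1normE oOe wO); apply: poweR_lty.
    apply/(E1_L2 mOe wO); have [_ [_ b0 _] [_ b1 _] [_ b2 _]] := a1; by split.
- apply: (apx_has_trace oOe wO (measurable_cst _) a1).
  apply/(tr_scale ch (fun n => cu _ n (sphi n)) (k := f)).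
    by move=> t; rewrite /heps mulrAC mulfV // mul1r.
  by under eq_fun do rewrite back.
- apply: (apx_has_trace oOe wO (measurable_cst _) a2).
  apply/(tr_scale (@cst_continuous R R 1) (fun n => cu _ n (spsi n)) (k := fun=> M)).
    by move=> t; rewrite mulfV.
  by have -> : (fun n => (psi n \o up) \o dn) = psi by apply/funext => n; exact: back.
Qed.

Lemma Rint_scale (g : R * R -> R) : mu.-integrable Om (EFin \o g) ->
  mu.-integrable Oe (EFin \o (g \o up)) /\ \int[mu]_(x in Oe) g (up x) = eps ^+ 2 * \int[mu]_(y in Om) g y.
Proof.
move=> ig; have i1 := integrable_aff 0 0 en' en' mO ig; rewrite -/up up_Om in i1.
split => //; have := Rint_aff 0 0 en en mOe i1; rewrite -/dn -up_Om dn_pre up_Om => ->.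
rewrite ger0_norm ?mulr_ge0 ?ltW // -expr2; congr (_ * _); apply: Rint_eq => y _.
by rewrite /= dnK.
Qed.

(** The factor eps^2 on the right side is that of the Laplacian under x = eps y; rescaled test
    functions are exactly those of [rs]. *)
Lemma rough_equation C u G : rough_solution L C f eps u -> weak_grad Xe u G ->
  forall Phi Psi, rs f l M Phi Psi ->
  \int[mu]_(y in Om) dot (eps * (G (dn y)).1, eps * (G (dn y)).2) (Psi y) = C * eps ^+ 2 * \int[mu]_(y in Om) Phi y.
Proof.
move=> [ru equ] wu Phi Psi rP; have [rPhi wPhi] := rs_rough rP.
have [lU l1 l2] := rs_L2 (rough_rs ru wu); have [lP p1 p2] := rs_L2 rP.
have [r hr] := @strip_sq R 0 l f M (-1) fge.
have iP := L2_integrable mO hr lP.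
have iD : mu.-integrable Om (EFin \o (fun y => dot (eps * (G (dn y)).1, eps * (G (dn y)).2) (Psi y))).
  exact: (areaD mO (A.L2_mul mO l1 p1) (A.L2_mul mO l2 p2)).
have [_ e1'] := Rint_scale (areaZ (eps^-1 ^+ 2) mO iD); have [_ e2'] := Rint_scale (areaZ C mO iP).
rewrite (RintZ _ mO iD) mulrA -exprMn mulfV // expr1n mul1r in e1'.
rewrite (RintZ _ mO iP) mulrA [eps ^+ 2 * C]mulrC in e2'.
rewrite -e1' -e2' -(equ _ rPhi _ _ wu wPhi); apply: Rint_eq => x _.
by rewrite upK /dot /=; field.
Qed.

(** In the plane the Dirichlet integral is invariant under scaling, while the squared L^2 norm gains
    eps^2. The second bound merely enlarges the domain of integration. *)
Lemma scaled_norms Phi Psi : weak_grad (band f M) Phi Psi -> L2 mu Om Phi ->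
  L2 mu Om (fun x => (Psi x).1) -> L2 mu Om (fun x => (Psi x).2) ->
  forall w, (forall x, Oe x -> w x = Phi (up x)) ->
  H1norm Oe w = ((eps ^+ 2 * Q mu Om Phi + (Q mu Om (fun x => (Psi x).1) + Q mu Om (fun x => (Psi x).2)))%:E `^ 2^-1)%E /\
  (L2norm (Omega0 L) w <= (eps ^+ 2 * Q mu Om Phi)%:E `^ 2^-1)%E.
Proof.
move=> wP l0 l1 l2 w hw.
have w1 := weak_grad_aff 0 0 en' en' oB wP; rewrite -/up up_band in w1.
have w2 := weak_grad_eq (fun x Ox => esym (hw x Ox)) (fun x _ => erefl) (weak_grad_restrict mX mOe OX w1).
have sc g : L2 mu Om g -> (\int[mu]_(x in Oe) (g (up x) ^+ 2)%:E = (eps ^+ 2 * Q mu Om g)%:E)%E.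
  by move=> lg; have [i e] := Rint_scale (A.L2_sqr lg); rewrite -(Rint_E mOe i) e.
have e0' : (\int[mu]_(x in Oe) (w x ^+ 2)%:E = (eps ^+ 2 * Q mu Om Phi)%:E)%E.
  by rewrite -(sc _ l0); apply: eq_integral => x; rewrite inE => Ox; rewrite hw.
have sc' (g : R * R -> R) : L2 mu Om g -> (\int[mu]_(x in Oe) ((eps^-1 * g (up x)) ^+ 2)%:E = (Q mu Om g)%:E)%E.
  move=> lg; have := sc _ (A.L2Z mO eps^-1 lg); rewrite (A.QZ mO _ lg) mulrA -exprMn mulfV // expr1n mul1r; exact.
split.
  by rewrite (H1normE oOe w2) (E1_E mOe w2) /= e0' (sc' _ l1) (sc' _ l2) -!EFinD.
rewrite /L2norm -e0'.
have sub : Omega0 L `<=` Oe.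
  move=> x [x1 /andP[x2 x3]]; split => //; rewrite x3 andbT; apply: lt_trans x2.
  by rewrite pmulr_rlt0.
have m0 : measurable (Omega0 L).
  have -> : Omega0 L = strip 0 L (fun=> 0) 1 by [].
  by apply: strip_measurable; exact: cst_continuous.
have mw : measurable_fun Oe w by case: w2 => -[].
apply: gt0_ler_poweR; rewrite ?invr_ge0 //.
- by rewrite in_itv /= leey andbT; apply: intE_ge0 => x _; exact: sqr_ge0.
- by rewrite in_itv /= leey andbT; apply: intE_ge0 => x _; exact: sqr_ge0.
- apply: (@le_int_sub _ _ _ mu _ mOe (fun x => w x ^+ 2) _ m0 _ _ sub); first exact: sqr_meas.
  by move=> x _; exact: sqr_ge0.
Qed.

End Scaling.

(** * Proof of the error estimate *)

Section Constants.
Variable R : realType.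
Implicit Types (eps C : R).

Lemma quadratic (c1 c2 : R) : let p y := (c2 * y + c1) * y in
  [/\ smooth1 p, derive1 p = (fun y => 2 * c2 * y + c1) & derive1 (derive1 p) = (fun=> 2 * c2)].
Proof.
move=> p; have sp : smooth1 p by apply: smooth1M; [exact: smooth1_affine|exact: smooth1_id].
have d1 : derive1 p = (fun y => 2 * c2 * y + c1).
  apply/funext => y; have h1 := is_derive_affine c2 c1 y; have h2 : is_derive y 1 (fun y : R => y) 1 by exact: is_derive_id.
  rewrite derive1E; apply: derive_val; rewrite /p; apply: is_derive_eq; rewrite /GRing.scale /=; ring.
split => //; rewrite d1; apply/funext => y; rewrite derive1E.
by apply: derive_val; exact: is_derive_affine.
Qed.

Lemma u20_derivatives C (x : R * R) : 'D_e2 (u20 C) (x.1, 0) = C / 2 /\ 'D_e2 ('D_e2 (u20 C)) (x.1, 0) = - C.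
Proof.
have [s1 d1 d2] := quadratic (C / 2) (- (C / 2)).
have e : u20 C = (fun x : R * R => (fun y => (- (C / 2) * y + C / 2) * y) x.2).
  by apply/funext => y; rewrite /u20 /=; ring.
have D y : 'D_e2 (u20 C) y = 2 * - (C / 2) * y.2 + C / 2.
  by rewrite e (D2_snd y s1) d1.
split; first by rewrite D /= mulr0 add0r.
have -> : 'D_e2 (u20 C) = (fun y : R * R => (derive1 (fun y => (- (C / 2) * y + C / 2) * y)) y.2).
  by apply/funext => y; rewrite D d1.
by rewrite (D2_snd _ (smooth1_derive1 s1)) d2; field.
Qed.

(* The coefficient of the boundary layer [beta] in the second order approximation. *)
Definition beta_coef C eps (bb gb : R) : R := eps / (1 + eps * bb) * (C / 2 * (1 + eps ^+ 2 * gb)).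
Definition gamma_coef C eps : R := - (eps ^+ 2 * C / 2).

(** The right side is the coefficient of y2 in the polynomial part of the approximation, written in
    cell variables. Its equality with the coefficient of beta makes that polynomial opposite to the
    datum of the cell function on the wall. *)
Lemma coef_relation C eps (bb gb : R) : 0 < eps -> 0 <= bb ->
  beta_coef C eps bb gb = C / 2 * eps - (beta_coef C eps bb gb * bb + gamma_coef C eps * gb) * eps.
Proof.
move=> e0 b0; have n0 : 1 + eps * bb != 0 by rewrite gt_eqF // ltr_pwDl // mulr_ge0 // ltW.
by rewrite /beta_coef /gamma_coef; field.
Qed.

Lemma coef_bounds C eps (bb gb E0 : R) : 0 < eps -> 0 <= bb -> eps <= E0 ->
  beta_coef C eps bb gb ^+ 2 <= eps ^+ 2 * (`|C| / 2 * (1 + E0 ^+ 2 * `|gb|)) ^+ 2 /\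
  gamma_coef C eps ^+ 2 <= eps ^+ 2 * (E0 * (`|C| / 2)) ^+ 2.
Proof.
move=> e0 b0 eE; have E00 : 0 < E0 by exact: lt_le_trans eE.
have h1 : `|beta_coef C eps bb gb| <= eps * (`|C| / 2 * (1 + E0 ^+ 2 * `|gb|)).
  rewrite /beta_coef normrM; apply: ler_pM => //.
    rewrite ger0_norm; last by rewrite divr_ge0 ?ltW // ltr_pwDl // mulr_ge0 // ltW.
    have d1 : 0 < 1 + eps * bb by rewrite ltr_pwDl // mulr_ge0 // ltW.
    by rewrite ler_pdivrMr // ler_peMr ?lerDl ?mulr_ge0 // ltW.
  rewrite normrM normrM [`|2^-1|]ger0_norm //; apply: ler_wpM2l; first by rewrite divr_ge0.
  rewrite (le_trans (ler_normD _ _)) // normr1 lerD2l normrM ger0_norm ?sqr_ge0 //.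
  by rewrite ler_wpM2r // lerXn2r // nnegrE ltW.
have h2 : `|gamma_coef C eps| <= eps * (E0 * (`|C| / 2)).
  rewrite /gamma_coef normrN -mulrA expr2 -mulrA !normrM [`|2^-1|]ger0_norm // !(ger0_norm (ltW e0)).
  apply: ler_wpM2l; first exact: ltW.
  by apply: ler_wpM2r => //; rewrite divr_ge0.
by rewrite -!exprMn; split; apply: sqr_le_bound.
Qed.

Lemma expR_double eps : expR (- (1 / eps)) ^+ 2 = expR (- 2 * eps^-1).
Proof. by rewrite expr2 -expRD; congr expR; rewrite mul1r; ring. Qed.

Lemma error_coef_ge0 (E0 B : R) : 0 <= 80 * (1 + E0) ^+ 2 * B ^+ 2 + 2 * E0 ^+ 2 + 24 * B ^+ 2 + 6.
Proof. by rewrite -mulrA -exprMn; have := sqr_ge0 ((1 + E0) * B); have := sqr_ge0 E0; have := sqr_ge0 B; lra. Qed.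

(** Poincare's inequality over the height 1 / eps costs (1/eps + 1)^2, which the eps^2 of the scaled
    L^2 norm compensates: the product is (1 + eps)^2 <= (1 + E0)^2. *)
Lemma final_bound eps (E0 B Dc q0 q12 C1 X : R) : 0 < eps -> eps <= E0 -> 0 <= C1 -> 0 <= X -> 0 <= Dc ->
  Dc <= C1 * eps * X ->
  q0 <= 80 * (eps^-1 + 1) ^+ 2 * B ^+ 2 * Dc + 2 * Dc -> q12 <= (24 * B ^+ 2 + 6) * Dc ->
  eps ^+ 2 * q0 + q12 <= (80 * (1 + E0) ^+ 2 * B ^+ 2 + 2 * E0 ^+ 2 + 24 * B ^+ 2 + 6) * C1 * eps * X.
Proof.
move=> e0 eE C10 X0 D0 hD h0 h12; have en : eps != 0 by rewrite gt_eqF.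
set C2 := _ + 6.
have e2 : eps ^+ 2 <= E0 ^+ 2 by rewrite lerXn2r // nnegrE ltW // (lt_le_trans e0).
have e3 : (1 + eps) ^+ 2 <= (1 + E0) ^+ 2 by rewrite lerXn2r ?lerD2l // nnegrE; lra.
have B0 := sqr_ge0 B.
have s1 : eps ^+ 2 * q0 <= 80 * (1 + eps) ^+ 2 * B ^+ 2 * Dc + 2 * eps ^+ 2 * Dc.
  apply: le_trans (ler_wpM2l (sqr_ge0 eps) h0) _; rewrite le_eqVlt; apply/orP; left; apply/eqP; by field.
have s2 : 80 * (1 + eps) ^+ 2 * B ^+ 2 * Dc <= 80 * (1 + E0) ^+ 2 * B ^+ 2 * Dc.
  by rewrite ler_wpM2r // ler_wpM2r // ler_wpM2l.
have s3 : 2 * eps ^+ 2 * Dc <= 2 * E0 ^+ 2 * Dc by rewrite ler_wpM2r // ler_wpM2l.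
have C20 : 0 <= C2 := error_coef_ge0 E0 B.
apply: (@le_trans _ _ (C2 * Dc)); last first.
  by rewrite -!mulrA ler_wpM2l // mulrA.
have -> : C2 * Dc = 80 * (1 + E0) ^+ 2 * B ^+ 2 * Dc + 2 * E0 ^+ 2 * Dc + (24 * B ^+ 2 + 6) * Dc by rewrite /C2; ring.
by apply: lerD h12; apply: le_trans s1 _; exact: lerD.
Qed.

End Constants.

Lemma lipschitz_bound (R : realType) (f : R -> R) : (exists k : R, k.-lipschitz f) ->
  exists2 kap, 0 <= kap & forall s t, `|f s - f t| <= kap * `|s - t|.
Proof.
move=> [k hk]; exists `|k| => // s t; apply: le_trans (hk (s, t) (conj I I)) _.
by rewrite ler_wpM2r // ler_norm.
Qed.

Lemma periods_eps (R : realType) (L eps : R) : 0 < L -> 0 < eps -> L / (2 * pi * eps) \is a Num.int ->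
  exists2 N : nat, (0 < N)%N & eps * (2 * pi * N%:R) = L.
Proof.
move=> L0 e0; have p0 := @pi_gt0 R; have q0 : 0 < L / (2 * pi * eps) by rewrite divr_gt0 ?mulr_gt0.
rewrite (intrEge0 (ltW q0)) => /natrP[N hN]; exists N.
  by rewrite -(ltr0n R) -hN.
have n0 : 2 * pi * eps != 0 by rewrite gt_eqF ?mulr_gt0.
by rewrite -hN; move: p0; generalize (@pi R) => P P0; field; rewrite !gt_eqF.
Qed.

Unset Implicit Arguments.

Theorem proposition4 (R : realType) (L C : R) (f : R -> R) (delta : R)
    (L_gt0 : 0 < L)
    (f_periodic : periodic f (2 * pi))
    (f_range : forall t, -1 <= f t < 0)
    (f_lipschitz : exists k : R, k.-lipschitz f)
    (delta_gt0 : 0 < delta) (f_lt : forall t, f t < - delta)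
    (beta gamma : R * R -> R)
    (beta_sol : cell_solution f (fun y => - y.2) beta)
    (gamma_sol : cell_solution f (fun y => - y.2 ^+ 2) gamma)
    (beta_bar gamma_bar : R)
    (beta_bar_avg : Gamma_average f beta beta_bar)
    (gamma_bar_avg : Gamma_average f gamma gamma_bar) :
  exists c10 c11 : R,
    forall eps : R, 0 < eps -> L / (2 * pi * eps) \is a Num.int ->
    forall u : R * R -> R, rough_solution L C f eps u ->
      let r := fun x => u x - u2_inf C beta gamma beta_bar gamma_bar eps x in
      (H1norm (Omega_eps L f eps) r <= (c10 * expR (- (1 / eps)))%:E)%E /\
      (L2norm (Omega0 L) r <= (c11 * Num.sqrt eps * expR (- (1 / eps)))%:E)%E.
Proof.
have [kap kap0 flip] := lipschitz_bound f_lipschitz.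
have fge t : -1 <= f t by have /andP[] := f_range t.
have f0 t : f t < 0 by have /andP[] := f_range t.
have cf := f_continuous kap0 flip.
have pi0 := @pi_gt0 R.
have [Gb [kb [kb0 cb]]] := @cell_solution_fun R f kap delta f_periodic fge delta_gt0 f_lt kap0 flip
  (fun y => - y.2) beta beta_bar (fun y => - y) (fun t => erefl) beta_sol beta_bar_avg.
have [Gc [kc [kc0 cc]]] := @cell_solution_fun R f kap delta f_periodic fge delta_gt0 f_lt kap0 flip
  (fun y => - y.2 ^+ 2) gamma gamma_bar (fun y => - y ^+ 2) (fun t => erefl) gamma_sol gamma_bar_avg.
have bb0 := beta_average_ge0 fge delta_gt0 f_lt kap0 flip beta_sol beta_bar_avg.
have [K K0 hK] := @dstep_bounded R.
(* The largest admissible eps, corresponding to one single period; it makes all constants uniform in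
   eps. *)
pose E0 := L / (2 * pi); have E0p : 0 < E0 by rewrite divr_gt0 ?mulr_gt0.
(* One layer thickness for all eps: at most 1, and at most 1 / eps so that the layer stays above
   height 0. *)
pose d := (1 + E0)^-1; have d0 : 0 < d by rewrite invr_gt0 addr_gt0.
have d1 : d <= 1 by rewrite invf_le1 ?lerDl ?ltW // addr_gt0.
pose B := 2 / d * K.
have hB (y : R) : 2 / d * dstep y <= B by rewrite ler_wpM2l // divr_ge0 // ltW.
pose a0 := `|C| / 2 * (1 + E0 ^+ 2 * `|gamma_bar|); pose b0 := E0 * (`|C| / 2).
pose Ck := 2 * (a0 ^+ 2 * kb + b0 ^+ 2 * kc).
have Ck0 : 0 <= Ck by rewrite mulr_ge0 // addr_ge0 // mulr_ge0 // sqr_ge0.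
pose C1 := E0 * Ck * expR 2; have C10 : 0 <= C1.
  by apply: mulr_ge0; [apply: mulr_ge0 => //; exact: ltW|exact: expR_ge0].
pose C2 := 80 * (1 + E0) ^+ 2 * B ^+ 2 + 2 * E0 ^+ 2 + 24 * B ^+ 2 + 6.
have C20 : 0 <= C2 by exact: error_coef_ge0.
(* Only c^2 >= C2 C1 is wanted; adding 1 achieves it without a square root. *)
pose c := 1 + C2 * C1; have cc1 : C2 * C1 <= c ^+ 2.
  by have := mulr_ge0 C20 C10; rewrite /c; set z := C2 * C1; nra.
have c0 : 0 <= c by rewrite addr_ge0 // mulr_ge0.
(* The H^1 error also carries the factor sqrt eps, which is bounded by sqrt E0 in the first
   constant. *)
exists (c * Num.sqrt E0), c => eps e0 /(periods_eps L_gt0 e0)[N N0 lE] u solu r.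
have eNE : eps * N%:R = E0.
  by rewrite /E0 -lE; move: pi0; generalize (@pi R) => P P0; field; rewrite gt_eqF.
have eE : eps <= E0 by rewrite -eNE ler_peMr ?ler1n // ltW.
have dM : d <= eps^-1 by rewrite lef_pV2 ?posrE ?addr_gt0 // (le_trans eE) // lerDr.
pose a := beta_coef C eps beta_bar gamma_bar; pose b := gamma_coef C eps.
have [ha hb] := coef_bounds C gamma_bar e0 bb0 eE; rewrite -/a -/b in ha hb.
have rel := coef_relation C gamma_bar e0 bb0; rewrite -/a -/b in rel.
have cq1 : continuous (fun y : R => - y) by move=> y; apply: cvgN; exact: cvg_id.
have cq2 : continuous (fun y : R => - y ^+ 2).
  by move=> y; apply: cvgN; apply: (@sqr_continuous R (fun y => y)) => z; exact: cvg_id.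
have [pv wv v1 v2 vP ov dv [psi apsi tpsi]] := cell_fun_comb delta_gt0 f_lt kap0 flip a b kb0 kc0 cq1 cq2 cb cc.
set v := (fun x => a * beta x + b * gamma x) in pv wv vP dv apsi.
set G := (fun x => (a * (Gb x).1 + b * (Gc x).1, a * (Gb x).2 + b * (Gc x).2)) in wv v1 v2 ov dv apsi.
set vbar := a * beta_bar + b * gamma_bar in dv rel.
set k2 := 2 * _ in dv.
(* The coefficients of the polynomial part in y = x / eps: those of [u20], and in the linear one
   also the subtracted multiples of the averages from both layers. *)
pose cc2 := - (C / 2 * eps ^+ 2); pose ccl := C / 2 * eps - vbar * eps.
have [sp dp ddp] := quadratic ccl cc2; set p := (fun y => (cc2 * y + ccl) * y) in sp dp ddp.
have en : eps != 0 by rewrite gt_eqF.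
have pM : p eps^-1 = - vbar by rewrite /p /cc2 /ccl; field.
have ddp' y : derive1 (derive1 p) y = - (C * eps ^+ 2) by rewrite ddp /cc2; field.
(* On the wall the combination of beta and gamma takes the value on the left; the polynomial [p]
   cancels it there, so p + v vanishes on the rough boundary. *)
have qp y : a * - y + b * - y ^+ 2 = - p y.
  by rewrite /p /ccl -rel /cc2 /b /gamma_coef; field.
have tpsi' : tr_cvg (2 * pi) f psi (fun t => - p (f t)) by apply: tr_cvg_eq tpsi => n t _; rewrite qp.
have [[[_ [Gu wu] _] _ _] _] := solu.
have rU := rough_rs cf fge e0 lE solu.1 wu.
have equ := rough_equation cf fge e0 lE solu wu.
have dv1 s : 0 <= s -> L2 (area R) (upper s) (fun x => v x - vbar) /\
  Q (area R) (upper s) (fun x => v x - vbar) <= k2 * expR (- 2 * s) by move=> /dv[].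
have dv2 s : 0 <= s -> Q (area R) (upper s) (fun x => (G x).1) + Q (area R) (upper s) (fun x => (G x).2) <= k2 * expR (- 2 * s).
  by move=> /dv[].
have [l0 l1 l2 bg bv] := remainder_bounds f_periodic fge delta_gt0 f_lt kap0 flip pv wv v1 v2 vP ov dv1 dv2 N0 d0 d1 dM hB
  sp pM ddp' apsi tpsi' rU equ.
have wr := remainder_grad kap0 flip wv sp rU.
pose up := aff eps^-1 0 eps^-1 0.
have hr x : Omega_eps L f eps x -> r x = ((u \o aff eps 0 eps 0) (up x) - (p (up x).2 + v (up x))).
  move=> _; have ux : aff eps 0 eps 0 (up x) = x by rewrite /up /aff /= !addr0 !mulVKf //; case: x.
  rewrite /r /= ux; congr (_ - _); rewrite /u2_inf.
  have [-> ->] := u20_derivatives C x.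
  have -> : up x = (x.1 / eps, x.2 / eps) by rewrite /up /aff !addr0 ![eps^-1 * _]mulrC.
  have n0 : 1 + eps * beta_bar != 0 by rewrite gt_eqF // ltr_pwDl // mulr_ge0 // ltW.
  rewrite /beta_layer /gamma_layer /u20 /v /p /cc2 /ccl /vbar /a /b /beta_coef /gamma_coef /=.
  by set X := beta _; set Y := gamma _; field; rewrite en n0.
have [h1 h2] := scaled_norms cf f0 e0 lE wr l0 l1 l2 hr.
set q0 := Q _ _ _ in h1 h2 bv; set q1 := Q _ _ _ in h1 bg; set q2 := Q _ _ _ in h1 bg.
have q00 : 0 <= q0 by exact: Q_ge0.
have q10 : 0 <= q1 + q2 by rewrite addr_ge0 // Q_ge0.
set Dc := N%:R * _ in bg bv.
set X := expR (- 2 * eps^-1) in Dc bg bv.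
have X0 : 0 <= X by exact: expR_ge0.
have k20 : 0 <= k2 by rewrite mulr_ge0 // addr_ge0 // mulr_ge0 // sqr_ge0.
have Dc0 : 0 <= Dc by rewrite mulr_ge0 // mulr_ge0 // mulr_ge0 // expR_ge0.
have k2le : k2 <= eps ^+ 2 * Ck.
  have -> : eps ^+ 2 * Ck = 2 * (eps ^+ 2 * a0 ^+ 2 * kb + eps ^+ 2 * b0 ^+ 2 * kc) by rewrite /Ck; ring.
  by rewrite /k2 ler_wpM2l //; apply: lerD; apply: ler_wpM2r.
(* As eps N = E0, the number of periods consumes one of the two powers of eps in [k2]; the other
   becomes the sqrt eps of the final bounds. *)
have DcX : Dc <= C1 * eps * X.
  have -> : C1 * eps * X = N%:R * (eps ^+ 2 * Ck * expR 2 * X) by rewrite /C1 -eNE; ring.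
  by rewrite ler_wpM2l // ler_wpM2r // ler_wpM2r // expR_ge0.
have fb := final_bound e0 eE C10 X0 Dc0 DcX bv bg; rewrite -/C2 in fb.
have c2b : C2 * C1 * eps * X <= c ^+ 2 * eps * X by rewrite ler_wpM2r // ler_wpM2r // ltW.
have es2 : (c * Num.sqrt eps * expR (- (1 / eps))) ^+ 2 = c ^+ 2 * eps * X.
  by rewrite !exprMn expR_double sqr_sqrtr // ltW.
have s0 : 0 <= c * Num.sqrt eps * expR (- (1 / eps)) by rewrite !mulr_ge0 ?sqrtr_ge0 ?expR_ge0.
have n1 : 0 <= eps ^+ 2 * q0 by rewrite mulr_ge0 // sqr_ge0.
have H : (H1norm (Omega_eps L f eps) r <= (c * Num.sqrt eps * expR (- (1 / eps)))%:E)%E.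
  have n2 : (0 <= (eps ^+ 2 * q0 + (q1 + q2))%:E)%E by rewrite lee_fin; apply: addr_ge0.
  rewrite h1 (half_leE n2 s0) lee_fin es2.
  exact: le_trans fb c2b.
split.
  apply: le_trans H _; rewrite lee_fin ler_wpM2r ?expR_ge0 // ler_wpM2l // ler_sqrt //.
  exact: ltW.
have n2 : (0 <= (eps ^+ 2 * q0)%:E)%E by rewrite lee_fin.
apply: le_trans h2 _; rewrite (half_leE n2 s0) lee_fin es2.
by apply: le_trans c2b; apply: le_trans fb; rewrite lerDl.
Qed.
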